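(* Let $1<\alpha\le 2$. Let $\{\xi_k,k\in\mathbb Z\}$ and $\{\eta_k,k\in\mathbb Z\}$ be mutually independent harmonizable symmetric $\alpha$-stable random sequences which have absolutely continuous spectral measures with spectral densities $f(\theta)>0$ and $g(\theta)>0$ satisfying the minimality condition $$\int_{-\pi}^{\pi}(f(\theta)+g(\theta))^{-1/(\alpha-1)}\,d\theta<\infty .$$ Let the complex numbers $a_j$, $j\ge 0$, satisfy $\sum_{j=0}^\infty|a_j|<\infty$ and $\sum_{j=0}^\infty (j+1)|a_j|^2<\infty$, and put $A(e^{i\theta})=\sum_{j=0}^\infty a_je^{ij\theta}$. Then the optimal linear estimate $\hat A\xi$ of the functional $A\xi=\sum_{j=0}^\infty a_j\xi_j$ from observations of $\xi_k+\eta_k$ at the points $k=-1,-2,\dots$ is of the form $$\hat A\xi=\int_{-\pi}^{\pi}h(\theta)\,\bigl(dZ^{\xi}(\theta)+dZ^{\eta}(\theta)\bigr),\qquad h\in L^{\alpha}_-(f+g).$$ The spectral characteristic $h(\theta)$ is determined by the equation $$\bigl(A(e^{i\theta})-h(\theta)\bigr)^{<\alpha-1>}f(\theta)-\bigl(h(\theta)\bigr)^{<\alpha-1>}g(\theta)=\overline{C(e^{i\theta})},\qquad C(e^{i\theta})=\sum_{j=0}^{\infty}c_je^{ij\theta},$$ where the unknown coefficients $c_j$ are determined from the system of equations $$\int_{-\pi}^{\pi}e^{-i\theta k}h(\theta)\,d\theta=0,\qquad k=0,1,2,\dots .$$ The error (variance) of the optimal estimate is $$\bigl\|A\xi-\hat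 A\xi\bigr\|_\alpha^\alpha=\int_{-\pi}^{\pi}\bigl|A(e^{i\theta})-h(\theta)\bigr|^{\alpha}f(\theta)\,d\theta+\int_{-\pi}^{\pi}|h(\theta)|^{\alpha}g(\theta)\,d\theta .$$
   Context: For a complex number $z$ and $\beta>0$, $z^{<\beta>}=|z|^{\beta-1}\bar z$ (with $0^{<\beta>}=0$). A real random variable is symmetric $\alpha$-stable ($S\alpha S$) if its characteristic function is $\exp(-c|t|^\alpha)$ for some $c\ge0$; a sequence or process is $S\alpha S$ if all finite linear combinations of its values are. For jointly $S\alpha S$ complex variables $\xi=\xi_1+i\xi_2$, $\eta=\eta_1+i\eta_2$ the covariation is $[\xi,\eta]_\alpha=\int_{S_4}(x_1+ix_2)(y_1+iy_2)^{<\alpha-1>}d\Gamma_{\xi_1,\xi_2,\eta_1,\eta_2}$, where $\Gamma$ is the symmetric spectral measure on the unit sphere of $\mathbb R^4$ of the vector $(\xi_1,\xi_2,\eta_1,\eta_2)$; $\|\xi\|_\alpha=[\xi,\xi]_\alpha^{1/\alpha}$ is a norm. For a complex $S\alpha S$ process $Z$ with independent increments, its spectral measure is $\mu((s,t])=\|Z(t)-Z(s)\|_\alpha^\alpha$, and integrals $\int u\,dZ$, $u\in L^\alpha(\mu)$, satisfy $\|\int u\,dZ\|_\alpha^\alpha=\int|u|^\alpha d\mu$ and $[\int u\,dZ,\int v\,dZ]_\alpha=\int u\,v^{<\alpha-1>}d\mu$. A sequence $\{\xi_n\}$ is harmonizable symmetric $\alpha$-stable if $\xi_n=\int_{-\pi}^\pi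 e^{in\theta}dZ^\xi(\theta)$, $n\in\mathbb Z$, for an $S\alpha S$ process $Z^\xi$ with independent increments on $[-\pi,\pi]$ and finite spectral measure $\mu$. It has spectral density $f$ if $d\mu=f(\theta)\,d\theta$. Here $f$, $Z^\xi$ belong to $\xi$ and $g$, $Z^\eta$ to $\eta$. By independence, for $u\in L^\alpha(f)$, $v\in L^\alpha(g)$: $\|\int u\,dZ^\xi+\int v\,dZ^\eta\|_\alpha^\alpha=\int|u|^\alpha f\,d\theta+\int|v|^\alpha g\,d\theta$. $L^\alpha(f+g)$ is the $L^\alpha$ space on $[-\pi,\pi]$ with weight $f+g$, and $L^\alpha_-(f+g)$ is its closed linear subspace generated by $e^{ik\theta}$, $k=-1,-2,\dots$. $H^-(\xi+\eta)$ is the $\|\cdot\|_\alpha$-closed linear span of $\xi_k+\eta_k$, $k=-1,-2,\dots$. The optimal linear estimate $\hat A\xi$ is the element of $H^-(\xi+\eta)$ closest to $A\xi$ in $\|\cdot\|_\alpha$; equivalently $[\xi_k+\eta_k,A\xi-\hat A\xi]_\alpha=0$ for all $k=-1,-2,\dots$. The series for $C$ is understood as a Fourier series. *)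

(* Defs.v *)
From HB Require Import structures.
From mathcomp Require Import all_boot all_order all_algebra.
From mathcomp Require Import all_classical all_reals all_analysis.
From mathcomp Require Import complex.

Set Implicit Arguments.
Unset Strict Implicit.
Unset Printing Implicit Defensive.

Import Order.TTheory GRing.Theory Num.Theory.
Import numFieldNormedType.Exports.

Local Open Scope classical_set_scope.
Local Open Scope ring_scope.
Local Open Scope complex_scope.

Section ComplexNumbers.
Context {R : realType}.

(* The real-valued modulus; the library's `|z| takes its values in R[i]. *)
Definition cabs (z : R[i]) : R := ComplexField.Normc.normc z.

(* z^{<b>}; the factor z^* makes this 0 at z = 0, whatever the power. *)
Definition spow (z : R[i]) (b : R) : R[i] :=
  (cabs z `^ (b - 1))%:C * z^*.

Definition expi (x : R) : R[i] := cos x +i* sin x.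

Definition cpair {T : Type} (X : T -> R[i]) (x : T) : R * R :=
  (complex.Re (X x), complex.Im (X x)).

Section Integral.
Context {d : measure_display} {T : measurableType d}.
Variable mu : {measure set T -> \bar R}.

Definition cintegral (D : set T) (F : T -> R[i]) : R[i] :=
  (\int[mu]_(x in D) complex.Re (F x)) +i* (\int[mu]_(x in D) complex.Im (F x)).

Definition cintegrable (D : set T) (F : T -> R[i]) : Prop :=
  mu.-integrable D (fun x => (complex.Re (F x))%:E) /\
  mu.-integrable D (fun x => (complex.Im (F x))%:E).

End Integral.

(* Componentwise sum of a complex series. *)
Definition cseries (u : nat -> R[i]) : R[i] :=
  limn (fun n => complex.Re (\sum_(j < n) u j)) +i*
  limn (fun n => complex.Im (\sum_(j < n) u j)).

End ComplexNumbers.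

Section Stable.
Context {R : realType} {d : measure_display} {Omega : measurableType d}.
Variable P : probability Omega R.
Variable alpha : R.

Definition charfun (Y : Omega -> R) (s : R) : R[i] :=
  cintegral P setT (fun w => expi (s * Y w)).

Definition SaS_real (Y : Omega -> R) : Prop :=
  measurable_fun setT Y /\
  exists2 c : R, 0 <= c &
    forall s : R, charfun Y s = (expR (- (c * `|s| `^ alpha)))%:C.

(* A family of complex variables is SaS when all finite linear combinations
   are.  Since Re (c * X) runs through all real combinations of Re X and Im X,
   this is symmetric stability of the real and imaginary parts jointly. *)
Definition SaS_family {I : Type} (D : set I) (X : I -> Omega -> R[i]) : Prop :=
  (forall i, D i -> measurable_fun setT (cpair (X i))) /\
  forall (n : nat) (i : 'I_n -> I) (c : 'I_n -> R[i]),
    (forall k, D (i k)) ->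
    SaS_real (fun w => complex.Re (\sum_(k < n) c k * X (i k) w)).

Definition SaS (X : Omega -> R[i]) : Prop :=
  SaS_family [set: unit] (fun=> X).

Definition R4 : Type := ((R * R) * (R * R))%type.

Definition dot4 (t x : R4) : R :=
  t.1.1 * x.1.1 + t.1.2 * x.1.2 + t.2.1 * x.2.1 + t.2.2 * x.2.2.

Definition opp4 (x : R4) : R4 := ((- x.1.1, - x.1.2), (- x.2.1, - x.2.2)).

Definition sphere4 : set R4 := [set x | dot4 x x = 1].

(* Gamma_{xi_1, xi_2, eta_1, eta_2}, as a finite measure on R^4 carried by
   the unit sphere. *)
Definition is_sphere_spectral_measure (xi eta : Omega -> R[i])
    (Gamma : {finite_measure set ((R * R) * (R * R))%type -> \bar R}) : Prop :=
  [/\ Gamma (~` sphere4) = 0%E,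
      forall B, measurable B -> Gamma (opp4 @^-1` B) = Gamma B
    & forall t : R4,
        charfun (fun w => dot4 t (cpair xi w, cpair eta w)) 1 =
        (expR (- (\int[Gamma]_x (`|dot4 t x| `^ alpha))))%:C ].

(* Gamma is unique for alpha < 2; for alpha = 2 it is not, but the integral
   below only involves its second moments and does not depend on the choice.
   The value 0 is a placeholder used only when there is no Gamma, which does
   not happen for jointly SaS variables. *)
Definition covariation (xi eta : Omega -> R[i]) : R[i] :=
  match pselect (exists Gamma, is_sphere_spectral_measure xi eta Gamma) with
  | left e =>
      cintegral (sval (cid e)) setT
        (fun x => (x.1.1 +i* x.1.2) * spow (x.2.1 +i* x.2.2) (alpha - 1))
  | right _ => 0
  end.

(* [xi, xi]_alpha is a nonnegative real number. *)
Definition alpha_norm (xi : Omega -> R[i]) : R :=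
  complex.Re (covariation xi xi) `^ alpha^-1.

(* Convergence in the norm; the norm of the difference is only meaningful
   when the difference is SaS. *)
Definition alpha_cvg (X : nat -> Omega -> R[i]) (Y : Omega -> R[i]) : Prop :=
  (forall n, SaS (fun w => X n w - Y w)) /\
  (fun n => alpha_norm (fun w => X n w - Y w)) @ \oo --> (0 : R).

(* Sequences are independent when the sigma-algebras they generate are. *)
Definition sigma_of {I : Type} (X : I -> Omega -> R[i]) : set (set Omega) :=
  <<s [set A | exists (k : I) (B : set (R * R)),
         measurable B /\ A = cpair (X k) @^-1` B] >>.

Definition independent_families {I J : Type}
    (X : I -> Omega -> R[i]) (Y : J -> Omega -> R[i]) : Prop :=
  forall A B, sigma_of X A -> sigma_of Y B -> P (A `&` B) = (P A * P B)%E.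

Definition circle : set R := `[(- pi), pi].

(* Taking some of the B k to be the full plane gives the product rule for
   every subfamily of the increments. *)
Definition independent_increments (Z : R -> Omega -> R[i]) : Prop :=
  forall (n : nat) (t : nat -> R) (B : nat -> set (R * R)),
    (forall k, (k <= n)%N -> circle (t k)) ->
    (forall k, (k < n)%N -> t k <= t k.+1) ->
    (forall k, measurable (B k)) ->
    let E k := cpair (fun w => Z (t k.+1) w - Z (t k) w) @^-1` B k in
    P (\bigcap_(k in `I_n) E k) = (\prod_(k < n) P (E k))%E.

Definition is_spectral_measure (Z : R -> Omega -> R[i])
    (mu : {finite_measure set R -> \bar R}) : Prop :=
  forall s t, circle s -> circle t -> s <= t ->
    mu `]s, t]%classic = (alpha_norm (fun w => Z t w - Z s w) `^ alpha)%:E.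

(* A step function sum_j c_j 1_{]s_j, t_j]}, given by its triples
   (c_j, (s_j, t_j)). *)
Definition step := seq (R[i] * (R * R)).

Definition step_ok (s : step) : Prop :=
  forall p, p \in s -> [/\ circle p.2.1, circle p.2.2 & p.2.1 <= p.2.2].

Definition step_fun (s : step) (x : R) : R[i] :=
  \sum_(p <- s) (if p.2.1 < x <= p.2.2 then p.1 else 0).

Definition step_integral (Z : R -> Omega -> R[i]) (s : step) (w : Omega)
    : R[i] :=
  \sum_(p <- s) p.1 * (Z p.2.2 w - Z p.2.1 w).

(* X is (a version of) the integral of u with respect to Z, that is, the
   extension from step functions to L^alpha(mu) by isometry. *)
Definition is_stoch_integral (Z : R -> Omega -> R[i])
    (mu : {measure set R -> \bar R}) (u : R -> R[i]) (X : Omega -> R[i])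
    : Prop :=
  measurable_fun circle (cpair u) /\
  exists s : nat -> step,
    [/\ forall n, step_ok (s n),
        (fun n => \int[mu]_(x in circle)
           (cabs (u x - step_fun (s n) x) `^ alpha)%:E)%E @ \oo --> 0%E
      & alpha_cvg (fun n => step_integral Z (s n)) X].

Definition harmonizable (xi : int -> Omega -> R[i]) (Z : R -> Omega -> R[i])
    (mu : {finite_measure set R -> \bar R}) : Prop :=
  [/\ SaS_family circle Z,
      independent_increments Z,
      is_spectral_measure Z mu
    & forall n : int,
        is_stoch_integral Z mu (fun x => expi (n%:~R * x)) (xi n)].

Definition spectral_density (mu : {measure set R -> \bar R}) (f : R -> R)
    : Prop :=
  measurable_fun circle f /\
  forall B : set R, measurable B -> B `<=` circle ->
    mu B = (\int[lebesgue_measure]_(x in B) (f x)%:E)%E.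

Definition past_combination (zeta : int -> Omega -> R[i])
    (b : seq R[i]) (w : Omega) : R[i] :=
  \sum_(j < size b) b`_j * zeta (- (j.+1)%:Z) w.

(* H^-(zeta): the norm-closed linear span of zeta_k, k = -1, -2, ... *)
Definition Hminus (zeta : int -> Omega -> R[i]) : set (Omega -> R[i]) :=
  [set X | forall e : R, 0 < e -> exists b : seq R[i],
     SaS (fun w => X w - past_combination zeta b w) /\
     alpha_norm (fun w => X w - past_combination zeta b w) < e].

Definition is_optimal_estimate (zeta : int -> Omega -> R[i])
    (Axi X : Omega -> R[i]) : Prop :=
  Hminus zeta X /\
  forall Y, Hminus zeta Y ->
    alpha_norm (fun w => Axi w - X w) <= alpha_norm (fun w => Axi w - Y w).

End Stable.

Section WeightedSpaces.
Context {R : realType}.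
Variable alpha : R.

Local Notation leb := (@lebesgue_measure R).

Definition Lalpha (w : R -> R) : set (R -> R[i]) :=
  [set h | measurable_fun circle (cpair h) /\
    (\int[leb]_(x in circle) (cabs (h x) `^ alpha * w x)%:E < +oo)%E].

Definition past_polynomial (b : seq R[i]) (x : R) : R[i] :=
  \sum_(j < size b) b`_j * expi (- (j.+1)%:R * x).

Definition Lalpha_minus (w : R -> R) : set (R -> R[i]) :=
  [set h | Lalpha w h /\
    forall e : R, 0 < e -> exists b : seq R[i],
      (\int[leb]_(x in circle)
         (cabs (h x - past_polynomial b x) `^ alpha * w x)%:E < e%:E)%E].

(* The Fourier series of C is sum_{j >= 0} c_j e^{ijx}; no convergence of the
   series is required. *)
Definition has_fourier_series (C : R -> R[i]) (c : nat -> R[i]) : Prop :=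
  [/\ cintegrable leb circle C,
      forall j : nat,
        ((2 * pi)^-1)%:C * cintegral leb circle
          (fun x => expi (- j%:R * x) * C x) = c j
    & forall j : nat,
        cintegral leb circle (fun x => expi (j.+1%:R * x) * C x) = 0].

Definition spectral_equation (f g : R -> R) (A h : R -> R[i])
    (c : nat -> R[i]) : Prop :=
  exists2 C : R -> R[i], has_fourier_series C c &
    {ae leb, forall x, circle x ->
      spow (A x - h x) (alpha - 1) * (f x)%:C
      - spow (h x) (alpha - 1) * (g x)%:C = (C x)^*}.

Definition coefficient_system (h : R -> R[i]) : Prop :=
  cintegrable leb circle h /\
  forall k : nat, cintegral leb circle (fun x => expi (- k%:R * x) * h x) = 0.

End WeightedSpaces.

(* Main.v *)
(* Only the laws of single complex stable variables V matter.  If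
   exp (- C(t)) denotes the characteristic function of V, moments of order
   p < alpha give measures on the circle whose weak limit as p tends to alpha
   is a spectral measure, so the covariation norm of V is computed from C; up
   to a constant, its alpha-th power is the mean of C over the circle.  It
   follows that this norm is comparable with the norm of L^1(P), that its
   alpha-th power is additive over independent summands, and that stochastic
   integrals are isometries.

   Hence the error of the estimate with spectral characteristic h is the strictly
   convex energy int |A - h|^alpha f + int |h|^alpha g, to be minimised over
   L^alpha_-(f + g).  A minimiser exists by uniform convexity, the minimality
   condition providing completeness, and the vanishing of the first variation
   says that the conjugate of the left-hand side E(h) of the spectral equation
   has no negative frequencies.

   Conversely, let h and h' solve the equation and the coefficient system.  Then
   F = h - h' has negative frequencies only, G = E(h) - E(h') has none that are
   positive, and F G is integrable, so that int F G = 0, while - Re (F G) >= 0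
   by monotonicity of z |-> z^{<alpha - 1>}; hence h = h'.  Since F and G are
   only in L^1, int F G = 0 needs a regularisation: both are multiplied by the
   square of a bounded function O with frequencies <= 0 which makes them bounded,
   O being one minus the best past approximation of 1 in L^2(1 + e (|F| + |G|)),
   and then e tends to 0. *)

(* The covariation norm is defined through a chosen spectral measure, with value 0 when there is
   none, so nothing can be said about it before such a measure has been built for an arbitrary
   complex stable variable; this is what forces the moment formula and the selection argument.
   Limits of random variables are taken in L^1(P): the norm of a difference makes sense only once
   the difference is known to be SaS, whereas L^1(P) needs no such knowledge and, as it turns out,
   preserves stability. On the function side the alpha-th power of the norm is kept, and (a + b)^p
   <= (1 + e) a^p + K b^p replaces the triangle inequality. Independence is assumed of the
   sequences, not of the processes [Zxi] and [Zeta]. Hence each random integral is described twice: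
   as a limit of step integrals, which gives the isometry, and as a limit of trigonometric sums,
   which gives the independence. The minimisation is done for a general exponent 1 < p <= 2 and a
   general linear class because it serves twice: with p = alpha for the estimate and with p = 2 for
   the bounded function O. *)
Require Import Defs.
From HB Require Import structures.
From mathcomp Require Import all_boot all_order all_algebra.
From mathcomp Require Import all_classical all_reals all_analysis.
From mathcomp Require Import complex.
From mathcomp Require Import measurable_realfun ring lra.

Set Implicit Arguments.
Unset Strict Implicit.
Unset Printing Implicit Defensive.

Import Order.TTheory GRing.Theory Num.Theory.
Import numFieldNormedType.Exports.

Local Open Scope classical_set_scope.
Local Open Scope ring_scope.
Local Open Scope complex_scope.

(** * Complex-valued integrals and weighted L^p spaces *)

Section ComplexModulus.
Context {R : realType}.
Implicit Types z w : R[i].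

Lemma cabs_ge0 z : 0 <= cabs z.
Proof. by case: z => a b; rewrite sqrtr_ge0. Qed.

Lemma cabs0 : cabs (0 : R[i]) = 0.
Proof. exact: ComplexField.Normc.normc0. Qed.

Lemma cabs0_eq z : cabs z = 0 -> z = 0.
Proof. exact: ComplexField.Normc.eq0_normc. Qed.

Lemma cabsM z w : cabs (z * w) = cabs z * cabs w.
Proof. exact: ComplexField.Normc.normcM. Qed.

Lemma cabsN z : cabs (- z) = cabs z.
Proof. by case: z => a b /=; rewrite !sqrrN. Qed.

Lemma cabs_conj z : cabs z^* = cabs z.
Proof. by case: z => a b /=; rewrite sqrrN. Qed.

Lemma cabsR (x : R) : cabs x%:C = `|x|.
Proof. by rewrite /cabs /= expr0n /= addr0 sqrtr_sqr. Qed.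

Lemma cabsD z w : cabs (z + w) <= cabs z + cabs w.
Proof.
have := ler_normD z w; rewrite /Num.norm /=.
by rewrite lecE/= => /andP[_].
Qed.

Lemma cabsB z w : cabs (z - w) <= cabs z + cabs w.
Proof. by rewrite (le_trans (cabsD _ _))// cabsN. Qed.

Lemma cabs_dist z w : `|cabs z - cabs w| <= cabs (z - w).
Proof.
rewrite ler_norml; apply/andP; split.
  rewrite lerBrDl addrC -lerBrDl.
  have := cabsD z (w - z); rewrite (addrC z) subrK -(cabsN (w - z)) opprB; lra.
by have := cabsD (z - w) w; rewrite subrK; lra.
Qed.

Lemma cabs_sqr z : cabs z ^+ 2 = complex.Re z ^+ 2 + complex.Im z ^+ 2.
Proof. by case: z => a b /=; rewrite sqr_sqrtr// addr_ge0 ?sqr_ge0. Qed.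

Lemma mulc_conj z : z * z^* = (cabs z ^+ 2)%:C.
Proof.
by rewrite cabs_sqr; case: z => a b; simpc; rewrite [b * a]mulrC addNr !expr2.
Qed.

Lemma Re_le_cabs z : `|complex.Re z| <= cabs z.
Proof.
rewrite -(@ler_pXn2r _ 2)// ?nnegrE ?cabs_ge0//.
by rewrite real_normK ?num_real// cabs_sqr lerDl sqr_ge0.
Qed.

Lemma Im_le_cabs z : `|complex.Im z| <= cabs z.
Proof.
rewrite -(@ler_pXn2r _ 2)// ?nnegrE ?cabs_ge0//.
by rewrite real_normK ?num_real// cabs_sqr lerDr sqr_ge0.
Qed.

Lemma cabs_le_ReIm z : cabs z <= `|complex.Re z| + `|complex.Im z|.
Proof.
rewrite {1}[z]complexE; apply: (le_trans (cabsD _ _)).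
rewrite cabsM !cabsR lerD2l.
by rewrite /cabs/= expr0n /= add0r expr1n sqrtr1 mul1r.
Qed.

Lemma cabs_expi (x : R) : cabs (expi x) = 1.
Proof. by rewrite /expi/cabs/= cos2Dsin2 sqrtr1. Qed.

Lemma expiD (x y : R) : expi (x + y) = expi x * expi y.
Proof. by rewrite /expi cosD sinD; simpc; congr (_ +i* _); rewrite addrC. Qed.

Lemma expi0 : expi (0 : R) = 1.
Proof. by rewrite /expi cos0 sin0. Qed.

Lemma expiN (x : R) : expi (- x) = (expi x)^*.
Proof. by rewrite /expi cosN sinN. Qed.

Lemma cReD z w : complex.Re (z + w) = complex.Re z + complex.Re w.
Proof. by case: z; case: w. Qed.
Lemma cImD z w : complex.Im (z + w) = complex.Im z + complex.Im w.
Proof. by case: z; case: w. Qed.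
Lemma cReN z : complex.Re (- z) = - complex.Re z.
Proof. by case: z. Qed.
Lemma cImN z : complex.Im (- z) = - complex.Im z.
Proof. by case: z. Qed.
Lemma cReM z w : complex.Re (z * w) =
  complex.Re z * complex.Re w - complex.Im z * complex.Im w.
Proof. by case: z; case: w. Qed.
Lemma cImM z w : complex.Im (z * w) =
  complex.Re z * complex.Im w + complex.Im z * complex.Re w.
Proof. by case: z; case: w. Qed.
Lemma cReC z : complex.Re z^* = complex.Re z.
Proof. by case: z. Qed.
Lemma cImC z : complex.Im z^* = - complex.Im z.
Proof. by case: z. Qed.
Lemma cabs_sum (I : Type) (r : seq I) (F : I -> R[i]) :
  cabs (\sum_(i <- r) F i) <= \sum_(i <- r) cabs (F i).
Proof.
elim/big_rec2: _ => [|i x y _ h]; first by rewrite cabs0.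
by rewrite (le_trans (cabsD _ _))// lerD2l.
Qed.

Lemma complex_eq z w : complex.Re z = complex.Re w ->
  complex.Im z = complex.Im w -> z = w.
Proof. by case: z; case: w => /= ? ? ? ? -> ->. Qed.

End ComplexModulus.

Section CMeas.
Context {R : realType} {d : measure_display} {T : measurableType d}.
Implicit Types (D : set T) (F G : T -> R[i]).

Definition cmeas D F := measurable_fun D (cpair F).

Lemma cmeasP D F : cmeas D F <->
  measurable_fun D (fun x => complex.Re (F x)) /\
  measurable_fun D (fun x => complex.Im (F x)).
Proof.
split=> [mF|[mr mi]]; last first.
  move=> mD; move: (mD); apply: (eq_measurable_fun (fun x =>
    (((fun x => complex.Re (F x)) \_ D) x, ((fun x => complex.Im (F x)) \_ D) x))).
    by move=> x xD; rewrite /patch xD.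
  apply: measurable_funTS; apply: measurable_fun_pair.
    exact/(measurable_restrictT _ mD).
  exact/(measurable_restrictT _ mD).
split; first exact: (measurableT_comp measurable_fst mF).
exact: (measurableT_comp measurable_snd mF).
Qed.

Lemma cmeas_cst D z : cmeas D (fun=> z).
Proof. exact: measurable_cst. Qed.

Lemma cmeasD D F G : cmeas D F -> cmeas D G -> cmeas D (fun x => F x + G x).
Proof.
move=> /cmeasP[a b] /cmeasP[c e]; apply/cmeasP.
split; (under eq_fun do rewrite ?cReD ?cImD); exact: measurable_funD.
Qed.

Lemma cmeasN D F : cmeas D F -> cmeas D (fun x => - F x).
Proof.
move=> /cmeasP[a b]; apply/cmeasP.
split; (under eq_fun do rewrite ?cReN ?cImN); exact: measurableT_comp.
Qed.

Lemma cmeasB D F G : cmeas D F -> cmeas D G -> cmeas D (fun x => F x - G x).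
Proof. by move=> a b; apply: cmeasD => //; apply: cmeasN. Qed.

Lemma cmeas_conj D F : cmeas D F -> cmeas D (fun x => (F x)^*).
Proof.
move=> /cmeasP[a b]; apply/cmeasP.
split; (under eq_fun do rewrite ?cReC ?cImC) => //; exact: measurableT_comp.
Qed.

Lemma cmeasM D F G : cmeas D F -> cmeas D G -> cmeas D (fun x => F x * G x).
Proof.
move=> /cmeasP[a b] /cmeasP[c e]; apply/cmeasP.
split; (under eq_fun do rewrite ?cReM ?cImM).
  by apply: measurable_funB; apply: measurable_funM.
by apply: measurable_funD; apply: measurable_funM.
Qed.

Lemma cmeasR D (f : T -> R) : measurable_fun D f -> cmeas D (fun x => (f x)%:C).
Proof. by move=> mf; apply/cmeasP; split. Qed.

Lemma cmeas_sum (I : Type) (r : seq I) D (F : I -> T -> R[i]) :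
  (forall i, cmeas D (F i)) -> cmeas D (fun x => \sum_(i <- r) F i x).
Proof.
move=> mF; elim: r => [|i r IH].
  by under eq_fun do rewrite big_nil; exact: cmeas_cst.
by under eq_fun do rewrite big_cons; apply: cmeasD.
Qed.

Lemma cmeas_expi D (f : T -> R) : measurable_fun D f ->
  cmeas D (fun x => expi (f x)).
Proof.
move=> mf; apply/cmeasP; split; apply: measurableT_comp => //.
  exact: continuous_measurable_fun (@continuous_cos R).
exact: continuous_measurable_fun (@continuous_sin R).
Qed.

Lemma measurable_cabs D F : cmeas D F -> measurable_fun D (fun x => cabs (F x)).
Proof.
move=> /cmeasP[a b].
have -> : (fun x => cabs (F x)) = (fun x => Num.sqrt (complex.Re (F x) ^+ 2 + complex.Im (F x) ^+ 2)).
  by apply/funext => x; case: (F x).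
apply: (measurableT_comp (continuous_measurable_fun (@sqrt_continuous R))).
by apply: measurable_funD; apply: measurable_funX.
Qed.

Lemma cmeas_spow D F (b : R) : cmeas D F -> cmeas D (fun x => spow (F x) b).
Proof.
move=> mF; apply: cmeasM; last exact: cmeas_conj.
apply: cmeasR; apply: (measurableT_comp (measurable_powR _)).
exact: measurable_cabs.
Qed.

Lemma cmeas_cvg D (F_ : nat -> T -> R[i]) F :
  (forall n, cmeas D (F_ n)) ->
  (forall x, D x -> (fun n => cabs (F_ n x - F x)) @ \oo --> (0 : R)) ->
  cmeas D F.
Proof.
move=> mF cv; apply/cmeasP; split.
  apply: (@measurable_fun_cvg _ _ _ _ (fun n x => complex.Re (F_ n x))).
    by move=> n; have /cmeasP[] := mF n.
  move=> x Dx; apply/cvgrPdist_le => e e0.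
  move/cvgrPdist_le: (cv x Dx) => /(_ e e0).
  apply: filterS => n; rewrite sub0r normrN ger0_norm ?cabs_ge0//; apply: le_trans.
  by rewrite -cReN -cReD -cabsN opprB Re_le_cabs.
apply: (@measurable_fun_cvg _ _ _ _ (fun n x => complex.Im (F_ n x))).
  by move=> n; have /cmeasP[] := mF n.
move=> x Dx; apply/cvgrPdist_le => e e0.
move/cvgrPdist_le: (cv x Dx) => /(_ e e0).
apply: filterS => n; rewrite sub0r normrN ger0_norm ?cabs_ge0//; apply: le_trans.
by rewrite -cImN -cImD -cabsN opprB Im_le_cabs.
Qed.

End CMeas.

Section AlmostEverywhere.
Context {R : realType} {d : measure_display} {T : measurableType d}.
Variable mu : {measure set T -> \bar R}.

Lemma ae_mono (P Q : T -> Prop) :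
  {ae mu, forall x, P x} -> (forall x, P x -> Q x) -> {ae mu, forall x, Q x}.
Proof.
move=> aeP PQ; apply: (@filterS _ _ (ae_filter_ringOfSetsType mu) P) => //.
Qed.

Lemma ae_and (P Q : T -> Prop) :
  {ae mu, forall x, P x} -> {ae mu, forall x, Q x} ->
  {ae mu, forall x, P x /\ Q x}.
Proof.
exact: (@filterI _ _ (ae_filter_ringOfSetsType mu) P Q).
Qed.

End AlmostEverywhere.

Section CInt.
Context {R : realType} {d : measure_display} {T : measurableType d}.
Variables (mu : {measure set T -> \bar R}) (D : set T).
Hypothesis mD : measurable D.
Implicit Types (F G : T -> R[i]).
Local Open Scope ereal_scope.

Definition cnorm1 F : \bar R := \int[mu]_(x in D) (cabs (F x))%:E.

Lemma cnorm1_ge0 F : 0 <= cnorm1 F.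
Proof. by apply: integral_ge0 => x _; rewrite lee_fin cabs_ge0. Qed.

Lemma measurable_cabsE F : cmeas D F -> measurable_fun D (fun x => (cabs (F x))%:E).
Proof. by move=> mF; apply/measurable_EFinP; exact: measurable_cabs. Qed.

Lemma cintegrableP F :
  cintegrable mu D F <-> cmeas D F /\ cnorm1 F < +oo.
Proof.
split=> [[iR iI]|[/[dup] mF /cmeasP[mR mI] foo]].
  have mR : measurable_fun D (fun x => complex.Re (F x)).
    by apply/measurable_EFinP; exact: measurable_int iR.
  have mI : measurable_fun D (fun x => complex.Im (F x)).
    by apply/measurable_EFinP; exact: measurable_int iI.
  have mF : cmeas D F by apply/cmeasP.
  split=> //.
  have := integrableD mD (integrable_abse iR) (integrable_abse iI).
  move/integrableP => [_]; apply: le_lt_trans.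
  apply: ge0_le_integral => //.
  - by move=> x _; rewrite lee_fin cabs_ge0.
  - exact: measurable_cabsE.
  - apply: measurableT_comp => //.
    by apply: emeasurable_funD; apply: measurableT_comp => //; exact/measurable_EFinP.
  - by move=> x _ /=; rewrite !lee_fin (le_trans (cabs_le_ReIm _))// ler_norm.
split; apply/integrableP; split; try exact/measurable_EFinP.
  apply: le_lt_trans foo; apply: ge0_le_integral => //.
  - by apply: measurableT_comp => //; exact/measurable_EFinP.
  - exact: measurable_cabsE.
  - by move=> x _; rewrite lee_fin Re_le_cabs.
apply: le_lt_trans foo; apply: ge0_le_integral => //.
- by apply: measurableT_comp => //; exact/measurable_EFinP.
- exact: measurable_cabsE.
- by move=> x _; rewrite lee_fin Im_le_cabs.
Qed.

Lemma cintegrable_le F (g : T -> R) : cmeas D F ->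
  (forall x, D x -> (cabs (F x) <= g x)%R) ->
  mu.-integrable D (fun x => (g x)%:E) -> cintegrable mu D F.
Proof.
move=> mF Fg ig; apply/cintegrableP; split=> //.
have /integrableP[mg] := ig; apply: le_lt_trans; apply: ge0_le_integral => //.
- by move=> x _; rewrite lee_fin cabs_ge0.
- exact: measurable_cabsE.
- exact: measurableT_comp.
- by move=> x Dx; rewrite lee_fin (le_trans (Fg _ Dx))// ler_norm.
Qed.

Lemma integrable_cabs F : cintegrable mu D F ->
  mu.-integrable D (fun x => (cabs (F x))%:E).
Proof.
move=> /cintegrableP[mF Foo]; apply/integrableP; split.
  exact: measurable_cabsE.
by under eq_integral do rewrite gee0_abs ?lee_fin ?cabs_ge0//.
Qed.

Lemma cintegrable_meas F : cintegrable mu D F -> cmeas D F.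
Proof. by move=> /cintegrableP[]. Qed.

Lemma cintegrableD F G : cintegrable mu D F -> cintegrable mu D G ->
  cintegrable mu D (fun x => F x + G x)%R.
Proof.
move=> [a b] [c e]; split.
  by under eq_fun do rewrite cReD EFinD; exact: integrableD.
by under eq_fun do rewrite cImD EFinD; exact: integrableD.
Qed.

Lemma cintegrableZ (c : R[i]) F : cintegrable mu D F ->
  cintegrable mu D (fun x => c * F x)%R.
Proof.
move=> iF; have /cintegrableP[mF _] := iF.
apply: (@cintegrable_le _ (fun x => cabs c * cabs (F x))%R).
- by apply: cmeasM => //; exact: cmeas_cst.
- by move=> x _; rewrite cabsM.
- under eq_fun do rewrite EFinM.
  by apply: integrableZl => //; exact: integrable_cabs.
Qed.

Lemma cintegrableN F : cintegrable mu D F ->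
  cintegrable mu D (fun x => - F x)%R.
Proof. by move=> /(cintegrableZ (-1)%R); under eq_fun do rewrite mulN1r. Qed.

Lemma cintegrableB F G : cintegrable mu D F -> cintegrable mu D G ->
  cintegrable mu D (fun x => F x - G x)%R.
Proof. by move=> iF iG; apply: cintegrableD => //; exact: cintegrableN. Qed.

Lemma cintegrable_conj F : cintegrable mu D F ->
  cintegrable mu D (fun x => (F x)^*)%R.
Proof.
move=> iF; have /cintegrableP[mF _] := iF.
apply: (cintegrable_le (cmeas_conj mF) _ (integrable_cabs iF)).
by move=> x _; rewrite cabs_conj.
Qed.

Lemma cintegrableMb F G (M : R) : cintegrable mu D F -> cmeas D G ->
  (forall x, D x -> (cabs (G x) <= M)%R) ->
  cintegrable mu D (fun x => G x * F x)%R.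
Proof.
move=> iF mG GM; have /cintegrableP[mF _] := iF.
apply: (@cintegrable_le _ (fun x => M * cabs (F x))%R).
- exact: cmeasM.
- by move=> x Dx; rewrite cabsM ler_wpM2r ?cabs_ge0// GM.
- under eq_fun do rewrite EFinM.
  by apply: integrableZl => //; exact: integrable_cabs.
Qed.

Lemma cintegral_eq F G : (forall x, D x -> F x = G x) ->
  cintegral mu D F = cintegral mu D G.
Proof.
move=> FG; rewrite /cintegral.
by congr (_ +i* _); apply: eq_Rintegral => x /set_mem Dx; rewrite FG.
Qed.

Lemma cintegralD F G : cintegrable mu D F -> cintegrable mu D G ->
  cintegral mu D (fun x => F x + G x)%R = (cintegral mu D F + cintegral mu D G)%R.
Proof.
move=> [a b] [c e]; rewrite /cintegral.
under eq_Rintegral do rewrite cReD.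
under [X in (_ +i* X)%C]eq_Rintegral do rewrite cImD.
by rewrite !RintegralD.
Qed.

Lemma cintegralZ (c : R[i]) F : cintegrable mu D F ->
  cintegral mu D (fun x => c * F x)%R = (c * cintegral mu D F)%R.
Proof.
move=> [a b]; rewrite /cintegral.
under eq_Rintegral do rewrite cReM.
under [X in (_ +i* X)%C]eq_Rintegral do rewrite cImM.
have iZ (k : R) (f : T -> R) : mu.-integrable D (EFin \o f) ->
    mu.-integrable D (EFin \o (fun x => k * f x)%R).
  by move=> /(integrableZl mD k).
rewrite RintegralB// ?RintegralD//; do ?exact: iZ.
rewrite !RintegralZl//.
by case: c => p q /=; simpc.
Qed.

Lemma cintegralN F : cintegrable mu D F ->
  cintegral mu D (fun x => - F x)%R = (- cintegral mu D F)%R.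
Proof.
move=> iF; rewrite -mulN1r -cintegralZ//.
by apply: cintegral_eq => x _; rewrite mulN1r.
Qed.

Lemma cintegralB F G : cintegrable mu D F -> cintegrable mu D G ->
  cintegral mu D (fun x => F x - G x)%R = (cintegral mu D F - cintegral mu D G)%R.
Proof. by move=> iF iG; rewrite cintegralD ?cintegralN//; exact: cintegrableN. Qed.

Lemma cintegral_conj F : cintegrable mu D F ->
  cintegral mu D (fun x => (F x)^*)%R = ((cintegral mu D F)^*)%R.
Proof.
move=> [a b]; rewrite /cintegral.
under eq_Rintegral do rewrite cReC.
under [X in (_ +i* X)%C]eq_Rintegral do rewrite cImC -mulN1r.
by rewrite RintegralZl// mulN1r.
Qed.

Lemma cintegral_ae F G : cmeas D F -> cmeas D G ->
  {ae mu, forall x, D x -> F x = G x} ->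
  cintegral mu D F = cintegral mu D G.
Proof.
move=> /cmeasP[Fr Fi] /cmeasP[Gr Gi] FG; rewrite /cintegral /Rintegral.
congr ((fine _) +i* (fine _)).
  apply: ae_eq_integral => //; [exact/measurable_EFinP|exact/measurable_EFinP|].
  by apply: (ae_mono FG) => x h Dx; rewrite h.
apply: ae_eq_integral => //; [exact/measurable_EFinP|exact/measurable_EFinP|].
by apply: (ae_mono FG) => x h Dx; rewrite h.
Qed.

(** The real and imaginary parts are bounded separately, which costs the factor 2. The bound is only
    used to show that integrals vanish, so the constant is harmless. *)
Lemma le_cintegral F : cintegrable mu D F ->
  (cabs (cintegral mu D F))%:E <= 2%:E * cnorm1 F.
Proof.
move=> /[dup] iF [a b].
have h (f : T -> R) : mu.-integrable D (EFin \o f) ->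
    (forall x, (`|f x| <= cabs (F x))%R) ->
    (`|\int[mu]_(x in D) f x|%R)%:E <= cnorm1 F.
  move=> intf fF; rewrite EFin_normr_Rintegral//.
  apply: (le_trans (le_abse_integral mu mD _)).
    exact: measurable_int intf.
  apply: ge0_le_integral => //.
  - by apply: measurableT_comp => //; exact: measurable_int intf.
  - exact: measurable_cabsE (cintegrable_meas iF).
  - by move=> x _; rewrite lee_fin.
have hh := leeD (h _ a (fun x => Re_le_cabs _)) (h _ b (fun x => Im_le_cabs _)).
rewrite (_ : 2%:E * cnorm1 F = cnorm1 F + cnorm1 F); last first.
  by rewrite (mule_natl _ 2) mule2n.
by apply: le_trans hh; rewrite -EFinD lee_fin; exact: cabs_le_ReIm.
Qed.

Lemma cintegral0_closed F : cintegrable mu D F ->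
  (forall e : R, (0 < e)%R -> exists G, [/\ cintegrable mu D G,
     cintegral mu D G = 0%R & cnorm1 (fun x => F x - G x)%R <= e%:E]) ->
  cintegral mu D F = 0%R.
Proof.
move=> iF h; apply/cabs0_eq/eqP; rewrite eq_le cabs_ge0 andbT.
apply/ler_addgt0Pr => e e0; rewrite add0r.
have [|G [iG G0 FG]] := h (e / 2)%R; first by rewrite divr_gt0.
rewrite -[cintegral _ _ F]subr0 -G0 -cintegralB// -lee_fin.
apply: (le_trans (le_cintegral (cintegrableB iF iG))).
rewrite (_ : e%:E = 2%:E * (e / 2)%:E); last first.
  by rewrite -EFinM mulrCA divff ?mulr1.
by apply: lee_wpmul2l => //; rewrite lee_fin.
Qed.

Lemma Re_cintegral F : complex.Re (cintegral mu D F) = (\int[mu]_(x in D) complex.Re (F x))%R.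
Proof. by []. Qed.

Lemma cintegrable_sum (I : Type) (r : seq I) (F : I -> T -> R[i]) :
  (forall i, cintegrable mu D (F i)) ->
  cintegrable mu D (fun x => \sum_(i <- r) F i x)%R.
Proof.
move=> iF; elim: r => [|i r IH].
  under eq_fun do rewrite big_nil.
  by split; rewrite /=; exact: integrable0.
by under eq_fun do rewrite big_cons; apply: cintegrableD.
Qed.

Lemma cintegral_sum (I : Type) (r : seq I) (F : I -> T -> R[i]) :
  (forall i, cintegrable mu D (F i)) ->
  cintegral mu D (fun x => \sum_(i <- r) F i x)%R = (\sum_(i <- r) cintegral mu D (F i))%R.
Proof.
move=> iF; elim: r => [|i r IH].
  rewrite big_nil; under cintegral_eq do rewrite big_nil.
  by rewrite /cintegral /= /Rintegral !integral0.
rewrite big_cons -IH -cintegralD//; last exact: cintegrable_sum.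
by apply: cintegral_eq => x _; rewrite big_cons.
Qed.

End CInt.

Lemma powR_add_le {R : realType} (a b p : R) : 0 <= a -> 0 <= b -> 0 <= p ->
  (a + b) `^ p <= 2 `^ p * (a `^ p + b `^ p).
Proof.
move=> a0 b0 p0.
apply: (@le_trans _ _ (2 `^ p * (Num.max a b) `^ p)).
  rewrite -powRM ?le_max ?a0//; apply: ge0_ler_powR => //.
  - by rewrite nnegrE addr_ge0.
  - by rewrite nnegrE mulr_ge0// le_max a0.
  - rewrite mulr2n mulrDl !mul1r lerD// le_max lexx ?orbT//.
rewrite ler_wpM2l ?powR_ge0//; have [_|_] := leP a b.
  by rewrite lerDr powR_ge0.
by rewrite lerDl powR_ge0.
Qed.

(** * Weighted L^p quantities *)

Section Lp.
Context {R : realType} {d : measure_display} {T : measurableType d}.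
Variables (mu : {measure set T -> \bar R}) (D : set T).
Hypothesis mD : measurable D.
Implicit Types (u v : T -> R[i]) (w : T -> R).
Local Open Scope ereal_scope.

(** The p-th power of the weighted norm. No root is taken, so that the quantity is additive in the
    weight and matches the alpha-th power of the covariation norm; the price is the constant 2^p in
    the triangle inequality. *)
Definition lp (p : R) w u : \bar R :=
  \int[mu]_(x in D) (cabs (u x) `^ p * w x)%:E.

Variables (p : R) (w : T -> R).
Hypotheses (p0 : (0 < p)%R) (mw : measurable_fun D w)
  (w0 : forall x, D x -> (0 <= w x)%R).

Lemma lp_integrand_ge0 u x : D x -> 0 <= (cabs (u x) `^ p * w x)%:E.
Proof. by move=> Dx; rewrite lee_fin mulr_ge0 ?powR_ge0 ?w0. Qed.

Lemma lp_ge0 u : 0 <= lp p w u.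
Proof. by apply: integral_ge0; exact: lp_integrand_ge0. Qed.

Lemma measurable_lp u : cmeas D u ->
  measurable_fun D (fun x => (cabs (u x) `^ p * w x)%:E).
Proof.
move=> mu_; apply/measurable_EFinP; apply: measurable_funM => //.
apply: (measurableT_comp (measurable_powR _)); exact: measurable_cabs.
Qed.

Lemma lp_eq u v : (forall x, D x -> u x = v x) -> lp p w u = lp p w v.
Proof. by move=> uv; apply: eq_integral => x /set_mem Dx; rewrite uv. Qed.

Lemma lpZ c u : cmeas D u ->
  lp p w (fun x => c * u x)%R = (cabs c `^ p)%:E * lp p w u.
Proof.
move=> mu_; rewrite -ge0_integralZl//.
- apply: eq_integral => x _.
  by rewrite cabsM powRM ?cabs_ge0// -EFinM mulrA.
- exact: measurable_lp.
- exact: lp_integrand_ge0.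
- by rewrite lee_fin powR_ge0.
Qed.

Lemma lpN u : lp p w (fun x => - u x)%R = lp p w u.
Proof. by apply: eq_integral => x _; rewrite cabsN. Qed.

Lemma lpBC u v : lp p w (fun x => u x - v x)%R = lp p w (fun x => v x - u x)%R.
Proof. by apply: eq_integral => x _; rewrite -cabsN opprB. Qed.

Lemma lp0 : lp p w (fun=> 0%R) = 0.
Proof.
rewrite /lp; under eq_integral do rewrite cabs0 powR0 ?gt_eqF// mul0r.
exact: integral0.
Qed.

Lemma lpD u v : cmeas D u -> cmeas D v ->
  lp p w (fun x => u x + v x)%R <= (2 `^ p)%:E * (lp p w u + lp p w v).
Proof.
move=> mu_ mv; rewrite -ge0_integralD//; [|exact: lp_integrand_ge0|exact: measurable_lp
  |exact: lp_integrand_ge0|exact: measurable_lp].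
rewrite -ge0_integralZl//; last 2 first.
- by apply: emeasurable_funD; exact: measurable_lp.
- by move=> x Dx; rewrite adde_ge0//; exact: lp_integrand_ge0.
apply: ge0_le_integral => //.
- exact: lp_integrand_ge0.
- by apply: measurable_lp; exact: cmeasD.
- apply: emeasurable_funM => //.
  by apply: emeasurable_funD; exact: measurable_lp.
- move=> x Dx; rewrite -EFinD -EFinM lee_fin -mulrDl mulrA ler_wpM2r ?w0//.
  apply: (@le_trans _ _ ((cabs (u x) + cabs (v x)) `^ p)%R).
    apply: ge0_ler_powR => //; rewrite ?nnegrE ?addr_ge0 ?cabs_ge0//.
      exact: ltW.
    exact: cabsD.
  by apply: powR_add_le; rewrite ?cabs_ge0// ltW.
Qed.

Lemma lp_triangle u v m : cmeas D u -> cmeas D v -> cmeas D m ->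
  lp p w (fun x => u x - v x)%R <=
  (2 `^ p)%:E * (lp p w (fun x => u x - m x)%R + lp p w (fun x => m x - v x)%R).
Proof.
move=> mu_ mv mm; rewrite (@lp_eq _ (fun x => (u x - m x) + (m x - v x))%R).
  by apply: lpD; exact: cmeasB.
by move=> x _; rewrite addrA subrK.
Qed.

Lemma lp_fin_add u v : cmeas D u -> cmeas D v ->
  lp p w u < +oo -> lp p w v < +oo -> lp p w (fun x => u x + v x)%R < +oo.
Proof.
move=> mu_ mv uoo voo; apply: (le_lt_trans (lpD mu_ mv)).
have uv : lp p w u + lp p w v < +oo by exact: (lte_add_pinfty uoo voo).
by apply: lte_mul_pinfty; [rewrite lee_fin powR_ge0|by []|exact: uv].
Qed.

End Lp.

(** * Completeness of the weighted spaces *)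

Section L1Complete.
Context {R : realType} {d : measure_display} {T : measurableType d}.
Variables (mu : {measure set T -> \bar R}) (D : set T).
Hypothesis mD : measurable D.
Local Open Scope ereal_scope.

(** The sum of the absolute differences is integrable, hence finite almost everywhere, and there the
    telescoping series converges absolutely. The limit is taken as an upper limit, which is
    measurable everywhere and agrees with the limit wherever that exists. *)
Lemma ae_cvg_real (f : nat -> T -> R) :
  (forall n, measurable_fun D (f n)) ->
  \sum_(0 <= n <oo) \int[mu]_(x in D) `|f n.+1 x - f n x|%:E < +oo ->
  exists2 g : T -> R, measurable_fun D g &
    {ae mu, forall x, D x -> (f ^~ x) @ \oo --> g x}.
Proof.
move=> mf foo.
exists (fun x => fine (limn_esup (fun n => (f n x)%:E))).
  apply: measurableT_comp => //.
  apply: measurable_fun_limn_esup => n; exact/measurable_EFinP.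
have mdf n : measurable_fun D (fun x => `|f n.+1 x - f n x|%:E).
  apply/measurable_EFinP; apply: measurableT_comp => //.
  exact: measurable_funB.
have iS : mu.-integrable D
    (fun x => \sum_(0 <= n <oo) `|f n.+1 x - f n x|%:E).
  apply/integrableP; split.
    by apply: ge0_emeasurable_sum => // n x Dx _; rewrite lee_fin.
  under eq_integral => x _.
    rewrite gee0_abs; last by apply: nneseries_ge0 => n _ _; rewrite lee_fin.
    over.
  by rewrite integral_nneseries.
apply: (ae_mono (integrable_ae mD iS)) => x h Dx.
have {h} hS := h Dx.
have cS : cvgn (series (fun n => `|f n.+1 x - f n x|)%R).
  apply: nondecreasing_is_cvgn.
    by apply: nondecreasing_series => n _ _.
  exists (fine (\sum_(0 <= n <oo) `|f n.+1 x - f n x|%:E)).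
  move=> _ [n _ <-]; rewrite -lee_fin fineK//.
  rewrite /series/= -sumEFin.
  exact: (@nneseries_lim_ge _ _ xpredT 0%N n).
have := normed_cvg cS.
rewrite (_ : series _ = (fun n => f n x - f 0%N x)%R); last first.
  by apply/funext => n; rewrite /series/= telescope_sumr.
move=> c2.
have c3 : cvgn (f ^~ x).
  have -> : (f ^~ x) = ((fun n => f n x - f 0%N x) \+ cst (f 0%N x))%R.
    by apply/funext => n /=; rewrite subrK.
  by apply: is_cvgD => //; exact: is_cvg_cst.
rewrite is_cvg_limn_esupE; last first.
  by apply/cvg_ex; exists (limn (f ^~ x))%:E; apply: cvg_EFin => //; exact: nearW.
by rewrite EFin_lim//.
Qed.

End L1Complete.

Lemma continuous_norm_powR {R : realType} (p : R) : 0 < p ->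
  continuous (fun r : R => `|r| `^ p).
Proof.
move=> p0 r; have [->|r0] := eqVneq r 0.
  apply/cvgrPdist_le => e e0.
  rewrite normr0 powR0 ?gt_eqF//.
  have d0 : 0 < e `^ p^-1 by exact: powR_gt0.
  apply/nbhs_ballP; exists (e `^ p^-1) => //= x; rewrite /ball/= sub0r normrN => xd.
  rewrite sub0r normrN ger0_norm ?powR_ge0//.
  have -> : e = (e `^ p^-1) `^ p by rewrite -powRrM mulVf ?gt_eqF// powRr1// ltW.
  by apply: ge0_ler_powR; rewrite ?nnegrE ?powR_ge0//; exact: ltW.
apply: (@continuous_comp _ _ _ (@Num.norm R R) (@powR R ^~ p)).
  exact: norm_continuous.
apply: differentiable_continuous; apply/derivable1_diffP.
by apply: derivable_powR; rewrite in_itv/= andbT normr_gt0.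
Qed.

Lemma cvg_norm_powR {R : realType} {T : Type} (F : set_system T) {FF : Filter F}
    (f : T -> R) (l p : R) :
  0 < p -> f @ F --> l -> (fun x => `|f x| `^ p) @ F --> `|l| `^ p.
Proof. by move=> p0 fl; apply: (@cvg_comp _ _ _ f (fun r : R => `|r| `^ p) F _ _ fl); exact: continuous_norm_powR. Qed.

Lemma cvg_cabs {R : realType} {T : Type} (F : set_system T) {FF : Filter F}
    (u : T -> R[i]) (l m : R[i]) :
  (fun n => cabs (u n - l)) @ F --> (0 : R) ->
  (fun n => cabs (m - u n)) @ F --> cabs (m - l).
Proof.
move=> /cvgrPdist_le ul; apply/cvgrPdist_le => e /ul; apply: filterS => n.
rewrite sub0r normrN ger0_norm ?cabs_ge0// => h.
by apply: le_trans (cabs_dist _ _) (le_trans _ h); rewrite (_ : _ - _ - _ = u n - l) ?lexx//; ring.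
Qed.

Lemma cvg_complex {R : realType} {T : Type} (F : set_system T) {FF : Filter F}
    (u : T -> R[i]) (a b : R) :
  (fun n => complex.Re (u n)) @ F --> a -> (fun n => complex.Im (u n)) @ F --> b ->
  (fun n => cabs (u n - (a +i* b))) @ F --> (0 : R).
Proof.
move=> /cvgrPdist_le ua /cvgrPdist_le ub; apply/cvgrPdist_le => e e0.
have e2 : 0 < e / 2 by rewrite divr_gt0.
move: (ua _ e2) (ub _ e2); apply: filterS2 => n h1 h2.
rewrite sub0r normrN ger0_norm ?cabs_ge0//.
rewrite (le_trans (cabs_le_ReIm _))// cReD cImD cReN cImN /= (splitr e).
by rewrite distrC in h1; rewrite distrC in h2; rewrite lerD.
Qed.

Section LpComplete.
Context {R : realType} {d : measure_display} {T : measurableType d}.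
Variables (mu : {measure set T -> \bar R}) (D : set T).
Hypothesis mD : measurable D.
Variables (p : R) (w : T -> R).
Hypotheses (p0 : (0 < p)%R) (mw : measurable_fun D w)
  (w0 : forall x, D x -> (0 <= w x)%R).
Local Open Scope ereal_scope.

(** Fatou's lemma: balls of the weighted space are closed under almost everywhere convergence. *)
Lemma lp_fatou (u : nat -> T -> R[i]) (v z : T -> R[i]) (e : \bar R) :
  (forall n, cmeas D (u n)) -> cmeas D v -> cmeas D z ->
  {ae mu, forall x, D x -> (fun n => cabs (u n x - v x)%R) @ \oo --> (0%R : R)} ->
  (\forall n \near \oo, lp mu D p w (fun x => z x - u n x)%R <= e) ->
  lp mu D p w (fun x => z x - v x)%R <= e.
Proof.
move=> mu_ mv mz uv [N _ hN].
pose f n x := (cabs (z x - u (n + N)%N x) `^ p * w x)%:E.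
have f0 n x : D x -> 0 <= f n x by move=> Dx; rewrite lee_fin mulr_ge0 ?powR_ge0 ?w0.
have mf n : measurable_fun D (f n) by apply: measurable_lp => //; exact: cmeasB.
have : \int[mu]_(x in D) limn_einf (f ^~ x) <= e.
  apply: (le_trans (fatou mu mD mf f0)).
  rewrite limn_einf_lim; apply: lime_le; first exact: is_cvg_einfs.
  apply: nearW => n; apply: (@le_trans _ _ (\int[mu]_(x in D) f n x)).
    by apply: ereal_inf_lbound; exists n => //=.
  by apply: hN; rewrite /= leq_addl.
apply: le_trans; rewrite le_eqVlt; apply/orP; left; apply/eqP.
apply: ae_eq_integral => //.
- by apply: measurable_lp => //; exact: cmeasB.
- have -> : (fun x => limn_einf (f ^~ x)) =
      (fun x => - limn_esup (fun n => - f n x)).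
    apply/funext => x; rewrite -limn_einfN; congr limn_einf.
    by apply: funext => n; rewrite /comp oppeK.
  apply: measurableT_comp => //; apply: measurable_fun_limn_esup => n.
  exact: measurableT_comp.
- apply: (ae_mono uv) => x h Dx.
  suff /cvg_limn_einf_sup[-> _] : f ^~ x @ \oo --> (cabs (z x - v x) `^ p * w x)%:E by [].
  apply: cvg_EFin; first exact: nearW.
  apply: cvgMr_tmp.
  have hc : (fun n => `|cabs (z x - u n x)| `^ p)%R @ \oo --> (`|cabs (z x - v x)| `^ p)%R.
    by apply: cvg_norm_powR => //; apply: cvg_cabs; exact: h.
  move: hc; rewrite -(cvg_shiftn N) ger0_norm ?cabs_ge0//.
  by under eq_fun do rewrite ger0_norm ?cabs_ge0//.
Qed.

(** Control of the unweighted L^1 norm lets a Cauchy sequence be thinned to a subsequence that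
    converges almost everywhere; [lp_fatou] then turns the Cauchy estimate into an estimate of the
    distance to the limit. *)
Lemma lp_complete (u : nat -> T -> R[i]) :
  (forall n, cmeas D (u n)) ->
  (forall e : R, (0 < e)%R -> exists2 k : R, (0 < k)%R &
     forall v, cmeas D v -> lp mu D p w v <= k%:E -> cnorm1 mu D v <= e%:E) ->
  (forall e : R, (0 < e)%R -> exists N, forall m n, (N <= m)%N -> (N <= n)%N ->
     lp mu D p w (fun x => u m x - u n x)%R <= e%:E) ->
  exists2 v, cmeas D v & forall e : R, (0 < e)%R -> exists N, forall n, (N <= n)%N ->
     lp mu D p w (fun x => u n x - v x)%R <= e%:E.
Proof.
move=> mu_ hdom hC.
have /choice[N hN] (k : nat) : exists N, forall m n, (N <= m)%N -> (N <= n)%N ->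
    cnorm1 mu D (fun x => u m x - u n x)%R <= (1 / (2 ^ k.+1)%:R)%:E.
  have e0 : (0 < 1 / (2 ^ k.+1)%:R :> R)%R by rewrite divr_gt0// ltr0n expn_gt0.
  have [dl dl0 hdl] := hdom _ e0; have [N hN] := hC _ dl0.
  by exists N => m n Nm Nn; apply: hdl; [exact: cmeasB|exact: hN].
(* These indices are nondecreasing, at least [N k] (for the rate 2^-(k+1)) and at least [k] (so that
   the subsequence tends to infinity). *)
pose phi k := (k + \sum_(i < k.+1) N i)%N.
have phiS k : (phi k <= phi k.+1)%N.
  by rewrite /phi leq_add// [X in (_ <= X)%N]big_ord_recr/= leq_addr.
have phiN k : (N k <= phi k)%N.
  by rewrite /phi big_ord_recr/= addnA leq_addl.
have sumfin (g : nat -> T -> R) :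
    (forall k, measurable_fun D (g k)) ->
    (forall k x, `|g k x| <= cabs (u (phi k.+1) x - u (phi k) x))%R ->
    \sum_(0 <= k <oo) \int[mu]_(x in D) `|g k x|%:E < +oo.
  move=> mg hg; apply: (@le_lt_trans _ _ 1%:E); last exact: ltry.
  apply: (le_trans _ (epsilon_trick0 xpredT (@ler01 R))).
  apply: lee_nneseries => // [k _ _|k _].
    by apply: integral_ge0 => x _; rewrite lee_fin.
  apply: le_trans (hN k (phi k.+1) (phi k) (leq_trans (phiN k) (phiS k)) (phiN k)).
  apply: ge0_le_integral => //.
  - by apply/measurable_EFinP; apply: measurableT_comp.
  - by apply: measurable_cabsE; exact: cmeasB.
  - by move=> x _; rewrite lee_fin.
have mre n : measurable_fun D (fun x => complex.Re (u n x)) by have /cmeasP[] := mu_ n.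
have mim n : measurable_fun D (fun x => complex.Im (u n x)) by have /cmeasP[] := mu_ n.
have [||gr mgr hgr] := @ae_cvg_real _ _ _ mu D mD (fun k x => complex.Re (u (phi k) x)).
- by [].
- apply: sumfin => [k|k x]; first exact: measurable_funB.
  by rewrite -cReN -cReD Re_le_cabs.
have [||gi mgi hgi] := @ae_cvg_real _ _ _ mu D mD (fun k x => complex.Im (u (phi k) x)).
- by [].
- apply: sumfin => [k|k x]; first exact: measurable_funB.
  by rewrite -cImN -cImD Im_le_cabs.
exists (fun x => gr x +i* gi x); first by apply/cmeasP.
move=> e e0; have [M hM] := hC _ e0; exists M => n Mn.
apply: (@lp_fatou (fun k => u (phi k))) => //; first by apply/cmeasP.
  apply: (ae_mono (ae_and hgr hgi)) => x [h1 h2] Dx.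
  by apply: cvg_complex; [exact: h1|exact: h2].
exists M => // k /= Mk; apply: hM => //.
by rewrite (leq_trans Mk)// /phi leq_addr.
Qed.

End LpComplete.

(** * Moments of stable laws *)

Section Affine.
Context {R : realType}.
Notation leb := (@lebesgue_measure R).
Local Open Scope ereal_scope.

(** The image of Lebesgue measure under x |-> l x + t, multiplied by l, agrees with Lebesgue measure
    on half-open intervals, hence everywhere by uniqueness. *)
Lemma integral_affine (l t : R) (f : R -> \bar R) : (0 < l)%R ->
  measurable_fun setT f -> (forall x, 0 <= f x) ->
  \int[leb]_x f x = l%:E * \int[leb]_x f (l * x + t)%R.
Proof.
move=> l0 mf f0.
pose phi (x : measurableTypeR R) : measurableTypeR R := (l * x + t)%R.
have mphi : measurable_fun setT phi.
  by apply: measurable_funD => //; exact: measurable_funM.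
pose pm : {measure set (measurableTypeR R) -> \bar R} :=
  measure_function_pushforward__canonical__measure_function_Measure leb mphi.
pose m : {measure set (measurableTypeR R) -> \bar R} := mscale (NngNum (ltW l0)) pm.
have lebm : forall X : set R, ocitv X -> leb X = m X.
  move=> X [[a b] /= _ <-].
  rewrite /m /mscale /= /pm /= /pushforward.
  have -> : phi @^-1` `]a, b]%classic = `]((a - t) / l)%R, ((b - t) / l)%R]%classic.
    apply/seteqP; split => x /=; rewrite !in_itv/= /phi => /andP[h1 h2].
      by rewrite ltr_pdivrMr// ler_pdivlMr// ltrBlDr lerBrDr (mulrC x) h1.
    by rewrite ltr_pdivrMr// in h1; rewrite ler_pdivlMr// in h2;
      rewrite (mulrC l) -ltrBlDr -lerBrDr h1.
  rewrite !lebesgue_measure_itv/= !lte_fin.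
  rewrite ltr_pM2r ?invr_gt0// ltrD2r; case: ifPn => ab.
    rewrite -EFinM -EFinB; congr EFin; field; exact: lt0r_neq0.
  by rewrite mule0.
transitivity (\int[m]_x f x).
  by apply: eq_measure_integral => A mA _; exact: (lebesgue_measure_unique lebm).
rewrite ge0_integral_mscale//=; congr (_ * _).
by rewrite ge0_integral_pushforward//= preimage_setT.
Qed.

End Affine.

Lemma integral_powR {R : realType} (a b r : R) : 0 < a -> a < b -> r != 0 ->
  (\int[@lebesgue_measure R]_(x in `[a, b]) (x `^ (r - 1))%:E =
   ((b `^ r - a `^ r) / r)%:E)%E.
Proof.
move=> a0 ab r0.
have pos x : x \in `[a, b] -> x \in `]0, +oo[.
  by rewrite !in_itv/= andbT => /andP[ax _]; exact: lt_le_trans ax.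
have cont (q x : R) : x \in `]0, +oo[ -> {for x, continuous (@powR R ^~ q)}.
  move=> x0; apply: differentiable_continuous; apply/derivable1_diffP.
  exact: derivable_powR.
rewrite (@continuous_FTC2 R (fun x => x `^ (r - 1)) (fun x => r^-1 * x `^ r) a b)//.
- rewrite -EFinB; congr EFin; field; exact: r0.
- apply: continuous_in_subspaceT => x; rewrite inE => xab.
  by apply: cont; exact: pos.
- have cF x : x \in `]0, +oo[ -> {for x, continuous (fun x => r^-1 * x `^ r)}.
    by move=> x0; apply: cvgMl_tmp; exact: cont.
  split.
  + move=> x xab; apply: derivableM; first exact: derivable_cst.
    apply: derivable_powR; apply: pos; exact: subset_itv_oo_cc.
  + apply: cvg_at_right_filter; apply: cF; apply: pos.
    by rewrite in_itv/= lexx ltW.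
  + apply: cvg_at_left_filter; apply: cF; apply: pos.
    by rewrite in_itv/= lexx ltW.
- move=> x xab; have x0 : x \in `]0, +oo[ by apply: pos; exact: subset_itv_oo_cc.
  rewrite derive1Ml; last exact: derivable_powR.
  by rewrite powR_derive1// mulrA mulVf// mul1r.
Qed.

(** * Power kernels and absolute moments *)

Section PowerKernel.
Context {R : realType}.
Notation leb := (@lebesgue_measure R).
Variable p : R.
Local Open Scope ereal_scope.

(** The Mellin-type integral of phi against s^(-1-p). A dilation of phi by l multiplies it by l^p,
    which is how powers |y|^p are produced from functions such as 1 - cos(s y). *)
Definition pker (phi : R -> R) : \bar R :=
  \int[leb]_(s in `]0%R, +oo[%classic) (phi s * s `^ (- 1 - p))%:E.

Lemma pker_scale (phi : R -> R) (l : R) : (0 < l)%R ->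
  measurable_fun setT phi -> (forall x, (0 <= phi x)%R) ->
  pker (fun s => phi (l * s)%R) = (l `^ p)%:E * pker phi.
Proof.
move=> l0 mphi phi0; rewrite /pker.
have mr : measurable_fun setT ((fun x : R => (phi x * x `^ (-1 - p))%:E) \_ `]0%R, +oo[).
  apply/(measurable_restrictT _ (measurable_itv _)).
  apply/measurable_EFinP; apply: measurable_funTS; apply: measurable_funM => //.
rewrite integral_mkcond [in RHS]integral_mkcond.
rewrite [in RHS](@integral_affine R l 0%R)//; last first.
  move=> x; rewrite patchE; case: ifPn => // _.
  by rewrite lee_fin mulr_ge0// powR_ge0.
rewrite muleA -EFinM -ge0_integralZl//; last 3 first.
- apply: (@measurableT_comp _ _ _ _ _ _ ((fun x : R => (phi x * x `^ (-1 - p))%:E) \_ `]0%R, +oo[)).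
    exact: mr.
  by apply: measurable_funD => //; exact: measurable_funM.
- move=> x _; rewrite patchE; case: ifPn => // _.
  by rewrite lee_fin mulr_ge0// powR_ge0.
- by rewrite lee_fin mulr_ge0// ?powR_ge0// ltW.
apply: eq_integral => x _; rewrite !patchE addr0.
have -> : ((l * x)%R \in `]0%R, +oo[%classic) = (x \in `]0%R, +oo[%classic).
  by apply/idP/idP; rewrite !inE/= !in_itv/= !andbT pmulr_rgt0.
case: ifPn => [|_]; last by rewrite -[point]/(0%R : \bar R) mule0.
rewrite inE/= in_itv/= andbT => x0.
rewrite -EFinM; congr EFin.
have key : (l `^ p * l * l `^ (-1 - p) = 1)%R.
  rewrite -[X in (_ * X * _)%R](powRr1 (ltW l0)) -!powRD ?(gt_eqF l0) ?implybT//.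
  by rewrite (_ : (_ + _)%R = 0%R) ?powRr0//; ring.
rewrite powRM ?ltW//; move: key.
move: (l `^ p)%R (l `^ (-1 - p))%R (x `^ (-1 - p))%R (phi (l * x))%R => A B C E key.
by rewrite -[LHS]mul1r -key; ring.
Qed.

(** The bound M x^q is used on ]0, 1], where it contributes M/(q - p), and the bound M beyond 1,
    where it contributes M/p. *)
Lemma pker_lt_pinfty (phi : R -> R) (M q : R) : (0 < p < q)%R ->
  measurable_fun setT phi ->
  (forall x, (0 < x)%R -> (0 <= phi x <= M)%R) ->
  (forall x, (0 < x)%R -> (phi x <= M * x `^ q)%R) ->
  pker phi < +oo.
Proof.
move=> /andP[p0 pq] mphi phiM phiq.
(* Compact intervals away from 0, on which the fundamental theorem of calculus evaluates powers; the
   index shift by 2 puts the cutting point 1 strictly inside each of them. *)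
pose S (n : nat) : set R := `[(n.+2%:R)^-1%R, n.+2%:R%R]%classic.
have S0 n x : S n x -> (0 < x)%R.
  by rewrite /S/= in_itv/= => /andP[h _]; exact: lt_le_trans h.
have M0 : (0 <= M)%R by have /andP[h1 h2] := phiM 1%R ltr01; exact: le_trans h2.
pose f x := (phi x * x `^ (- 1 - p))%:E.
have f0 x : (0 < x)%R -> 0 <= f x.
  by move=> x0; rewrite lee_fin mulr_ge0 ?powR_ge0//; have /andP[] := phiM _ x0.
have mf : measurable_fun setT f.
  by apply/measurable_EFinP; apply: measurable_funM => //; exact: measurable_powR.
have cvgS : \int[leb]_(s in S n) f s @[n --> \oo] --> \int[leb]_(s in \bigcup_n S n) f s.
  apply: ge0_nondecreasing_set_cvg_integral.
  - move=> m n mn; apply/subsetPset => x; rewrite /S/= !in_itv/= => /andP[h1 h2].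
    apply/andP; split.
      by apply: le_trans h1; rewrite lef_pV2 ?posrE// ler_nat.
    by apply: (le_trans h2); rewrite ler_nat.
  - by move=> n; exact: measurable_itv.
  - by move=> n; exact: measurable_funTS.
  - by move=> n x /S0; exact: f0.
have SU : \bigcup_n S n = `]0%R, +oo[%classic.
  apply/seteqP; split => [x [n _ /S0 x0]|x]; rewrite /= in_itv/= andbT// => x0.
  have hx : (x < (Num.bound x)%:R)%R by apply: archi_boundP; exact: ltW.
  have hy : (x^-1 < (Num.bound x^-1)%:R)%R by apply: archi_boundP; rewrite invr_ge0 ltW.
  exists (Num.bound x + Num.bound x^-1)%N => //.
  rewrite /S/= in_itv/=; apply/andP; split.
    rewrite -[leRHS]invrK lef_pV2 ?posrE ?invr_gt0//.
    by apply: (le_trans (ltW hy)); rewrite ler_nat; do 2 apply: leqW; exact: leq_addl.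
  by apply: (le_trans (ltW hx)); rewrite ler_nat; do 2 apply: leqW; exact: leq_addr.
have pownn (a : R) (r : R) : (0 < a)%R -> (0 < a `^ r)%R by move=> ?; exact: powR_gt0.
have bnd n : \int[leb]_(s in S n) f s <= (M / (q - p) + M / p)%:E.
  have n1 : ((n.+2%:R)^-1 < 1 :> R)%R by rewrite invf_lt1// ltr1n.
  have n2 : (1 < n.+2%:R :> R)%R by rewrite ltr1n.
  have ->: S n = `[(n.+2%:R)^-1%R, 1%R]%classic `|` `]1%R, n.+2%:R%R]%classic.
    by rewrite /S (@itv_bndbnd_setU _ _ _ (BRight 1%R))// bnd_simp ltW.
  rewrite ge0_integral_setU//; last 3 first.
  - exact: measurable_funTS.
  - move=> x [|]; rewrite /= in_itv/= => /andP[h _]; apply: f0.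
      exact: lt_le_trans h.
    exact: lt_trans h.
  - rewrite disj_set2E; apply/eqP/seteqP; split => x //=; rewrite !in_itv/=.
    by move=> [/andP[_ h1] /andP[h2 _]]; move: (le_lt_trans h1 h2); rewrite ltxx.
  rewrite EFinD; apply: leeD.
    apply: (@le_trans _ _ (\int[leb]_(x in `[(n.+2%:R)^-1%R, 1%R]) (M%:E * (x `^ ((q - p) - 1))%:E))).
      apply: ge0_le_integral => //.
      - by move=> x; rewrite /= in_itv/= => /andP[h _]; apply: f0; exact: lt_le_trans h.
      - exact: measurable_funTS.
      - by apply/measurable_EFinP; apply: measurable_funM => //; apply: measurable_funTS; exact: measurable_powR.
      - move=> x; rewrite /= in_itv/= => /andP[h _].
        have x0 : (0 < x)%R by exact: lt_le_trans h.
        rewrite -EFinM lee_fin (_ : (q - p - 1 = q + (-1 - p))%R); last by ring.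
        by rewrite (@powRD _ x q) ?(gt_eqF x0) ?implybT// mulrA ler_wpM2r ?powR_ge0// phiq.
    rewrite ge0_integralZl//; last 2 first.
    - by apply/measurable_EFinP; apply: measurable_funTS; exact: measurable_powR.
    - by move=> x _; rewrite lee_fin powR_ge0.
    rewrite integral_powR//; last by rewrite subr_eq0 gt_eqF.
    rewrite -EFinM lee_fin ler_wpM2l// powR1 ler_pdivrMr ?subr_gt0//.
    by rewrite mulVf ?subr_eq0 ?gt_eqF// gerBl powR_ge0.
  apply: (@le_trans _ _ (\int[leb]_(x in `]1%R, n.+2%:R%R]) (M%:E * (x `^ (- p - 1))%:E))).
    apply: ge0_le_integral => //.
    - by move=> x; rewrite /= in_itv/= => /andP[h _]; apply: f0; exact: lt_trans h.
    - exact: measurable_funTS.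
    - by apply/measurable_EFinP; apply: measurable_funM => //; apply: measurable_funTS; exact: measurable_powR.
    - move=> x; rewrite /= in_itv/= => /andP[h _].
      have x0 : (0 < x)%R by exact: lt_trans h.
      rewrite -EFinM lee_fin (_ : (- p - 1 = -1 - p)%R); last by ring.
      by rewrite ler_wpM2r ?powR_ge0//; have /andP[] := phiM _ x0.
  rewrite ge0_integralZl//; last 2 first.
  - by apply/measurable_EFinP; apply: measurable_funTS; exact: measurable_powR.
  - by move=> x _; rewrite lee_fin powR_ge0.
  apply: (@le_trans _ _ (M%:E * \int[leb]_(x in `[1%R, n.+2%:R%R]) (x `^ (- p - 1))%:E)).
    apply: lee_wpmul2l => //; apply: ge0_subset_integral => //.
    - by apply/measurable_EFinP; apply: measurable_funTS; exact: measurable_powR.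
    - by move=> x _; rewrite lee_fin powR_ge0.
    - by apply: subset_itvr; rewrite bnd_simp.
  rewrite integral_powR//; last by rewrite oppr_eq0 gt_eqF.
  rewrite -EFinM lee_fin ler_wpM2l// powR1 invrN mulrN -mulNr opprB.
  by rewrite ler_pdivrMr// mulVf ?gt_eqF// gerBl powR_ge0.
rewrite /pker -SU -/f; apply: (@le_lt_trans _ _ (M / (q - p) + M / p)%:E); last exact: ltry.
rewrite -(cvg_lim _ cvgS)//; apply: lime_le; first by apply/cvg_ex; eexists; exact: cvgS.
exact: nearW.
Qed.
End PowerKernel.

Section OneMinusCos.
Context {R : realType}.

Lemma sin_le_id (x : R) : 0 <= x -> sin x <= x.
Proof.
move=> x0; pose g (x : R) := x - sin x.
have dg (y : R) : is_derive y 1 g (1 - cos y) by apply: is_deriveB.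
have : g 0 <= g x.
  apply: (@ger0_derive1_ndecry R g 0) => //.
  - move=> y _; rewrite derive1E derive_val subr_ge0; exact: cos_le1.
  - apply: continuous_subspaceT => y.
    by apply: differentiable_continuous; apply/derivable1_diffP.
by rewrite /g sin0 subr0 subr_ge0.
Qed.

Lemma one_sub_cos_le (x : R) : 0 <= x -> 1 - cos x <= x ^+ 2.
Proof.
move=> x0; have -> : 1 - cos x = 2 * sin (x / 2) ^+ 2.
  have -> : cos x = cos ((x / 2) *+ 2) by rewrite -mulr_natr divfK.
  rewrite cos_mulr2n cos2sin2; ring.
have [x2|x2] := leP x 2.
  have s0 : 0 <= sin (x / 2).
    apply: sin_ge0_pi; have := @pi_ge2 R; move=> ?; apply/andP; split; lra.
  have s1 := sin_le_id (divr_ge0 x0 (ler0n R 2)).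
  have : sin (x / 2) ^+ 2 <= (x / 2) ^+ 2.
    by rewrite ler_pXn2r// nnegrE divr_ge0.
  rewrite expr_div_n; nra.
have h1 : `|sin (x / 2)| <= 1 by rewrite ler_norml sin_geN1 sin_le1.
have : sin (x / 2) ^+ 2 <= 1 by rewrite -real_normK ?num_real// expr_le1.
nra.
Qed.

End OneMinusCos.

Section StableMoments.
Context {R : realType}.
Notation leb := (@lebesgue_measure R).
Local Open Scope ereal_scope.

Lemma measurable_cosE : measurable_fun setT (@cos R).
Proof. exact: continuous_measurable_fun (@continuous_cos R). Qed.

Definition cosker (p : R) := pker p (fun s : R => 1 - cos s)%R.
Definition expker (p a : R) := pker p (fun s : R => 1 - expR (- (s `^ a)))%R.

Lemma one_sub_cos_ge0 (x : R) : (0 <= 1 - cos x)%R.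
Proof. by rewrite subr_ge0 cos_le1. Qed.

Lemma measurable_one_sub_cos : measurable_fun setT (fun s : R => 1 - cos s)%R.
Proof. by apply: measurable_funB => //; exact: measurable_cosE. Qed.

Lemma measurable_one_sub_exp (a : R) :
  measurable_fun setT (fun s : R => 1 - expR (- (s `^ a)))%R.
Proof.
apply: measurable_funB => //; apply: measurableT_comp => //.
by apply: measurableT_comp => //; exact: measurable_powR.
Qed.

Lemma pker_gt0 (p a b k : R) (phi : R -> R) : (0 < a < b)%R -> (0 < k)%R ->
  (0 < p)%R -> measurable_fun setT phi -> (forall x, 0 <= phi x)%R ->
  (forall x, (a <= x <= b)%R -> (k <= phi x)%R) -> 0 < pker p phi.
Proof.
move=> /andP[a0 ab] k0 p0 mphi phi0 phik.
have b0 := lt_trans a0 ab.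
have mf : measurable_fun setT (fun x => (phi x * x `^ (-1 - p))%:E).
  by apply/measurable_EFinP; apply: measurable_funM => //; exact: measurable_powR.
apply: (@lt_le_trans _ _ (\int[leb]_(x in `[a, b]) (k * b `^ (-1 - p))%:E)).
  rewrite integral_cst//= lebesgue_measure_itv/= lte_fin ab -EFinB -EFinM lte_fin.
  by rewrite !mulr_gt0 ?powR_gt0 ?subr_gt0.
apply: (@le_trans _ _ (\int[leb]_(x in `[a, b]) (phi x * x `^ (-1 - p))%:E)).
  apply: ge0_le_integral => //.
  - by move=> x _; rewrite lee_fin mulr_ge0 ?powR_ge0// ltW.
  - exact: measurable_funTS.
  - move=> x; rewrite /= in_itv/= => /andP[h1 h2].
    have x0 : (0 < x)%R by exact: lt_le_trans h1.
    rewrite lee_fin ler_pM ?powR_ge0//; first exact: ltW.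
      by apply: phik; rewrite h1.
    rewrite (_ : (-1 - p = - (1 + p))%R); last by ring.
    rewrite !powRN lef_pV2 ?posrE ?powR_gt0//; apply: ge0_ler_powR => //.
    + by rewrite addr_ge0// ltW.
    + by rewrite nnegrE ltW.
    + by rewrite nnegrE ltW.
apply: ge0_subset_integral => //.
- exact: measurable_funTS.
- by move=> x _; rewrite lee_fin mulr_ge0// powR_ge0.
- by move=> x; rewrite /= !in_itv/= andbT => /andP[h _]; exact: lt_le_trans h.
Qed.

Lemma cosker_gt0 (p : R) : (0 < p)%R -> 0 < cosker p.
Proof.
move=> p0; apply: (@pker_gt0 p (pi / 2) pi 1) => //.
- by have := @pi_gt0 R; lra.
- exact: measurable_one_sub_cos.
- move=> x /andP[h1 h2]; rewrite lerBrDl -lerBrDr subrr -(@cos_pihalf R).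
  have := @pi_gt0 R => pi0; rewrite leNgt; apply/negP => h; have := ltr_cos; move=> /(_ R) lc; rewrite lc ?in_itv/= in h; lra.
Qed.

Lemma expker_gt0 (p a : R) : (0 < p)%R -> (0 < a)%R -> 0 < expker p a.
Proof.
move=> p0 a0; apply: (@pker_gt0 p 1 2 (1 - expR (-1))) => //.
- by apply/andP; split; lra.
- exact: measurable_one_sub_exp.
- by move=> x; rewrite subr_ge0 -[leRHS]expR0 ler_expR oppr_le0 powR_ge0.
- move=> x /andP[h1 h2]; rewrite lerD2l lerN2 ler_expR lerN2.
  rewrite [leLHS](_ : _ = 1 `^ a)%R; last by rewrite powR1.
by rewrite ge0_ler_powR ?nnegrE ?(le_trans ler01 h1)// ltW.
Qed.

Lemma cosker_lty (p : R) : (0 < p < 2)%R -> cosker p < +oo.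
Proof.
move=> p02; apply: (@pker_lt_pinfty _ _ _ 2 2) => //.
- exact: measurable_one_sub_cos.
- by move=> x _; rewrite one_sub_cos_ge0/=; have := cos_geN1 x; lra.
- move=> x x0; rewrite (powR_mulrn 2 (ltW x0)).
  by apply: (le_trans (one_sub_cos_le (ltW x0))); rewrite ler_peMl ?sqr_ge0// ler1n.
Qed.

Lemma expker_lty (p a : R) : (0 < p < a)%R -> expker p a < +oo.
Proof.
move=> /[dup] pa /andP[p0 p_a]; apply: (@pker_lt_pinfty _ _ _ 1 a) => //.
- exact: measurable_one_sub_exp.
- move=> x x0; rewrite subr_ge0 -expR0 ler_expR oppr_le0 powR_ge0/= expR0.
  by rewrite gerBl expR_ge0.
- move=> x x0; rewrite mul1r lerBlDl -lerBlDr.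
  exact: expR_ge1Dx.
Qed.

Lemma pker_cos (p y : R) : (0 < p)%R ->
  pker p (fun s => 1 - cos (s * y))%R = (`|y| `^ p)%:E * cosker p.
Proof.
move=> p0; have [->|y0] := eqVneq y 0%R.
  rewrite normr0 powR0 ?gt_eqF// mul0e /pker.
  by under eq_integral do rewrite mulr0 cos0 subrr mul0r; rewrite integral0.
have y0' : (0 < `|y|)%R by rewrite normr_gt0.
rewrite /cosker -(@pker_scale R p _ _ y0' measurable_one_sub_cos one_sub_cos_ge0).
apply: eq_integral => s _; congr (((1 - _) * _)%R%:E).
have [h|h] := leP 0%R y; first by rewrite ger0_norm// mulrC.
by rewrite ltr0_norm// mulNr cosN mulrC.
Qed.

Lemma pker_exp (p a c : R) : (0 < p)%R -> (0 < a)%R -> (0 <= c)%R ->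
  pker p (fun s => 1 - expR (- (c * s `^ a)))%R = (c `^ (p / a))%:E * expker p a.
Proof.
move=> p0 a0; rewrite le_eqVlt => /predU1P[<-|c0].
  rewrite powR0 ?gt_eqF ?divr_gt0// mul0e /pker.
  by under eq_integral do rewrite mul0r oppr0 expR0 subrr mul0r; rewrite integral0.
have cc : (0 < c `^ a^-1)%R by exact: powR_gt0.
have e0 (x : R) : (0 <= 1 - expR (- (x `^ a)))%R.
  by rewrite subr_ge0 -[leRHS]expR0 ler_expR oppr_le0 powR_ge0.
rewrite (mulrC p) powRrM /expker -(@pker_scale R p _ _ cc (measurable_one_sub_exp a) e0).
apply: eq_integral => s; rewrite inE/= in_itv/= andbT => s0.
congr (((1 - expR (- _)) * _)%R%:E).
by rewrite powRM ?powR_ge0 ?ltW// -powRrM mulVf ?gt_eqF// powRr1// ltW.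
Qed.

(** The p-th absolute moment of the standard law with characteristic function exp(-|s|^a). *)
Definition stable_mom (p a : R) : R := (fine (expker p a) / fine (cosker p))%R.

Lemma stable_mom_gt0 (p a : R) : (0 < p < a)%R -> (a <= 2)%R -> (0 < stable_mom p a)%R.
Proof.
move=> /[dup] pa /andP[p0 p_a] a2; have a0 := lt_trans p0 p_a.
apply: divr_gt0; apply: fine_gt0; apply/andP; split.
- exact: expker_gt0.
- exact: expker_lty.
- exact: cosker_gt0.
- by apply: cosker_lty; rewrite p0 (lt_le_trans p_a).
Qed.

Context {d : measure_display} {Omega : measurableType d}.
Variable P : probability Omega R.

(** Up to the factor [cosker p], |Y|^p is the integral of (1 - cos(s Y)) s^(-1-p) over s > 0. Taking
    expectations under the integral by Tonelli replaces 1 - cos(s Y) by 1 - exp(-c s^a), whose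
    integral scales as c^(p/a). *)
Lemma stable_moment (p a c : R) (Y : Omega -> R) :
  (0 < p < a)%R -> (a <= 2)%R -> (0 <= c)%R -> measurable_fun setT Y ->
  (forall s : R, charfun P Y s = (expR (- (c * `|s| `^ a)))%:C%C) ->
  \int[P]_w (`|Y w| `^ p)%:E = (stable_mom p a * c `^ (p / a))%:E.
Proof.
move=> /[dup] pa /andP[p0 p_a] a2 c0 mY chY; have a0 := lt_trans p0 p_a.
have p2 : (0 < p < 2)%R by rewrite p0 (lt_le_trans p_a).
have fc : cosker p \is a fin_num.
  by rewrite ge0_fin_numE ?cosker_lty// ltW// cosker_gt0.
have fe : expker p a \is a fin_num.
  by rewrite ge0_fin_numE ?expker_lty// ltW// expker_gt0.
have cos0 : (0 < fine (cosker p))%R.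
  by apply: fine_gt0; rewrite cosker_gt0// cosker_lty.
have mZ (s : R) : measurable_fun setT (fun w => s * Y w)%R.
  exact: measurable_funM.
have icos (s : R) : P.-integrable setT (fun w => (cos (s * Y w))%:E).
  apply: measurable_bounded_integrable => //.
  - by apply: (le_lt_trans (probability_le1 _ _)); rewrite ?ltry.
  - exact: measurableT_comp measurable_cosE (mZ s).
  - exists 1%R; split=> // M M1 w _ /=; rewrite (le_trans _ (ltW M1))//.
    by rewrite ler_norml cos_geN1 cos_le1.
have Ecos (s : R) : \int[P]_w (1 - cos (s * Y w))%:E = (1 - expR (- (c * `|s| `^ a)))%:E.
  under eq_integral do rewrite EFinB.
  rewrite integralB//; last first.
    by apply: finite_measure_integrable_cst.
  have -> : \int[P]_(_ in setT) 1%:E = 1%:E.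
    by rewrite integral_cst// mul1e; exact: probability_setT.
  have := chY s; rewrite /charfun /cintegral => -[h _].
  rewrite EFinB -h /Rintegral fineK//; exact: integrable_fin_num (icos s).
(* The half-line is encoded by an indicator, so that Tonelli applies on the whole product space. *)
pose F (z : Omega * R) : \bar R :=
  (((1 - cos (z.2 * Y z.1)) * z.2 `^ (-1 - p)) * (\1_(`]0%R, +oo[%classic : set R) z.2))%:E.
have mF : measurable_fun setT F.
  apply/measurable_EFinP; apply: measurable_funM.
    apply: measurable_funM.
      apply: measurable_funB => //; apply: (measurableT_comp measurable_cosE).
      by apply: measurable_funM => //; exact: measurableT_comp.
    by apply: (measurableT_comp (measurable_powR _)).
  by apply: (@measurableT_comp _ _ _ _ _ _ (\1_(`]0%R, +oo[%classic : set R) : R -> R)) => //.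
have F0 z : 0 <= F z.
  by rewrite lee_fin !mulr_ge0 ?one_sub_cos_ge0 ?powR_ge0.
have Fpk (g : R -> R) : pker p g = \int[leb]_s ((g s * s `^ (-1 - p)) * (\1_(`]0%R, +oo[%classic : set R) s))%:E.
  rewrite /pker integral_mkcond; apply: eq_integral => s _.
  by rewrite patchE indicE; case: (s \in _); rewrite ?mulr1 ?mulr0.
have := @fubini_tonelli _ _ _ _ R P leb F mF F0.
have -> : \int[P]_w \int[leb]_s F (w, s) = cosker p * \int[P]_w (`|Y w| `^ p)%:E.
  have h1 : measurable_fun setT (fun w => (`|Y w| `^ p)%:E).
    apply/measurable_EFinP; apply: (measurableT_comp (measurable_powR _)).
    exact: measurableT_comp.
  have h2 w : setT w -> 0 <= (`|Y w| `^ p)%:E by rewrite lee_fin powR_ge0.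
  rewrite -(ge0_integralZl P measurableT h1 h2 (ltW (cosker_gt0 p0))).
  by apply: eq_integral => w _; rewrite muleC -pker_cos// Fpk.
have -> : \int[leb]_s \int[P]_w F (w, s) = (c `^ (p / a))%:E * expker p a.
  rewrite -pker_exp// Fpk; apply: eq_integral => s _; rewrite /F/=.
  rewrite indicE; case: (boolP (s \in _)) => hs; last first.
    by under eq_integral do rewrite mulr0; rewrite integral0 mulr0.
  rewrite mulr1; under eq_integral do rewrite mulr1 mulrC EFinM.
  have h1 : measurable_fun setT (fun w => (1 - cos (s * Y w))%:E).
    apply/measurable_EFinP; apply: measurable_funB => //.
    exact: measurableT_comp measurable_cosE (mZ s).
  have h2 w : setT w -> 0 <= (1 - cos (s * Y w))%:E.
    by rewrite lee_fin one_sub_cos_ge0.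
  have h3 : 0 <= (s `^ (-1 - p))%:E by rewrite lee_fin powR_ge0.
  rewrite (ge0_integralZl P measurableT h1 h2 h3).
  move: hs; rewrite inE/= in_itv/= andbT => s0.
  by rewrite Ecos -EFinM mulrC gtr0_norm.
rewrite -[cosker p]fineK// -[expker p a]fineK// -EFinM => h.
have : (fine (cosker p))^-1%:E * ((fine (cosker p))%:E * \int[P]_w (`|Y w| `^ p)%:E)
   = (fine (cosker p))^-1%:E * (c `^ (p / a) * fine (expker p a))%:E by rewrite h.
rewrite muleA -EFinM mulVf ?gt_eqF// mul1e => ->.
by rewrite -EFinM; congr EFin; rewrite /stable_mom; ring.
Qed.

End StableMoments.

(** * Existence of spectral measures *)

Section UltraLimit.
Context {R : realType}.

(** The limit is the supremum of the levels r that f exceeds on a set of U. One ultrafilter makes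
    all the bounded sequences needed later converge at once, which replaces the diagonal extraction
    of subsequences. *)
Lemma ultra_bounded_lim (U : set_system nat) {UF : ProperFilter U}
    (UU : UltraFilter U) (f : nat -> R) (M : R) :
  (forall n, 0 <= f n <= M) ->
  exists2 l : R, 0 <= l <= M & forall e : R, 0 < e -> U [set n | `|f n - l| <= e].
Proof.
move=> fM.
pose S := [set r | U [set n | r <= f n]].
have S0 : S 0 by apply: filterE => n; have /andP[] := fM n.
have SM : ubound S M.
  move=> r Sr; have [n /= rn] := filter_ex Sr.
  by apply: le_trans rn _; have /andP[] := fM n.
have hS : has_sup S by split; [exists 0|exists M].
exists (sup S).
  by rewrite (sup_upper_bound hS)//= ge_sup//; exists 0.
move=> e e0.
have [r Sr rS] := sup_adherent e0 hS.
have nS : ~ S (sup S + e).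
  move=> /(sup_upper_bound hS); apply/negP; rewrite -ltNge ltrDl//.
have [//|h] := in_ultra_setVsetC [set n | sup S + e <= f n] UU.
apply: (filterS _ (filterI h Sr)) => n [/= /negP h3 h4].
rewrite -ltNge in h3; rewrite ler_norml; apply/andP; split; lra.
Qed.

Lemma norm_chain (u v w z e k : R) : `|u - v| <= e * k -> `|v - w| <= e * k ->
  `|z - w| <= e -> `|u - z| <= 2 * e * k + e.
Proof.
rewrite !ler_norml => /andP[? ?] /andP[? ?] /andP[? ?]; apply/andP; split; lra.
Qed.

Lemma abel_sum (a D : nat -> R) (N : nat) :
  \sum_(i < N) a i * (D i.+1 - D i) =
  a N * D N - a 0%N * D 0%N - \sum_(i < N) (a i.+1 - a i) * D i.+1.
Proof.
elim: N => [|N IH]; first by rewrite !big_ord0; ring.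
by rewrite !big_ord_recr/= IH; ring.
Qed.

End UltraLimit.

Section RiemannSum.
Context {R : realType} {d : measure_display} {T : measurableType d}.
Variables (mu : {measure set T -> \bar R}) (E : set T).
Hypothesis mE : measurable E.
Variables (theta g : T -> R) (phi : R -> R) (x : nat -> R) (N : nat) (e : R).
Hypotheses (mtheta : measurable_fun E theta) (ig : mu.-integrable E (EFin \o g))
  (g0 : forall t, E t -> 0 <= g t) (mphi : measurable_fun setT phi)
  (xnd : forall i, x i <= x i.+1)
  (hE : forall t, E t -> x 0%N < theta t <= x N)
  (hphi : forall i y, (i < N)%N -> x i < y <= x i.+1 -> `|phi y - phi (x i)| <= e).

Let J i : set R := `]x i, x i.+1]%classic.

Let step_eq n y : x 0%N < y <= x n ->
  exists2 i, (i < n)%N & x i < y <= x i.+1 /\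
    \sum_(i < n) phi (x i) * \1_(J i) y = phi (x i).
Proof.
have JE i : (y \in J i) = (x i < y <= x i.+1).
  by apply/idP/idP; rewrite inE /J/= in_itv.
elim: n => [|n IH] /andP[h1 h2]; first by rewrite leNgt h1 in h2.
have [yn|yn] := leP y (x n).
  have [|i iN [hi hs]] := IH; first by rewrite h1.
  exists i; [exact: ltnW|split=> //]; rewrite big_ord_recr/= hs.
  by rewrite indicE JE ltNge yn/= mulr0 addr0.
exists n => //; split; first by rewrite yn.
rewrite big_ord_recr/= indicE JE yn h2/= mulr1 big1 ?add0r// => i _.
have xle j m : (j <= m)%N -> x j <= x m.
  elim: m => [|m IHm]; first by rewrite leqn0 => /eqP ->.
  rewrite leq_eqVlt => /predU1P[->//|/IHm h]; exact: le_trans (xnd m).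
by rewrite indicE JE [y <= _]leNgt (le_lt_trans (xle _ _ (ltn_ord i)) yn) andbF mulr0.
Qed.

Let step_close y : x 0%N < y <= x N ->
  `|phi y - \sum_(i < N) phi (x i) * \1_(J i) y| <= e.
Proof. by move=> /step_eq[i iN [hi ->]]; exact: hphi. Qed.

Let mg : measurable_fun E g.
Proof. by apply/measurable_EFinP; exact: measurable_int ig. Qed.

Let mJ i : measurable_fun E (fun t => \1_(J i) (theta t) : R).
Proof.
apply: (@measurableT_comp _ _ _ _ _ _ (\1_(J i) : R -> R)) => //.
by apply: measurable_indic; exact: measurable_itv.
Qed.

Let iJ i : mu.-integrable E (EFin \o (fun t => phi (x i) * (\1_(J i) (theta t) * g t))).
Proof.
rewrite (_ : _ \o _ = fun t => ((phi (x i))%:E * (\1_(J i) (theta t) * g t)%:E)%E)//.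
apply: integrableZl => //; apply: le_integrable ig => //.
  by apply/measurable_EFinP; apply: measurable_funM; [exact: mJ|exact: mg].
move=> t Et /=; rewrite lee_fin normrM ler_piMl//.
by rewrite indicE; case: (_ \in _); rewrite ?normr1 ?normr0.
Qed.

Let isum n : mu.-integrable E (EFin \o (fun t => \sum_(i < n) phi (x i) * (\1_(J i) (theta t) * g t))).
Proof.
elim: n => [|n IH].
  rewrite (_ : _ \o _ = cst 0%E); first exact: integrable0.
  by apply/funext => t; rewrite /= big_ord0.
rewrite (_ : _ \o _ = fun t => ((\sum_(i < n) phi (x i) * (\1_(J i) (theta t) * g t))%:E +
   (phi (x n) * (\1_(J n) (theta t) * g t))%:E)%E).
  by apply: integrableD => //; exact: iJ.
by apply/funext => t; rewrite /= big_ord_recr/= EFinD.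
Qed.

Let Isum n : \int[mu]_(t in E) (\sum_(i < n) phi (x i) * (\1_(J i) (theta t) * g t)) =
  \sum_(i < n) phi (x i) * \int[mu]_(t in E) (\1_(J i) (theta t) * g t).
Proof.
elim: n => [|n IH].
  by rewrite big_ord0; under eq_Rintegral do rewrite big_ord0; rewrite /Rintegral integral0.
under eq_Rintegral do rewrite big_ord_recr/=.
rewrite (RintegralD mE (isum n) (iJ n)).
rewrite big_ord_recr/= IH RintegralZl//.
apply: le_integrable ig => //.
  by apply/measurable_EFinP; apply: measurable_funM; [exact: mJ|exact: mg].
move=> t Et /=; rewrite lee_fin normrM ler_piMl//.
by rewrite indicE; case: (_ \in _); rewrite ?normr1 ?normr0.
Qed.

Let mphig : measurable_fun E (fun t => phi (theta t) * g t).
Proof. by apply: measurable_funM => //; exact: measurableT_comp. Qed.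

Let close t : E t ->
  `|phi (theta t) * g t - \sum_(i < N) phi (x i) * (\1_(J i) (theta t) * g t)| <= e * g t.
Proof.
move=> Et; under eq_bigr do rewrite mulrA.
rewrite -mulr_suml -mulrBl normrM (ger0_norm (g0 Et)) ler_wpM2r// ?g0//.
by apply: step_close; exact: hE.
Qed.

Let ieg : mu.-integrable E (EFin \o (fun t => e * g t)).
Proof. by rewrite (_ : _ \o _ = fun t => (e%:E * (g t)%:E)%E)//; exact: integrableZl. Qed.

Let idiff : mu.-integrable E (EFin \o (fun t => phi (theta t) * g t -
  \sum_(i < N) phi (x i) * (\1_(J i) (theta t) * g t))).
Proof.
apply: le_integrable ieg => //.
  apply/measurable_EFinP; apply: measurable_funB => //.
  by apply/measurable_EFinP; exact: measurable_int (isum N).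
by move=> t Et /=; rewrite lee_fin (le_trans (close Et))// ler_norm.
Qed.

Lemma riemann_integrable : mu.-integrable E (EFin \o (fun t => phi (theta t) * g t)).
Proof.
have := integrableD mE idiff (isum N).
apply: eq_integrable => // t _ /=.
by rewrite -EFinD subrK.
Qed.

(** Used twice with the same sums in view: for the limit measure, with theta the identity and g = 1,
    and for P, with theta the angle of V and g a moment density. Both integrals are thereby compared
    with sums over increments of distribution functions. *)
Lemma riemann_sum_close :
  `| \int[mu]_(t in E) (phi (theta t) * g t) -
     \sum_(i < N) phi (x i) * \int[mu]_(t in E) (\1_(`]x i, x i.+1]%classic : set R) (theta t) * g t) |
  <= e * \int[mu]_(t in E) g t.
Proof.
rewrite -Isum -(RintegralB mE riemann_integrable (isum N)).
apply: (le_trans (le_normr_Rintegral mE idiff)).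
rewrite -RintegralZl//; apply: le_Rintegral => //.
exact: (integrable_norm idiff).
Qed.

End RiemannSum.

(** * Helly selection *)

Section Helly.
Context {R : realType}.
Context (U : set_system nat) {UF : ProperFilter U} (UU : UltraFilter U).
Variables (F : nat -> R -> R) (M a b : R).
Hypotheses (ab : a < b) (F_nd : forall n x y, x <= y -> F n x <= F n y)
  (F0 : forall n x, x <= a -> F n x = 0) (FM : forall n x, b <= x -> F n x = F n b)
  (FbM : forall n, F n b <= M).

Let F_ge0 n x : 0 <= F n x.
Proof.
have [xa|/ltW ax] := leP x a; first by rewrite F0.
by rewrite -(F0 n (lexx a)) F_nd.
Qed.

Let F_leM n x : F n x <= M.
Proof.
have [bx|/ltW xb] := leP b x; first by rewrite FM.
by apply: le_trans (FbM n); apply: F_nd.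
Qed.

Let exG x : exists l : R, 0 <= l <= M /\ forall e : R, 0 < e -> U [set n | `|F n x - l| <= e].
Proof.
have [|l h1 h2] := @ultra_bounded_lim R U UF UU (F ^~ x) M; last by exists l.
by move=> n; rewrite F_ge0 F_leM.
Qed.

Let G x := sval (cid (exG x)).

Let nearG x (e : R) : 0 < e -> U [set n | `|F n x - G x| <= e].
Proof. by rewrite /G; case: cid => l /= [_ h]; exact: h. Qed.

Let G_ge0 x : 0 <= G x.
Proof. by rewrite /G; case: cid => l /= [/andP[h _] _]. Qed.

Let G_leM x : G x <= M.
Proof. by rewrite /G; case: cid => l /= [/andP[_ h] _]. Qed.

Let G_nd x y : x <= y -> G x <= G y.
Proof.
move=> xy; apply/ler_addgt0Pr => e e0.
have e2 : 0 < e / 2 by rewrite divr_gt0.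
have [n [/=]] := filter_ex (filterI (nearG x e2) (nearG y e2)).
rewrite !ler_norml => /andP[h1 h2] /andP[h3 h4].
have := F_nd n xy; lra.
Qed.

Let G0 x : x <= a -> G x = 0.
Proof.
move=> xa; apply/eqP; rewrite eq_le G_ge0 andbT; apply/ler_addgt0Pr => e e0.
have [n /=] := filter_ex (nearG x e0).
rewrite F0// ler_norml => /andP[h1 h2]; lra.
Qed.

Let Gb x : b <= x -> G x = G b.
Proof.
move=> bx; apply/eqP; rewrite eq_le (G_nd bx) andbT; apply/ler_addgt0Pr => e e0.
have e2 : 0 < e / 2 by rewrite divr_gt0.
have [n [/=]] := filter_ex (filterI (nearG x e2) (nearG b e2)).
rewrite FM// !ler_norml => /andP[h1 h2] /andP[h3 h4]; lra.
Qed.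

(** The pointwise limit [G] need not be right-continuous, as a Stieltjes measure requires; [H] is
    its right-continuous version, with the same value beyond [b]. *)
Let H x := inf (G @` `]x, +oo[).

Let hasinf x : has_inf (G @` `]x, +oo[).
Proof.
split; last by exists 0 => _ [y _ <-].
by exists (G (x + 1)); exists (x + 1) => //=; rewrite in_itv/= andbT ltrDl.
Qed.

Let H_le x y : x < y -> H x <= G y.
Proof.
move=> xy; apply: inf_lbound; first by have [_] := hasinf x.
by exists y => //=; rewrite in_itv/= andbT.
Qed.

Let G_le_H x : G x <= H x.
Proof.
apply: lb_le_inf; first by have [] := hasinf x.
by move=> _ [y yx <-]; move: yx; rewrite /= in_itv/= andbT => /ltW xy; exact: G_nd.
Qed.

Let H_nd : nondecreasing H.
Proof.
move=> x y xy; apply: lb_le_inf; first by have [] := hasinf y.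
move=> _ [z zy <-]; move: zy; rewrite /= in_itv/= andbT => yz; apply: H_le.
exact: le_lt_trans yz.
Qed.

Let H_rc x : H y @[y --> x^'+] --> H x.
Proof.
apply/cvgrPdist_le => e e0.
have [_ [y yx <-] Gy] := inf_adherent e0 (hasinf x).
move: yx; rewrite /= in_itv/= andbT => xy.
near=> z.
have xz : x < z by near: z; exact: nbhs_right_gt.
have zy : z < y by near: z; exact: nbhs_right_lt.
have h1 := H_nd (ltW xz); have h2 := H_le zy.
by rewrite distrC ler_norml; apply/andP; split; move: Gy; rewrite -/(H x); lra.
Unshelve. all: by end_near. Qed.

Let A := a - 1.
Let B := b + 1.

Let H0 x : x < a -> H x = 0.
Proof.
move=> xa; apply/eqP; rewrite eq_le -{1}(G0 (lexx a)) H_le//=.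
by rewrite (le_trans _ (G_le_H x)).
Qed.

Let Hb x : b <= x -> H x = G b.
Proof.
move=> bx; apply/eqP; rewrite eq_le -{2}(Gb bx) G_le_H andbT.
by rewrite -(Gb (_ : b <= x + 1)) ?H_le// ?ltrDl//; lra.
Qed.

(* The jumps D = H - G are summable with sum at most M, because D at a
   partition point is bounded by the next increment of G; Abel summation then
   shows that replacing G by its right-continuous version H changes a
   Riemann-Stieltjes sum by at most e * M. *)
Let sum_GH (phi : R -> R) (x : nat -> R) (N : nat) (e : R) : (0 < N)%N ->
  (forall i, x i < x i.+1) -> x 0%N < a -> b <= x N -> 0 <= e ->
  (forall i, (i < N)%N -> `|phi (x i.+1) - phi (x i)| <= e) ->
  `|\sum_(i < N) phi (x i) * (H (x i.+1) - H (x i)) -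
    \sum_(i < N) phi (x i) * (G (x i.+1) - G (x i))| <= e * M.
Proof.
move=> N0 xi x0 xN e0 he.
pose D i := H (x i) - G (x i).
have D_ge0 i : 0 <= D i by rewrite subr_ge0 G_le_H.
have -> : \sum_(i < N) phi (x i) * (H (x i.+1) - H (x i)) -
    \sum_(i < N) phi (x i) * (G (x i.+1) - G (x i)) =
    \sum_(i < N) phi (x i) * (D i.+1 - D i).
  by rewrite -sumrB; apply: eq_bigr => i _; rewrite /D; ring.
rewrite (abel_sum (fun i => phi (x i)) D N).
have -> : D N = 0 by rewrite /D Hb// Gb// subrr.
have -> : D 0%N = 0 by rewrite /D H0// G0 ?subrr// ltW.
rewrite !mulr0 subrr sub0r normrN.
apply: (le_trans (ler_norm_sum _ _ _)).
apply: (@le_trans _ _ (\sum_(i < N) e * (G (x i.+2) - G (x i.+1)))).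
  apply: ler_sum => i _; rewrite normrM; apply: ler_pM => //.
    exact: he.
  by rewrite ger0_norm// lerD2r H_le.
rewrite -mulr_sumr ler_wpM2l//.
rewrite -(big_mkord xpredT (fun i => G (x i.+2) - G (x i.+1))).
rewrite (telescope_sumr (fun i => G (x i.+1)))//.
have := G_leM (x N.+1); have := G_ge0 (x 1%N); lra.
Qed.

Let sum_FG (phi : R -> R) (x : nat -> R) (N : nat) (e : R) : 0 < e ->
  U [set n | `|\sum_(i < N) phi (x i) * (F n (x i.+1) - F n (x i)) -
    \sum_(i < N) phi (x i) * (G (x i.+1) - G (x i))| <= e].
Proof.
elim: N e => [|N IH] e e0.
  by apply: filterE => n /=; rewrite !big_ord0 subrr normr0 ltW.
have e2 : 0 < e / 2 by rewrite divr_gt0.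
(* The last term involves two values of [F n], each within [k] of the limit, so it contributes at
   most 2 k (1 + |phi (x N)|) = e/2. *)
pose k := e / 4 / (1 + `|phi (x N)|).
have k1 : 0 < 1 + `|phi (x N)| by rewrite ltr_wpDr.
have k0 : 0 < k by rewrite !divr_gt0.
apply: (filterS _ (filterI (IH _ e2) (filterI (nearG (x N) k0) (nearG (x N.+1) k0)))).
move=> n [/= h1 [h2 h3]]; rewrite !big_ord_recr/=.
set S1 := \sum_(i < N) _ in h1 *; set S2 := \sum_(i < N) _ in h1 *.
have -> : S1 + phi (x N) * (F n (x N.+1) - F n (x N)) - (S2 + phi (x N) * (G (x N.+1) - G (x N)))
  = (S1 - S2) + phi (x N) * ((F n (x N.+1) - G (x N.+1)) - (F n (x N) - G (x N))) by ring.
apply: (le_trans (ler_normD _ _)); rewrite (splitr e) lerD// normrM.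
apply: (@le_trans _ _ ((1 + `|phi (x N)|) * (k + k))).
  apply: ler_pM => //; first by rewrite lerDr.
  by apply: (le_trans (ler_normB _ _)); rewrite lerD.
rewrite le_eqVlt; apply/orP; left; apply/eqP; rewrite /k; field.
by rewrite gt_eqF.
Qed.

(** The measure is the Stieltjes measure of [H]. The window is widened by 1 on both sides because
    [H] may already be positive at [a], while it vanishes at a - 1. The error 2 e M + e collects the
    Riemann sum (e M), the passage from [H] to [G] (e M) and the passage from [G] to [F n] (e). *)
Lemma helly_measure : exists nu : {measure set (measurableTypeR R) -> \bar R},
  (nu `](a - 1)%R, (b + 1)%R]%classic < +oo)%E /\
   forall (phi : R -> R) (x : nat -> R) (N : nat) (e : R), (0 < N)%N ->
     measurable_fun setT phi -> 0 < e ->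
     (forall i, x i < x i.+1) -> x 0%N = a - 1 -> x N = b + 1 ->
     (forall i y, (i < N)%N -> x i <= y <= x i.+1 -> `|phi y - phi (x i)| <= e) ->
     nu.-integrable `](a - 1)%R, (b + 1)%R]%classic (EFin \o phi) /\
     U [set n | `| \int[nu]_(y in `](a - 1)%R, (b + 1)%R]%classic) phi y -
        \sum_(i < N) phi (x i) * (F n (x i.+1) - F n (x i)) | <= 2 * e * M + e].
Proof.
have a1a : a - 1 < a by rewrite ltrBlDr ltrDl.
have bb1 : b <= b + 1 by rewrite lerDl.
have ab1 : a - 1 <= b + 1 := le_trans (ltW a1a) (le_trans (ltW ab) bb1).
pose Hc : cumulative R R := HB.pack H (isCumulative.Build R _ R H H_nd H_rc).
pose nu : {measure set (measurableTypeR R) -> \bar R} := lebesgue_stieltjes_measure Hc.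
have nuE u v : u <= v -> nu `]u, v]%classic = (H v - H u)%:E.
  move=> uv; rewrite /nu/= /lebesgue_stieltjes_measure /measure_extension.
  by rewrite measurable_mu_extE/=; [rewrite wlength_itv_bnd|exact: is_ocitv].
exists nu; split; first by rewrite nuE// ltry.
move=> phi x N e N0 mphi e0 xlt x0 xN hphi.
set E : set R := `](a - 1)%R, (b + 1)%R]%classic.
have mE : measurable (E : set (measurableTypeR R)) by exact: measurable_itv.
have xnd i j : (i <= j)%N -> x i <= x j.
  elim: j => [|j IH]; first by rewrite leqn0 => /eqP ->.
  rewrite leq_eqVlt => /predU1P[->//|/IH h]; exact: le_trans h (ltW (xlt j)).
have i1 : nu.-integrable E (EFin \o cst 1).
  apply/integrableP; split; first by apply/measurable_EFinP; exact: measurable_cst.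
  under eq_integral do rewrite /= normr1.
  by rewrite integral_cst// nuE// mul1e ltry.
have hE (t : measurableTypeR R) : E t -> x 0%N < t <= x N by rewrite x0 xN /E/= in_itv.
have hphi' i y : (i < N)%N -> x i < y <= x i.+1 -> `|phi y - phi (x i)| <= e.
  by move=> iN /andP[h1 h2]; apply: hphi => //; rewrite (ltW h1).
have h01 (t : measurableTypeR R) : E t -> 0 <= (cst 1 : measurableTypeR R -> R) t by [].
have mid : measurable_fun E (id : measurableTypeR R -> R) by exact: measurable_id.
have ri := riemann_integrable mE mid i1 h01 mphi (fun i => ltW (xlt i)) hE hphi'.
have rc := riemann_sum_close mE mid i1 h01 mphi (fun i => ltW (xlt i)) hE hphi'.
split.
  by apply: eq_integrable ri => // t _ /=; rewrite mulr1.
have Iphi : \int[nu]_(t in E) (phi t * (cst 1 : measurableTypeR R -> R) t) = \int[nu]_(t in E) phi t.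
  by apply: eq_Rintegral => t _; rewrite mulr1.
have I1 : \int[nu]_(t in E) (cst 1 : measurableTypeR R -> R) t <= M.
  rewrite /= Rintegral_cst// mul1r /E nuE//= Hb//.
  by rewrite H0// subr0; exact: G_leM.
have IJ i : (i < N)%N -> \int[nu]_(t in E) (\1_(`]x i, x i.+1]%classic : set R) t * (cst 1 : measurableTypeR R -> R) t)
   = H (x i.+1) - H (x i).
  move=> iN; under eq_Rintegral do rewrite mulr1.
  rewrite /Rintegral integral_indic//.
  rewrite (_ : _ `&` _ = `]x i, x i.+1]%classic) ?nuE//; first exact: ltW.
  apply/setIidPl => t; rewrite /E/= !in_itv/= => /andP[h1 h2].
  rewrite -x0 -xN (le_lt_trans _ h1) ?xnd//= (le_trans h2)// xnd//.
rewrite Iphi in rc.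
have sH : \sum_(i < N) phi (x i) * \int[nu]_(t in E) (\1_(`]x i, x i.+1]%classic : set R) t * (cst 1 : measurableTypeR R -> R) t)
  = \sum_(i < N) phi (x i) * (H (x i.+1) - H (x i)).
  by apply: eq_bigr => i _; rewrite IJ.
rewrite sH in rc.
have M0 : 0 <= M by exact: le_trans (G_leM b).
have gh := @sum_GH phi x N e N0 xlt.
apply: (filterS _ (sum_FG phi x N e0)) => n /= hF.
have {}gh := gh _ _ (ltW e0) _.
have x0a : x 0%N < a by rewrite x0.
have xNb : b <= x N by rewrite xN.
have {}gh := gh x0a xNb.
have hh : forall i, (i < N)%N -> `|phi (x i.+1) - phi (x i)| <= e.
  by move=> i iN; apply: hphi => //; rewrite lexx ltW.
have {}gh := gh hh.
have rc' : `|\int[nu]_(x in E) phi x - \sum_(i < N) phi (x i) * (H (x i.+1) - H (x i))| <= e * M.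
  by apply: (le_trans rc); rewrite ler_wpM2l// ltW.
exact: (norm_chain rc' gh hF).
Qed.

End Helly.

(** * Elementary power inequalities *)

Section PowerInequalities.
Context {R : realType}.

(** Young's inequality for the product of r^(a-1) and s, with exponents a/(a-1) and a. It serves as
    the convexity of the power function throughout, without derivatives. *)
Lemma powR_tangent (a r s : R) : 1 < a -> 0 <= r -> 0 <= s ->
  r `^ a + a * r `^ (a - 1) * (s - r) <= s `^ a.
Proof.
move=> a1 r0 s0; have a0 : 0 < a by exact: lt_trans a1.
have b0 : 0 < a - 1 by rewrite subr_gt0.
have q0 : 0 < a / (a - 1) by rewrite divr_gt0.
have := @conjugate_powR R (r `^ (a - 1)) s (a / (a - 1)) a.
rewrite powR_ge0 s0 q0 a0 => /(_ isT isT isT isT).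
have -> : (a / (a - 1))^-1 + a^-1 = 1 by field; rewrite !gt_eqF.
move=> /(_ erefl); rewrite -powRrM mulrCA divff ?gt_eqF// mulr1 => h.
have h2 : a * (r `^ (a - 1) * s) <= (a - 1) * r `^ a + s `^ a.
  apply: (@le_trans _ _ (a * (r `^ a / (a / (a - 1)) + s `^ a / a))).
    by rewrite ler_wpM2l// ltW.
  rewrite le_eqVlt; apply/orP; left; apply/eqP; field; by rewrite !gt_eqF.
have h3 : r * r `^ (a - 1) = r `^ a by exact: mulr_powRB1.
move: h2 h3; move: (r `^ a) (r `^ (a - 1)) (s `^ a) => u v w h2 h3.
have -> : u + a * v * (s - r) = u + a * (v * s) - a * (r * v) by ring.
rewrite h3; lra.
Qed.

Lemma powR_lip (a r s : R) : 1 < a <= 2 -> 0 <= r <= 1 -> 0 <= s <= 1 ->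
  `|r `^ a - s `^ a| <= 2 * `|r - s|.
Proof.
move=> /andP[a1 a2].
have key u v : 0 <= u <= 1 -> 0 <= v <= 1 -> u `^ a - v `^ a <= 2 * `|u - v|.
  move=> /andP[u0 u1] /andP[v0 v1]; have := powR_tangent a1 u0 v0.
  have h : 0 <= a * u `^ (a - 1) <= 2.
    have a0 : 0 <= a by rewrite (le_trans ler01)// ltW.
    have w1 : u `^ (a - 1) <= 1.
      rewrite [leRHS](_ : _ = 1 `^ (a - 1)); last by rewrite powR1.
      by rewrite ge0_ler_powR ?nnegrE// subr_ge0 ltW.
    rewrite mulr_ge0 ?powR_ge0//= -[leRHS]mulr1.
    exact: ler_pM a0 (powR_ge0 _ _) a2 w1.
  move=> h2; apply: (@le_trans _ _ (a * u `^ (a - 1) * (u - v))).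
    move: h2; set k := a * _; rewrite -[v - u]opprB mulrN; lra.
  have /andP[h0 h3] := h; apply: (@le_trans _ _ (a * u `^ (a - 1) * `|u - v|)).
    by rewrite ler_wpM2l// ler_norm.
  by rewrite ler_wpM2r.
move=> r01 s01; rewrite ler_norml; apply/andP; split.
  by rewrite -lerN2 opprK opprB distrC; exact: key.
exact: key.
Qed.

(** The difference is r^p (1 - r^(a-p)), where r^p <= r and 1 - r^(a-p) <= (a - p)(- ln r), and r (-
    ln r) <= 1. The bound is uniform in r, so the exponent p of a moment can be replaced by the
    limit exponent at all angles simultaneously. *)
Lemma powR_exponent_close (a p r : R) : 1 <= p -> p <= a -> 0 <= r <= 1 ->
  `|r `^ p - r `^ a| <= a - p.
Proof.
move=> p1 pa /andP[r0 r1].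
have p0 : 0 < p by exact: lt_le_trans p1.
have [r00|rn0] := eqVneq r 0.
  by rewrite r00 !powR0 ?gt_eqF ?(lt_le_trans p0)// subrr normr0 subr_ge0.
have rp : 0 < r by rewrite lt_neqAle eq_sym rn0.
have ra : r `^ a = r `^ p * r `^ (a - p).
  by rewrite -powRD ?rn0 ?implybT//; congr powR; ring.
have d1 : r `^ (a - p) <= 1.
  by rewrite -[leRHS](powRr0 r) ger_powR ?rp ?subr_ge0.
rewrite ra -{1}[r `^ p]mulr1 -mulrBr normrM !ger0_norm ?powR_ge0 ?subr_ge0//.
have rp1 : r `^ p <= r by apply: ge1r_powR => //; rewrite rp.
have h1 : 1 - r `^ (a - p) <= (a - p) * (- ln r).
  rewrite /powR (negbTE rn0) lerBlDl.
  have := expR_ge1Dx ((a - p) * ln r); lra.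
have h2 : - ln r <= r^-1 - 1.
  rewrite -lnV ?posrE//.
  have := expR_ge1Dx (ln r^-1); rewrite lnK ?posrE ?invr_gt0//; lra.
have h3 : r * (- ln r) <= 1.
  apply: (@le_trans _ _ (r * (r^-1 - 1))); first by rewrite ler_wpM2l.
  rewrite mulrBr divff// mulr1; lra.
apply: (@le_trans _ _ (r * ((a - p) * - ln r))).
  by apply: ler_pM => //; rewrite ?powR_ge0 ?subr_ge0.
by rewrite mulrCA -[leRHS]mulr1 ler_wpM2l// subr_ge0.
Qed.

Lemma powR_cvg_exponent (c : R) (p : nat -> R) (a : R) : 0 <= c -> 0 < a ->
  p n @[n --> \oo] --> a -> (fun n => c `^ (p n / a)) @ \oo --> c.
Proof.
move=> c0 a0 pa; have pa1 : p n / a @[n --> \oo] --> (1 : R).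
  have a0' : a != 0 by rewrite gt_eqF.
  by rewrite -(divff a0'); apply: cvgMr_tmp.
have [->|cn0] := eqVneq c 0.
  apply/cvgrPdist_le => e e0.
  (* The power of 0 with exponent 0 is 1, so the exponents must be kept away from 0; those at
     distance less than 1 from 1 are. *)
  have h : 0 < (1 : R) by []; move/cvgrPdist_lt: pa1 => /(_ 1 h); apply: filterS => n hn.
  rewrite powR0 ?subrr ?normr0 ?ltW//; apply: contraTN hn => /eqP ->.
  by rewrite subr0 normr1 ltxx.
have -> : (fun n => c `^ (p n / a)) = (fun n => expR (p n / a * ln c)).
  by apply/funext => n; rewrite /powR (negbTE cn0).
have h : (fun n => expR (p n / a * ln c)) @ \oo --> expR (1 * ln c).
  by apply: continuous_cvg; [exact: continuous_expR|apply: cvgMr_tmp].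
by move: h; rewrite mul1r lnK// posrE lt_neqAle eq_sym cn0.
Qed.

Lemma sin_lip0 (x : R) : `|sin x| <= `|x|.
Proof.
wlog x0 : x / 0 <= x.
  move=> h; have [/h//|/ltW x0] := leP 0 x.
  by rewrite -normrN -sinN -[leRHS]normrN h// oppr_ge0.
rewrite (ger0_norm x0) ler_norml sin_le_id// andbT.
have [x1|/ltW x1] := leP 1 x; first by have := sin_geN1 x; lra.
suff : 0 <= sin x by lra.
by apply: sin_ge0_pi; rewrite x0 (le_trans x1)// (le_trans _ (pi_ge2 R))// ler1n.
Qed.

Lemma cos_sin_lip (t1 t2 y z : R) : `|t1| <= 1 -> `|t2| <= 1 ->
  `|(t1 * cos y + t2 * sin y) - (t1 * cos z + t2 * sin z)| <= 2 * `|y - z|.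
Proof.
move=> h1 h2; pose u := (y + z) / 2; pose v := (y - z) / 2.
have -> : y = u + v by rewrite /u /v; field.
have -> : z = u - v by rewrite /u /v; field.
rewrite !cosD !sinD cosN sinN (_ : u + v - (u - v) = 2 * v); last by ring.
have -> : (t1 * (cos u * cos v - sin u * sin v) + t2 * (sin u * cos v + cos u * sin v)) -
  (t1 * (cos u * cos v - sin u * - sin v) + t2 * (sin u * cos v + cos u * - sin v))
  = 2 * sin v * (t2 * cos u - t1 * sin u) by ring.
rewrite !normrM !(ger0_norm (ler0n R 2)) mulrC.
apply: ler_pM => //; rewrite ?mulr_ge0//.
  apply: (le_trans (ler_normB _ _)); rewrite (_ : 2 = 1 + 1 :> R)//.
  rewrite !normrM lerD// -[leRHS]mulr1 ler_pM// ler_norml ?cos_geN1 ?cos_le1//.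
  by rewrite sin_geN1 sin_le1.
by rewrite -normrM -/v ler_wpM2l// sin_lip0.
Qed.

End PowerInequalities.

Lemma norm_chain4 {R : realType} (i s j c1 c2 e M : R) :
  `|i - s| <= 2 * e * M + e -> `|j - s| <= e * M -> `|c1 - j| <= e * M ->
  `|c1 - c2| <= e -> `|i - c2| <= (2 * e * M + e) + e * M + e * M + e.
Proof.
rewrite !ler_norml => /andP[? ?] /andP[? ?] /andP[? ?] /andP[? ?].
by apply/andP; split; lra.
Qed.

Section PolarAngle.
Context {R : realType}.

(* The direction of the line through 0 and [z], as an angle in ]-pi/2, pi/2]. *)
Definition angle (z : R[i]) : R :=
  if complex.Re z == 0 then pi / 2 else atan (complex.Im z / complex.Re z).

Lemma angle_gt (z : R[i]) : - (pi / 2) < angle z.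
Proof.
rewrite /angle; case: ifPn => _; last exact: atan_gtNpi2.
by have := @pi_gt0 R; lra.
Qed.

Lemma angle_le (z : R[i]) : angle z <= pi / 2.
Proof. by rewrite /angle; case: ifPn => _ //; exact/ltW/atan_ltpi2. Qed.

(** The vector z equals plus or minus |z| times the unit vector at its angle, and the absolute value
    removes the sign. This is why a half-circle of angles is enough. *)
Lemma angleP (z : R[i]) (t1 t2 : R) :
  `|t1 * complex.Re z + t2 * complex.Im z| =
  cabs z * `|t1 * cos (angle z) + t2 * sin (angle z)|.
Proof.
case: z => x y; rewrite /angle/cabs/=; case: ifPn => [/eqP ->|x0].
  rewrite cos_pihalf sin_pihalf !mulr0 !add0r mulr1 expr0n/= add0r sqrtr_sqr.
  by rewrite normrM mulrC.
set c := cos _; set s := sin _.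
have c0 : c != 0 by rewrite gt_eqF// cos_gt0_pihalf// atan_gtNpi2 atan_ltpi2.
have sc : s = y / x * c by rewrite -[y / x]atanK /tan -/s -/c divfK.
have c2 : Num.sqrt (x ^+ 2 + y ^+ 2) * `|c| = `|x|.
  rewrite -[`|c|]sqrtr_sqr -sqrtrM ?addr_ge0 ?sqr_ge0// -[RHS]sqrtr_sqr; congr Num.sqrt.
  have h : c ^+ 2 + s ^+ 2 = 1 by rewrite cos2Dsin2.
  rewrite -[RHS]mulr1 -h sc; field; exact: x0.
have -> : t1 * c + t2 * s = (t1 * x + t2 * y) / x * c by rewrite sc; field; exact: x0.
rewrite [in RHS]normrM mulrCA c2 -normrM divfK//.
Qed.

Lemma measurable_angle {d : measure_display} {T : measurableType d} (V : T -> R[i]) :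
  cmeas setT V -> measurable_fun setT (fun w => angle (V w)).
Proof.
move=> /cmeasP[mr mi]; rewrite /angle.
apply: measurable_fun_ifT.
- by apply: measurable_fun_eqr.
- exact: measurable_cst.
- apply: (measurableT_comp (continuous_measurable_fun (@continuous_atan R))).
  (* The inverse of x is x times (x^2)^(-1), also at x = 0 where both sides are 0; the right-hand
     side is a product of measurable functions. *)
  have -> : (fun w => complex.Im (V w) / complex.Re (V w)) =
      (fun w => complex.Im (V w) * (complex.Re (V w) * (complex.Re (V w) ^+ 2) `^ (-1))).
    apply/funext => w; congr (_ * _); rewrite powR_inv1 ?sqr_ge0//.
    have [->|x0] := eqVneq (complex.Re (V w)) 0; first by rewrite invr0 mul0r.
    by field.
  apply: measurable_funM => //; apply: measurable_funM => //.
  apply: (measurableT_comp (measurable_powR _)).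
  exact: measurable_funX.
Qed.

End PolarAngle.

(** * The angular measure of a complex stable variable *)

Section AngularMeasure.
Context {R : realType} {d : measure_display} {Omega : measurableType d}.
Variable P : probability Omega R.
Variables (alpha : R) (V : Omega -> R[i]) (C : R -> R -> R).
Hypotheses (halpha : 1 < alpha <= 2) (mV : cmeas setT V).
Hypothesis C0 : forall t1 t2, 0 <= C t1 t2.
Hypothesis chV : forall t1 t2 s,
  charfun P (fun w => t1 * complex.Re (V w) + t2 * complex.Im (V w)) s =
  (expR (- (C t1 t2 * `|s| `^ alpha)))%:C.

Let X t1 t2 w := t1 * complex.Re (V w) + t2 * complex.Im (V w).

Let a1 : 1 < alpha. Proof. by have /andP[] := halpha. Qed.
Let a2 : alpha <= 2. Proof. by have /andP[] := halpha. Qed.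
Let a0 : 0 < alpha. Proof. exact: lt_trans a1. Qed.

Lemma char_exponent_homogeneous (l t1 t2 : R) : 0 <= l ->
  C (l * t1) (l * t2) = l `^ alpha * C t1 t2.
Proof.
move=> l0; have h1 := chV (l * t1) (l * t2) 1; have h2 := chV t1 t2 l.
have e : charfun P (fun w => l * t1 * complex.Re (V w) + l * t2 * complex.Im (V w)) 1 =
  charfun P (fun w => t1 * complex.Re (V w) + t2 * complex.Im (V w)) l.
  by rewrite /charfun; apply: cintegral_eq => w _; congr expi; ring.
move: h1; rewrite e h2 => -[/expR_inj/oppr_inj].
by rewrite normr1 powR1 mulr1 ger0_norm// mulrC => ->.
Qed.

Let mX t1 t2 : measurable_fun setT (X t1 t2).
Proof.
by have /cmeasP[? ?] := mV; apply: measurable_funD; apply: measurable_funM.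
Qed.

(** Exponents below alpha, where moments are finite, tending to alpha; the factor (alpha - 1)/2
    keeps them above 1, as [powR_exponent_close] requires. *)
Let p (n : nat) : R := alpha - (alpha - 1) / 2 * harmonic n.

Let pP n : 1 <= p n /\ p n < alpha.
Proof.
have h0 : 0 < harmonic n :> R by rewrite invr_gt0.
have h1 : harmonic n <= 1 :> R by rewrite /harmonic /= invf_le1 // ler1n.
have b0 : 0 < alpha - 1 by rewrite subr_gt0.
have h2 : (alpha - 1) / 2 * harmonic n <= (alpha - 1) / 2 * 1.
  by rewrite ler_wpM2l// divr_ge0// ltW.
have h3 : 0 < (alpha - 1) / 2 * harmonic n by rewrite mulr_gt0// divr_gt0.
by rewrite /p; move: h2 h3; set k := _ * harmonic n; split; lra.
Qed.

Let p_cvg : p n @[n --> \oo] --> alpha.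
Proof.
rewrite -[X in _ --> X]subr0 -[X in _ - X](mulr0 ((alpha - 1) / 2)).
apply: cvgB; first exact: cvg_cst.
by apply: cvgMl_tmp; exact: cvg_harmonic.
Qed.

Let kap n := stable_mom (p n) alpha.

Let kap0 n : 0 < kap n.
Proof.
have [h1 h2] := pP n; apply: stable_mom_gt0 => //; rewrite h2 andbT.
exact: lt_le_trans h1.
Qed.

Let moment n t1 t2 :
  (\int[P]_w (`|X t1 t2 w| `^ (p n))%:E = (kap n * C t1 t2 `^ (p n / alpha))%:E)%E.
Proof.
have [h1 h2] := pP n; apply: stable_moment => //.
- by rewrite h2 (lt_le_trans _ h1).
- exact: chV.
Qed.

Let theta w := angle (V w).
(** The image of g dP under [theta] is the approximate angular measure: by [angleP] and [moment] it
    integrates |t1 cos + t2 sin|^(p n) to C(t1,t2)^(p n/alpha). The division by [kap n] keeps its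
    total mass bounded as [p n] tends to alpha. *)
Let g n w := cabs (V w) `^ (p n) / kap n.

Let g0 n w : 0 <= g n w.
Proof. by rewrite divr_ge0 ?powR_ge0// ltW. Qed.

Let mg n : measurable_fun setT (g n).
Proof.
apply: measurable_funM => //; apply: (measurableT_comp (measurable_powR _)).
exact: measurable_cabs.
Qed.

(** A bound of the total masses: |V|^p <= 2^p (|Re V|^p + |Im V|^p) with 2^p <= 4, and each
    normalised moment is at most 1 + C by [powC]. *)
Let M := 4 * (2 + C 1 0 + C 0 1).

Let M0 : 0 <= M.
Proof. by rewrite /M mulr_ge0// !addr_ge0. Qed.

Let powC n t1 t2 : C t1 t2 `^ (p n / alpha) <= 1 + C t1 t2.
Proof.
have [h1 h2] := pP n.
have q1 : p n / alpha <= 1 by rewrite ler_pdivrMr// mul1r ltW.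
have q0 : 0 <= p n / alpha by rewrite divr_ge0 ?(le_trans ler01)// ltW.
have [c1|/ltW c1] := leP (C t1 t2) 1.
  apply: (@le_trans _ _ 1); last by rewrite lerDl.
  have -> : 1 = 1 `^ (p n / alpha) :> R by rewrite powR1.
  by rewrite ge0_ler_powR ?nnegrE.
by apply: (le_trans (ler1_powR c1 q1)); rewrite lerDr.
Qed.

Let int_g n : (\int[P]_w (g n w)%:E <= M%:E)%E.
Proof.
have [h1 h2] := pP n.
have mXp t1 t2 : measurable_fun setT (fun w => (`|X t1 t2 w| `^ (p n))%:E).
  apply/measurable_EFinP; apply: (measurableT_comp (measurable_powR _)).
  exact: measurableT_comp.
apply: (@le_trans _ _ (\int[P]_w ((4 / kap n)%:E * ((`|X 1 0 w| `^ (p n))%:E + (`|X 0 1 w| `^ (p n))%:E)))%E).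
  apply: ge0_le_integral => //.
  - by move=> w _; rewrite lee_fin.
  - exact/measurable_EFinP.
  - by apply: emeasurable_funM => //; exact: emeasurable_funD.
  move=> w _; rewrite -EFinD -EFinM lee_fin /g mulrAC ler_pM2r ?invr_gt0//.
  apply: (@le_trans _ _ ((`|X 1 0 w| + `|X 0 1 w|) `^ (p n))).
    have p0 : 0 <= p n by exact: le_trans h1.
    apply: ge0_ler_powR => //.
    - by rewrite nnegrE cabs_ge0.
    - by rewrite nnegrE; exact: addr_ge0.
    by rewrite /X !mul1r !mul0r addr0 add0r cabs_le_ReIm.
  apply: (le_trans (powR_add_le _ _ _)) => //; first exact: le_trans h1.
  rewrite ler_wpM2r ?addr_ge0 ?powR_ge0//.
  have -> : 4 = 2 `^ 2%:R :> R by rewrite powR_mulrn// -natrX.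
  by rewrite ler_powR ?ler1n// (le_trans (ltW h2)).
rewrite ge0_integralZl//; last 3 first.
- exact: emeasurable_funD.
- by move=> w _; rewrite -EFinD lee_fin addr_ge0 ?powR_ge0.
- by rewrite lee_fin divr_ge0// ltW.
rewrite ge0_integralD//; try by [move=> w _; rewrite lee_fin powR_ge0].
rewrite !moment -EFinD -EFinM lee_fin -mulrDr mulrA divfK ?gt_eqF//.
rewrite /M ler_wpM2l//.
have := powC n 1 0; have := powC n 0 1; lra.
Qed.

Let ig n : P.-integrable setT (EFin \o g n).
Proof.
apply/integrableP; split; first exact/measurable_EFinP.
under eq_integral do rewrite gee0_abs ?lee_fin//.
exact: le_lt_trans (int_g n) (ltry _).
Qed.

Let F n x := \int[P]_w (\1_(`]-oo, x]%classic : set R) (theta w) * g n w).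

Let mtheta : measurable_fun setT theta.
Proof. exact: measurable_angle. Qed.

Let iJ n (J : set R) : measurable J ->
  P.-integrable setT (EFin \o (fun w => \1_J (theta w) * g n w)).
Proof.
move=> mJ; apply: le_integrable (ig n) => //.
  apply/measurable_EFinP; apply: measurable_funM => //.
  by apply: (@measurableT_comp _ _ _ _ _ _ (\1_J : R -> R)) => //; apply: measurable_indic.
move=> t Et /=; rewrite lee_fin normrM ler_piMl//.
by rewrite indicE; case: (_ \in _); rewrite ?normr1 ?normr0.
Qed.

Let F_nd n x y : x <= y -> F n x <= F n y.
Proof.
move=> xy; apply: le_Rintegral => //; [exact: iJ|exact: iJ|].
move=> w _; rewrite ler_wpM2r// !indicE ler_nat.
case: (boolP (theta w \in `]-oo, x]%classic)) => //; rewrite inE/= in_itv/= => h.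
by rewrite mem_set//= in_itv/= (le_trans h).
Qed.

Let FB n x y : x <= y ->
  \int[P]_w (\1_(`]x, y]%classic : set R) (theta w) * g n w) = F n y - F n x.
Proof.
move=> xy; rewrite /F -RintegralB//; [|exact: iJ|exact: iJ].
apply: eq_Rintegral => w _; rewrite -mulrBl; congr (_ * _).
rewrite !indicE.
have -> : (theta w \in `]x, y]%classic) = (x < theta w <= y).
  by apply/idP/idP; rewrite inE/= in_itv.
have E z : (theta w \in `]-oo, z]%classic) = (theta w <= z).
  by apply/idP/idP; rewrite inE/= in_itv.
rewrite !E; have [h|h] := leP (theta w) x.
  by rewrite (le_trans h xy) subrr.
by rewrite subr0.
Qed.

Let F0 n x : x <= - (pi / 2) -> F n x = 0.
Proof.
move=> xa; rewrite /F (@eq_Rintegral _ _ _ _ _ (cst 0)); first by rewrite /Rintegral integral0.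
move=> w _; rewrite indicE memNset ?mul0r//= in_itv/=; apply/negP.
by rewrite -ltNge (le_lt_trans xa)// angle_gt.
Qed.

Let FM n x : pi / 2 <= x -> F n x = F n (pi / 2).
Proof.
move=> xb; apply: eq_Rintegral => w _; rewrite !indicE !mem_set//=; rewrite in_itv/= ?angle_le//.
by rewrite (le_trans _ xb)// angle_le.
Qed.

Let FbM n : F n (pi / 2) <= M.
Proof.
rewrite -lee_fin /F /Rintegral fineK; last first.
  by apply: integrable_fin_num => //; exact: (iJ n (measurable_itv _)).
apply: le_trans (int_g n); apply: ge0_le_integral => //.
- by move=> w _; rewrite lee_fin mulr_ge0.
- exact: measurable_int (iJ n (measurable_itv _)).
- exact/measurable_EFinP.
- by move=> w _; rewrite lee_fin ler_piMl.
Qed.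

Let e_ (t1 t2 y : R) := `|t1 * cos y + t2 * sin y|.

Let me_ t1 t2 : measurable_fun setT (e_ t1 t2).
Proof.
apply: measurableT_comp => //; apply: measurable_funD; apply: measurable_funM => //.
  exact: measurable_cosE.
exact: continuous_measurable_fun (@continuous_sin R).
Qed.

Let e_01 t1 t2 y : `|t1| + `|t2| <= 1 -> 0 <= e_ t1 t2 y <= 1.
Proof.
move=> t12; rewrite normr_ge0/=; apply: (le_trans (ler_normD _ _)).
apply: le_trans t12; rewrite !normrM lerD// -[leRHS]mulr1 ler_wpM2l// ler_norml.
  by rewrite cos_geN1 cos_le1.
by rewrite sin_geN1 sin_le1.
Qed.

(** For one well-chosen index n, the integral against the limit measure, the Riemann sum over [F n],
    the P-integral with exponent alpha and the P-integral with exponent [p n] are successively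
    close, and the last one is known. This is done for |t1| + |t2| <= 1, where the test function is
    Lipschitz with values in [0, 1]; homogeneity gives the rest. *)
Lemma angular_measure : exists (nu : {measure set (measurableTypeR R) -> \bar R}) (D : set (measurableTypeR R)),
  [/\ measurable D, (nu D < +oo)%E & forall t1 t2,
   (C t1 t2)%:E = (\int[nu]_(y in D) (`|t1 * cos y + t2 * sin y| `^ alpha)%:E)%E].
Proof.
have [U [UU Uoo]] := @ultraFilterLemma _ \oo _.
have UF : ProperFilter U by exact: ultra_proper.
have [nu [nuoo hnu]] := @helly_measure R U UF UU F M (- (pi / 2)) (pi / 2)
  ltac:(have := @pi_gt0 R; lra) F_nd F0 FM FbM.
pose D : set (measurableTypeR R) := `](- (pi / 2) - 1)%R, (pi / 2 + 1)%R]%classic.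
have mD : measurable D by exact: measurable_itv.
have small t1 t2 : `|t1| + `|t2| <= 1 ->
    nu.-integrable D (EFin \o (fun y => e_ t1 t2 y `^ alpha)) /\
    \int[nu]_(y in D) (e_ t1 t2 y `^ alpha) = C t1 t2.
  move=> t12.
  have t1l : `|t1| <= 1 by apply: le_trans t12; rewrite lerDl.
  have t2l : `|t2| <= 1 by apply: le_trans t12; rewrite lerDr.
  pose phi y := e_ t1 t2 y `^ alpha.
  have mphi : measurable_fun setT phi by apply: (measurableT_comp (measurable_powR _)); exact: me_.
  have philip y z : `|phi y - phi z| <= 4 * `|y - z|.
    apply: (le_trans (powR_lip halpha (e_01 y t12) (e_01 z t12))).
    rewrite (_ : 4 = 2 * 2 :> R); last by ring.
    rewrite -mulrA ler_wpM2l//; apply: le_trans (cos_sin_lip _ _ t1l t2l).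
    exact: ler_dist_dist.
  have close (e : R) : 0 < e -> exists2 n0 : nat,
      nu.-integrable D (EFin \o phi) &
      `| \int[nu]_(y in D) phi y - C t1 t2| <= (2 * e * M + e) + e * M + e * M + e.
    move=> e0; pose L := pi + 2 : R.
    have L0 : 0 < L by rewrite addr_gt0// pi_gt0.
    (* [L] is the length of the widened window and the test function is 4-Lipschitz, so on cells of
       length L/N it oscillates by at most e. *)
    pose N := (Num.bound (4 * L / e)).+1.
    have NR0 : 0 < N%:R :> R by rewrite ltr0n.
    have hN : 4 * (L / N%:R) <= e.
      have h0 : 0 <= 4 * L / e by apply: divr_ge0; [exact: mulr_ge0 (ler0n _ _) (ltW L0)|exact: ltW].
      rewrite mulrA ler_pdivrMr// [leRHS]mulrC -ler_pdivrMr//.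
      have h := archi_boundP h0.
      by apply: (le_trans (ltW h)); rewrite ler_nat leqnSn.
    pose x (i : nat) : R := - (pi / 2) - 1 + i%:R * (L / N%:R).
    have xlt i : x i < x i.+1.
      by rewrite ltrD2l ltr_pM2r ?divr_gt0// ltr_nat.
    have x0 : x 0%N = - (pi / 2) - 1 by rewrite /x mul0r addr0.
    have xN : x N = pi / 2 + 1.
      by rewrite /x mulrCA divff ?gt_eqF// mulr1 /L; field.
    have hphi i y : (i < N)%N -> x i <= y <= x i.+1 -> `|phi y - phi (x i)| <= e.
      move=> _ /andP[h1 h2]; apply: (le_trans (philip _ _)); apply: le_trans hN.
      rewrite ler_wpM2l// ger0_norm ?subr_ge0// lerBlDl (le_trans h2)//.
      by rewrite /x; move: (L / N%:R) => q; have -> : i.+1%:R = i%:R + 1 :> R; [rewrite natr1|rewrite [(_ + 1) * q]mulrDl mul1r addrA].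
    have [iphi Uphi] := hnu phi x N e isT mphi e0 xlt x0 xN hphi.
    have Ucvg : U [set n | `|C t1 t2 `^ (p n / alpha) - C t1 t2| <= e].
      apply: Uoo; have /cvgrPdist_le/(_ e e0) := powR_cvg_exponent (C0 t1 t2) a0 p_cvg.
      by apply: filterS => n /=; rewrite distrC.
    have Up : U [set n | alpha - p n <= e].
      apply: Uoo; have /cvgrPdist_le/(_ e e0) := p_cvg.
      by apply: filterS => n /=; apply: le_trans; rewrite ler_norm.
    have [n [/= h1 [h2 h3]]] := filter_ex (filterI Uphi (filterI Ucvg Up)).
    exists n => //.
    have hphi' i y : (i < N)%N -> x i < y <= x i.+1 -> `|phi y - phi (x i)| <= e.
      by move=> iN /andP[k1 k2]; apply: hphi => //; rewrite (ltW k1).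
    have hE (w : Omega) : setT w -> x 0%N < theta w <= x N.
      move=> _; rewrite x0 xN; apply/andP; split.
        by apply: lt_trans (angle_gt _); rewrite ltrBlDr ltrDl.
      by apply: (le_trans (angle_le _)); rewrite lerDl.
    have g0' (w : Omega) : setT w -> 0 <= g n w by [].
    have ri := riemann_integrable measurableT mtheta (ig n) g0' mphi (fun i => ltW (xlt i)) hE hphi'.
    have rc := riemann_sum_close measurableT mtheta (ig n) g0' mphi (fun i => ltW (xlt i)) hE hphi'.
    have IgM : \int[P]_w g n w <= M.
      rewrite -lee_fin /Rintegral fineK ?integrable_fin_num//; exact: ig.
    have rc2 : `| \int[P]_w (phi (theta w) * g n w) -
        \sum_(i < N) phi (x i) * (F n (x i.+1) - F n (x i)) | <= e * M.
      apply: le_trans (_ : _ <= e * \int[P]_w g n w) _; last by rewrite ler_wpM2l// ltW.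
      apply: le_trans rc; rewrite le_eqVlt; apply/orP; left; apply/eqP.
      congr (`| _ - _ |); apply: eq_bigr => i _; congr (_ * _).
      by rewrite FB// ltW.
    have [p1 pa] := pP n.
    pose psi w := e_ t1 t2 (theta w) `^ (p n) * g n w.
    have psiE w : psi w = `|X t1 t2 w| `^ (p n) / kap n.
      by rewrite /psi /g /X angleP powRM ?cabs_ge0//; ring.
    have Ipsi : (\int[P]_w (psi w)%:E)%E = (C t1 t2 `^ (p n / alpha))%:E.
      under eq_integral do rewrite psiE mulrC EFinM.
      rewrite ge0_integralZl//; do ?[by move=> w _; rewrite lee_fin powR_ge0
        |by rewrite lee_fin invr_ge0 ltW
        |(apply/measurable_EFinP; apply: (measurableT_comp (measurable_powR _)); exact: measurableT_comp)].
      by rewrite moment -EFinM mulrA mulVf ?gt_eqF// mul1r.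
    have ipsi : P.-integrable setT (EFin \o psi).
      apply/integrableP; split.
        apply/measurable_EFinP; apply: measurable_funM => //.
        apply: (measurableT_comp (measurable_powR _)).
        by apply: (@measurableT_comp _ _ _ _ _ _ (e_ t1 t2)) => //; exact: me_.
      have psi0 w : 0 <= psi w by rewrite psiE divr_ge0 ?powR_ge0// ltW.
      under eq_integral do rewrite gee0_abs ?lee_fin ?psi0//.
      by rewrite Ipsi ltry.
    have IpsiR : \int[P]_w psi w = C t1 t2 `^ (p n / alpha) by rewrite /Rintegral Ipsi.
    have d1 : `| \int[P]_w psi w - \int[P]_w (phi (theta w) * g n w)| <= e * M.
      rewrite -(RintegralB measurableT ipsi ri).
      apply: le_trans (le_normr_Rintegral measurableT _) _.
        by have := integrableB measurableT ipsi ri; apply: eq_integrable.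
      apply: le_trans (_ : _ <= e * \int[P]_w g n w) _; last by rewrite ler_wpM2l// ltW.
      rewrite -(RintegralZl _ measurableT (ig n)); apply: le_Rintegral => //.
      - by have := integrable_norm (integrableB measurableT ipsi ri); apply: eq_integrable.
      - by have := integrableZl measurableT e (ig n); apply: eq_integrable.
      move=> w _; rewrite /psi /phi -mulrBl normrM (ger0_norm (g0 n w)) ler_wpM2r//.
      apply: le_trans h3; apply: powR_exponent_close => //; first exact: ltW.
      exact: e_01.
    rewrite IpsiR in d1; exact: (norm_chain4 h1 rc2 d1 h2).
  have [_ iphi _] := close 1 ltr01; split=> //.
  apply/eqP; rewrite -subr_eq0 -normr_eq0 eq_le normr_ge0 andbT.
  apply/ler_addgt0Pr => e e0; rewrite add0r.
  (* At level e the total error of [close] is e (4 M + 2). *)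
  have K0 : 0 < 4 * M + 2 by rewrite ltr_wpDl// mulr_ge0.
  have [|n _ hn] := close (e / (4 * M + 2)); first by rewrite divr_gt0.
  apply: (le_trans hn); rewrite le_eqVlt; apply/orP; left; apply/eqP.
  by field; rewrite gt_eqF.
exists nu, D; split => // t1 t2.
(* Scaling by [l] brings the coefficients into the range of [small]; the summand 1 keeps [l]
   positive at the origin. *)
pose l : R := `|t1| + `|t2| + 1.
have l0 : 0 < l by rewrite ltr_wpDl// addr_ge0.
have [|hi hI] := small (t1 / l) (t2 / l).
  rewrite !normrM -mulrDl normfV (gtr0_norm l0) ler_pdivrMr// mul1r.
  by rewrite /l lerDl.
have -> : C t1 t2 = l `^ alpha * C (t1 / l) (t2 / l).
  rewrite -char_exponent_homogeneous ?ltW//; congr C; rewrite mulrC divfK ?gt_eqF//.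
rewrite -hI EFinM /Rintegral fineK; last exact: integrable_fin_num.
rewrite -ge0_integralZl//; do ?[exact: measurable_int hi|by move=> y _; rewrite lee_fin powR_ge0
  |by rewrite lee_fin powR_ge0].
apply: eq_integral => y _; rewrite -EFinM -powRM ?normr_ge0 ?ltW//; congr (_ `^ _)%:E.
rewrite /e_ -{1}(gtr0_norm l0) -normrM; congr `| _ |; field; by rewrite gt_eqF.
Qed.

End AngularMeasure.

Section StableExponent.
Context {R : realType} {d : measure_display} {Omega : measurableType d}.
Variable P : probability Omega R.
Variable alpha : R.
Implicit Types (V : Omega -> R[i]) (C : R -> R -> R).

Definition stable_exponent V C :=
  [/\ cmeas setT V, (forall t1 t2, 0 <= C t1 t2) & forall t1 t2 s,
    charfun P (fun w => t1 * complex.Re (V w) + t2 * complex.Im (V w)) s =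
    (expR (- (C t1 t2 * `|s| `^ alpha)))%:C].

(** A finite combination of copies of the single variable V is a multiple z V, and Re (z V) runs
    through the real combinations of Re V and Im V. *)
Lemma SaS_exponent V : SaS P alpha V <-> exists C, stable_exponent V C.
Proof.
split=> [[mV hV]|[C [mV C0 hC]]].
  have /choice[C hC] (t : R * R) : exists c, 0 <= c /\ forall s,
      charfun P (fun w => t.1 * complex.Re (V w) + t.2 * complex.Im (V w)) s =
      (expR (- (c * `|s| `^ alpha)))%:C.
    have [_ [c c0 hc]] := hV 1%N (fun=> tt) (fun=> t.1 -i* t.2) (fun=> I).
    exists c; split=> // s; rewrite -hc /charfun; apply: cintegral_eq => w _.
    by rewrite big_ord1 cReM /= mulNr opprK.
  exists (fun t1 t2 => C (t1, t2)); split; first exact: (mV tt).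
    by move=> t1 t2; have [] := hC (t1, t2).
  by move=> t1 t2 s; have [_ /(_ s)] := hC (t1, t2).
split=> // n i c _.
have mcV : cmeas setT (fun w => (\sum_(k < n) c k) * V w).
  by apply: cmeasM => //; exact: cmeas_cst.
have e w : complex.Re (\sum_(k < n) c k * V w) = complex.Re ((\sum_(k < n) c k) * V w).
  by rewrite mulr_suml.
split.
  by under eq_fun do rewrite e; have /cmeasP[] := mcV.
exists (C (complex.Re (\sum_(k < n) c k)) (- complex.Im (\sum_(k < n) c k))) => // s.
rewrite -hC /charfun; apply: cintegral_eq => w _; congr expi; congr (_ * _).
by rewrite e cReM mulNr.
Qed.

End StableExponent.

Lemma finite_measure_of {R : realType} {d : measure_display} {T : measurableType d}
    (mu : {measure set T -> \bar R}) : (mu setT < +oo)%E ->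
  exists nu : {finite_measure set T -> \bar R}, forall A, nu A = mu A.
Proof.
move=> muoo; exists (mfrestr measurableT muoo) => A.
by rewrite -[LHS]/(mu (A `&` setT)) setIT.
Qed.

(** * The spectral measure on the sphere of R^4 *)

Section SpectralMeasure.
Context {R : realType} {d : measure_display} {Omega : measurableType d}.
Variable P : probability Omega R.
Variable alpha : R.
Hypothesis halpha : 1 < alpha <= 2.

Let a0 : 0 < alpha. Proof. by apply: lt_trans ltr01 _; have /andP[] := halpha. Qed.

Lemma integral_mrestr {d' : measure_display} {T : measurableType d'}
    (mu : {measure set T -> \bar R}) (D : set T) (mD : measurable D) (f : T -> \bar R) :
  measurable_fun setT f -> (forall x, (0 <= f x)%E) ->
  (\int[mrestr mu mD]_x f x = \int[mu]_(x in D) f x)%E.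
Proof.
move=> mf f0.
have -> : setT = D `|` ~` D by rewrite setUv.
rewrite ge0_integral_setU//=; first last.
- by rewrite disj_set2E setICr.
- by rewrite setUv.
- exact: measurableC.
rewrite [X in (_ + X)%E](_ : _ = 0%E) ?adde0; last first.
  apply: null_set_integral; [exact: measurableC|exact: measurable_funTS|].
  by rewrite [LHS]/= /mrestr setICl measure0.
apply: eq_measure_integral => A mA AD.
by rewrite -[LHS]/(mu (A `&` D)) (setIidl AD).
Qed.

(** The diagonal embedding of the unit circle: the vector to be represented is (V, V), and 1/sqrt 2
    brings the repeated unit vector back to the sphere. *)
Definition circle4 (y : R) : R4 :=
  ((cos y / Num.sqrt 2, sin y / Num.sqrt 2), (cos y / Num.sqrt 2, sin y / Num.sqrt 2)).

Lemma measurable_opp4 : measurable_fun setT (@opp4 R : ((R * R) * (R * R))%type -> ((R * R) * (R * R))%type).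
Proof.
have m1 := @measurable_fst _ _ R R. have m2 := @measurable_snd _ _ R R.
have m3 := @measurable_fst _ _ (R * R)%type (R * R)%type.
have m4 := @measurable_snd _ _ (R * R)%type (R * R)%type.
apply: measurable_fun_pair; apply: measurable_fun_pair; apply: measurableT_comp => //.
- exact: measurableT_comp m1 m3.
- exact: measurableT_comp m2 m3.
- exact: measurableT_comp m1 m4.
- exact: measurableT_comp m2 m4.
Qed.

Lemma measurable_circle4 : measurable_fun setT (circle4 : measurableTypeR R -> ((R * R) * (R * R))%type).
Proof.
have mc : measurable_fun setT (@cos R : measurableTypeR R -> R) by exact: measurable_cosE.
have ms : measurable_fun setT (@sin R : measurableTypeR R -> R).
  exact: continuous_measurable_fun (@continuous_sin R).
have q : measurable_fun setT (fun y : measurableTypeR R => (cos y / Num.sqrt 2, sin y / Num.sqrt 2) : (R * R)%type).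
  by apply: measurable_fun_pair; apply: measurable_funM.
by apply: measurable_fun_pair.
Qed.

Lemma measurable_dot4 (t : R4) : measurable_fun setT (@dot4 R t : ((R * R) * (R * R))%type -> R).
Proof.
have m1 := @measurable_fst _ _ R R. have m2 := @measurable_snd _ _ R R.
have m3 := @measurable_fst _ _ (R * R)%type (R * R)%type.
have m4 := @measurable_snd _ _ (R * R)%type (R * R)%type.
rewrite /dot4; do ! apply: measurable_funD; apply: measurable_funM => //.
- exact: measurableT_comp m1 m3.
- exact: measurableT_comp m2 m3.
- exact: measurableT_comp m1 m4.
- exact: measurableT_comp m2 m4.
Qed.

Lemma measurable_powdot (t : R4) : measurable_fun setT
  (fun x : ((R * R) * (R * R))%type => (`|dot4 t x| `^ alpha)%:E).
Proof.
apply/measurable_EFinP; apply: (measurableT_comp (measurable_powR _)).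
apply: measurableT_comp => //; exact: measurable_dot4.
Qed.

Lemma exists_spectral_measure (V : Omega -> R[i]) C :
  stable_exponent P alpha V C -> exists Gamma, is_sphere_spectral_measure P alpha V V Gamma.
Proof.
move=> [mV C0 hC].
have [nu [D [mD nuoo hnu]]] := angular_measure halpha mV C0 hC.
(* The mass of each of the two antipodal images: (sqrt 2)^alpha undoes the factor 1/sqrt 2 of
   [circle4] under the power alpha, and 1/2 shares the mass equally, which gives the symmetry. *)
have k0 : 0 <= (Num.sqrt 2 `^ alpha) / 2 :> R by rewrite divr_ge0 ?powR_ge0.
have mo : measurable_fun setT (@opp4 R \o circle4 : measurableTypeR R -> ((R * R) * (R * R))%type).
  exact: measurableT_comp measurable_opp4 measurable_circle4.
pose m1 := measure_function_pushforward__canonical__measure_function_Measure (mrestr nu mD) measurable_circle4.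
pose m2 := measure_function_pushforward__canonical__measure_function_Measure (mrestr nu mD) mo.
pose G := measure_add (mscale (NngNum k0) m1) (mscale (NngNum k0) m2).
have GE A : G A = ((Num.sqrt 2 `^ alpha / 2)%:E * nu (circle4 @^-1` A `&` D) +
    (Num.sqrt 2 `^ alpha / 2)%:E * nu ((@opp4 R \o circle4) @^-1` A `&` D))%E.
  by rewrite /G measure_addE.
have Goo : (G setT < +oo)%E.
  rewrite [X in (X < _)%E](GE setT) !preimage_setT !setTI.
  apply: lte_add_pinfty; apply: lte_mul_pinfty => //; rewrite ?lee_fin//.
have [Gf GfG] := finite_measure_of Goo.
have GfE A : Gf A = ((Num.sqrt 2 `^ alpha / 2)%:E * nu (circle4 @^-1` A `&` D) +
    (Num.sqrt 2 `^ alpha / 2)%:E * nu ((@opp4 R \o circle4) @^-1` A `&` D))%E.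
  by rewrite GfG; exact: GE.
exists Gf; split.
- have s2 : Num.sqrt 2 != 0 :> R by rewrite gt_eqF// sqrtr_gt0.
  have s22 : Num.sqrt 2 * Num.sqrt 2 = 2 :> R by rewrite -expr2 sqr_sqrtr.
  have onS y : dot4 (circle4 y) (circle4 y) = 1.
    rewrite /dot4/=; have := cos2Dsin2 y.
    have -> : cos y / Num.sqrt 2 * (cos y / Num.sqrt 2) + sin y / Num.sqrt 2 * (sin y / Num.sqrt 2) +
      cos y / Num.sqrt 2 * (cos y / Num.sqrt 2) + sin y / Num.sqrt 2 * (sin y / Num.sqrt 2) =
      (cos y ^+ 2 + sin y ^+ 2) * 2 / (Num.sqrt 2 * Num.sqrt 2) by field.
    by rewrite s22 => ->; rewrite mul1r divff.
  rewrite GfE [X in nu (X `&` _)](_ : _ = set0); last first.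
    by apply/seteqP; split => // y /=; apply; exact: onS.
  rewrite [X in (_ + _ * nu (X `&` _))%E](_ : _ = set0); last first.
    apply/seteqP; split => // y /=; apply; rewrite /sphere4/=.
    by rewrite -[RHS](onS y) /dot4 /opp4/= !mulrNN.
  by rewrite !set0I measure0 !mule0 adde0.
- move=> B mB; rewrite !GfE addeC; congr (_ * nu (_ `&` _) + _)%E.
  have oo (y : R) : opp4 (opp4 (circle4 y)) = circle4 y by rewrite /opp4/= !opprK.
  by apply/seteqP; split => y /=; rewrite oo.
- move=> t.
  have -> : charfun P (fun w => dot4 t (cpair V w, cpair V w)) 1 =
     charfun P (fun w => (t.1.1 + t.2.1) * complex.Re (V w) + (t.1.2 + t.2.2) * complex.Im (V w)) 1.
    by rewrite /charfun; apply: cintegral_eq => w _; congr (expi (_ * _)); rewrite /dot4/=; ring.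
  rewrite hC normr1 powR1 mulr1; congr ((expR (- _))%:C).
  have Cfin : (\int[Gf]_x (`|dot4 t x| `^ alpha)%:E = (C (t.1.1 + t.2.1) (t.1.2 + t.2.2))%:E)%E.
    have mp := measurable_powdot t.
    have p0 x : (0 <= (`|dot4 t x| `^ alpha)%:E)%E by rewrite lee_fin powR_ge0.
    have half (h : measurableTypeR R -> R4) (mh : measurable_fun setT h) :
        (forall y, `|dot4 t (h y)| = `|(t.1.1 + t.2.1) * cos y + (t.1.2 + t.2.2) * sin y| / Num.sqrt 2) ->
        (\int[mscale (NngNum k0) (measure_function_pushforward__canonical__measure_function_Measure (mrestr nu mD) mh)]_x
           (`|dot4 t x| `^ alpha)%:E = (C (t.1.1 + t.2.1) (t.1.2 + t.2.2) / 2)%:E)%E.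
      move=> hh; rewrite ge0_integral_mscale//= ge0_integral_pushforward//= preimage_setT.
      rewrite integral_mrestr; last 2 first.
      - exact: measurableT_comp mp mh.
      - by move=> y; rewrite lee_fin powR_ge0.
      have s0 : 0 < Num.sqrt 2 :> R by rewrite sqrtr_gt0.
      have hy y : (`|dot4 t (h y)| `^ alpha)%:E = (((Num.sqrt 2)^-1 `^ alpha)%:E *
          (`|(t.1.1 + t.2.1) * cos y + (t.1.2 + t.2.2) * sin y| `^ alpha)%:E)%E.
        by rewrite hh powRM ?invr_ge0 ?sqrtr_ge0// mulrC EFinM.
      under eq_integral do rewrite hy.
      have mq : measurable_fun setT (fun y => (`|(t.1.1 + t.2.1) * cos y + (t.1.2 + t.2.2) * sin y| `^ alpha)%:E : \bar R).
        apply/measurable_EFinP; apply: (measurableT_comp (measurable_powR _)).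
        apply: measurableT_comp => //.
        apply: measurable_funD; apply: measurable_funM => //.
          exact: measurable_cosE.
        exact: continuous_measurable_fun (@continuous_sin R).
      rewrite ge0_integralZl//; do ?[by move=> y _; rewrite lee_fin powR_ge0
        |by rewrite lee_fin powR_ge0|exact: measurable_funTS].
      rewrite -hnu -!EFinM; congr EFin.
      have e : Num.sqrt 2 `^ alpha * (Num.sqrt 2)^-1 `^ alpha = 1 :> R.
        by rewrite -powRM ?invr_ge0 ?sqrtr_ge0// divff ?gt_eqF// powR1.
      by rewrite mulrA [X in X * _]mulrAC e mul1r mulrC.
    transitivity (\int[G]_x (`|dot4 t x| `^ alpha)%:E)%E.
      by apply: eq_measure_integral => A mA _; rewrite ?GfG -?GfG.
    transitivity (\int[mscale (NngNum k0) m1]_x (`|dot4 t x| `^ alpha)%:E + \int[mscale (NngNum k0) m2]_x (`|dot4 t x| `^ alpha)%:E)%E.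
      by rewrite -ge0_integral_measure_add.
    rewrite !half.
    + by rewrite -EFinD; congr EFin; field.
    + move=> y; rewrite /dot4/=.
      have -> : t.1.1 * - (cos y / Num.sqrt 2) + t.1.2 * - (sin y / Num.sqrt 2) +
        t.2.1 * - (cos y / Num.sqrt 2) + t.2.2 * - (sin y / Num.sqrt 2) =
        - (((t.1.1 + t.2.1) * cos y + (t.1.2 + t.2.2) * sin y) / Num.sqrt 2) by ring.
      by rewrite normrN normrM normfV (ger0_norm (sqrtr_ge0 _)).
    + move=> y; rewrite /dot4/=.
      have -> : t.1.1 * (cos y / Num.sqrt 2) + t.1.2 * (sin y / Num.sqrt 2) +
        t.2.1 * (cos y / Num.sqrt 2) + t.2.2 * (sin y / Num.sqrt 2) =
        (((t.1.1 + t.2.1) * cos y + (t.1.2 + t.2.2) * sin y) / Num.sqrt 2) by ring.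
      by rewrite normrM normfV (ger0_norm (sqrtr_ge0 _)).
  by rewrite /Rintegral Cfin.
Qed.

End SpectralMeasure.

(** * Changes of variables: densities and rotations *)

Section Density.
Context {R : realType} {d1 d2 : measure_display} {T1 : measurableType d1} {T2 : measurableType d2}.
Variables (mu : {measure set T1 -> \bar R}) (nu : {measure set T2 -> \bar R}).
Variables (D : set T1) (X : T1 -> T2) (G : T1 -> R).
Hypotheses (mD : measurable D) (mX : measurable_fun setT X) (mG : measurable_fun D G).
Hypothesis G0 : forall x, D x -> 0 <= G x.
Hypothesis nuE : forall B, measurable B -> nu B = (\int[mu]_(x in D `&` X @^-1` B) (G x)%:E)%E.
Import HBNNSimple.
Local Open Scope ereal_scope.

Let density_nnsfun (h : {nnsfun T2 >-> R}) :
  \int[nu]_y (h y)%:E = \int[mu]_(x in D) (h (X x) * G x)%:E.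
Proof.
have mr (r : R) : measurable (h @^-1` [set r]) by exact: measurable_funPTI.
have mi (r : R) : measurable_fun setT (fun x => (\1_(h @^-1` [set r]) (X x) : R)).
  exact: measurableT_comp.
rewrite integralT_nnsfun sintegralE.
transitivity (\int[mu]_(x in D) \sum_(r \in range h) ((r * \1_(h @^-1` [set r]) (X x))%:E * (G x)%:E)).
  rewrite ge0_integral_fsum//; last 2 first.
  - move=> r; apply: emeasurable_funM; apply/measurable_EFinP => //.
    by apply: measurable_funTS; exact: measurable_funM.
  - by move=> r x Dx; rewrite mule_ge0// ?lee_fin ?G0// -lee_fin EFinM nnfun_muleindic_ge0.
  apply: eq_fsbigr => r /[!inE] -[y _ hy].
  have r0 : (0 <= r)%R by rewrite -hy; exact: fun_ge0.
  under eq_integral do rewrite EFinM -muleA.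
  rewrite ge0_integralZl//; last 2 first.
  - apply: emeasurable_funM; apply/measurable_EFinP => //; exact: measurable_funTS.
  - by move=> x Dx; rewrite mule_ge0 ?lee_fin ?G0.
  rewrite nuE// integral_mkcondr; congr (_ * _); apply: eq_integral => x _.
  rewrite patchE indicE.
  have -> : (x \in X @^-1` (h @^-1` [set r])) = (X x \in h @^-1` [set r]).
    by apply/idP/idP; rewrite !inE.
  by case: ifP; rewrite ?mul1e ?mul0e.
apply: eq_integral => x /[!inE] Dx.
rewrite -ge0_mule_fsuml => [|r]; last by rewrite EFinM nnfun_muleindic_ge0.
by rewrite fsumEFin// -fimfunE.
Qed.

(** Simple functions and monotone convergence. A density and a change of variables are combined
    because both uses are instances: spectral densities, with X the identity, and independence, with
    a shifted bounded variable as density. *)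
Lemma integral_density (F : T2 -> R) : measurable_fun setT F -> (forall y, 0 <= F y)%R ->
  \int[nu]_y (F y)%:E = \int[mu]_(x in D) (F (X x) * G x)%:E.
Proof.
move=> mF F0.
have mF' : measurable_fun setT (EFin \o F) by exact/measurable_EFinP.
pose h := nnsfun_approx measurableT mF'.
have hc y : (fun n => (h n y)%:E) @ \oo --> (F y)%:E.
  by apply: (@cvg_nnsfun_approx _ _ _ _ measurableT _ mF') => // z _; rewrite lee_fin.
have hnd y : {homo (fun n => h n y) : a b / (a <= b)%N >-> (a <= b)%R}.
  by move=> a b ab; exact/lefP/nd_nnsfun_approx.
have e1 : \int[nu]_y (F y)%:E = limn (fun n => \int[nu]_y (h n y)%:E).
  rewrite -monotone_convergence//.
  - by apply: eq_integral => y _; apply/esym/cvg_lim.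
  - by move=> n; exact/measurable_EFinP.
  - by move=> n y _; rewrite lee_fin.
  - by move=> y _ a b ab; rewrite lee_fin hnd.
have e2 : \int[mu]_(x in D) (F (X x) * G x)%:E = limn (fun n => \int[mu]_(x in D) (h n (X x) * G x)%:E).
  rewrite -monotone_convergence//.
  - apply: eq_integral => x _; apply/esym/cvg_lim => //.
    rewrite EFinM; under eq_fun do rewrite EFinM.
    by apply: cvgeZr.
  - move=> n; apply/measurable_EFinP; apply: measurable_funM => //.
    by apply: measurable_funTS; exact: measurableT_comp.
  - by move=> n x Dx; rewrite lee_fin mulr_ge0 ?G0.
  - by move=> x Dx a b ab; rewrite lee_fin ler_wpM2r ?G0 ?hnd.
by rewrite e1 e2; congr (limn _); apply/funext => n; exact: density_nnsfun.
Qed.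

End Density.

Section Rotation.
Context {R : realType}.
Local Notation leb := (@lebesgue_measure R).
Local Notation J := (`[0%R, 2 * pi[%classic : set R).
Local Open Scope ereal_scope.

Lemma integral_translate (b : R) (A : set R) (f : R -> \bar R) :
  measurable A -> measurable_fun setT f -> (forall x, 0 <= f x) ->
  \int[leb]_(x in A) f x = \int[leb]_(x in [set y | A (y + b)%R]) f (x + b)%R.
Proof.
move=> mA mf f0.
rewrite integral_mkcond [RHS]integral_mkcond.
rewrite (@integral_affine R 1 b _ ltr01); last 2 first.
- by apply/(measurable_restrictT _ mA); exact: measurable_funTS.
- by move=> x; rewrite patchE; case: ifP.
rewrite mul1e; apply: eq_integral => x _; rewrite !patchE mul1r.
by congr (if _ then _ else _); apply: asbool_equiv_eq.
Qed.

(** The interval [b, 2 pi + b[ is cut at 2 pi and its right piece is moved back by one period. *)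
Lemma integral_period (b : R) (f : R -> \bar R) : (0 <= b <= 2 * pi)%R ->
  measurable_fun setT f -> (forall x, 0 <= f x) -> (forall x, f (x + 2 * pi)%R = f x) ->
  \int[leb]_(x in J) f (x + b)%R = \int[leb]_(x in J) f x.
Proof.
move=> /andP[b0 b2] mf f0 fp.
have mfT A : measurable_fun A f by exact: measurable_funTS.
transitivity (\int[leb]_(x in `[b, (2 * pi + b)%R[) f x).
  rewrite (@integral_translate b _ f)//; congr (integral _ _ _).
  by apply/seteqP; split => x /=; rewrite !in_itv/= lerDr ltrD2r.
rewrite (_ : `[b, (2 * pi + b)%R[%classic = `[b, (2 * pi)%R[ `|` `[(2 * pi)%R, (2 * pi + b)%R[); last first.
  by rewrite -itv_bndbnd_setU// bnd_simp// lerDl.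
rewrite ge0_integral_setU//; last 2 first.
- exact: mfT.
- apply/disj_setPLR => x /=; rewrite !in_itv/= => /andP[_ h]; apply/negP; rewrite negb_and.
  by rewrite -ltNge h.
rewrite (@integral_translate (2 * pi)%R `[(2 * pi)%R, (2 * pi + b)%R[ f)//.
rewrite (_ : [set y | `[(2 * pi)%R, (2 * pi + b)%R[%classic (y + 2 * pi)%R] = `[0%R, b[%classic); last first.
  by apply/seteqP; split => x /=; rewrite !in_itv/= lerDr addrC ltrD2l.
under [X in _ + X]eq_integral do rewrite fp.
rewrite addeC -ge0_integral_setU//; last 2 first.
- exact: mfT.
- apply/disj_setPLR => x /=; rewrite !in_itv/= => /andP[_ h]; apply/negP; rewrite negb_and.
  by rewrite -ltNge h.
by rewrite -itv_bndbnd_setU// bnd_simp.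
Qed.

Variable p : R.

Definition circle_moment := \int[leb]_(x in J) (`|cos x| `^ p)%:E.

Lemma measurable_abs_cos : measurable_fun setT (fun x : R => (`|cos x| `^ p)%:E).
Proof.
apply/measurable_EFinP; apply: (measurableT_comp (measurable_powR _)).
by apply: measurableT_comp => //; exact: measurable_cosE.
Qed.

(** By [angleP] the integrand is |z|^p |cos(x - a)|^p with a the angle of z, and a shift by a leaves
    the integral over a period unchanged. For a > 0 the shift is by 2 pi - a, since
    [integral_period] moves by nonnegative amounts. *)
Lemma integral_rotation (z : R[i]) : (0 < p)%R ->
  \int[leb]_(x in J) (`|cos x * complex.Re z + sin x * complex.Im z| `^ p)%:E =
  (cabs z `^ p)%:E * circle_moment.
Proof.
move=> p0.
have zp : (0 <= cabs z `^ p)%R by exact: powR_ge0.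
under eq_integral do rewrite angleP powRM ?cabs_ge0// -cosB EFinM.
have cp (x : R) : (`|cos (x + 2 * pi)| `^ p)%:E = (`|cos x| `^ p)%:E.
  by rewrite mulr_natl cosD2pi.
have mm b : measurable_fun setT (fun x : R => (`|cos (x + b)| `^ p)%:E).
  by apply: (measurableT_comp measurable_abs_cos); exact: measurable_funD.
have shift (a : R) : (- pi <= a <= pi)%R ->
    \int[leb]_(x in J) (`|cos (x - a)| `^ p)%:E = circle_moment.
  move=> /andP[a1 a2]; have pi0 := pi_ge0 R; have [a0|a0] := leP a 0%R.
    rewrite (@integral_period (- a) (fun x => (`|cos x| `^ p)%:E))//.
    - by apply/andP; split; lra.
    - exact: measurable_abs_cos.
  have b2 : (0 <= 2 * pi - a <= 2 * pi)%R by apply/andP; split; lra.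
  have c0 (x : R) : 0 <= (`|cos x| `^ p)%:E by rewrite lee_fin powR_ge0.
  rewrite /circle_moment -(@integral_period (2 * pi - a) (fun x => (`|cos x| `^ p)%:E) b2 measurable_abs_cos c0 cp).
  apply: eq_integral => x _; rewrite -[in LHS]cp; congr (`|cos _| `^ _)%:E; ring.
have mJ : measurable J by exact: measurable_itv.
have sh : (- pi <= angle z <= pi)%R.
  by have pi0 := pi_ge0 R; have := angle_gt z; have := angle_le z; move=> ? ?; apply/andP; split; lra.
rewrite -(shift _ sh) -ge0_integralZl.
- by [].
- exact: mJ.
- by apply: measurable_funTS; exact: mm.
- by move=> x _; rewrite lee_fin powR_ge0.
- by rewrite lee_fin.
Qed.

Lemma circle_moment_fin : (0 <= p)%R -> circle_moment <= (2 * pi)%:E.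
Proof.
move=> p0; apply: (@le_trans _ _ (\int[leb]_(x in J) 1)).
  apply: ge0_le_integral => //.
  - by apply: measurable_funTS; exact: measurable_abs_cos.
  - move=> x _; rewrite lee_fin; apply: le_trans (_ : 1 `^ p <= _)%R; last by rewrite powR1.
    by apply: ge0_ler_powR => //; rewrite ?nnegrE// cos_max.
by rewrite integral_cst//= mul1e lebesgue_measure_itv/= lte_fin mulr_gt0// ?pi_gt0// -EFinD subr0.
Qed.

Lemma circle_moment_gt0 : (0 < p)%R -> 0 < circle_moment.
Proof.
move=> p0.
pose k := (`|cos 1%R| `^ p)%R : R.
have c1 : (0 < cos 1%R :> R)%R by rewrite cos1_gt0.
have k0 : (0 < k)%R by rewrite powR_gt0// normr_gt0 gt_eqF.
apply: (@lt_le_trans _ _ (\int[leb]_(x in `[0%R, 1%R]) k%:E)).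
  by rewrite integral_cst//= lebesgue_measure_itv/= lte_fin ltr01 -EFinD subr0 mule1 lte_fin.
apply: (@le_trans _ _ (\int[leb]_(x in `[0%R, 1%R]) (`|cos x| `^ p)%:E)).
  apply: ge0_le_integral => //.
  - by move=> x _; rewrite lee_fin ltW.
  - by apply: measurable_funTS; exact: measurable_abs_cos.
  - move=> x /=; rewrite in_itv/= => /andP[x0 x1]; rewrite lee_fin.
    have pi2 := pi_ge2 R.
    have cc : (cos 1 <= cos x)%R.
      have [->|x1'] := eqVneq x 1%R; first exact: lexx.
      by apply/ltW; rewrite ltr_cos// ?in_itv/=; lra.
    have c0 : (0 <= cos x)%R by lra.
    by rewrite /k !ger0_norm ?(ltW c1)// ge0_ler_powR// ?nnegrE ?(ltW p0)// ?(ltW c1).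
apply: ge0_subset_integral => //.
- by apply: measurable_funTS; exact: measurable_abs_cos.
move=> x /=; rewrite !in_itv/= => /andP[-> x1]; have := pi_ge2 R; lra.
Qed.

End Rotation.

Lemma mule_inj {R : realType} (x y K : R) : K != 0 -> (x%:E * K%:E = y%:E * K%:E)%E -> x = y.
Proof. by move=> K0; rewrite -!EFinM => -[h]; exact: (mulIf K0 h). Qed.

(** * The covariation norm *)

Section AlphaNorm.
Context {R : realType} {d : measure_display} {Omega : measurableType d}.
Variable P : probability Omega R.
Variable alpha : R.
Hypothesis halpha : 1 < alpha <= 2.
Local Notation leb := (@lebesgue_measure R).
Local Notation J := (`[0%R, (2 * pi)%R[%classic : set R).
Local Notation M4 := ((R * R) * (R * R))%type.
Implicit Types (V W : Omega -> R[i]) (C : R -> R -> R) (z : R[i]).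

Let a0 : 0 < alpha. Proof. by apply: lt_trans ltr01 _; have /andP[] := halpha. Qed.

Lemma mul_spow (p : R) z : 0 < p -> z * spow z (p - 1) = (cabs z `^ p)%:C.
Proof.
move=> p0; rewrite /spow mulrCA mulc_conj -rmorphM/=; congr (_%:C).
have [->|z0] := eqVneq (cabs z) 0; first by rewrite expr0n/= mulr0 powR0 ?gt_eqF.
have z1 : 0 < cabs z by rewrite lt_def z0 cabs_ge0.
by rewrite -powR_mulrn ?cabs_ge0// -powRD ?z0 ?implybT//; congr (_ `^ _); ring.
Qed.

Lemma exponent0 V C : stable_exponent P alpha V C -> C 0 0 = 0.
Proof.
move=> [mV C0 hC]; have := @char_exponent_homogeneous R d Omega P alpha V C hC 0 0 0 (lexx 0).
by rewrite !mul0r powR0 ?gt_eqF// mul0r.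
Qed.

Let m11 : measurable_fun setT (fun x : M4 => x.1.1).
Proof. exact: measurableT_comp measurable_fst measurable_fst. Qed.
Let m12 : measurable_fun setT (fun x : M4 => x.1.2).
Proof. exact: measurableT_comp measurable_snd measurable_fst. Qed.
Let m21 : measurable_fun setT (fun x : M4 => x.2.1).
Proof. exact: measurableT_comp measurable_fst measurable_snd. Qed.
Let m22 : measurable_fun setT (fun x : M4 => x.2.2).
Proof. exact: measurableT_comp measurable_snd measurable_snd. Qed.
Let mz : cmeas setT (fun x : M4 => x.1.1 +i* x.1.2).
Proof. by apply/cmeasP; split. Qed.
Let mw : cmeas setT (fun x : M4 => x.2.1 +i* x.2.2).
Proof. by apply/cmeasP; split. Qed.
Let mpow (f : M4 -> R) : measurable_fun setT f -> measurable_fun setT (fun x => (`|f x| `^ alpha)%:E).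
Proof.
move=> mf; apply/measurable_EFinP; apply: (measurableT_comp (measurable_powR _)).
exact: measurableT_comp.
Qed.

Lemma spectral_integral V C (Gamma : {finite_measure set M4 -> \bar R}) :
  stable_exponent P alpha V C -> is_sphere_spectral_measure P alpha V V Gamma ->
  forall t : M4, (\int[Gamma]_x (`|dot4 t x| `^ alpha)%:E = (C (t.1.1 + t.2.1) (t.1.2 + t.2.2))%:E)%E.
Proof.
move=> [mV C0 hC] [G1 _ G3] t.
(* The equation defining Gamma involves the real-valued integral, which is 0 for an infinite
   integral. Finiteness must therefore come first: Gamma is finite and carried by the sphere, where
   the integrand is bounded. *)
have fin : (\int[Gamma]_x (`|dot4 t x| `^ alpha)%:E)%E \is a fin_num.
  pose M := `|t.1.1| + `|t.1.2| + `|t.2.1| + `|t.2.2|.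
  have Goo : (\int[Gamma]_x (M `^ alpha)%:E < +oo)%E.
    rewrite integral_cst//; apply: lte_mul_pinfty; rewrite ?lee_fin ?powR_ge0//.
    by rewrite ltey_eq fin_num_measure.
  rewrite ge0_fin_numE; last by apply: integral_ge0 => x _; rewrite lee_fin powR_ge0.
  apply: le_lt_trans Goo; apply: ae_ge0_le_integral => //;
    do ?[by move=> x _; rewrite lee_fin powR_ge0|exact: measurable_powdot].
  exists (~` (@sphere4 R)); split => //.
    apply: measurableC.
    have mdd : measurable_fun setT (fun x : M4 => dot4 x x).
      by rewrite /dot4; do ! apply: measurable_funD; apply: measurable_funM.
    rewrite (_ : sphere4 = setT `&` (fun x : M4 => dot4 x x) @^-1` [set 1]); last by rewrite setTI.
    exact: mdd.
  move=> x /= hx sx; apply: hx => _; rewrite lee_fin.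
  apply: ge0_ler_powR; rewrite ?nnegrE ?(ltW a0)// ?addr_ge0//.
  have hb (u : R) : u ^+ 2 <= 1 -> `|u| <= 1.
    by move=> h; rewrite -[leRHS]normr1 -ler_sqr ?nnegrE ?normr_ge0// !real_normK ?num_real// expr1n.
  have s1 : x.1.1 ^+ 2 + x.1.2 ^+ 2 + x.2.1 ^+ 2 + x.2.2 ^+ 2 = 1 by rewrite -sx /dot4; ring.
  have q1 := sqr_ge0 x.1.1; have q2 := sqr_ge0 x.1.2.
  have q3 := sqr_ge0 x.2.1; have q4 := sqr_ge0 x.2.2.
  have b (u v : R) : v ^+ 2 <= 1 -> `|u * v| <= `|u|.
    by move=> /hb hv; rewrite normrM ler_piMr.
  rewrite /dot4 /M.
  apply: le_trans (ler_normD _ _) (lerD _ _); last by apply: b; lra.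
  apply: le_trans (ler_normD _ _) (lerD _ _); last by apply: b; lra.
  by apply: le_trans (ler_normD _ _) (lerD _ _); apply: b; lra.
have := G3 t.
have -> : charfun P (fun w => dot4 t (cpair V w, cpair V w)) 1 =
   charfun P (fun w => (t.1.1 + t.2.1) * complex.Re (V w) + (t.1.2 + t.2.2) * complex.Im (V w)) 1.
  by rewrite /charfun; apply: cintegral_eq => w _; congr (expi (_ * _)); rewrite /dot4/=; ring.
rewrite hC normr1 powR1 mulr1 => -[/expR_inj/oppr_inj ->].
by rewrite /Rintegral fineK.
Qed.

(* Testing Gamma against t = (e, -e) shows that it is carried by the diagonal
   of C x C, where the covariation integrand is |z|^alpha. *)
Lemma alpha_norm_spectral V C : stable_exponent P alpha V C ->
  exists Gamma : {finite_measure set M4 -> \bar R},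
    (forall t1 t2, \int[Gamma]_x (`|t1 * x.1.1 + t2 * x.1.2| `^ alpha)%:E = (C t1 t2)%:E)%E /\
    ((alpha_norm P alpha V `^ alpha)%:E = \int[Gamma]_x (cabs (x.1.1 +i* x.1.2) `^ alpha)%:E)%E.
Proof.
move=> sV; rewrite /alpha_norm /covariation; case: pselect => [e|]; last first.
  by have := exists_spectral_measure halpha sV.
have hG := svalP (cid e); set Gamma := sval _ in hG *; exists Gamma.
have I := spectral_integral sV hG.
have I1 t1 t2 : (\int[Gamma]_x (`|t1 * x.1.1 + t2 * x.1.2| `^ alpha)%:E = (C t1 t2)%:E)%E.
  rewrite -[in RHS](addr0 t1) -[in RHS](addr0 t2) -(I ((t1, t2), (0, 0))).
  by apply: eq_integral => x _; rewrite /dot4/= !mul0r !addr0.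
split=> //.
have ae0 (f : M4 -> R) : measurable_fun setT f -> (\int[Gamma]_x (`|f x| `^ alpha)%:E = 0)%E ->
    {ae Gamma, forall x, f x = 0}.
  move=> mf; have e0 : (fun x => (`|f x| `^ alpha)%:E) = (fun x => `|(`|f x| `^ alpha)%:E|%E).
    by apply/funext => x; rewrite gee0_abs// lee_fin powR_ge0.
  rewrite e0 => /(ae_eq_integral_abs Gamma measurableT (mpow mf)).1 h.
  apply: (ae_mono h) => x /(_ Logic.I)/= -[/eqP].
  by rewrite powR_eq0 normr_eq0 => /andP[/eqP].
have e1 : {ae Gamma, forall x : M4, x.1.1 - x.2.1 = 0}.
  apply: ae0; first exact: measurable_funB.
  rewrite -[RHS](_ : (C (1 + -1) (0 + 0))%:E = 0%E); last first.
    by rewrite subrr addr0 (exponent0 sV).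
  rewrite -(I ((1, 0), (-1, 0))); apply: eq_integral => x _; congr (`|_| `^ _)%:E.
  by rewrite /dot4/=; ring.
have e2 : {ae Gamma, forall x : M4, x.1.2 - x.2.2 = 0}.
  apply: ae0; first exact: measurable_funB.
  rewrite -[RHS](_ : (C (0 + 0) (1 + -1))%:E = 0%E); last first.
    by rewrite subrr addr0 (exponent0 sV).
  rewrite -(I ((0, 1), (0, -1))); apply: eq_integral => x _; congr (`|_| `^ _)%:E.
  by rewrite /dot4/=; ring.
have mcab : measurable_fun setT (fun x : M4 => (cabs (x.1.1 +i* x.1.2) `^ alpha)%:E).
  by apply/measurable_EFinP; apply: (measurableT_comp (measurable_powR _)); exact: measurable_cabs.
have fin : (\int[Gamma]_x (cabs (x.1.1 +i* x.1.2) `^ alpha)%:E)%E \is a fin_num.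
  rewrite ge0_fin_numE; last by apply: integral_ge0 => x _; rewrite lee_fin powR_ge0.
  apply: (@le_lt_trans _ _ (\int[Gamma]_x ((2 `^ alpha)%:E *
    ((`|1 * x.1.1 + 0 * x.1.2| `^ alpha)%:E + (`|0 * x.1.1 + 1 * x.1.2| `^ alpha)%:E)))%E).
    apply: ge0_le_integral => //; do ?[by move=> x _; rewrite lee_fin powR_ge0|
      by apply: emeasurable_funM => //; apply: emeasurable_funD; apply: mpow;
        apply: measurable_funD; apply: measurable_funM].
      move=> x _; rewrite -EFinD -EFinM lee_fin !mul1r !mul0r addr0 add0r.
      apply: le_trans (powR_add_le _ _ (ltW a0)); rewrite ?normr_ge0//.
      apply: ge0_ler_powR; rewrite ?nnegrE ?(ltW a0) ?cabs_ge0 ?addr_ge0//.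
      exact: (cabs_le_ReIm (x.1.1 +i* x.1.2)).
  rewrite ge0_integralZl//; do ?[by move=> x _; rewrite -EFinD lee_fin addr_ge0 ?powR_ge0
    | by rewrite lee_fin powR_ge0
    | by apply: emeasurable_funD; apply: mpow; apply: measurable_funD; apply: measurable_funM].
  rewrite ge0_integralD//; do ?[by move=> x _; rewrite lee_fin powR_ge0
    | by apply: mpow; apply: measurable_funD; apply: measurable_funM].
  by rewrite !I1 -EFinD -EFinM ltry.
set G := (\int[Gamma]_x (cabs _ `^ alpha)%:E)%E in fin *.
have -> : cintegral Gamma setT (fun x : M4 => (x.1.1 +i* x.1.2) * spow (x.2.1 +i* x.2.2) (alpha - 1)) = (fine G)%:C.
  rewrite (@cintegral_ae _ _ _ Gamma _ measurableT _ (fun x : M4 => (cabs (x.1.1 +i* x.1.2) `^ alpha)%:C)).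
  - by rewrite /cintegral/=; congr (_ +i* _); rewrite /Rintegral integral0.
  - by apply: cmeasM => //; exact: cmeas_spow.
  - by apply: cmeasR; apply/measurable_EFinP.
  apply: (ae_mono (ae_and e1 e2)) => x [/eqP + /eqP + _]; rewrite !subr_eq0 => /eqP <- /eqP <-.
  by rewrite mul_spow.
rewrite /= -powRrM mulVf ?gt_eqF// powRr1 ?fineK//.
by rewrite fine_ge0//; apply: integral_ge0 => x _; rewrite lee_fin powR_ge0.
Qed.

Let rotF z (q : measurableTypeR R * M4) : \bar R :=
  (`|cos q.1 * complex.Re (z * (q.2.1.1 +i* q.2.1.2)) +
     sin q.1 * complex.Im (z * (q.2.1.1 +i* q.2.1.2))| `^ alpha)%:E.

Let measurable_rotF z : measurable_fun setT (rotF z).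
Proof.
apply/measurable_EFinP; apply: (measurableT_comp (measurable_powR _)).
apply: measurableT_comp => //.
have mc : measurable_fun setT (fun q : measurableTypeR R * M4 => cos q.1).
  by apply: measurableT_comp measurable_fst; exact: measurable_cosE.
have ms : measurable_fun setT (fun q : measurableTypeR R * M4 => sin q.1).
  by apply: measurableT_comp measurable_fst; exact: continuous_measurable_fun (@continuous_sin R).
have mzq : cmeas setT (fun q : measurableTypeR R * M4 => z * (q.2.1.1 +i* q.2.1.2)).
  apply: cmeasM; first exact: cmeas_cst.
  exact: (measurableT_comp mz measurable_snd).
have /cmeasP[mr mi] := mzq.
by apply: measurable_funD; apply: measurable_funM.
Qed.

Lemma measurable_exponent V C : stable_exponent P alpha V C ->
  measurable_fun setT (fun x : R => (C (cos x) (sin x))%:E).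
Proof.
move=> sV; have [Gamma [I1 _]] := alpha_norm_spectral sV.
have -> : (fun x : R => (C (cos x) (sin x))%:E) = (fun x => \int[Gamma]_y rotF 1%R (x, y))%E.
  by apply/funext => x; rewrite -I1; apply: eq_integral => y _; rewrite /rotF mul1r.
by apply: (@measurable_fun_fubini_tonelli_F _ _ _ _ _ Gamma _ (measurable_rotF 1)) => q; rewrite lee_fin powR_ge0.
Qed.

(** By Tonelli, averaging |Re (e^(-ix) z v)|^alpha over x before integrating in v against Gamma
    produces |z v|^alpha times a constant, by rotation invariance. Gamma then disappears from all
    later arguments; the parameter z makes homogeneity an immediate consequence. *)
Lemma alpha_norm_rotation V C z : stable_exponent P alpha V C ->
  (\int[leb]_(x in J) (C (cos x * complex.Re z + sin x * complex.Im z)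
                        (sin x * complex.Re z - cos x * complex.Im z))%:E =
   ((cabs z * alpha_norm P alpha V) `^ alpha)%:E * circle_moment alpha)%E.
Proof.
move=> sV; have [Gamma [I1 I2]] := alpha_norm_spectral sV.
pose F := rotF z. have mF := measurable_rotF z.
have F0 q : (0 <= F q)%E by rewrite lee_fin powR_ge0.
have mJ : measurable J by [].
have Joo : (leb J < +oo)%E by rewrite lebesgue_measure_itv/= lte_fin; case: ifP => _; rewrite ?ltry.
have [L hL] : exists L : {finite_measure set (measurableTypeR R) -> \bar R}, forall A, L A = mrestr leb mJ A.
  by apply: (@finite_measure_of _ _ _ (mrestr leb mJ)); rewrite /= /mrestr setTI.
have LE (f : R -> \bar R) : measurable_fun setT f -> (forall x, (0 <= f x)%E) ->
    (\int[leb]_(x in J) f x = \int[L]_x f x)%E.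
  move=> mf f0; rewrite -(integral_mrestr leb mJ mf f0).
  by apply: eq_measure_integral => A mA _; symmetry; exact: hL.
transitivity (\int[leb]_(x in J) \int[Gamma]_y F (x, y))%E.
  apply: eq_integral => x _; rewrite -I1; apply: eq_integral => y _; congr (`|_| `^ _)%:E.
  by rewrite cReM cImM/=; ring.
rewrite (LE (fun x => \int[Gamma]_y F (x, y))%E); last 2 first.
- exact: (@measurable_fun_fubini_tonelli_F _ _ _ _ _ Gamma _ mF).
- by move=> x; exact: integral_ge0.
rewrite fubini_tonelli//.
transitivity (\int[Gamma]_y ((cabs z `^ alpha)%:E * circle_moment alpha * (cabs (y.1.1 +i* y.1.2) `^ alpha)%:E))%E.
  apply: eq_integral => y _; rewrite -(LE (fun x => F (x, y))); last 2 first.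
  - exact: (measurableT_comp mF (measurable_pair2 y)).
  - by move=> x.
  rewrite [LHS](integral_rotation (z * (y.1.1 +i* y.1.2)) a0) cabsM powRM ?cabs_ge0//.
  by rewrite EFinM -!muleA; congr (_ * _)%E; rewrite muleC.
have c0 := ltW (circle_moment_gt0 a0).
rewrite ge0_integralZl//; last 3 first.
- by apply/measurable_EFinP; apply: (measurableT_comp (measurable_powR _)); exact: measurable_cabs.
- by move=> x _; rewrite lee_fin powR_ge0.
- by rewrite mule_ge0// lee_fin powR_ge0.
by rewrite -I2 powRM ?cabs_ge0 ?powR_ge0// EFinM -!muleA [in LHS](muleC (circle_moment _)).
Qed.

Lemma alpha_norm_ge0 V : 0 <= alpha_norm P alpha V.
Proof. exact: powR_ge0. Qed.

Lemma circle_momentE : exists2 K : R, 0 < K & circle_moment alpha = K%:E.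
Proof.
have h0 := circle_moment_gt0 a0.
have h1 : circle_moment alpha \is a fin_num.
  rewrite ge0_fin_numE ?(ltW h0)//; apply: le_lt_trans (circle_moment_fin (ltW a0)) (ltry _).
by exists (fine (circle_moment alpha)); rewrite ?fineK// fine_gt0// h0 ltey_eq h1.
Qed.

Lemma alpha_norm_mean V C : stable_exponent P alpha V C ->
  (\int[leb]_(x in J) (C (cos x) (sin x))%:E =
   (alpha_norm P alpha V `^ alpha)%:E * circle_moment alpha)%E.
Proof.
move=> sV; have := alpha_norm_rotation 1 sV; rewrite cabsR normr1 mul1r => <-.
by apply: eq_integral => x _; rewrite /= !mulr1 !mulr0 addr0 subr0.
Qed.

Lemma stable_exponentZ V C z : stable_exponent P alpha V C ->
  stable_exponent P alpha (fun w => z * V w) (fun t1 t2 =>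
    C (t1 * complex.Re z + t2 * complex.Im z) (t2 * complex.Re z - t1 * complex.Im z)).
Proof.
move=> [mV C0 hC]; split=> //; first by apply: cmeasM => //; exact: cmeas_cst.
move=> t1 t2 s; rewrite -hC /charfun; apply: cintegral_eq => w _; congr (expi (_ * _)).
by rewrite cReM cImM; ring.
Qed.

Lemma alpha_normZ V z : SaS P alpha V ->
  alpha_norm P alpha (fun w => z * V w) `^ alpha = (cabs z * alpha_norm P alpha V) `^ alpha.
Proof.
move=> /SaS_exponent[C sV]; have := alpha_norm_mean (stable_exponentZ z sV).
rewrite /= (alpha_norm_rotation z sV); have [K K0 ->] := circle_momentE => /mule_inj <-//.
by rewrite gt_eqF.
Qed.

Lemma alpha_normD V W C C' : stable_exponent P alpha V C -> stable_exponent P alpha W C' ->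
  stable_exponent P alpha (fun w => V w + W w) (fun t1 t2 => C t1 t2 + C' t1 t2) ->
  alpha_norm P alpha (fun w => V w + W w) `^ alpha =
  alpha_norm P alpha V `^ alpha + alpha_norm P alpha W `^ alpha.
Proof.
move=> sV sW sVW; have := alpha_norm_mean sVW; under eq_integral do rewrite EFinD.
have [[_ C0 _] [_ C0' _]] := (sV, sW).
rewrite ge0_integralD//; do ?[by apply: measurable_funTS; apply: measurable_exponent; eassumption
  |by move=> x _; rewrite lee_fin].
rewrite (alpha_norm_mean sV) (alpha_norm_mean sW).
have [K K0 ->] := circle_momentE => h; apply: (@mule_inj _ _ _ K); first by rewrite gt_eqF.
by rewrite -h EFinD ge0_muleDl// lee_fin powR_ge0.
Qed.

End AlphaNorm.

Opaque alpha_norm.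

Lemma cvg_of_le {R : realType} (u : nat -> R) (l k : R) : 0 <= k ->
  (forall e, 0 < e -> exists N, forall n, (N <= n)%N -> `|u n - l| <= k * e) ->
  u @ \oo --> l.
Proof.
move=> k0 h; apply/cvgrPdist_le => e e0.
have k1 : 0 < k + 1 by lra.
have [N hN] := h (e / (k + 1)) (divr_gt0 e0 k1).
exists N => // n /= /hN; rewrite distrC => /le_trans; apply.
by rewrite mulrA ler_pdivrMr// mulrC ler_pM2l//; lra.
Qed.

Lemma cvg_cancelr {R : realType} (u : nat -> R) (l K : R) : K != 0 ->
  (fun n => u n * K) @ \oo --> l * K -> u @ \oo --> l.
Proof.
move=> K0 h; rewrite -(mulfK K0 l).
rewrite (_ : u = (fun n => u n * K / K)); last by apply/funext => n; rewrite mulfK.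
by apply: cvgM; [exact: h|exact: cvg_cst].
Qed.

Lemma cnorm1D {R : realType} {d : measure_display} {T : measurableType d}
    (mu : {measure set T -> \bar R}) (D : set T) (F G : T -> R[i]) :
  measurable D -> cmeas D F -> cmeas D G ->
  (cnorm1 mu D (fun x => (F x + G x)%R) <= cnorm1 mu D F + cnorm1 mu D G)%E.
Proof.
move=> mD mF mG.
have mFG : measurable_fun D (fun x => ((cabs (F x))%:E + (cabs (G x))%:E)%E).
  by apply: emeasurable_funD; exact: measurable_cabsE.
have mS : measurable_fun D (fun x => (cabs (F x + G x))%:E).
  by apply: measurable_cabsE => //; exact: cmeasD.
rewrite -ge0_integralD//; do ?[by move=> w _; rewrite lee_fin cabs_ge0|exact: measurable_cabsE].
apply: ge0_le_integral => //; first by move=> w _; rewrite lee_fin cabs_ge0.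
by move=> w _; rewrite -EFinD lee_fin; exact: cabsD.
Qed.

Lemma Rintegral_cvg {R : realType} {d : measure_display} {T : measurableType d}
    (mu : {measure set T -> \bar R}) (D : set T) (mD : measurable D)
    (f_ : nat -> T -> R) (f g : T -> R) :
  (forall n, measurable_fun D (f_ n)) -> measurable_fun D f ->
  {ae mu, forall x, D x -> (fun n => f_ n x) @ \oo --> f x} ->
  mu.-integrable D (EFin \o g) -> (forall n x, D x -> `|f_ n x| <= g x) ->
  mu.-integrable D (EFin \o f) /\
  (fun n => \int[mu]_(x in D) f_ n x) @ \oo --> \int[mu]_(x in D) f x.
Proof.
move=> mf_ mf f_f ig f_g.
have m1 n : measurable_fun D (EFin \o f_ n) by exact/measurable_EFinP.
have m2 : measurable_fun D (EFin \o f) by exact/measurable_EFinP.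
have cf : {ae mu, forall x, D x -> (fun n => (EFin \o f_ n) x) @ \oo --> (EFin \o f) x}.
  apply: (ae_mono f_f) => x h /h /= h'; apply: cvg_EFin; first exact: nearW.
  exact: h'.
have gb : {ae mu, forall x n, D x -> (`|(EFin \o f_ n) x| <= (EFin \o g) x)%E}.
  by apply: aeW => x n Dx; rewrite /= lee_fin; exact: f_g.
have [i1 _ c] := dominated_convergence mD m1 m2 cf ig gb.
split=> //; apply: fine_cvg; rewrite fineK; last exact: integrable_fin_num.
exact: c.
Qed.

Lemma integrable_bounded_cst {R : realType} {d : measure_display} {T : measurableType d}
    (mu : {measure set T -> \bar R}) (D : set T) (k : R) :
  measurable D -> (mu D < +oo)%E -> mu.-integrable D (EFin \o (fun=> k)).
Proof.
move=> mD Doo; apply/integrableP; split; first exact/measurable_EFinP.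
by rewrite /= integral_cst// lte_mul_pinfty.
Qed.

(** * Comparison with L^1(P) and limits of stable variables *)

Section Moments.
Context {R : realType} {d : measure_display} {Omega : measurableType d}.
Variable P : probability Omega R.
Variable alpha : R.
Hypothesis halpha : 1 < alpha <= 2.
Local Notation leb := (@lebesgue_measure R).
Local Notation J := (`[0%R, (2 * pi)%R[%classic : set R).
Local Notation kappa := (stable_mom 1 alpha).
Local Notation E1 V := (cnorm1 P setT V).
Implicit Types (V W : Omega -> R[i]) (C : R -> R -> R) (z : R[i]).

Let a1 : 1 < alpha. Proof. by have /andP[] := halpha. Qed.
Let a2 : alpha <= 2. Proof. by have /andP[] := halpha. Qed.
Let a0 : 0 < alpha. Proof. exact: lt_trans a1. Qed.

Let kappa0 : 0 < kappa.
Proof. by apply: stable_mom_gt0 => //; rewrite ltr01. Qed.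

Let mlin V t1 t2 : cmeas setT V ->
  measurable_fun setT (fun w => t1 * complex.Re (V w) + t2 * complex.Im (V w)).
Proof. by move=> /cmeasP[? ?]; apply: measurable_funD; apply: measurable_funM. Qed.

Let powRVK (x : R) : 0 <= x -> (x `^ alpha^-1) `^ alpha = x.
Proof. by move=> x0; rewrite -powRrM mulVf ?gt_eqF// powRr1. Qed.

Lemma first_moment V C t1 t2 : stable_exponent P alpha V C ->
  (\int[P]_w (`|t1 * complex.Re (V w) + t2 * complex.Im (V w)|)%:E =
   (kappa * C t1 t2 `^ alpha^-1)%:E)%E.
Proof.
move=> [mV C0 hC].
have h1 : 0 < (1 : R) < alpha by rewrite ltr01.
have := stable_moment h1 a2 (C0 t1 t2) (mlin t1 t2 mV) (hC t1 t2).
by rewrite div1r => <-; apply: eq_integral => w _; rewrite powRr1.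
Qed.

(** Each of |Re V| and |Im V| has mean kappa C^(1/alpha), and this C is at most the alpha-th power
    of the norm because a coordinate is bounded by the modulus under Gamma. The two coordinates give
    the factor 2. *)
Lemma cnorm1_le_alpha_norm V : SaS P alpha V ->
  (E1 V <= (2 * kappa * alpha_norm P alpha V)%:E)%E.
Proof.
move=> /SaS_exponent[C sV]; have [mV C0 _] := sV; have /cmeasP[mr mi] := mV.
have [Gamma [I1 I2]] := alpha_norm_spectral halpha sV.
have mab : measurable_fun setT (fun x : (R * R) * (R * R) => (cabs (x.1.1 +i* x.1.2) `^ alpha)%:E).
  apply/measurable_EFinP; apply: (measurableT_comp (measurable_powR _)).
  apply: measurable_cabs; apply/cmeasP; split=> /=.
    exact: measurableT_comp measurable_fst measurable_fst.
  exact: measurableT_comp measurable_snd measurable_fst.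
have mlinx t1 t2 : measurable_fun setT (fun x : (R * R) * (R * R) => (`|t1 * x.1.1 + t2 * x.1.2| `^ alpha)%:E).
  apply/measurable_EFinP; apply: (measurableT_comp (measurable_powR _)).
  apply: measurableT_comp => //; apply: measurable_funD; apply: measurable_funM => //.
    exact: measurableT_comp measurable_fst measurable_fst.
  exact: measurableT_comp measurable_snd measurable_fst.
have Cle t1 t2 : (forall z, `|t1 * complex.Re z + t2 * complex.Im z| <= cabs z) ->
    C t1 t2 `^ alpha^-1 <= alpha_norm P alpha V.
  move=> ht.
  have h : C t1 t2 <= alpha_norm P alpha V `^ alpha.
    rewrite -lee_fin I2 -I1; apply: ge0_le_integral => //.
      move=> x _; rewrite lee_fin; apply: ge0_ler_powR; rewrite ?nnegrE ?cabs_ge0 ?(ltW a0)//.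
      exact: (ht (x.1.1 +i* x.1.2)).
  rewrite -[leRHS](_ : (alpha_norm P alpha V `^ alpha) `^ alpha^-1 = _).
    by apply: ge0_ler_powR; rewrite ?nnegrE ?powR_ge0 ?invr_ge0 ?(ltW a0).
  by rewrite -powRrM mulfV ?gt_eqF// powRr1// alpha_norm_ge0.
apply: (@le_trans _ _ ((kappa * C 1 0 `^ alpha^-1)%:E + (kappa * C 0 1 `^ alpha^-1)%:E)%E).
  rewrite -!(first_moment _ _ sV) -ge0_integralD//; last 2 first.
  - by apply/measurable_EFinP; apply: measurableT_comp => //; exact: mlin.
  - by apply/measurable_EFinP; apply: measurableT_comp => //; exact: mlin.
  apply: ge0_le_integral => //.
  - by move=> w _; rewrite lee_fin cabs_ge0.
  - exact: measurable_cabsE.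
  - by apply: emeasurable_funD; apply/measurable_EFinP; apply: measurableT_comp => //; exact: mlin.
  - by move=> w _; rewrite -EFinD lee_fin !mul1r !mul0r addr0 add0r cabs_le_ReIm.
rewrite -EFinD lee_fin (_ : 2 * kappa * alpha_norm P alpha V =
  kappa * alpha_norm P alpha V + kappa * alpha_norm P alpha V); last by ring.
by rewrite lerD// ler_pM2l//; apply: Cle => z; rewrite mul1r mul0r ?addr0 ?add0r;
  [exact: Re_le_cabs|exact: Im_le_cabs].
Qed.

Lemma exponent_le_cnorm1 V C (e x : R) : stable_exponent P alpha V C ->
  (E1 V <= e%:E)%E -> C (cos x) (sin x) <= (kappa^-1 * e) `^ alpha.
Proof.
move=> sV Ve; have [mV C0 _] := sV.
have h : kappa * C (cos x) (sin x) `^ alpha^-1 <= e.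
  rewrite -lee_fin -(first_moment _ _ sV); apply: le_trans Ve; apply: ge0_le_integral => //.
  - by apply/measurable_EFinP; apply: measurableT_comp => //; exact: mlin.
  - exact: measurable_cabsE.
  - move=> w _; rewrite lee_fin angleP ler_piMr ?cabs_ge0// -cosB ler_norml cos_geN1 cos_le1//.
rewrite -[leLHS]powRVK//; apply: ge0_ler_powR; rewrite ?nnegrE ?powR_ge0 ?(ltW a0)//.
  rewrite mulr_ge0 ?invr_ge0 ?(ltW kappa0)//; apply: le_trans h.
  by rewrite mulr_ge0 ?powR_ge0 ?(ltW kappa0).
by rewrite -(ler_pM2l kappa0) mulrA mulfV ?gt_eqF// mul1r.
Qed.

(** Every unit direction has an exponent controlled by the first absolute moment, and the alpha-th
    power of the norm is a mean of these exponents over the circle; [B] is what remains after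
    dividing by [circle_moment] and taking the root. *)
Lemma alpha_norm_le_cnorm1 : exists2 B : R, 0 < B &
  forall V (e : R), SaS P alpha V -> 0 <= e -> (E1 V <= e%:E)%E -> alpha_norm P alpha V <= B * e.
Proof.
have [K K0 KE] := circle_momentE halpha.
have pi0 := pi_gt0 R.
exists ((2 * pi / K) `^ alpha^-1 * kappa^-1).
  by rewrite mulr_gt0 ?invr_gt0// powR_gt0// divr_gt0// mulr_gt0.
move=> V e /SaS_exponent[C sV] e0 Ve; have [mV C0 _] := sV.
have h : (\int[leb]_(x in J) (C (cos x) (sin x))%:E <= \int[leb]_(x in J) ((kappa^-1 * e) `^ alpha)%:E)%E.
  apply: ge0_le_integral => //.
  - by move=> x _; rewrite lee_fin.
  - by apply: measurable_funTS; apply: measurable_exponent; eassumption.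
  - by move=> x _; rewrite lee_fin; exact: exponent_le_cnorm1 sV Ve.
move: h; rewrite (alpha_norm_mean halpha sV) KE integral_cst//= lebesgue_measure_itv/= lte_fin.
rewrite mulr_gt0// -EFinB subr0 -!EFinM lee_fin => h.
have h2 : alpha_norm P alpha V `^ alpha <= (2 * pi / K) * (kappa^-1 * e) `^ alpha.
  by rewrite mulrAC ler_pdivlMr// [leRHS]mulrC.
rewrite -[leLHS](_ : (alpha_norm P alpha V `^ alpha) `^ alpha^-1 = _); last first.
  by rewrite -powRrM mulfV ?gt_eqF// powRr1// alpha_norm_ge0.
have ke : 0 <= kappa^-1 * e by rewrite mulr_ge0 ?invr_ge0 ?(ltW kappa0).
rewrite -mulrA -[X in _ * X](_ : ((kappa^-1 * e) `^ alpha) `^ alpha^-1 = _); last first.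
  by rewrite -powRrM mulfV ?gt_eqF// powRr1.
rewrite -powRM ?powR_ge0 ?divr_ge0 ?mulr_ge0 ?(ltW pi0) ?(ltW K0)//.
by apply: ge0_ler_powR; rewrite ?nnegrE ?powR_ge0 ?invr_ge0 ?(ltW a0)// mulr_ge0 ?powR_ge0//
  divr_ge0 ?mulr_ge0 ?(ltW pi0) ?(ltW K0).
Qed.

(** Preferred to [alpha_cvg] because it does not presuppose that the differences are SaS. *)
Definition l1_cvg (V_ : nat -> Omega -> R[i]) V :=
  forall e : R, 0 < e -> exists N, forall n, (N <= n)%N ->
    (E1 (fun w => (V_ n w - V w)%R) <= e%:E)%E.

Let Rint_dist (Y Z : Omega -> R) V (k e : R) : 0 <= k ->
  P.-integrable setT (EFin \o Y) -> P.-integrable setT (EFin \o Z) -> cmeas setT V ->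
  (forall w, `|Y w - Z w| <= k * cabs (V w)) -> (E1 V <= e%:E)%E ->
  `|\int[P]_w Y w - \int[P]_w Z w| <= k * e.
Proof.
move=> k0 iY iZ mV YZ Ve; rewrite -RintegralB//.
have iYZ : P.-integrable setT (EFin \o (fun w => Y w - Z w)).
  by rewrite (_ : _ \o _ = (fun w => (Y w)%:E - (Z w)%:E)%E)//; exact: integrableB.
apply: le_trans (le_normr_Rintegral measurableT iYZ) _.
rewrite -lee_fin /Rintegral fineK; last first.
  exact: integrable_fin_num (integrable_abse iYZ).
apply: (@le_trans _ _ (\int[P]_w (k%:E * (cabs (V w))%:E))%E).
  apply: ge0_le_integral => //.
  - by have /measurable_int := integrable_abse iYZ.
  - by apply: emeasurable_funM => //; exact: measurable_cabsE.
  - by move=> w _; rewrite -EFinM lee_fin.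
rewrite ge0_integralZl//; last 2 first.
- exact: measurable_cabsE.
- by move=> w _; rewrite lee_fin cabs_ge0.
by rewrite EFinM; apply: lee_wpmul2l.
Qed.

Lemma SaS_cintegrable V : SaS P alpha V -> cintegrable P setT V.
Proof.
move=> sV; apply/cintegrableP => //; split; last exact: le_lt_trans (cnorm1_le_alpha_norm sV) (ltry _).
by case: sV => /(_ tt Logic.I).
Qed.

Lemma l1_cvg_cintegrable (V_ : nat -> Omega -> R[i]) V : (forall n, cintegrable P setT (V_ n)) -> cmeas setT V ->
  l1_cvg V_ V -> cintegrable P setT V.
Proof.
move=> iV_ mV /(_ 1 ltr01)[N /(_ N (leqnn _)) hN].
have h : cintegrable P setT (fun w => V_ N w - V w).
  apply/cintegrableP => //; split; last exact: le_lt_trans hN (ltry _).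
  by apply: cmeasB => //; have /cintegrable_meas := iV_ N; exact.
have := cintegrableB measurableT (iV_ N) h.
by under eq_fun do rewrite subKr.
Qed.

(** First absolute moments converge, hence so do the exponents in every direction; characteristic
    functions converge because sine and cosine are Lipschitz. This identifies the law of the limit.
    The norms are circle means of the exponents and converge by domination. *)
Lemma SaS_l1_cvg (V_ : nat -> Omega -> R[i]) V : (forall n, SaS P alpha (V_ n)) -> cmeas setT V -> l1_cvg V_ V ->
  SaS P alpha V /\ (fun n => alpha_norm P alpha (V_ n) `^ alpha) @ \oo --> alpha_norm P alpha V `^ alpha.
Proof.
move=> sV_ mV VV; have iV_ n := SaS_cintegrable (sV_ n).
have mV_ n : cmeas setT (V_ n) by have /cintegrable_meas := iV_ n; exact.
have iV := l1_cvg_cintegrable iV_ mV VV.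
have /choice[C_ hC] n : exists C, stable_exponent P alpha (V_ n) C by apply/SaS_exponent.
pose Y (W : Omega -> R[i]) t1 t2 w := t1 * complex.Re (W w) + t2 * complex.Im (W w).
have iY W t1 t2 : cintegrable P setT W -> P.-integrable setT (EFin \o Y W t1 t2).
  move=> [ir ii]; rewrite (_ : _ \o _ = (fun w => t1%:E * (complex.Re (W w))%:E + t2%:E * (complex.Im (W w))%:E)%E)//.
  by apply: integrableD => //; exact: integrableZl.
have dY W W' t1 t2 w : `|Y W t1 t2 w - Y W' t1 t2 w| <= (`|t1| + `|t2|) * cabs (W w - W' w).
  rewrite (_ : Y W t1 t2 w - Y W' t1 t2 w = t1 * complex.Re (W w - W' w) + t2 * complex.Im (W w - W' w)); last first.
    by rewrite /Y cReD cImD cReN cImN; ring.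
  rewrite mulrDl; apply: le_trans (ler_normD _ _) _.
  by rewrite !normrM lerD// ler_wpM2l// ?Re_le_cabs ?Im_le_cabs.
have iaY W t1 t2 : cintegrable P setT W -> P.-integrable setT (EFin \o (fun w => `|Y W t1 t2 w|)).
  by move=> /iY-/(_ t1 t2)/integrable_abse.
pose M t1 t2 := \int[P]_w `|Y V t1 t2 w|.
have hM t1 t2 : (fun n => kappa * C_ n t1 t2 `^ alpha^-1) @ \oo --> M t1 t2.
  apply: (@cvg_of_le _ _ _ (`|t1| + `|t2|)); first by rewrite addr_ge0.
  move=> e /VV[N hN]; exists N => n /hN h.
  have -> : kappa * C_ n t1 t2 `^ alpha^-1 = \int[P]_w `|Y (V_ n) t1 t2 w|.
    by rewrite /Rintegral (first_moment t1 t2 (hC n)).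
  apply: (Rint_dist _ (iaY _ _ _ (iV_ n)) (iaY _ _ _ iV) _ _ h); rewrite ?addr_ge0//.
    exact: cmeasB.
  by move=> w; apply: le_trans (dY _ _ _ _ _); exact: ler_dist_dist.
pose C t1 t2 := (`|kappa^-1 * M t1 t2|) `^ alpha.
have hCC t1 t2 : (fun n => C_ n t1 t2) @ \oo --> C t1 t2.
  have h : (fun n => `|kappa^-1 * (kappa * C_ n t1 t2 `^ alpha^-1)| `^ alpha) @ \oo --> C t1 t2.
    by apply: cvg_norm_powR => //; apply: cvgM => //; exact: cvg_cst.
  rewrite (_ : (fun n => C_ n t1 t2) =
    (fun n => `|kappa^-1 * (kappa * C_ n t1 t2 `^ alpha^-1)| `^ alpha))//.
  apply/funext => n; have [_ C0 _] := hC n.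
  by rewrite mulrA mulVf ?gt_eqF// mul1r ger0_norm ?powR_ge0// powRVK.
have iexp W t1 t2 s : cmeas setT W -> cintegrable P setT (fun w => expi (s * Y W t1 t2 w)).
  move=> mW; apply: (@cintegrable_le _ _ _ P _ measurableT _ (fun=> 1)) => //.
  - by apply: cmeas_expi; apply: measurable_funM => //; exact: mlin.
  - by move=> w _; rewrite cabs_expi.
  - exact: finite_measure_integrable_cst.
have lip (x y : R) : (`|cos x - cos y| <= 2 * `|x - y|) /\ (`|sin x - sin y| <= 2 * `|x - y|).
  have h1 : `|1 : R| <= 1 by rewrite normr1. have h2 : `|0 : R| <= 1 by rewrite normr0.
  have := @cos_sin_lip R 1 0 x y h1 h2; have := @cos_sin_lip R 0 1 x y h2 h1.
  by rewrite !mul1r !mul0r !addr0 !add0r.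
have sVC : stable_exponent P alpha V C.
  split=> // [t1 t2|t1 t2 s]; first exact: powR_ge0.
  have k0 : 0 <= 2 * (`|s| * (`|t1| + `|t2|)) by rewrite !mulr_ge0 ?addr_ge0.
  have hl n (f : R -> R) : (forall x y, `|f x - f y| <= 2 * `|x - y|) -> forall w,
     `|f (s * Y (V_ n) t1 t2 w) - f (s * Y V t1 t2 w)| <=
     2 * (`|s| * (`|t1| + `|t2|)) * cabs (V_ n w - V w).
    move=> fl w; apply: le_trans (fl _ _) _; rewrite -mulrA ler_pM2l// -mulrA -mulrBr normrM.
    by rewrite ler_wpM2l.
  have chn n := let: And3 _ _ h := hC n in h t1 t2 s.
  apply: complex_eq => /=.
  - have c1 : (fun n => complex.Re (charfun P (Y (V_ n) t1 t2) s)) @ \oo -->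
        complex.Re (charfun P (Y V t1 t2) s).
      apply: (cvg_of_le k0) => e /VV[N hN]; exists N => n /hN h.
      apply: (Rint_dist _ (iexp _ _ _ _ (mV_ n)).1 (iexp _ _ _ _ mV).1 _ _ h) => //.
        exact: cmeasB.
      by apply: hl => x y; case: (lip x y).
    have c2 : (fun n => complex.Re (charfun P (Y (V_ n) t1 t2) s)) @ \oo -->
        expR (- (C t1 t2 * `|s| `^ alpha)).
      under eq_fun do rewrite chn /=.
      apply: (@cvg_comp _ _ _ _ (@expR R)); last exact: continuous_expR.
      by apply: cvgN; apply: cvgM => //; exact: cvg_cst.
    exact: cvg_unique c1 c2.
  - have c1 : (fun n => complex.Im (charfun P (Y (V_ n) t1 t2) s)) @ \oo -->
        complex.Im (charfun P (Y V t1 t2) s).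
      apply: (cvg_of_le k0) => e /VV[N hN]; exists N => n /hN h.
      apply: (Rint_dist _ (iexp _ _ _ _ (mV_ n)).2 (iexp _ _ _ _ mV).2 _ _ h) => //.
        exact: cmeasB.
      by apply: hl => x y; case: (lip x y).
    have c2 : (fun n => complex.Im (charfun P (Y (V_ n) t1 t2) s)) @ \oo --> (0 : R).
      by under eq_fun do rewrite chn /=; exact: cvg_cst.
    exact: cvg_unique c1 c2.
split; first by apply/SaS_exponent; exists C.
have [K K0 KE] := circle_momentE halpha.
have [_ Voo] := proj1 (@cintegrableP _ _ _ P setT measurableT V) iV.
have Vfin : E1 V \is a fin_num by rewrite ge0_fin_numE// cnorm1_ge0.
pose b := fine (E1 V) + 1.
have [N hN] := VV 1 ltr01.
have Vb n : (N <= n)%N -> (E1 (V_ n) <= b%:E)%E.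
  move=> /hN h; rewrite /b EFinD fineK//.
  apply: le_trans (leeD (lexx (E1 V)) h).
  apply: le_trans (cnorm1D P measurableT mV (cmeasB (mV_ n) mV)).
  by under [X in (_ <= X)%E]eq_integral do rewrite addrC subrK.
(* The dominating constant is valid only from the index [N] on, hence the shift. *)
pose f_ n x := C_ (n + N)%N (cos x) (sin x).
have mf_ n : measurable_fun J (f_ n).
  apply: measurable_funTS; apply/measurable_EFinP.
  by apply: measurable_exponent; [exact: halpha|exact: hC].
have mf : measurable_fun J (fun x => C (cos x) (sin x)).
  apply: measurable_funTS; apply/measurable_EFinP.
  by apply: measurable_exponent; [exact: halpha|exact: sVC].
have cf x : (fun n => f_ n x) @ \oo --> C (cos x) (sin x).
  by have := hCC (cos x) (sin x); rewrite -(@cvg_shiftn N); apply.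
have ig : leb.-integrable J (EFin \o (fun=> (kappa^-1 * b) `^ alpha)).
  apply: integrable_bounded_cst => //.
  by rewrite /= lebesgue_measure_itv/= lte_fin mulr_gt0 ?pi_gt0// -EFinB ltry.
have gb n x : J x -> `|f_ n x| <= (kappa^-1 * b) `^ alpha.
  move=> _; have [_ C0 _] := hC (n + N)%N.
  have h : (E1 (V_ (n + N)%N) <= b%:E)%E by apply: Vb; rewrite leq_addl.
  have := @exponent_le_cnorm1 _ _ b x (hC (n + N)%N) h.
  by rewrite /f_ (ger0_norm (C0 _ _)).
have mJ : measurable J by [].
have acf : {ae leb, forall x : measurableTypeR R, J x -> (fun n => f_ n x) @ \oo --> C (cos x) (sin x)}.
  by apply: aeW => x _; exact: cf.
have [_] := @Rintegral_cvg R _ (measurableTypeR R) leb J mJ f_ _ _ mf_ mf acf ig gb.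
rewrite /Rintegral (alpha_norm_mean halpha sVC) KE -EFinM.
have -> : (fun n => fine (\int[leb]_(x in J) (f_ n x)%:E)%E) =
    (fun n => alpha_norm P alpha (V_ (n + N)%N) `^ alpha * K).
  by apply/funext => n; rewrite (alpha_norm_mean halpha (hC _)) KE.
move=> h; rewrite -(@cvg_shiftn N).
exact: (cvg_cancelr (lt0r_neq0 K0) h).
Qed.

End Moments.

(** * Independence and stochastic integrals *)

Section MeanIndep.
Context {R : realType} {d d' : measure_display} {Omega : measurableType d} {T : measurableType d'}.
Variable P : probability Omega R.
Variables (X : Omega -> T).
Hypothesis mX : measurable_fun setT X.

Let mpre B : measurable B -> measurable (X @^-1` B).
Proof. by move=> mB; rewrite -[X in measurable X]setTI; exact: mX. Qed.

Lemma integrable_bounded (D : set Omega) (G : Omega -> R) (M : R) : measurable D ->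
  measurable_fun setT G -> (forall w, `|G w| <= M) -> P.-integrable D (EFin \o G).
Proof.
move=> mD mG GM; have Poo : (P D < +oo)%E.
  by rewrite (le_lt_trans (probability_le1 P mD)) ?ltry.
apply: le_integrable (integrable_bounded_cst M mD Poo) => //.
  by apply/measurable_EFinP; exact: measurable_funTS.
by move=> w _; rewrite lee_fin (le_trans (GM w)) ?ler_norm.
Qed.

(** The image under X of the measure (G + M) dP is proportional to the law of X, by the hypothesis
    on events; integrating phi + M' against it gives the product formula. The constants M and M'
    make both functions nonnegative. *)
Lemma mean_indep_real (G : Omega -> R) (phi : T -> R) (M M' : R) :
  measurable_fun setT G -> (forall w, `|G w| <= M) ->
  measurable_fun setT phi -> (forall x, `|phi x| <= M') ->
  (forall B, measurable B ->
     \int[P]_(w in X @^-1` B) G w = (\int[P]_w G w) * fine (P (X @^-1` B))) ->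
  \int[P]_w (G w * phi (X w)) = (\int[P]_w G w) * (\int[P]_w phi (X w)).
Proof.
move=> mG GM mphi phiM hB.
have mphiX : measurable_fun setT (phi \o X) by exact: measurableT_comp.
have iG D : measurable D -> P.-integrable D (EFin \o G).
  by move=> mD; exact: integrable_bounded mD mG GM.
have iphi := integrable_bounded measurableT mphiX (fun w => phiM (X w)).
have G0 w : 0 <= G w + M by have := GM w; rewrite ler_norml => /andP[]; lra.
have phi0 x : 0 <= phi x + M' by have := phiM x; rewrite ler_norml => /andP[]; lra.
have icst k : P.-integrable setT (EFin \o (fun=> k)).
  by apply: integrable_bounded_cst => //; rewrite (le_lt_trans (probability_le1 P measurableT)) ?ltry.
have cst_int k D : measurable D -> \int[P]_(w in D) k = k * fine (P D).
  by move=> mD; rewrite Rintegral_cst.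
have GM_int D : measurable D -> \int[P]_(w in D) (G w + M) = \int[P]_(w in D) G w + M * fine (P D).
  move=> mD; rewrite RintegralD// ?cst_int//; first exact: iG.
  by apply: integrable_bounded_cst => //; rewrite (le_lt_trans (probability_le1 P mD)) ?ltry.
have fP1 : fine (P setT) = 1 by rewrite probability_setT.
pose a := \int[P]_w (G w + M).
have a0 : 0 <= a by apply: Rintegral_ge0.
pose nu := mscale (NngNum a0) (measure_function_pushforward__canonical__measure_function_Measure P mX).
have nuE B : measurable B -> nu B = (\int[P]_(w in setT `&` X @^-1` B) (G w + M)%:E)%E.
  move=> mB; rewrite setTI -[LHS]/(a%:E * P (X @^-1` B))%E.
  have mXB := mpre mB.
  have iGM : P.-integrable (X @^-1` B) (EFin \o (fun w => G w + M)).
    apply: (@integrable_bounded _ _ (M + M)) => //; first exact: measurable_funD.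
    by move=> w; rewrite ger0_norm// lerD2r (le_trans (ler_norm _)).
  rewrite -[RHS]fineK; last exact: integrable_fin_num iGM.
  rewrite -[X in (_ * X)%E]fineK; last exact: fin_num_measure.
  rewrite -EFinM; congr EFin; rewrite -[RHS]/(\int[P]_(w in X @^-1` B) (G w + M)).
  by rewrite GM_int// hB// /a GM_int// fP1 mulr1 mulrDl.
have mGM : measurable_fun setT (fun w => G w + M) by exact: measurable_funD.
have mpM : measurable_fun setT (fun x => phi x + M') by exact: measurable_funD.
have := integral_density measurableT mX mGM (fun w _ => G0 w) nuE mpM phi0.
rewrite ge0_integral_mscale//=; last first.
- by move=> x _; rewrite lee_fin.
- exact/measurable_EFinP.
rewrite ge0_integral_pushforward//; last first.
- by move=> x _; rewrite lee_fin.
- exact/measurable_EFinP.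
rewrite preimage_setT => /(congr1 fine).
have ipM : P.-integrable setT (EFin \o (fun w => phi (X w) + M')).
  by rewrite (_ : _ \o _ = (fun w => (phi (X w))%:E + (M')%:E)%E)//; exact: integrableD (icst M').
have iGp : P.-integrable setT (EFin \o (fun w => G w * phi (X w))).
  apply: (@integrable_bounded _ _ (M * M')) => //; first exact: measurable_funM.
  by move=> w; rewrite normrM ler_pM.
rewrite fineM//; last exact: integrable_fin_num ipM.
rewrite -[fine (\int[P]_w _)]/(\int[P]_w (phi (X w) + M')) -[RHS]/(\int[P]_w ((phi (X w) + M') * (G w + M))) /=.
rewrite RintegralD// ?cst_int// fP1 mulr1 /a GM_int// fP1 mulr1.
have -> : \int[P]_w ((phi (X w) + M') * (G w + M)) =
   \int[P]_w (G w * phi (X w)) + (M * \int[P]_w phi (X w) + (M' * \int[P]_w G w + M' * M)).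
  transitivity (\int[P]_w (G w * phi (X w) + (M * phi (X w) + (M' * G w + M' * M)))).
    by apply: eq_Rintegral => w _; ring.
  have iZ k (f : Omega -> R) : P.-integrable setT (EFin \o f) -> P.-integrable setT (EFin \o (fun w => k * f w)).
    by move=> /(integrableZl measurableT k).
  have iD (f g : Omega -> R) : P.-integrable setT (EFin \o f) -> P.-integrable setT (EFin \o g) ->
      P.-integrable setT (EFin \o (fun w => f w + g w)).
    by move=> h1 h2; exact: (integrableD measurableT h1 h2).
  have i1 := iZ M _ iphi; have i2 := iZ M' _ (iG _ measurableT); have i3 := icst (M' * M).
  have iphi' : P.-integrable setT (EFin \o (fun w => phi (X w))) by exact: iphi.
  rewrite (RintegralD measurableT iGp (iD _ _ i1 (iD _ _ i2 i3))).
  rewrite (RintegralD measurableT i1 (iD _ _ i2 i3)) (RintegralD measurableT i2 i3).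
  have z1 : \int[P]_w (M * phi (X w)) = M * \int[P]_w phi (X w) by rewrite RintegralZl.
  have z2 : \int[P]_w (M' * G w) = M' * \int[P]_w G w by rewrite RintegralZl//; exact: iG.
  by rewrite z1 z2 cst_int// fP1 mulr1.
set u := \int[P]_w G w; set v := \int[P]_w phi (X w); move=> h; lra.
Qed.

Lemma mean_indep (G : Omega -> R[i]) (phi : T -> R[i]) (M M' : R) :
  cmeas setT G -> (forall w, cabs (G w) <= M) ->
  cmeas setT phi -> (forall x, cabs (phi x) <= M') ->
  (forall B, measurable B ->
     cintegral P (X @^-1` B) G = cintegral P setT G * (fine (P (X @^-1` B)))%:C) ->
  cintegral P setT (fun w => G w * phi (X w)) =
  cintegral P setT G * cintegral P setT (fun w => phi (X w)).
Proof.
move=> mG GM mphi phiM hB; have /cmeasP[mGr mGi] := mG; have /cmeasP[mpr mpi] := mphi.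
have hr B : measurable B -> \int[P]_(w in X @^-1` B) complex.Re (G w) =
    (\int[P]_w complex.Re (G w)) * fine (P (X @^-1` B)).
  by move=> /hB/(congr1 (@complex.Re R)); rewrite cReM /= mulr0 subr0.
have hi B : measurable B -> \int[P]_(w in X @^-1` B) complex.Im (G w) =
    (\int[P]_w complex.Im (G w)) * fine (P (X @^-1` B)).
  by move=> /hB/(congr1 (@complex.Im R)); rewrite cImM /= mulr0 add0r.
have Gr w : `|complex.Re (G w)| <= M by exact: le_trans (Re_le_cabs _) (GM w).
have Gi w : `|complex.Im (G w)| <= M by exact: le_trans (Im_le_cabs _) (GM w).
have pr x : `|complex.Re (phi x)| <= M' by exact: le_trans (Re_le_cabs _) (phiM x).
have pi x : `|complex.Im (phi x)| <= M' by exact: le_trans (Im_le_cabs _) (phiM x).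
have ib (f : Omega -> R) (g : T -> R) : measurable_fun setT f -> measurable_fun setT g ->
    (forall w, `|f w| <= M) -> (forall x, `|g x| <= M') ->
    P.-integrable setT (EFin \o (fun w => f w * g (X w))).
  move=> mf mg fM gM; apply: (@integrable_bounded _ _ (M * M')) => //.
    by apply: measurable_funM => //; exact: measurableT_comp.
  by move=> w; rewrite normrM ler_pM.
apply: complex_eq; rewrite /= ?cReM ?cImM /=.
- under eq_Rintegral do rewrite cReM.
  rewrite (RintegralB measurableT (ib _ _ mGr mpr Gr pr) (ib _ _ mGi mpi Gi pi)).
  by rewrite (mean_indep_real mGr Gr mpr pr hr) (mean_indep_real mGi Gi mpi pi hi).
- under eq_Rintegral do rewrite cImM.
  rewrite (RintegralD measurableT (ib _ _ mGr mpi Gr pi) (ib _ _ mGi mpr Gi pr)).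
  by rewrite (mean_indep_real mGr Gr mpi pi hr) (mean_indep_real mGi Gi mpr pr hi).
Qed.

End MeanIndep.

Section ProductRule.
Context {R : realType} {d d' : measure_display} {Omega : measurableType d} {T : measurableType d'}.
Variable P : probability Omega R.
Variables (n : nat) (X : nat -> Omega -> T) (phi : nat -> T -> R[i]).
Hypothesis mX : forall k, measurable_fun setT (X k).
Hypothesis mphi : forall k, cmeas setT (phi k).
Hypothesis phi1 : forall k x, cabs (phi k x) <= 1.
Hypothesis XB : forall B : nat -> set T, (forall k, measurable (B k)) ->
  P (\bigcap_(k in `I_n) (X k @^-1` B k)) = (\prod_(k < n) P (X k @^-1` B k))%E.

Let mpre k B : measurable B -> measurable (X k @^-1` B).
Proof. by move=> mB; rewrite -[X in measurable X]setTI; exact: mX. Qed.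

Let ind (A : set T) (x : T) : R[i] := if x \in A then 1 else 0.

Let mind A : measurable A -> cmeas setT (ind A).
Proof.
move=> mA; have mI : measurable_fun setT (\1_A : T -> R) by exact: measurable_indic.
have := cmeasR mI.
by rewrite (_ : (fun x => (\1_A x)%:C) = ind A)//; apply/funext => x; rewrite indicE /ind; case: ifP.
Qed.

Let ind1 A x : cabs (ind A x) <= 1.
Proof. by rewrite /ind; case: ifP => _; rewrite ?cabs0 ?cabsR ?normr1. Qed.

Let cintegral_ind k B (G : Omega -> R[i]) : measurable B ->
  cintegral P (X k @^-1` B) G = cintegral P setT (fun w => G w * ind B (X k w)).
Proof.
move=> mB; rewrite /cintegral /Rintegral.
have e w : (w \in X k @^-1` B) = (X k w \in B) by apply/idP/idP; rewrite !inE.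
by apply: complex_eq => /=; congr fine; rewrite integral_mkcond; apply: eq_integral => w _;
  rewrite patchE /ind e; case: ifP; rewrite ?mulr1 ?mulr0.
Qed.

(** Mixed products: functions in the first j places and indicators of arbitrary events in the
    others. They interpolate between the product rule for events and the product rule for
    functions. *)
Let F j (B : nat -> set T) k w := if (k < j)%N then phi k (X k w) else ind (B k) (X k w).
Let c j (B : nat -> set T) k : R[i] := if (k < j)%N then cintegral P setT (fun w => phi k (X k w))
  else (fine (P (X k @^-1` B k)))%:C.

Let cprod_le1 (I : Type) (r : seq I) (p : pred I) (G : I -> R[i]) :
  (forall i, cabs (G i) <= 1) -> cabs (\prod_(i <- r | p i) G i) <= 1.
Proof.
move=> G1; elim/big_ind: _ => //; first by rewrite cabsR normr1.
by move=> x y hx hy; rewrite cabsM mulr_ile1// cabs_ge0.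
Qed.

Let cmeas_prod (I : Type) (r : seq I) (p : pred I) (G : I -> Omega -> R[i]) :
  (forall i, cmeas setT (G i)) -> cmeas setT (fun w => \prod_(i <- r | p i) G i w).
Proof.
move=> mG; elim: r => [|i r IH].
  by under eq_fun do rewrite big_nil; exact: cmeas_cst.
by under eq_fun do rewrite big_cons; case: (p i) => //; exact: cmeasM.
Qed.

(** Induction on the number of indicators already replaced by functions. As the remaining events are
    arbitrary, the product of all factors except the j-th is uncorrelated with every event in [X j],
    so [mean_indep] replaces the j-th indicator. *)
Lemma cintegral_prod : cintegral P setT (fun w => \prod_(k < n) phi k (X k w)) =
  \prod_(k < n) cintegral P setT (fun w => phi k (X k w)).
Proof.
suff H j : (j <= n)%N -> forall B, (forall k, measurable (B k)) ->
    cintegral P setT (fun w => \prod_(k < n) F j B k w) = \prod_(k < n) c j B k.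
  have := H n (leqnn _) (fun=> setT) (fun=> measurableT).
  rewrite /F /c; under [RHS]eq_bigr do rewrite ltn_ord.
  by move=> <-; apply: cintegral_eq => w _; apply: eq_bigr => k _; rewrite ltn_ord.
elim: j => [_ B mB|j IH jn B mB].
  have e w : \prod_(k < n) F 0 B k w = (\1_(\bigcap_(k in `I_n) (X k @^-1` B k)) w)%:C.
    rewrite indicE; case: (boolP (w \in _)) => [/set_mem h|/negP h].
      by rewrite big1// => k _; rewrite /F /ind mem_set//; exact: (h k (ltn_ord k)).
    have [k hk] : exists k : 'I_n, ~ B k (X k w).
      by apply/not_existsP => hh; apply: h; apply/mem_set => k /= kn; have /contrapT := hh (Ordinal kn).
    by rewrite (bigD1 k)//= /F /ind memNset// mul0r.
  under cintegral_eq do rewrite e.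
  have mI : measurable (\bigcap_(k in `I_n) (X k @^-1` B k)).
    by apply: fin_bigcap_measurable => [|k _]; [exact: finite_II|exact: mpre].
  rewrite /cintegral /= /Rintegral integral0 integral_indic//.
  rewrite setIT.
  transitivity ((fine (\prod_(k < n) P (X k @^-1` B k))%E)%:C); first by rewrite -XB.
  rewrite /c /= -rmorph_prod/=; congr (_%:C).
  suff: (\prod_(k < n) P (X k @^-1` B k))%E \is a fin_num /\
    fine (\prod_(k < n) P (X k @^-1` B k))%E = \prod_(k < n) fine (P (X k @^-1` B k)) by case.
  elim: (index_enum _) => [|k r [fr IHr]]; first by rewrite !big_nil.
  have f1 : P (X k @^-1` B k) \is a fin_num by apply: fin_num_measure; exact: mpre.
  by rewrite !big_cons fineM// IHr fin_numM.
pose oj := Ordinal jn.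
have FS B' w : (forall k, k != j -> B' k = B k) ->
    \prod_(k < n | k != oj) F j.+1 B k w = \prod_(k < n | k != oj) F j B' k w.
  move=> hB'; apply: eq_bigr => k; rewrite -val_eqE/= => kj.
  by rewrite /F ltnS leq_eqVlt (negbTE kj)/= hB'.
have cS B' : (forall k, k != j -> B' k = B k) ->
    \prod_(k < n | k != oj) c j.+1 B k = \prod_(k < n | k != oj) c j B' k.
  move=> hB'; apply: eq_bigr => k; rewrite -val_eqE/= => kj.
  by rewrite /c ltnS leq_eqVlt (negbTE kj)/= hB'.
pose G w := \prod_(k < n | k != oj) F j.+1 B k w.
have GE A : measurable A -> cintegral P setT (fun w => G w * ind A (X j w)) =
    (\prod_(k < n | k != oj) c j.+1 B k) * (fine (P (X j @^-1` A)))%:C.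
  move=> mA; pose B' k := if k == j then A else B k.
  have mB' k : measurable (B' k) by rewrite /B'; case: ifP.
  have hB' k : k != j -> B' k = B k by rewrite /B' => /negbTE ->.
  have := IH (ltnW jn) B' mB'; rewrite (bigD1 oj)//= -(cS B' hB') /c ltnn /B' eqxx mulrC => <-.
  apply: cintegral_eq => w _; rewrite [in RHS](bigD1 oj)//= -(FS B' w hB') mulrC.
  by rewrite /F ltnn /B' eqxx.
have GT : cintegral P setT G = \prod_(k < n | k != oj) c j.+1 B k.
  have := GE setT measurableT; rewrite preimage_setT probability_setT mulr1 => <-.
  by apply: cintegral_eq => w _; rewrite /ind in_setT mulr1.
rewrite [RHS](bigD1 oj)//= {1}/c ltnS leqnn -GT mulrC.
rewrite -(@mean_indep _ _ _ _ _ P (X j) (mX j) G (phi j) 1 1)//.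
- by apply: cintegral_eq => w _; rewrite [LHS](bigD1 oj)//= mulrC /F ltnS leqnn.
- apply: cmeas_prod => k; rewrite /F; case: (k < j.+1)%N.
    exact: (measurableT_comp (mphi k) (mX k)).
  exact: (measurableT_comp (mind (mB k)) (mX k)).
- by move=> w; apply: cprod_le1 => k; rewrite /F; case: ifP.
- by move=> A mA; rewrite cintegral_ind// GE// GT.
Qed.

End ProductRule.

Section IndependentSums.
Context {R : realType} {d : measure_display} {Omega : measurableType d}.
Variable P : probability Omega R.
Variable alpha : R.
Hypothesis halpha : 1 < alpha <= 2.
Local Notation leb := (@lebesgue_measure R).
Local Notation J := (`[0%R, (2 * pi)%R[%classic : set R).

Lemma alpha_norm_eq0 V : stable_exponent P alpha V (fun _ _ => 0) -> alpha_norm P alpha V `^ alpha = 0.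
Proof.
move=> sV; have := alpha_norm_mean halpha sV; rewrite integral0.
have [K K0 ->] := circle_momentE halpha; rewrite -EFinM => -[/esym/eqP].
by rewrite mulf_eq0 (gt_eqF K0) orbF => /eqP.
Qed.

(** Characteristic functions multiply, so exponents add, and the alpha-th power of the norm is
    linear in the exponent. Partial sums are treated as well, to allow an induction on the number of
    terms. *)
Lemma alpha_norm_indep_sum n (V : nat -> Omega -> R[i]) (c : nat -> R[i]) :
  (forall k, SaS P alpha (V k)) ->
  (forall B : nat -> set (R * R), (forall k, measurable (B k)) ->
    P (\bigcap_(k in `I_n) (cpair (V k) @^-1` B k)) = (\prod_(k < n) P (cpair (V k) @^-1` B k))%E) ->
  SaS P alpha (fun w => \sum_(k < n) c k * V k w) /\
  alpha_norm P alpha (fun w => \sum_(k < n) c k * V k w) `^ alpha =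
    \sum_(k < n) (cabs (c k) * alpha_norm P alpha (V k)) `^ alpha.
Proof.
move=> sV hB.
have /choice[C hC] k : exists C, stable_exponent P alpha (V k) C by apply/SaS_exponent.
pose D k t1 t2 := C k (t1 * complex.Re (c k) + t2 * complex.Im (c k)) (t2 * complex.Re (c k) - t1 * complex.Im (c k)).
have hD k : stable_exponent P alpha (fun w => c k * V k w) (D k) by exact: stable_exponentZ.
have mV k : cmeas setT (V k) by have [] := hC k.
have ch (r : nat) t1 t2 s : (r <= n)%N ->
    charfun P (fun w => t1 * complex.Re (\sum_(k < r) c k * V k w) + t2 * complex.Im (\sum_(k < r) c k * V k w)) s =
    (expR (- ((\sum_(k < r) D k t1 t2) * `|s| `^ alpha)))%:C.
  (* The factors beyond [r] are set to 1, so that the product rule, known for exactly [n] variables,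
     yields the partial sum of length [r]. *)
  move=> rn; pose phi k (x : R * R) : R[i] := if (k < r)%N then
    expi (s * (t1 * complex.Re (c k * (x.1 +i* x.2)) + t2 * complex.Im (c k * (x.1 +i* x.2)))) else 1.
  have mphi k : cmeas setT (phi k).
    rewrite /phi; case: (k < r)%N; last exact: cmeas_cst.
    have m2 : cmeas setT (fun x : R * R => c k * (x.1 +i* x.2)).
      by apply: cmeasM; [exact: cmeas_cst|apply/cmeasP; split; [exact: measurable_fst|exact: measurable_snd]].
    have /cmeasP[mr mi] := m2.
    by apply: cmeas_expi; apply: measurable_funM => //; apply: measurable_funD; apply: measurable_funM.
  have phi1 k x : cabs (phi k x) <= 1.
    by rewrite /phi; case: ifP => _; rewrite ?cabs_expi ?cabsR ?normr1.
  have phiE k : cintegral P setT (fun w => phi k (cpair (V k) w)) =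
      if (k < r)%N then (expR (- (D k t1 t2 * `|s| `^ alpha)))%:C else 1.
    rewrite /phi; case: ifP => kr.
      have [_ _ <-] := hD k; rewrite /charfun; apply: cintegral_eq => w _.
      by rewrite /cpair /=; case: (V k w).
    have h : (\int[P]_x (1 : R)%:E = 1)%E by rewrite integral_cst// mul1e; exact: probability_setT.
    by apply: complex_eq; rewrite /= /Rintegral ?integral0 ?h.
  have := @cintegral_prod _ _ _ _ _ P n (fun k => cpair (V k)) phi mV mphi phi1 hB.
  under [in RHS]eq_bigr do rewrite phiE.
  have cut (G : nat -> R[i]) : \prod_(k < n) (if (k < r)%N then G k else 1) = \prod_(k < r) G k.
    by rewrite -big_mkcond/= (big_ord_widen_cond n (fun=> true) G rn); apply: eq_bigl => k.
  rewrite (cut (fun k => (expR (- (D k t1 t2 * `|s| `^ alpha)))%:C)) => h.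
  transitivity (cintegral P setT (fun w => \prod_(k < n) phi k (cpair (V k) w))).
    rewrite /charfun; apply: cintegral_eq => w _.
    rewrite (cut (fun k => expi (s * (t1 * complex.Re (c k * ((cpair (V k) w).1 +i* (cpair (V k) w).2)) +
      t2 * complex.Im (c k * ((cpair (V k) w).1 +i* (cpair (V k) w).2)))))).
    transitivity (\prod_(k < r) expi (s * (t1 * complex.Re (c k * V k w) + t2 * complex.Im (c k * V k w)))); last first.
      by apply: eq_bigr => k _; rewrite /cpair/=; case: (V k w).
    elim: (r) => [|m IH]; first by rewrite !big_ord0 /= !mulr0 addr0 mulr0 expi0.
    by rewrite !big_ord_recr/= -IH -expiD; congr expi; rewrite cReD cImD; ring.
  rewrite h.
  elim: (r) => [|m IH]; first by rewrite !big_ord0 mul0r oppr0 expR0.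
  by rewrite !big_ord_recr/= IH mulrDl opprD expRD rmorphM.
have sS r : (r <= n)%N -> stable_exponent P alpha (fun w => \sum_(k < r) c k * V k w)
    (fun t1 t2 => \sum_(k < r) D k t1 t2).
  move=> rn; split=> [|t1 t2|t1 t2 s]; last exact: ch.
    by apply: cmeas_sum => k; apply: cmeasM => //; exact: cmeas_cst.
  by apply: sumr_ge0 => k _; have [] := hD k.
split; first by apply/SaS_exponent; eexists; exact: sS.
suff H r : (r <= n)%N -> alpha_norm P alpha (fun w => \sum_(k < r) c k * V k w) `^ alpha =
    \sum_(k < r) (cabs (c k) * alpha_norm P alpha (V k)) `^ alpha by exact: H.
elim: r => [_|r IH rn].
  rewrite big_ord0; apply: alpha_norm_eq0; have [m0 c0 h0] := sS 0%N (leq0n _).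
  split=> // t1 t2 s; have := h0 t1 t2 s; rewrite big_ord0; exact.
have e : (fun w => \sum_(k < r.+1) c k * V k w) = (fun w => \sum_(k < r) c k * V k w + c r * V r w).
  by apply/funext => w; rewrite big_ord_recr.
have sr := eq_ind _ (fun F => stable_exponent P alpha F _) (sS r.+1 rn) _ e.
apply: etrans (congr1 (fun F => alpha_norm P alpha F `^ alpha) e) _.
have sr' : stable_exponent P alpha (fun w => \sum_(k < r) c k * V k w + c r * V r w)
    (fun t1 t2 => \sum_(k < r) D k t1 t2 + D r t1 t2).
  have [m0 c0 h0] := sr; split=> // [t1 t2|t1 t2 s].
    by rewrite addr_ge0 ?sumr_ge0// => [k _|]; [have [] := hD k|have [] := hD r].
  by rewrite h0 big_ord_recr.
apply: etrans (alpha_normD halpha (sS r (ltnW rn)) (hD r) sr') _.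
rewrite big_ord_recr/=; exact: (congr2 +%R (IH (ltnW rn)) (alpha_normZ halpha (c r) (sV r))).
Qed.

Lemma SaS_normD_indep V W : SaS P alpha V -> SaS P alpha W ->
  (forall A B : set (R * R), measurable A -> measurable B ->
    P (cpair V @^-1` A `&` cpair W @^-1` B) = (P (cpair V @^-1` A) * P (cpair W @^-1` B))%E) ->
  SaS P alpha (fun w => V w + W w) /\
  alpha_norm P alpha (fun w => V w + W w) `^ alpha =
    alpha_norm P alpha V `^ alpha + alpha_norm P alpha W `^ alpha.
Proof.
move=> sV sW hVW; pose U k := if k is 0%N then V else W.
have sU k : SaS P alpha (U k) by case: k.
have e : (fun w => \sum_(k < 2) 1 * U k w) = (fun w => V w + W w).
  by apply/funext => w; rewrite !big_ord_recr big_ord0/= add0r !mul1r.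
have c1 : cabs (1 : R[i]) = 1 by rewrite (cabsR 1) normr1.
have [B mB|s1 s2] := @alpha_norm_indep_sum 2 U (fun=> 1) sU.
  rewrite !big_ord_recr big_ord0/= mul1e -hVW//; congr (P _).
  apply/seteqP; split => w /=; first by move=> h; split; [exact: (h 0%N)|exact: (h 1%N)].
  by move=> [h0 h1] [|[|//]] _.
split; first exact: (eq_ind _ (SaS P alpha) s1 _ e).
apply: etrans (esym (congr1 (fun F => alpha_norm P alpha F `^ alpha) e)) _.
apply: etrans s2 _.
transitivity (\sum_(k < 2) alpha_norm P alpha (U k) `^ alpha).
  by apply: eq_bigr => k _; congr (_ `^ _); rewrite -[RHS]mul1r; congr (_ * _); exact: c1.
by rewrite !big_ord_recr big_ord0/= add0r.
Qed.

End IndependentSums.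

(** * Step functions on a common grid *)

Section StepGrid.
Context {R : realType}.
Implicit Types (t : nat -> R) (q : seq (R[i] * (nat * nat))) (s : @step R).

Definition grid_step t q : step := [seq (r.1, (t r.2.1, t r.2.2)) | r <- q].

Definition grid_coef q (k : nat) : R[i] :=
  \sum_(r <- q) (if (r.2.1 <= k < r.2.2)%N then r.1 else 0).

(** The intervals of a step function may overlap, while independence is available for consecutive
    increments only. All end points are sorted into one grid and each interval is recorded by the
    indices of its end points. *)
Lemma step_gridP s : step_ok s -> exists n t q,
  [/\ forall k, circle (t k), {in [pred k | (k <= n)%N] &, {homo t : i j / (i <= j)%N >-> i <= j}},
      forall r, r \in q -> (r.2.1 <= r.2.2 <= n)%N & s = grid_step t q].
Proof.
move=> sok.
pose pts := sort <=%R (flatten [seq [:: p.2.1; p.2.2] | p <- s]).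
have ptsP p : p \in s -> p.2.1 \in pts /\ p.2.2 \in pts.
  by move=> ps; rewrite !mem_sort; split; apply/flatten_mapP; exists p => //;
    rewrite !inE eqxx ?orbT.
have pts_circle x : x \in pts -> circle x.
  rewrite mem_sort => /flatten_mapP[p ps]; have [h1 h2 _] := sok p ps.
  by rewrite !inE => /orP[] /eqP ->.
(* The default value lies on the circle, so that every [t k] does; monotonicity is claimed only
   within the list. *)
pose t k := nth (- pi) pts k.
have pi0 := pi_ge0 R.
have tc k : circle (t k).
  have [kp|kp] := ltnP k (size pts); first by apply: pts_circle; exact: mem_nth.
  by rewrite /t nth_default// /circle/= in_itv/= lexx; lra.
have tle i j : (i <= j)%N -> (j < size pts)%N -> t i <= t j.
  move=> ij jp; apply: (@sorted_leq_nth _ _ (@le_trans _ _) (@lexx _ _)) => //.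
  - exact: sort_sorted le_total _.
  - by rewrite inE (leq_ltn_trans ij).
exists (size pts).-1, t, [seq (p.1, (index p.2.1 pts, index p.2.2 pts)) | p <- s].
split=> //.
- move=> i j; rewrite !inE => ip jp ij.
  have [sz|sz] := posnP (size pts).
    by rewrite sz in ip jp; move: ip jp; rewrite !leqn0 => /eqP -> /eqP ->.
  by apply: tle => //; rewrite -(prednK sz) ltnS.
- move=> _ /mapP[p ps ->] /=; have [h1 h2] := ptsP p ps; have [_ _ le12] := sok p ps.
  have i1 : (index p.2.1 pts < size pts)%N by rewrite index_mem.
  have i2 : (index p.2.2 pts < size pts)%N by rewrite index_mem.
  have -> : (index p.2.2 pts <= (size pts).-1)%N by rewrite -ltnS prednK// (leq_ltn_trans _ i2).
  rewrite andbT.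
  rewrite leqNgt; apply/negP => lt21.
  have : t (index p.2.2 pts) <= t (index p.2.1 pts) by apply: tle => //; exact: ltnW.
  rewrite /t !nth_index// => le21; have e : p.2.1 = p.2.2 by apply/le_anti; rewrite le12 le21.
  by move: lt21; rewrite e ltnn.
- rewrite /grid_step -map_comp -[LHS]map_id; apply/eq_in_map => p /ptsP[h1 h2] /=.
  by rewrite /t !nth_index//; case: p {h1 h2} => c [a b].
Qed.

Lemma step_integral_grid {d : measure_display} {Omega : measurableType d} (Z : R -> Omega -> R[i]) n t q w :
  (forall r, r \in q -> (r.2.1 <= r.2.2 <= n)%N) ->
  step_integral Z (grid_step t q) w =
  \sum_(k < n) grid_coef q k * (Z (t k.+1) w - Z (t k) w).
Proof.
move=> qn; rewrite /step_integral /grid_step big_map /=.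
transitivity (\sum_(r <- q) \sum_(k < n)
    (if (r.2.1 <= k < r.2.2)%N then r.1 else 0) * (Z (t k.+1) w - Z (t k) w)).
  rewrite big_seq [RHS]big_seq; apply: eq_bigr => r /qn /andP[ij jn].
  have H m : \sum_(k < m) (if (r.2.1 <= k < r.2.2)%N then r.1 else 0) * (Z (t k.+1) w - Z (t k) w) =
      if (m <= r.2.1)%N then 0 else r.1 * (Z (t (minn m r.2.2)) w - Z (t r.2.1) w).
    elim: m => [|m IH]; first by rewrite big_ord0.
    rewrite big_ord_recr/= IH; case: (ltngtP m r.2.1) => [h|h|h].
    - by rewrite mul0r addr0.
    - case: (ltnP m r.2.2) => h2.
        have -> : minn m.+1 r.2.2 = m.+1 by exact/minn_idPl.
        by rewrite /= -mulrDr; congr (_ * _); rewrite addrC addrA subrK.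
      have -> : minn m.+1 r.2.2 = r.2.2 by apply/minn_idPr/(leq_trans h2).
      by rewrite /= mul0r addr0.
    - rewrite -h; case: (ltnP m r.2.2) => h2 /=.
        have -> : minn m.+1 r.2.2 = m.+1 by exact/minn_idPl.
        by rewrite add0r.
      have e : r.2.2 = m by apply/eqP; rewrite eqn_leq h2 h ij.
      by rewrite mul0r e (minn_idPr (leqnSn m)) addr0 subrr mulr0.
  rewrite H; case: ifPn => [nr|_].
    have e : r.2.1 = r.2.2 by apply/eqP; rewrite eqn_leq ij (leq_trans jn nr).
    by rewrite e subrr mulr0.
  by rewrite (minn_idPr jn).
by rewrite exchange_big/=; apply: eq_bigr => k _; rewrite mulr_suml.
Qed.

(** A deterministic process in u whose increment over ]s, t] is the indicator of that interval at x.
    The value of a step function at x is its step integral against this process, so the regrouping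
    on a grid is proved once for both. *)
Let below (x u : R) (_ : unit) : R[i] := if u < x then - 1 else 0.

Let step_fun_below s x : step_ok s -> step_fun s x = step_integral (below x) s tt.
Proof.
move=> sok; rewrite /step_fun /step_integral big_seq [RHS]big_seq.
apply: eq_bigr => p /sok[_ _ le12]; rewrite /below.
have [h1|h1] := ltP p.2.1 x; have [h2|h2] /= := ltP p.2.2 x; rewrite ?sub0r ?opprK ?subr0 ?subrr ?addNr ?oppr0 ?mulr0 ?mulr1//.
by move: (lt_le_trans h2 (le_trans h1 le12)); rewrite ltxx.
Qed.

Lemma step_fun_grid n t q x : {in [pred k | (k <= n)%N] &, {homo t : i j / (i <= j)%N >-> i <= j}} ->
  step_ok (grid_step t q) ->
  (forall r, r \in q -> (r.2.1 <= r.2.2 <= n)%N) ->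
  step_fun (grid_step t q) x = \sum_(k < n) (if t k < x <= t k.+1 then grid_coef q k else 0).
Proof.
move=> tm sok qn; rewrite step_fun_below// (step_integral_grid _ _ _ qn).
apply: eq_bigr => k _; rewrite /below.
have le12 : t k <= t k.+1 by apply: tm; rewrite ?inE// ltnW.
have [h1|h1] := ltP (t k) x; have [h2|h2] /= := ltP (t k.+1) x; rewrite ?sub0r ?opprK ?subr0 ?subrr ?addNr ?oppr0 ?mulr0 ?mulr1//.
by move: (lt_le_trans h2 (le_trans h1 le12)); rewrite ltxx.
Qed.

(** The cells of the grid are disjoint, so at most one term is nonzero and the power passes through
    the sum. *)
Lemma cabs_step_fun_grid (p : R) n t q x : 0 < p ->
  {in [pred k | (k <= n)%N] &, {homo t : i j / (i <= j)%N >-> i <= j}} ->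
  step_ok (grid_step t q) -> (forall r, r \in q -> (r.2.1 <= r.2.2 <= n)%N) ->
  cabs (step_fun (grid_step t q) x) `^ p =
  \sum_(k < n) (cabs (grid_coef q k) `^ p * \1_(`]t k, t k.+1]%classic) x).
Proof.
move=> p0 tm sok qn; rewrite (step_fun_grid x tm sok qn).
have ind1 k : t k < x <= t k.+1 -> \1_(`]t k, t k.+1]%classic) x = 1 :> R.
  by move=> h; rewrite indicE mem_setE in_itv/= h.
have ind0 k : ~ (t k < x <= t k.+1) -> \1_(`]t k, t k.+1]%classic) x = 0 :> R.
  by move=> /negP/negbTE h; rewrite indicE mem_setE in_itv/= h.
have uniqk (i j : 'I_n) : t i < x <= t i.+1 -> t j < x <= t j.+1 -> i = j.
  move=> /andP[i1 i2] /andP[j1 j2]; apply/val_inj/eqP; rewrite eqn_leq; apply/andP; split; rewrite leqNgt;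
    apply/negP => h.
    have : t j.+1 <= t i by apply: tm; rewrite ?inE// ltnW.
    by move=> tt; move: (lt_le_trans i1 (le_trans j2 tt)); rewrite ltxx.
  have : t i.+1 <= t j by apply: tm; rewrite ?inE// ltnW.
  by move=> tt; move: (lt_le_trans j1 (le_trans i2 tt)); rewrite ltxx.
have [[k hk]|no] := pselect (exists k : 'I_n, t k < x <= t k.+1).
  rewrite (bigD1 k)//= hk [X in _ + X]big1 ?addr0; last first.
    by move=> j jk; case: ifP => // hj; move: jk; rewrite (uniqk _ _ hj hk) eqxx.
  rewrite (bigD1 k)//= (ind1 k hk) mulr1 big1 ?addr0// => j jk.
  have [hj|/negP hj] := boolP (t j < x <= t j.+1); last by rewrite ind0// mulr0.
  by move: jk; rewrite (uniqk _ _ hj hk) eqxx.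
rewrite !big1 => [|k _|k _].
- by rewrite cabs0 powR0 ?gt_eqF.
- by rewrite ind0 ?mulr0// => hk; case: no; exists k.
- by case: ifP => hk //; case: no; exists k.
Qed.

End StepGrid.

Section StepIsometry.
Context {R : realType} {d : measure_display} {Omega : measurableType d}.
Variable P : probability Omega R.
Variable alpha : R.
Hypothesis halpha : 1 < alpha <= 2.
Variables (Z : R -> Omega -> R[i]) (mu : {finite_measure set R -> \bar R}).
Hypotheses (hZ : SaS_family P alpha circle Z) (hind : independent_increments P Z)
  (hmu : is_spectral_measure P alpha Z mu).

Let a0 : 0 < alpha. Proof. by apply: lt_trans ltr01 _; have /andP[] := halpha. Qed.

Lemma SaS_increment s t : circle s -> circle t -> SaS P alpha (fun w => Z t w - Z s w).
Proof.
move=> cs ct; have [mZ lin] := hZ; split.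
  by move=> _ _; apply: cmeasB; exact: mZ.
move=> n i c _.
have := lin 2%N (fun k : 'I_2 => if k == 0 :> nat then t else s)
  (fun k : 'I_2 => if k == 0 :> nat then \sum_(j < n) c j else - \sum_(j < n) c j).
have h (k : 'I_2) : circle (if k == 0 :> nat then t else s) by case: ifP.
move=> /(_ h); congr SaS_real; apply/funext => w; congr complex.Re.
by rewrite !big_ord_recr big_ord0/= add0r mulNr -mulrBr mulr_suml.
Qed.

(** On the grid the integral is a combination of independent increments, whose norms to the power
    alpha are the masses of the cells. *)
Lemma step_isometry s : step_ok s -> SaS P alpha (step_integral Z s) /\
  ((alpha_norm P alpha (step_integral Z s) `^ alpha)%:E =
   \int[mu]_(x in circle) (cabs (step_fun s x) `^ alpha)%:E)%E.
Proof.
move=> sok; have [n [t [q [tc tm qn e]]]] := step_gridP sok.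
have iE : step_integral Z s = fun w => \sum_(k < n) grid_coef q k * (Z (t k.+1) w - Z (t k) w).
  by apply/funext => w; rewrite e; exact: step_integral_grid.
have le12 k : (k < n)%N -> t k <= t k.+1 by move=> kn; apply: tm; rewrite ?inE// ltnW.
have sV k : SaS P alpha (fun w => Z (t k.+1) w - Z (t k) w) by exact: SaS_increment.
have hB (B : nat -> set (R * R)) : (forall k, measurable (B k)) ->
    P (\bigcap_(k in `I_n) (cpair (fun w => Z (t k.+1) w - Z (t k) w) @^-1` B k)) =
    (\prod_(k < n) P (cpair (fun w => (Z (t k.+1) w - Z (t k) w)%R) @^-1` B k))%E.
  by move=> mB; apply: hind.
have mc : measurable (circle : set R) by exact: measurable_itv.
have [s1 s2] := alpha_norm_indep_sum halpha (grid_coef q) sV hB.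
split; first exact: (eq_ind _ (SaS P alpha) s1 _ (esym iE)).
apply: etrans (congr1 (fun F => (alpha_norm P alpha F `^ alpha)%:E) iE) _.
apply: etrans (congr1 EFin s2) _.
have sok' : step_ok (grid_step t q) by rewrite -e.
symmetry; transitivity (\int[mu]_(x in circle) \sum_(k < n)
    (cabs (grid_coef q k) `^ alpha * \1_(`]t k, t k.+1]%classic : set R) x)%:E)%E.
  by apply: eq_integral => x _; rewrite e (cabs_step_fun_grid x a0 tm sok' qn) sumEFin.
rewrite ge0_integral_sum//; last 2 first.
- by move=> k; apply/measurable_EFinP; apply: measurable_funM => //; exact: measurable_indic.
- by move=> k x _; rewrite lee_fin mulr_ge0 ?powR_ge0.
rewrite -sumEFin; apply: eq_bigr => k _.
under eq_integral do rewrite EFinM.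
rewrite ge0_integralZl//; do ?[by move=> x _; rewrite lee_fin|by rewrite lee_fin powR_ge0
  |by apply/measurable_EFinP; exact: measurable_indic].
rewrite (integral_indic mu mc (measurable_itv _)) setIidl; last first.
  have /andP[c1 _] : - pi <= t k <= pi by have := tc k; rewrite /circle/= in_itv.
  have /andP[_ c2] : - pi <= t k.+1 <= pi by have := tc k.+1; rewrite /circle/= in_itv.
  move=> x /=; rewrite /circle/= !in_itv/= => /andP[x1 x2].
  by rewrite (le_trans c1 (ltW x1)) (le_trans x2 c2).
apply: etrans (congr1 (fun y => (cabs (grid_coef q k) `^ alpha)%:E * y)%E
  (hmu (tc k) (tc k.+1) (le12 k (ltn_ord k)))) _.
by rewrite -EFinM powRM ?cabs_ge0 ?alpha_norm_ge0.
Qed.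

End StepIsometry.

(** Convexity of the power for a + b = l (a/l) + (1 - l) (b/(1 - l)), with l chosen so that l^(1-p)
    = 1 + e. It plays the role of the triangle inequality for p-th powers, with a leading constant
    as close to 1 as desired. *)
Lemma powR_split {R : realType} (p e : R) : 1 < p -> 0 < e ->
  exists2 K : R, 0 <= K & forall a b, 0 <= a -> 0 <= b ->
    (a + b) `^ p <= (1 + e) * a `^ p + K * b `^ p.
Proof.
move=> p1 e0; have p0 : 0 < p by exact: lt_trans p1.
have q0 : 0 < p - 1 by rewrite subr_gt0.
have e1 : 0 < 1 + e by lra.
pose l := (1 + e) `^ (- (p - 1)^-1).
have l0 : 0 < l by exact: powR_gt0.
have l1 : l < 1.
  have pw1 : 1 `^ (p - 1)^-1 = 1 :> R by rewrite powR1.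
  rewrite /l powRN invf_lt1 ?powR_gt0// -[ltLHS]pw1.
  by apply: gt0_ltr_powR; rewrite ?invr_gt0 ?nnegrE ?(ltW e1)//; lra.
have scale (m a : R) : 0 < m -> 0 <= a -> m * (a / m) `^ p = m `^ (1 - p) * a `^ p.
  move=> m0 a0; rewrite powRM ?invr_ge0 ?(ltW m0)// powRD ?(gt_eqF m0) ?implybT//.
  have -> : m^-1 `^ p = (m `^ p)^-1.
    apply: (mulIf (lt0r_neq0 (powR_gt0 p m0))).
    by rewrite -powRM ?invr_ge0 ?(ltW m0)// !mulVf ?powR1 ?gt_eqF ?powR_gt0.
  by rewrite powRr1 ?(ltW m0)// powRN; ring.
have lp1 : l `^ (1 - p) = 1 + e.
  rewrite /l -powRrM (_ : - (p - 1)^-1 * (1 - p) = 1) ?powRr1 ?(ltW e1)//.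
  by rewrite -(opprB p 1) mulrNN mulVf// gt_eqF.
exists ((1 - l) `^ (1 - p)); first exact: powR_ge0.
move=> a b a0 b0; have m0 : 0 < 1 - l by lra.
have ab0 : 0 <= a + b by rewrite addr_ge0.
have h1 := powR_tangent p1 ab0 (divr_ge0 a0 (ltW l0)).
have h2 := powR_tangent p1 ab0 (divr_ge0 b0 (ltW m0)).
rewrite -lp1 -!scale//.
move: h1 h2; rewrite -(ler_pM2l l0) -(ler_pM2l m0 (_ + _)) => h1 h2.
apply: le_trans (lerD h1 h2).
set X := (a + b) `^ p; set Y := p * _.
have -> : l * (X + Y * (a / l - (a + b))) + (1 - l) * (X + Y * (b / (1 - l) - (a + b))) = X.
  by field; rewrite !gt_eqF.
exact: lexx.
Qed.

Lemma inv_nat_small {R : realType} (e : R) : 0 < e -> exists N, forall n, (N <= n)%N -> n.+1%:R^-1 <= e.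
Proof.
move=> e0; exists (Num.truncn e^-1) => n hn.
rewrite -[leRHS]invrK lef_pV2 ?posrE ?invr_gt0//.
apply: le_trans (ltW (truncnS_gt _)) _; by rewrite ler_nat.
Qed.

(** * Limits of norms and closures of isometric correspondences *)

Section LpLimit.
Context {R : realType} {d : measure_display} {T : measurableType d}.
Variables (mu : {measure set T -> \bar R}) (D : set T).
Hypothesis mD : measurable D.
Variables (p : R) (w : T -> R).
Hypotheses (p1 : 1 < p) (mw : measurable_fun D w) (w0 : forall x, D x -> 0 <= w x).
Implicit Types u v : T -> R[i].
Local Notation N u := (lp mu D p w u).

Lemma lp_split (e : R) : 0 < e -> exists2 K : R, 0 <= K &
  forall u v, cmeas D u -> cmeas D v ->
    (N u <= (1 + e)%:E * N v + K%:E * N (fun x => (u x - v x)%R))%E.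
Proof.
move=> e0; have [K K0 hK] := powR_split p1 e0; exists K => // u v mu_ mv.
have m1 := measurable_lp p mw mv; have m2 := measurable_lp p mw (cmeasB mu_ mv).
have p0 : 0 < p by exact: lt_trans p1.
rewrite /lp -!ge0_integralZl//; do ?[by move=> x Dx; rewrite lee_fin mulr_ge0 ?powR_ge0 ?w0|by rewrite lee_fin; lra].
rewrite -ge0_integralD//; do ?[by move=> x Dx; rewrite mule_ge0 ?lee_fin ?mulr_ge0 ?powR_ge0 ?w0//; lra
  |by apply: emeasurable_funM].
apply: ge0_le_integral => //; do ?[by move=> x Dx; rewrite lee_fin mulr_ge0 ?powR_ge0 ?w0|exact: measurable_lp
  |by apply: emeasurable_funD; apply: emeasurable_funM].
move=> x Dx; rewrite -!EFinM -EFinD lee_fin !mulrA -mulrDl ler_wpM2r ?w0//.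
apply: le_trans (hK _ _ (cabs_ge0 _) (cabs_ge0 _)).
apply: ge0_ler_powR; rewrite ?nnegrE ?addr_ge0 ?cabs_ge0 ?(ltW p0)//.
by apply: le_trans (cabsD _ _); rewrite addrC subrK.
Qed.

Definition lp_cvg (u_ : nat -> T -> R[i]) u := forall e : R, 0 < e -> exists n0, forall n, (n0 <= n)%N ->
  (N (fun x => (u_ n x - u x)%R) <= e%:E)%E.

(** The constant 2^p of [lpD] would not give equality in the limit; [lp_split], applied in both
    directions, loses only the factor 1 + e. *)
Lemma lp_limit (u_ : nat -> T -> R[i]) u (a_ : nat -> R) (a : R) :
  (forall n, cmeas D (u_ n)) -> cmeas D u -> (forall n, N (u_ n) = (a_ n)%:E) ->
  a_ @ \oo --> a -> lp_cvg u_ u -> N u = a%:E.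
Proof.
move=> mu_ mmu ua /cvgrPdist_le aa uu.
have close (eta : R) : 0 < eta -> exists n0, forall n, (n0 <= n)%N -> `|a - a_ n| <= eta.
  by move=> /aa[n0 _ h]; exists n0 => n; exact: h.
have ub (e : R) : 0 < e -> exists2 K : R, 0 <= K & forall del : R, 0 < del ->
    (N u <= ((1 + e) * (a + del) + K * del)%:E)%E.
  move=> e0; have [K K0 hK] := lp_split e0; exists K => // del del0.
  have [n1 h1] := uu _ del0; have [n2 h2] := close _ del0.
  have := h1 _ (leq_maxl n1 n2); have := h2 _ (leq_maxr n1 n2); set n := maxn _ _ => h3 h4.
  apply: le_trans (hK _ _ mmu (mu_ n)) _.
  apply: (@le_trans _ _ ((1 + e)%:E * (a + del)%:E + K%:E * del%:E)%E); last by rewrite -!EFinM -EFinD.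
  apply: leeD.
    rewrite ua -!EFinM lee_fin ler_wpM2l//; first by lra.
    by move: h3; rewrite ler_norml => /andP[]; lra.
  apply: lee_wpmul2l; first by rewrite lee_fin.
  by rewrite lpBC.
have Nfin : N u \is a fin_num.
  have [K _ /(_ 1 ltr01) h] := ub 1 ltr01.
  by rewrite ge0_fin_numE ?(le_lt_trans h) ?ltry// lp_ge0.
have lb (e : R) : 0 < e -> exists2 K : R, 0 <= K & forall del : R, 0 < del ->
    a <= (1 + e) * fine (N u) + K * del + del.
  move=> e0; have [K K0 hK] := lp_split e0; exists K => // del del0.
  have [n1 h1] := uu _ del0; have [n2 h2] := close _ del0.
  have := h1 _ (leq_maxl n1 n2); have := h2 _ (leq_maxr n1 n2); set n := maxn _ _ => h3 h4.
  have : a_ n <= (1 + e) * fine (N u) + K * del.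
    rewrite -lee_fin -ua; apply: le_trans (hK _ _ (mu_ n) mmu) _.
    apply: (@le_trans _ _ ((1 + e)%:E * N u + K%:E * del%:E)%E).
      by apply: leeD2l; apply: lee_wpmul2l; first rewrite lee_fin.
    by rewrite -[X in (_ * X + _)%E]fineK// -!EFinM -EFinD.
  by move: h3; rewrite ler_norml => /andP[]; lra.
set L := fine (N u) in lb; have NL : N u = L%:E by rewrite fineK.
rewrite NL; congr EFin; apply/le_anti/andP; split; apply/ler_addgt0Pr => eta eta0.
(* The excess over [a] is e a + (1 + e + K) del; [e] makes the first term at most eta/2 and [del],
   chosen after [K], makes the second equal to eta/2. *)
- pose e := eta / (2 * (`|a| + 1)).
  have a1 : 0 < 2 * (`|a| + 1) by have := normr_ge0 a; lra.
  have e0 : 0 < e by rewrite divr_gt0.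
  have [K K0 hK] := ub e e0.
  have k1 : 0 < 2 * (1 + e + K) by lra.
  have := hK (eta / (2 * (1 + e + K))) (divr_gt0 eta0 k1); rewrite NL lee_fin.
  set del := eta / _ => h; apply: le_trans h _.
  have hd : 2 * (1 + e + K) * del = eta by rewrite mulrC divfK// gt_eqF.
  have he : e * (2 * (`|a| + 1)) = eta by rewrite divfK// gt_eqF.
  have ea : e * a <= e * `|a| by rewrite ler_wpM2l ?(ltW e0)// ler_norm.
  rewrite (_ : (1 + e) * (a + del) + K * del = a + e * a + (2 * (1 + e + K) * del) / 2); last by field.
  by rewrite hd; move: he; rewrite mulrCA mulrDr mulr1; lra.
- have L0 : 0 <= L by rewrite /L fine_ge0 ?lp_ge0.
  pose e := eta / (2 * (L + 1)).
  have a1 : 0 < 2 * (L + 1) by lra.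
  have e0 : 0 < e by rewrite divr_gt0.
  have [K K0 hK] := lb e e0.
  have k1 : 0 < 2 * (1 + K) by lra.
  have := hK (eta / (2 * (1 + K))) (divr_gt0 eta0 k1).
  set del := eta / _ => h; apply: le_trans h _.
  have hd : 2 * (1 + K) * del = eta by rewrite mulrC divfK// gt_eqF.
  have he : e * (2 * (L + 1)) = eta by rewrite divfK// gt_eqF.
  rewrite (_ : (1 + e) * L + K * del + del = L + e * L + (2 * (1 + K) * del) / 2); last by field.
  by rewrite hd; move: he; rewrite mulrCA mulrDr mulr1; lra.
Qed.

End LpLimit.

Section Closure.
Context {R : realType} {d : measure_display} {Omega : measurableType d}.
Variable P : probability Omega R.
Variable alpha : R.
Hypothesis halpha : 1 < alpha <= 2.
Variable f : R -> R.
Local Notation leb := (@lebesgue_measure R).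
Local Notation N u := (lp leb (circle : set (measurableTypeR R)) alpha f u).
Local Notation E1 V := (cnorm1 P setT V).
Hypotheses (mf : measurable_fun (circle : set (measurableTypeR R)) f) (f0 : forall x, circle x -> 0 <= f x).
Implicit Types (V W U : Omega -> R[i]) (u v : R -> R[i]).

Let a1 : 1 < alpha. Proof. by have /andP[] := halpha. Qed.
Let a0 : 0 < alpha. Proof. exact: lt_trans a1. Qed.
Let mc : measurable (circle : set (measurableTypeR R)). Proof. exact: measurable_itv. Qed.
Local Notation cm u := (cmeas (circle : set (measurableTypeR R)) u).

Let lpT u v m : cm u -> cm v -> cm m -> (N (fun x => (u x - v x)%R) <=
  (2 `^ alpha)%:E * (N (fun x => (u x - m x)%R) + N (fun x => (m x - v x)%R)))%E :=
  @lp_triangle R _ (measurableTypeR R) leb circle mc alpha f a0 mf f0 u v m.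
Let lpA u v : cm u -> cm v -> (N (fun x => (u x + v x)%R) <= (2 `^ alpha)%:E * (N u + N v))%E :=
  @lpD R _ (measurableTypeR R) leb circle mc alpha f a0 mf f0 u v.
Let lpS c u : cm u -> (N (fun x => (c * u x)%R) = (cabs c `^ alpha)%:E * N u)%E :=
  @lpZ R _ (measurableTypeR R) leb circle mc alpha f mf f0 c u.
Let cB u v : cm u -> cm v -> cm (fun x => u x - v x).
Proof. exact: cmeasB. Qed.
Let lpe u v : (forall x, circle x -> u x = v x) -> N u = N v :=
  @lp_eq R _ (measurableTypeR R) leb circle alpha f u v.

(* The graph of the extension by continuity of a correspondence E between
   random variables (in L^1) and functions (in L^alpha(f)). *)
Definition ext (E : (Omega -> R[i]) -> (R -> R[i]) -> Prop) V u :=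
  [/\ cmeas setT V, cm u & forall e : R, 0 < e -> exists U v,
     [/\ E U v, (N (fun x => (u x - v x)%R) <= e%:E)%E & (E1 (fun w => (U w - V w)%R) <= e%:E)%E]].

Variable E : (Omega -> R[i]) -> (R -> R[i]) -> Prop.
Hypothesis mE : forall U v, E U v -> cmeas setT U /\ cm v.
Hypothesis ED : forall U v U' v', E U v -> E U' v' ->
  E (fun w => U w + U' w) (fun x => v x + v' x).
Hypothesis EZ : forall U v c, E U v -> E (fun w => c * U w) (fun x => c * v x).
Hypothesis Eiso : forall U v, E U v -> SaS P alpha U /\ ((alpha_norm P alpha U `^ alpha)%:E = N v)%E.

Lemma ext_sub U v : E U v -> ext E U v.
Proof.
move=> /[dup] UE /mE[mU mv]; split=> // e e0; exists U, v; split=> //.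
  under lp_eq do rewrite subrr; by rewrite lp0// lee_fin ltW.
rewrite /cnorm1; under eq_integral do rewrite subrr cabs0.
by rewrite integral0 lee_fin ltW.
Qed.

Lemma ext_seq V u : ext E V u -> exists (U_ : nat -> Omega -> R[i]) (v_ : nat -> R -> R[i]), [/\ forall n, E (U_ n) (v_ n),
  lp_cvg leb (circle : set (measurableTypeR R)) alpha f v_ u & l1_cvg P U_ V].
Proof.
move=> [mV mu h].
have /choice[F hF] n : exists Uv : (Omega -> R[i]) * (R -> R[i]), [/\ E Uv.1 Uv.2,
    (N (fun x => (u x - Uv.2 x)%R) <= (n.+1%:R^-1)%:E)%E & (E1 (fun w => (Uv.1 w - V w)%R) <= (n.+1%:R^-1)%:E)%E].
  have [|U [v h']] := h n.+1%:R^-1; first by rewrite invr_gt0.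
  by exists (U, v).
exists (fun n => (F n).1), (fun n => (F n).2); split=> [n|e /inv_nat_small[n0 hn0]|e /inv_nat_small[n0 hn0]].
- by have [] := hF n.
- exists n0 => n /hn0 hn; have [_ h1 _] := hF n; rewrite lpBC; apply: le_trans h1 _.
  by rewrite lee_fin.
- exists n0 => n /hn0 hn; have [_ _ h1] := hF n; apply: le_trans h1 _.
  by rewrite lee_fin.
Qed.

Lemma ext_isometry V u : ext E V u -> SaS P alpha V /\ ((alpha_norm P alpha V `^ alpha)%:E = N u)%E.
Proof.
move=> /[dup] hV /ext_seq[U_ [v_ [hE cv cU]]]; have [mV mu _] := hV.
have sU n : SaS P alpha (U_ n) by have [] := Eiso (hE n).
have [sV cn] := SaS_l1_cvg halpha sU mV cU; split=> //; symmetry.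
apply: (lp_limit mc a1 mf f0 _ mu _ cn cv); first by move=> n; have [] := mE (hE n).
by move=> n; have [] := Eiso (hE n).
Qed.

Let E1D V W : cmeas setT V -> cmeas setT W -> (E1 (fun w => (V w + W w)%R) <= E1 V + E1 W)%E.
Proof. by move=> mV mW; exact: cnorm1D. Qed.

Lemma ext_closed V u : cmeas setT V -> cm u ->
  (forall e : R, 0 < e -> exists U v, [/\ ext E U v, (N (fun x => (u x - v x)%R) <= e%:E)%E &
     (E1 (fun w => (U w - V w)%R) <= e%:E)%E]) -> ext E V u.
Proof.
move=> mV mu h; split=> // e e0.
pose k : R := 2 `^ alpha * 2; have k0 : 0 < k by rewrite mulr_gt0// powR_gt0.
(* Two approximations are chained: this costs the factor 2^alpha * 2 for functions, by the weak
   triangle inequality, and the factor 2 for variables in L^1(P). *)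
pose e' := Num.min (e / k) (e / 2).
have e'0 : 0 < e' by rewrite lt_min !divr_gt0.
have e'1 : 2 `^ alpha * (e' + e') <= e.
  have : e' <= e / k by rewrite ge_min lexx.
  rewrite ler_pdivlMr// => h'; apply: le_trans h'; rewrite le_eqVlt; apply/orP; left; apply/eqP.
  by rewrite /k; ring.
have e'2 : e' + e' <= e.
  have : e' <= e / 2 by rewrite ge_min lexx orbT.
  lra.
have [U [v [[mU mv hU] h1 h2]]] := h _ e'0; have [U' [v' [UE' h3 h4]]] := hU _ e'0.
have [mU' mv'] := mE UE'.
exists U', v'; split=> //.
  apply: le_trans (lpT mu mv' mv) _.
  apply: le_trans (_ : ((2 `^ alpha)%:E * (e'%:E + e'%:E) <= _)%E); last by rewrite -EFinD -EFinM lee_fin.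
  by apply: lee_wpmul2l; [rewrite lee_fin powR_ge0|exact: (leeD h1 h3)].
apply: le_trans (_ : (e'%:E + e'%:E <= _)%E); last by rewrite -EFinD lee_fin.
apply: le_trans (leeD h4 h2).
apply: le_trans (E1D (cmeasB mU' mU) (cmeasB mU mV)).
by rewrite /cnorm1; under [X in (_ <= X)%E]eq_integral do rewrite addrA subrK.
Qed.

Lemma extD V u W v : ext E V u -> ext E W v -> ext E (fun w => V w + W w) (fun x => u x + v x).
Proof.
move=> [mV mu hV] [mW mv hW]; split; [exact: cmeasD|exact: cmeasD|] => e e0.
pose k : R := 2 `^ alpha * 2; have k0 : 0 < k by rewrite mulr_gt0// powR_gt0.
pose e' := Num.min (e / k) (e / 2).
have e'0 : 0 < e' by rewrite lt_min !divr_gt0.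
have e'1 : 2 `^ alpha * (e' + e') <= e.
  have : e' <= e / k by rewrite ge_min lexx.
  rewrite ler_pdivlMr// => h'; apply: le_trans h'; rewrite le_eqVlt; apply/orP; left; apply/eqP.
  by rewrite /k; ring.
have e'2 : e' + e' <= e.
  have : e' <= e / 2 by rewrite ge_min lexx orbT.
  lra.
have [U [u' [UE h1 h2]]] := hV _ e'0; have [U' [v' [UE' h3 h4]]] := hW _ e'0.
have [mU mu'] := mE UE; have [mU' mv'] := mE UE'.
exists (fun w => U w + U' w), (fun x => u' x + v' x); split; first exact: ED.
  rewrite (@lpe _ (fun x => (u x - u' x) + (v x - v' x))); last by move=> x _; ring.
  apply: le_trans (lpA (cB mu mu') (cB mv mv')) _.
  apply: le_trans (_ : ((2 `^ alpha)%:E * (e'%:E + e'%:E) <= _)%E); last by rewrite -EFinD -EFinM lee_fin.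
  by apply: lee_wpmul2l; [rewrite lee_fin powR_ge0|exact: (leeD h1 h3)].
apply: le_trans (_ : (e'%:E + e'%:E <= _)%E); last by rewrite -EFinD lee_fin.
apply: le_trans (leeD h2 h4).
apply: le_trans (E1D (cmeasB mU mV) (cmeasB mU' mW)).
rewrite /cnorm1 le_eqVlt; apply/orP; left; apply/eqP; apply: eq_integral => w _.
by congr (cabs _)%:E; ring.
Qed.

Lemma extZ V u c : ext E V u -> ext E (fun w => c * V w) (fun x => c * u x).
Proof.
move=> [mV mu hV]; split; [by apply: cmeasM => //; exact: cmeas_cst|by apply: cmeasM => //; exact: cmeas_cst|].
move=> e e0.
pose k : R := 1 + cabs c + cabs c `^ alpha.
have k0 : 0 < k by have := cabs_ge0 c; have := powR_ge0 (cabs c) alpha; rewrite /k; lra.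
have ek0 : 0 < e / k by rewrite divr_gt0.
have ekk : k * (e / k) = e by rewrite mulrC divfK// gt_eqF.
have [U [v [UE h1 h2]]] := hV _ ek0; have [mU mv] := mE UE.
exists (fun w => c * U w), (fun x => c * v x); split; first exact: EZ.
  rewrite (@lpe _ (fun x => c * (u x - v x))); last by move=> x _; ring.
  rewrite lpS//; last exact: cB.
  apply: le_trans (_ : ((cabs c `^ alpha)%:E * (e / k)%:E <= _)%E).
    by rewrite lee_wpmul2l ?lee_fin ?powR_ge0.
  rewrite -EFinM lee_fin -[leRHS]ekk ler_wpM2r ?(ltW ek0)//.
  by have := cabs_ge0 c; rewrite /k; lra.
have -> : E1 (fun w => c * U w - c * V w) = ((cabs c)%:E * E1 (fun w => (U w - V w)%R))%E.
  rewrite /cnorm1 -ge0_integralZl//; do ?[by move=> w _; rewrite lee_fin cabs_ge0|by rewrite lee_fin cabs_ge0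
    |by apply: measurable_cabsE => //; exact: cmeasB].
  by apply: eq_integral => w _; rewrite -mulrBr cabsM EFinM.
apply: le_trans (_ : ((cabs c)%:E * (e / k)%:E <= _)%E).
  by rewrite lee_wpmul2l ?lee_fin ?cabs_ge0.
rewrite -EFinM lee_fin -[leRHS]ekk ler_wpM2r ?(ltW ek0)//.
by have := powR_ge0 (cabs c) alpha; rewrite /k; lra.
Qed.

End Closure.

(** * Stochastic integrals and trigonometric sums *)

Section Process.
Context {R : realType} {d : measure_display} {Omega : measurableType d}.
Variable P : probability Omega R.
Variable alpha : R.
Hypothesis halpha : 1 < alpha <= 2.
Local Notation leb := (@lebesgue_measure R).
Local Notation cir := (circle : set (measurableTypeR R)).
Local Notation E1 V := (cnorm1 P setT V).
Implicit Types (V W U : Omega -> R[i]) (u v : R -> R[i]) (p : seq (R[i] * int)).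
Local Notation cm u := (cmeas cir u).

Let a1 : 1 < alpha. Proof. by have /andP[] := halpha. Qed.
Let a0 : 0 < alpha. Proof. exact: lt_trans a1. Qed.
Let mc : measurable cir. Proof. exact: measurable_itv. Qed.

Definition trig_sum (xi : int -> Omega -> R[i]) p w := \sum_(r <- p) r.1 * xi r.2 w.
Definition trig_poly p (x : R) : R[i] := \sum_(r <- p) r.1 * expi (r.2%:~R * x).

(** This correspondence and the next are the two to which [ext] is applied. Trigonometric sums are
    functions of the sequence, so independence of the sequences reaches them; step integrals are
    functions of the process, for which the isometry is known. *)
Definition trig_graph xi U v := exists p, U = trig_sum xi p /\ v = trig_poly p.
Definition step_graph Z U v := exists s : @step R, [/\ step_ok s, U = step_integral Z s & v = step_fun s].

Section OneProcess.
Variables (xi : int -> Omega -> R[i]) (Z : R -> Omega -> R[i]).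
Variables (mu : {finite_measure set R -> \bar R}) (f : R -> R).
Hypotheses (hxi : harmonizable P alpha xi Z mu) (hf : spectral_density mu f)
  (hf0 : forall x, circle x -> 0 < f x).
Local Notation N u := (lp leb cir alpha f u).
Local Notation SI := (ext P alpha f (step_graph Z)).
Local Notation TI := (ext P alpha f (trig_graph xi)).

Let f0 x : circle x -> 0 <= f x. Proof. by move=> /hf0/ltW. Qed.
Let mf : measurable_fun cir f. Proof. by case: hf. Qed.

Lemma integral_spectral_density u : cm u ->
  (\int[mu]_(x in circle) (cabs (u x) `^ alpha)%:E = N u)%E.
Proof.
move=> mu_.
have mc' : measurable (circle : set R) by exact: measurable_itv.
pose F : R -> R := (fun x => cabs (u x) `^ alpha) \_ circle.
have mF : measurable_fun setT F.
  apply/(measurable_restrictT _ mc'); apply: (measurableT_comp (measurable_powR _)).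
  exact: measurable_cabs.
have F0 x : 0 <= F x by rewrite /F patchE; case: ifP => // _; exact: powR_ge0.
have [_ hB] := hf.
have nuE B : measurable B -> mrestr mu mc' B = (\int[leb]_(x in cir `&` id @^-1` B) (f x)%:E)%E.
  by move=> mB; rewrite /mrestr setIC; apply: hB; [exact: measurableI|exact: subIsetl].
have := @integral_density R _ _ (measurableTypeR R) _ leb (mrestr mu mc') cir id f mc (@measurable_id _ _ _) mf f0 nuE F mF F0.
rewrite integral_mrestr; last 2 first.
- exact/measurable_EFinP.
- by move=> x; rewrite lee_fin.
move=> h; transitivity (\int[mu]_(x in circle) (F x)%:E)%E.
  by apply: eq_integral => x xc; rewrite /F patchE xc.
by rewrite h; apply: eq_integral => x xc; rewrite /F patchE xc.
Qed.

Lemma density_integrable : leb.-integrable cir (EFin \o f).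
Proof.
apply/integrableP; split; first exact/measurable_EFinP.
have mc' : measurable (circle : set R) by exact: measurable_itv.
have [_ /(_ circle mc' (@subset_refl _ _)) h] := hf.
have : (mu circle < +oo)%E by rewrite ltey_eq fin_num_measure.
rewrite h; congr (_ < _)%E; apply: eq_integral => x /set_mem xc.
by rewrite /= ger0_norm ?f0.
Qed.

Lemma step_graph_meas U v : step_graph Z U v -> cmeas setT U /\ cm v.
Proof.
have [hZ hi hs _] := hxi; move=> [s [sok -> ->]].
have [[mU _] _] := step_isometry halpha hZ hi hs sok; split; first exact: (mU tt).
apply: cmeas_sum => p.
have -> : (fun x : measurableTypeR R => if p.2.1 < x <= p.2.2 then p.1 else 0) =
    (fun x => p.1 * (\1_(`]p.2.1, p.2.2]%classic : set R) x)%:C).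
  by apply/funext => x; rewrite indicE mem_setE in_itv/=; case: ifP; rewrite ?mulr1 ?mulr0.
apply: cmeasM; first exact: cmeas_cst.
by apply: cmeasR; apply: measurable_indic; exact: measurable_itv.
Qed.

Lemma step_graphD U v U' v' : step_graph Z U v -> step_graph Z U' v' ->
  step_graph Z (fun w => U w + U' w) (fun x => v x + v' x).
Proof.
move=> [s [sok -> ->]] [s' [sok' -> ->]]; exists (s ++ s'); split.
- by move=> q; rewrite mem_cat => /orP[/sok|/sok'].
- by apply/funext => w; rewrite /step_integral big_cat.
- by apply/funext => w; rewrite /step_fun big_cat.
Qed.

Lemma step_graphZ U v c : step_graph Z U v -> step_graph Z (fun w => c * U w) (fun x => c * v x).
Proof.
move=> [s [sok -> ->]]; exists [seq (c * q.1, q.2) | q <- s]; split.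
- by move=> q' /mapP[q qs ->] /=; exact: (sok q qs).
- by apply/funext => w; rewrite /step_integral big_map mulr_sumr; apply: eq_bigr => q _; rewrite mulrA.
- apply/funext => w; rewrite /step_fun big_map mulr_sumr; apply: eq_bigr => q _ /=.
  by case: ifP => _; rewrite ?mulr0.
Qed.

Lemma step_graph_isometry U v : step_graph Z U v ->
  SaS P alpha U /\ ((alpha_norm P alpha U `^ alpha)%:E = N v)%E.
Proof.
move=> /[dup] /step_graph_meas[_ mv]; have [hZ hi hs _] := hxi.
move=> [s [sok -> e]]; have [h1 h2] := step_isometry halpha hZ hi hs sok; split; first exact: h1.
by apply: etrans h2 _; rewrite e; apply: integral_spectral_density; rewrite -e.
Qed.

Let SID V u W v : SI V u -> SI W v -> SI (fun w => V w + W w) (fun x => u x + v x).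
Proof. exact: (extD halpha mf f0 step_graph_meas step_graphD). Qed.
Let SIZ V u c : SI V u -> SI (fun w => c * V w) (fun x => c * u x).
Proof. exact: (extZ mf f0 step_graph_meas step_graphZ). Qed.

Lemma stoch_integral_ext u X : is_stoch_integral P alpha Z mu u X -> SI X u.
Proof.
move=> [mu_ [s [sok h1 [sX h2]]]].
have sm n := step_graph_meas (ex_intro _ (s n) (And3 (sok n) erefl erefl)).
have mX : cmeas setT X.
  have [m1 _] := sm 0%N; have [m2 _] := sX 0%N.
  have := cmeasB m1 (m2 tt Logic.I); by under eq_fun do rewrite subKr.
split=> // e e0.
have k0 : 0 < 2 * stable_mom 1 alpha + 1.
  have : 0 < stable_mom 1 alpha by apply: stable_mom_gt0; rewrite ?ltr01 ?a1//; have /andP[] := halpha.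
  lra.
have [n1 _ hn1] : \forall n \near \oo, (N (fun x => (u x - step_fun (s n) x)%R) < e%:E)%E.
  have : \forall n \near \oo, (\int[mu]_(x in circle) (cabs (u x - step_fun (s n) x) `^ alpha)%:E < e%:E)%E.
    move/fine_cvgP: h1 => [hfin hc]; have hlt := cvgr_lt _ hc _ e0.
    have [n1 _ hn1] := hfin; have [n2 _ hn2] := hlt _.
    exists (maxn n1 n2) => // n /=; rewrite geq_max => /andP[/hn1/= fn /hn2/= ln].
    by rewrite -(fineK fn) lte_fin.
  apply: filterS => n; rewrite integral_spectral_density//.
  by apply: cmeasB => //; have [] := sm n.
have [n2 _ hn2] : \forall n \near \oo, alpha_norm P alpha (fun w => step_integral Z (s n) w - X w) <
    e / (2 * stable_mom 1 alpha + 1).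
  by apply: (cvgr_lt _ h2); rewrite divr_gt0.
pose n := maxn n1 n2.
exists (step_integral Z (s n)), (step_fun (s n)); split; first by exists (s n).
  by apply/ltW/hn1; exact: leq_maxl.
apply: le_trans (cnorm1_le_alpha_norm halpha (sX n)) _; rewrite lee_fin.
have := hn2 n (leq_maxr _ _); rewrite ltr_pdivlMr// => /ltW; apply: le_trans.
rewrite mulrC ler_wpM2l ?alpha_norm_ge0//; lra.
Qed.

(** The definition of the integral demands that the differences with the approximations be SaS. They
    are, because they belong to the extended correspondence too, which is linear and consists of SaS
    variables. *)
Lemma ext_stoch_integral u X : SI X u -> is_stoch_integral P alpha Z mu u X.
Proof.
move=> /[dup] [[mX mu_ _]] hX.
have [U_ [v_ [hE cv cU]]] := ext_seq hX.
have /choice[s hs] n : exists s : @step R, [/\ step_ok s, U_ n = step_integral Z s & v_ n = step_fun s].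
  exact: hE.
have sD n : SaS P alpha (fun w => U_ n w - X w).
  have : SI (fun w => U_ n w + (-1) * X w) (fun x => v_ n x + (-1) * u x).
    by apply: SID; [exact: (ext_sub P halpha f step_graph_meas (hE n))|exact: SIZ].
  move=> /(ext_isometry halpha mf f0 step_graph_meas step_graph_isometry)[h _].
  by move: h; congr (SaS P alpha); apply/funext => w; rewrite mulN1r.
split=> //; exists s; split.
- by move=> n; have [] := hs n.
- have mv n : cm (v_ n) by have [] := step_graph_meas (hE n).
  apply/fine_cvgP.
  have e n : (\int[mu]_(x in circle) (cabs (u x - step_fun (s n) x) `^ alpha)%:E)%E =
      N (fun x => (v_ n x - u x)%R).
    have mD : cm (fun x => u x - v_ n x) by exact: cmeasB.
    have [_ _ ev] := hs n; rewrite lpBC -ev; exact: (integral_spectral_density mD).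
  have N0 n : (0 <= N (fun x => (v_ n x - u x)%R))%E by exact: lp_ge0.
  split.
    have [n0 h0] := cv 1 ltr01; exists n0 => // n /= /h0 h; rewrite e ge0_fin_numE//.
    exact: le_lt_trans h (ltry _).
  apply/cvgrPdist_le => e1 e10; have [n0 h0] := cv e1 e10; exists n0 => // n /= /h0 h.
  rewrite sub0r normrN e ger0_norm ?fine_ge0// -lee_fin fineK// ge0_fin_numE//.
  exact: le_lt_trans h (ltry _).
- have es n : (fun w => step_integral Z (s n) w - X w) = (fun w => U_ n w - X w).
    by have [_ -> _] := hs n.
  split=> [n|]; first exact: (eq_ind_r (SaS P alpha) (sD n) (es n)).
  have [B B0 hB] := alpha_norm_le_cnorm1 P halpha.
  apply: (cvg_of_le (ltW B0)) => e /cU[n0 h0]; exists n0 => n /h0 h.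
  rewrite subr0 (congr1 (fun F => `|alpha_norm P alpha F|) (es n)) ger0_norm ?alpha_norm_ge0//.
  apply: (hB _ _ (sD n) _ h).
  by rewrite -lee_fin; apply: le_trans h; exact: cnorm1_ge0.
Qed.

Lemma trig_graph_SI U v : trig_graph xi U v -> SI U v.
Proof.
have [_ _ _ hn] := hxi; move=> [p [-> ->]].
elim: p => [|[c n] p IH].
  apply: (ext_sub P halpha f step_graph_meas); exists [::]; split=> //.
    by apply/funext => w; rewrite /trig_sum /step_integral !big_nil.
  by apply/funext => w; rewrite /trig_poly /step_fun !big_nil.
have := SID (SIZ c (stoch_integral_ext (hn n))) IH.
by congr (ext _ _ _ _); apply/funext => w; rewrite /trig_sum /trig_poly big_cons.
Qed.

Lemma trig_graph_meas U v : trig_graph xi U v -> cmeas setT U /\ cm v.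
Proof. by move=> /trig_graph_SI[]. Qed.

Lemma trig_graphD U v U' v' : trig_graph xi U v -> trig_graph xi U' v' ->
  trig_graph xi (fun w => U w + U' w) (fun x => v x + v' x).
Proof.
move=> [p [-> ->]] [p' [-> ->]]; exists (p ++ p'); split; apply/funext => w;
  by rewrite /trig_sum /trig_poly big_cat.
Qed.

Lemma trig_graphZ U v c : trig_graph xi U v -> trig_graph xi (fun w => c * U w) (fun x => c * v x).
Proof.
move=> [p [-> ->]]; exists [seq (c * q.1, q.2) | q <- p]; split; apply/funext => w;
  by rewrite /trig_sum /trig_poly big_map mulr_sumr; apply: eq_bigr => q _; rewrite mulrA.
Qed.

Lemma trig_graph_isometry U v : trig_graph xi U v ->
  SaS P alpha U /\ ((alpha_norm P alpha U `^ alpha)%:E = N v)%E.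
Proof. by move=> /trig_graph_SI; exact: (ext_isometry halpha mf f0 step_graph_meas step_graph_isometry). Qed.

Lemma trig_ext_isometry V u : TI V u -> SaS P alpha V /\ ((alpha_norm P alpha V `^ alpha)%:E = N u)%E.
Proof. exact: (ext_isometry halpha mf f0 trig_graph_meas trig_graph_isometry). Qed.

Lemma trig_extD V u W v : TI V u -> TI W v -> TI (fun w => V w + W w) (fun x => u x + v x).
Proof. exact: (extD halpha mf f0 trig_graph_meas trig_graphD). Qed.

Lemma trig_extZ V u c : TI V u -> TI (fun w => c * V w) (fun x => c * u x).
Proof. exact: (extZ mf f0 trig_graph_meas trig_graphZ). Qed.

Lemma trig_ext_sub V u : trig_graph xi V u -> TI V u.
Proof. exact: (ext_sub P halpha f trig_graph_meas). Qed.

Lemma trig_extB V u W v : TI V u -> TI W v -> TI (fun w => V w - W w) (fun x => u x - v x).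
Proof.
move=> hV /(trig_extZ (-1)) hW; have := trig_extD hV hW.
by congr (ext _ _ _ _); apply/funext => w; rewrite mulN1r.
Qed.

Lemma trig_ext_stoch V u : TI V u -> is_stoch_integral P alpha Z mu u V.
Proof.
move=> [mV mu_ h]; apply: ext_stoch_integral.
apply: (ext_closed halpha mf f0 step_graph_meas mV mu_) => e /h[U [v [hE h1 h2]]].
by exists U, v; split=> //; exact: trig_graph_SI.
Qed.

End OneProcess.
End Process.

(** A pointwise form of Hölder's inequality with the dual weight w^(-1/(a-1)) and a free parameter
    l. Either l r is at most this dual weight, and the second term suffices, or (l r)^(a-1) w >= 1,
    and the first does. *)
Lemma le_powR_weight {R : realType} (a r w l : R) : 1 < a -> 0 <= r -> 0 < w -> 0 < l ->
  r <= l `^ (a - 1) * (r `^ a * w) + l^-1 * w `^ (- (a - 1)^-1).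
Proof.
move=> a1 r0 w0 l0; have b0 : 0 < a - 1 by rewrite subr_gt0.
have W0 : 0 < w `^ (- (a - 1)^-1) by exact: powR_gt0.
have [h|h] := leP (l * r) (w `^ (- (a - 1)^-1)).
  have : r <= l^-1 * w `^ (- (a - 1)^-1) by rewrite mulrC ler_pdivlMr// mulrC.
  by move=> /le_trans; apply; rewrite lerDr !mulr_ge0 ?powR_ge0 ?(ltW w0).
have r1 : 0 < r by rewrite -(pmulr_rgt0 _ l0) (lt_trans W0).
have : 1 <= (l * r) `^ (a - 1) * w.
  have : (w `^ (- (a - 1)^-1)) `^ (a - 1) <= (l * r) `^ (a - 1).
    by apply: ge0_ler_powR; rewrite ?nnegrE ?(ltW b0) ?(ltW W0) ?(ltW h)// mulr_ge0// ltW.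
  rewrite -powRrM mulNr mulVf ?gt_eqF// powR_inv1 ?(ltW w0)//.
  move=> h'; apply: le_trans (_ : w^-1 * w <= _); first by rewrite mulVf ?gt_eqF.
  by rewrite ler_wpM2r ?(ltW w0).
rewrite powRM ?(ltW l0)// => h1.
apply: le_trans (_ : r * (l `^ (a - 1) * r `^ (a - 1) * w) <= _); first by rewrite ler_peMr.
have -> : r `^ a = r * r `^ (a - 1).
  have e : r `^ a = r `^ 1 * r `^ (a - 1).
    by rewrite -powRD ?(gt_eqF r1) ?implybT//; congr (_ `^ _); ring.
  by rewrite e powRr1.
rewrite (_ : r * _ = l `^ (a - 1) * (r * r `^ (a - 1) * w)); last by ring.
by rewrite lerDl mulr_ge0 ?invr_ge0 ?(ltW l0) ?powR_ge0.
Qed.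

Lemma lp_close {R : realType} {d : measure_display} {T : measurableType d}
    (mu : {measure set T -> \bar R}) (D : set T) (p : R) (w : T -> R) (u v m : T -> R[i]) (e : R) :
  measurable D -> 0 < p -> measurable_fun D w -> (forall x, D x -> 0 <= w x) ->
  cmeas D u -> cmeas D v -> cmeas D m ->
  (lp mu D p w (fun x => (u x - m x)%R) <= e%:E)%E ->
  (lp mu D p w (fun x => (v x - m x)%R) <= e%:E)%E ->
  (lp mu D p w (fun x => (u x - v x)%R) <= (2 `^ p * 2 * e)%:E)%E.
Proof.
move=> mD p0 mw w0 mu_ mv mm h1 h2.
apply: le_trans (@lp_triangle R _ T mu D mD p w p0 mw w0 u v m mu_ mv mm) _.
have h3 : (lp mu D p w (fun x => (m x - v x)%R) <= e%:E)%E by rewrite lpBC.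
rewrite -mulrA EFinM; apply: lee_wpmul2l; first by rewrite lee_fin powR_ge0.
rewrite (_ : 2 * e = e + e); last by ring.
by apply: (@le_trans _ _ (e%:E + e%:E)%E); [exact: (leeD h1 h3)|rewrite -EFinD lexx].
Qed.

(** * The minimality condition *)

Section Domination.
Context {R : realType} {d : measure_display} {T : measurableType d}.
Variables (mu : {measure set T -> \bar R}) (D : set T).
Hypothesis mD : measurable D.
Variables (a : R) (w : T -> R).
Hypotheses (a1 : 1 < a) (mw : measurable_fun D w) (w0 : forall x, D x -> 0 < w x).
Hypothesis hw : (\int[mu]_(x in D) ((w x) `^ (- (a - 1)^-1))%:E < +oo)%E.

(** The minimality condition enters here: the weighted norm controls the L^1 norm, so that weighted
    Cauchy sequences converge and Fourier coefficients depend continuously on the function. *)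
Lemma lp_dominates_cnorm1 (e : R) : 0 < e -> exists2 k : R, 0 < k &
  forall v, cmeas D v -> (lp mu D a w v <= k%:E)%E -> (cnorm1 mu D v <= e%:E)%E.
Proof.
move=> e0; pose W := (\int[mu]_(x in D) ((w x) `^ (- (a - 1)^-1))%:E)%E; have hW : (W < +oo)%E := hw.
have W0 : (0 <= W)%E by apply: integral_ge0 => x Dx; rewrite lee_fin powR_ge0.
have Wfin : W \is a fin_num by rewrite ge0_fin_numE.
pose I := fine W; have I0 : 0 <= I by rewrite fine_ge0.
(* This value makes the dual-weight term equal to (e/2) I/(I+1), which is at most e/2; the other
   half of e then dictates [k]. *)
pose l := 2 * (I + 1) / e.
have l0 : 0 < l by rewrite divr_gt0// mulr_gt0//; lra.
have la : 0 < l `^ (a - 1) by exact: powR_gt0.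
exists (e / (2 * l `^ (a - 1))); first by rewrite divr_gt0// mulr_gt0.
move=> v mv hv.
have mwp : measurable_fun D (fun x => (w x `^ (- (a - 1)^-1))%:E).
  by apply/measurable_EFinP; exact: (measurableT_comp (measurable_powR _)).
have mlp := measurable_lp a mw mv.
apply: (@le_trans _ _ ((l `^ (a - 1))%:E * lp mu D a w v + (l^-1)%:E * W)%E).
  rewrite /lp /W -!ge0_integralZl//; do ?[by move=> x Dx; rewrite lee_fin ?mulr_ge0 ?powR_ge0 ?(ltW (w0 Dx))
    |by rewrite lee_fin ?invr_ge0 ltW].
  rewrite -ge0_integralD//; do ?[by move=> x Dx; rewrite -EFinM lee_fin ?mulr_ge0 ?invr_ge0 ?powR_ge0 ?(ltW (w0 Dx)) ?(ltW l0)
    |by apply: emeasurable_funM].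
  apply: ge0_le_integral => //; do ?[by move=> x Dx; rewrite lee_fin cabs_ge0|exact: measurable_cabsE
    |by apply: emeasurable_funD; apply: emeasurable_funM].
  by move=> x Dx; rewrite -!EFinM -EFinD lee_fin; apply: le_powR_weight => //; [exact: cabs_ge0|exact: w0].
apply: (@le_trans _ _ ((l `^ (a - 1))%:E * (e / (2 * l `^ (a - 1)))%:E + (l^-1)%:E * W)%E).
  by apply: leeD2r; apply: lee_wpmul2l; first rewrite lee_fin ltW.
rewrite -(fineK Wfin) -!EFinM -EFinD lee_fin -/I.
have -> : l `^ (a - 1) * (e / (2 * l `^ (a - 1))) = e / 2 by field; rewrite gt_eqF.
have -> : l^-1 * I = (e / 2) * (I / (I + 1)).
  by rewrite /l; field; rewrite !gt_eqF//; lra.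
rewrite [leRHS](splitr e) lerD2l ler_piMr ?divr_ge0 ?(ltW e0)//.
by rewrite ler_pdivrMr ?mul1r; lra.
Qed.

End Domination.

Lemma limit_add {R : realType} (a b c : nat -> R) (la lb lc : R) :
  (forall n, c n = a n + b n) -> a @ \oo --> la -> b @ \oo --> lb -> c @ \oo --> lc -> lc = la + lb.
Proof.
move=> e ha hb hc; have -> : lc = lim (c @ \oo) by apply/esym/cvg_lim.
apply/cvg_lim => //; rewrite (_ : c = (fun n => a n + b n)); last exact/funext.
exact: cvgD.
Qed.

Section PastIndex.
Context {R : realType}.

Definition past_index (b : seq R[i]) : seq (R[i] * int) :=
  [seq (b`_j, (- (j.+1)%:Z)%R) | j <- iota 0 (size b)].

Lemma past_polynomialE b : past_polynomial b = trig_poly (past_index b).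
Proof.
have e : iota 0 (size b) = index_iota 0 (size b) by rewrite /index_iota subn0.
apply/funext => x; rewrite /trig_poly big_map e big_mkord; apply: eq_bigr => j _ /=; congr (_ * expi (_ * _)).
Qed.

Lemma past_combinationE {d : measure_display} {Omega : measurableType d} (xi : int -> Omega -> R[i]) b :
  past_combination xi b = trig_sum xi (past_index b).
Proof.
have e : iota 0 (size b) = index_iota 0 (size b) by rewrite /index_iota subn0.
by apply/funext => x; rewrite /trig_sum big_map e big_mkord.
Qed.

End PastIndex.

(** * The signal and the noise together *)

Section Joint.
Context {R : realType} {d : measure_display} {Omega : measurableType d}.
Variable P : probability Omega R.
Variable alpha : R.
Hypothesis halpha : 1 < alpha <= 2.
Local Notation leb := (@lebesgue_measure R).
Local Notation cir := (circle : set (measurableTypeR R)).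
Local Notation E1 V := (cnorm1 P setT V).
Implicit Types (V W U Y : Omega -> R[i]) (u v h : R -> R[i]).
Local Notation cm u := (cmeas cir u).
Variables (xi eta : int -> Omega -> R[i]) (Zxi Zeta : R -> Omega -> R[i])
    (muxi mueta : {finite_measure set R -> \bar R}) (f g : R -> R).
Hypotheses (hxi : harmonizable P alpha xi Zxi muxi)
    (heta : harmonizable P alpha eta Zeta mueta)
    (hind : independent_families P xi eta)
    (hf : spectral_density muxi f) (hg : spectral_density mueta g)
    (hf0 : forall x, circle x -> 0 < f x)
    (hg0 : forall x, circle x -> 0 < g x)
    (hmin : (\int[leb]_(x in circle) ((f x + g x) `^ (- (alpha - 1)^-1))%:E < +oo)%E).
Local Notation TX := (ext P alpha f (trig_graph xi)).
Local Notation TE := (ext P alpha g (trig_graph eta)).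
Local Notation zeta := (fun k w => xi k w + eta k w).
Local Notation fg := (fun x => f x + g x).
Local Notation N w u := (lp leb cir alpha w u).

Let a1 : 1 < alpha. Proof. by have /andP[] := halpha. Qed.
Let a0 : 0 < alpha. Proof. exact: lt_trans a1. Qed.
Let mc : measurable cir. Proof. exact: measurable_itv. Qed.
Let f0 x : circle x -> 0 <= f x. Proof. by move=> /hf0/ltW. Qed.
Let g0 x : circle x -> 0 <= g x. Proof. by move=> /hg0/ltW. Qed.
Let mf : measurable_fun cir f. Proof. by case: hf. Qed.
Let mg : measurable_fun cir g. Proof. by case: hg. Qed.
Let mfg : measurable_fun cir fg. Proof. exact: measurable_funD. Qed.
Let fg0 x : circle x -> 0 < f x + g x. Proof. by move=> cx; rewrite addr_gt0 ?hf0 ?hg0. Qed.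
Let fg0' x : circle x -> 0 <= f x + g x. Proof. by move=> /fg0/ltW. Qed.

(** Omega is given the sigma-algebra generated by the sequence, for which each term, hence each
    finite sum, is measurable. *)
Lemma trig_sum_sigma (chi : int -> Omega -> R[i]) p B : measurable B ->
  sigma_of chi (cpair (trig_sum chi p) @^-1` B).
Proof.
move=> mB; rewrite /sigma_of; set G := [set A | _].
pose S := g_sigma_algebraType G.
have mchi k : cmeas (setT : set S) (chi k).
  by move=> _ A mA; rewrite setTI; apply: sub_sigma_algebra; exists k, A.
have : cmeas (setT : set S) (trig_sum chi p).
  by apply: cmeas_sum => r; apply: cmeasM; [exact: cmeas_cst|exact: mchi].
by move=> /(_ measurableT B mB); rewrite setTI.
Qed.

Lemma trig_graph_indep U u V v : trig_graph xi U u -> trig_graph eta V v ->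
  SaS P alpha (fun w => U w + V w) /\
  alpha_norm P alpha (fun w => U w + V w) `^ alpha =
    alpha_norm P alpha U `^ alpha + alpha_norm P alpha V `^ alpha.
Proof.
move=> hU hV; have [sU _] := trig_graph_isometry halpha hxi hf hf0 hU.
have [sV _] := trig_graph_isometry halpha heta hg hg0 hV.
apply: SaS_normD_indep => // A B mA mB; have [p [-> _]] := hU; have [q [-> _]] := hV.
by apply: hind; exact: trig_sum_sigma.
Qed.

(** Independence itself is not carried to the limit: it gives additivity of the norms for
    trigonometric sums, and this numerical identity passes to the limit together with stability. *)
Lemma joint_isometry U u V v : TX U u -> TE V v ->
  SaS P alpha (fun w => U w + V w) /\
  ((alpha_norm P alpha (fun w => U w + V w) `^ alpha)%:E = N f u + N g v)%E.
Proof.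
move=> hU hV.
have [sU nU] := trig_ext_isometry halpha hxi hf hf0 hU.
have [sV nV] := trig_ext_isometry halpha heta hg hg0 hV.
have [U_ [u_ [gU _ cU]]] := ext_seq hU; have [V_ [v_ [gV _ cV]]] := ext_seq hV.
have [mU _ _] := hU; have [mV _ _] := hV.
have sU_ n := (trig_graph_isometry halpha hxi hf hf0 (gU n)).1.
have sV_ n := (trig_graph_isometry halpha heta hg hg0 (gV n)).1.
have mU_ n : cmeas setT (U_ n) by have [m _] := sU_ n; exact: (m tt Logic.I).
have mV_ n : cmeas setT (V_ n) by have [m _] := sV_ n; exact: (m tt Logic.I).
pose S_ n w := U_ n w + V_ n w.
have sS n : SaS P alpha (S_ n) by have [] := trig_graph_indep (gU n) (gV n).
have nS n : alpha_norm P alpha (S_ n) `^ alpha = alpha_norm P alpha (U_ n) `^ alpha + alpha_norm P alpha (V_ n) `^ alpha.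
  by have [] := trig_graph_indep (gU n) (gV n).
have mS : cmeas setT (fun w => U w + V w) by exact: cmeasD.
have cS : l1_cvg P S_ (fun w => U w + V w).
  move=> e e0; have e2 : 0 < e / 2 by rewrite divr_gt0.
  have [n1 h1] := cU _ e2; have [n2 h2] := cV _ e2.
  exists (maxn n1 n2) => n; rewrite geq_max => /andP[/h1 h3 /h2 h4].
  rewrite (splitr e) EFinD; apply: le_trans (leeD h3 h4).
  apply: le_trans (cnorm1D P measurableT (cmeasB (mU_ n) mU) (cmeasB (mV_ n) mV)).
  rewrite /cnorm1 le_eqVlt; apply/orP; left; apply/eqP; apply: eq_integral => w _.
  by congr (cabs _)%:E; rewrite /S_; ring.
have [sUV c] := SaS_l1_cvg halpha sS mS cS; split; first exact: sUV.
have [_ c1] := SaS_l1_cvg halpha sU_ mU cU; have [_ c2] := SaS_l1_cvg halpha sV_ mV cV.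
rewrite -nU -nV -EFinD; congr EFin; exact: (limit_add nS c1 c2 c).
Qed.

Lemma lp_add_weight u : cm u -> (N fg u = N f u + N g u)%E.
Proof.
move=> mu_; rewrite /lp -ge0_integralD//; do ?[exact: measurable_lp
  |by move=> x cx; rewrite lee_fin mulr_ge0 ?powR_ge0 ?f0 ?g0].
by apply: eq_integral => x _; rewrite -EFinD mulrDr.
Qed.

Lemma past_graph (chi : int -> Omega -> R[i]) b :
  trig_graph chi (past_combination chi b) (past_polynomial b).
Proof. by exists (past_index b); rewrite past_combinationE past_polynomialE. Qed.

Lemma past_combinationD b w : past_combination zeta b w =
  past_combination xi b w + past_combination eta b w.
Proof. by rewrite /past_combination -big_split/=; apply: eq_bigr => j _; rewrite mulrDr. Qed.

Let E1_complete (V_ : nat -> Omega -> R[i]) : (forall n, cmeas setT (V_ n)) ->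
  (forall e : R, 0 < e -> exists n0, forall m n, (n0 <= m)%N -> (n0 <= n)%N ->
    (E1 (fun w => (V_ m w - V_ n w)%R) <= e%:E)%E) ->
  exists2 V, cmeas setT V & l1_cvg P V_ V.
Proof.
move=> mV hC.
have lp1 V : lp P setT 1 (fun=> 1) V = E1 V.
  by apply: eq_integral => w _; rewrite mulr1 powRr1// cabs_ge0.
have [e e0|e /hC[n0 h]|V mV' h] := @lp_complete R _ _ P setT measurableT 1 (fun=> 1) ltr01 (measurable_cst _) (fun _ _ => ler01) V_ mV.
- by exists e => // v mv; rewrite lp1.
- by exists n0 => m n hm hn; rewrite lp1; exact: h.
- by exists V => // e /h[n0 h0]; exists n0 => n /h0; rewrite lp1.
Qed.

Let dom (e : R) : 0 < e -> exists2 k : R, 0 < k &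
  forall v, cm v -> (N fg v <= k%:E)%E -> (cnorm1 leb cir v <= e%:E)%E.
Proof.
exact: (@lp_dominates_cnorm1 R _ (measurableTypeR R) leb cir mc alpha fg a1 mfg fg0 hmin).
Qed.

Lemma lp_fg_complete (u_ : nat -> R -> R[i]) : (forall n, cm (u_ n)) ->
  (forall e : R, 0 < e -> exists n0, forall m n, (n0 <= m)%N -> (n0 <= n)%N ->
     (N fg (fun x => (u_ m x - u_ n x)%R) <= e%:E)%E) ->
  exists2 h, cm h & lp_cvg leb cir alpha fg u_ h.
Proof.
move=> mu_ hC.
exact: (@lp_complete R _ (measurableTypeR R) leb cir mc alpha fg a0 mfg fg0' u_ mu_ dom hC).
Qed.

Let le_fg u : cm u -> (N f u <= N fg u)%E /\ (N g u <= N fg u)%E.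
Proof.
move=> mu_; rewrite lp_add_weight//; split; [rewrite leeDl|rewrite leeDr] => //; exact: lp_ge0.
Qed.

(** The isometry makes the variables a Cauchy sequence in the covariation norm, hence in L^1(P),
    which is complete. *)
Lemma trig_limit (chi : int -> Omega -> R[i]) (Zc : R -> Omega -> R[i])
    (muc : {finite_measure set R -> \bar R}) (w : R -> R)
    (hc : harmonizable P alpha chi Zc muc) (hw : spectral_density muc w)
    (hw0 : forall x, circle x -> 0 < w x)
    (U_ : nat -> Omega -> R[i]) (u_ : nat -> R -> R[i]) h :
  (forall n, trig_graph chi (U_ n) (u_ n)) -> cm h -> lp_cvg leb cir alpha w u_ h ->
  exists2 V, l1_cvg P U_ V & ext P alpha w (trig_graph chi) V h.
Proof.
move=> gU mh ch.
have mu_ n : cm (u_ n) by have [] := trig_graph_meas halpha hc hw hw0 (gU n).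
have mU n : cmeas setT (U_ n) by have [] := trig_graph_meas halpha hc hw hw0 (gU n).
have mw : measurable_fun cir w by case: hw.
have w0 x : circle x -> 0 <= w x by move=> /hw0/ltW.
have kap : 0 < stable_mom 1 alpha by apply: stable_mom_gt0; rewrite ?ltr01 ?a1//; have /andP[] := halpha.
have [|V mV cV] := @E1_complete U_ mU.
  (* An alpha-th power of the norm below [del] forces an L^1 norm below e, by
     [cnorm1_le_alpha_norm]. *)
  move=> e e0; pose del := (e / (2 * stable_mom 1 alpha)) `^ alpha.
  have kap2 : 0 < 2 * stable_mom 1 alpha by exact: mulr_gt0.
  have ek : 0 < e / (2 * stable_mom 1 alpha) by exact: divr_gt0.
  have del0 : 0 < del by exact: powR_gt0.
  pose k : R := 2 `^ alpha * 2; have k0 : 0 < k by rewrite mulr_gt0// powR_gt0.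
  have [n0 h0] := ch (del / k) (divr_gt0 del0 k0); exists n0 => m n /h0 hm /h0 hn.
  have hmn : (N w (fun x => (u_ m x - u_ n x)%R) <= del%:E)%E.
    have kk : 2 `^ alpha * 2 * (del / k) = del by rewrite mulrC divfK// gt_eqF.
    rewrite -kk; exact: (@lp_close R _ (measurableTypeR R) leb cir alpha w _ _ _ _ mc a0 mw w0 (mu_ m) (mu_ n) mh hm hn).
  have gD : trig_graph chi (fun w => U_ m w - U_ n w) (fun x => u_ m x - u_ n x).
    have := trig_graphD (gU m) (trig_graphZ (-1) (gU n)).
    by congr (trig_graph _ _ _); apply/funext => x; rewrite mulN1r.
  have [sD nD] := trig_graph_isometry halpha hc hw hw0 gD.
  apply: le_trans (cnorm1_le_alpha_norm halpha sD) _; rewrite lee_fin.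
  rewrite mulrC -(ler_pdivlMr _ _ kap2).
  have : alpha_norm P alpha (fun w => U_ m w - U_ n w) `^ alpha <= del by rewrite -lee_fin nD.
  rewrite leNgt => /negP hle; rewrite leNgt; apply/negP => hlt; apply: hle.
  by apply: gt0_ltr_powR; rewrite ?nnegrE ?(ltW ek) ?alpha_norm_ge0.
exists V => //; split=> // e e0.
have [n1 h1] := ch e e0; have [n2 h2] := cV e e0.
exists (U_ (maxn n1 n2)), (u_ (maxn n1 n2)); split=> //.
  by rewrite lpBC; apply: h1; exact: leq_maxl.
by apply: h2; exact: leq_maxr.
Qed.

Lemma Lalpha_minus_seq h : Lalpha_minus alpha fg h -> exists2 b_ : nat -> seq R[i],
  cm h & lp_cvg leb cir alpha fg (fun n => past_polynomial (b_ n)) h.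
Proof.
move=> [[mh _] hb].
have /choice[b hb'] n : exists b : seq R[i], (N fg (fun x => (h x - past_polynomial b x)%R) < (n.+1%:R^-1)%:E)%E.
  by apply: hb; rewrite invr_gt0.
exists b => // e /inv_nat_small[n0 h0]; exists n0 => n /h0 hn.
by rewrite lpBC; apply: le_trans (ltW (hb' n)) _; rewrite lee_fin.
Qed.

Lemma trig_ext_past h : Lalpha_minus alpha fg h -> exists V W, TX V h /\ TE W h.
Proof.
move=> /Lalpha_minus_seq[b mh ch].
have mq n : cm (past_polynomial (b n)) by have [] := trig_graph_meas halpha hxi hf hf0 (past_graph xi (b n)).
have cf : lp_cvg leb cir alpha f (fun n => past_polynomial (b n)) h.
  move=> e /ch[n0 h0]; exists n0 => n /h0; apply: le_trans.
  by have [] := le_fg (cmeasB (mq n) mh).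
have cg : lp_cvg leb cir alpha g (fun n => past_polynomial (b n)) h.
  move=> e /ch[n0 h0]; exists n0 => n /h0; apply: le_trans.
  by have [] := le_fg (cmeasB (mq n) mh).
have [V _ hV] := trig_limit hxi hf hf0 (fun n => past_graph xi (b n)) mh cf.
have [W _ hW] := trig_limit heta hg hg0 (fun n => past_graph eta (b n)) mh cg.
by exists V, W.
Qed.

Lemma trig_ext_Hminus h V W : Lalpha_minus alpha fg h -> TX V h -> TE W h ->
  Hminus P alpha zeta (fun w => V w + W w).
Proof.
move=> hh hV hW e e0.
have e1 : 0 < e `^ alpha by exact: powR_gt0.
have [[mh _] /(_ _ e1)[b hb]] := hh; exists b.
have gX := trig_extB halpha hxi hf hf0 hV (trig_ext_sub halpha hxi hf hf0 (past_graph xi b)).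
have gE := trig_extB halpha heta hg hg0 hW (trig_ext_sub halpha heta hg hg0 (past_graph eta b)).
have ee : (fun w => V w + W w - past_combination zeta b w) =
    (fun w => (V w - past_combination xi b w) + (W w - past_combination eta b w)).
  by apply/funext => w; rewrite past_combinationD; ring.
have [sJ nJ] := joint_isometry gX gE; split; first exact: (eq_ind_r (SaS P alpha) sJ ee).
rewrite (congr1 (fun F => alpha_norm P alpha F < e) ee).
have mq : cm (past_polynomial b) by have [] := trig_graph_meas halpha hxi hf hf0 (past_graph xi b).
move: nJ; rewrite -lp_add_weight; last exact: cmeasB.
move=> nJ; rewrite ltNge; apply/negP => hle.
have : e `^ alpha <= alpha_norm P alpha (fun w => (V w - past_combination xi b w) + (W w - past_combination eta b w)) `^ alpha.
  by apply: ge0_ler_powR; rewrite ?nnegrE ?(ltW e0) ?(ltW a0) ?alpha_norm_ge0.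
by rewrite leNgt => /negP; apply; rewrite -lte_fin nJ.
Qed.

(** The sums of signal and noise are Cauchy in L^1(P). Their differences are SaS, so their norms are
    small, and [joint_isometry] makes the underlying polynomials Cauchy in L^alpha(f+g). The signal
    parts then converge on their own, to an integral of the same h. *)
Lemma Hminus_trig_ext Y : Hminus P alpha zeta Y -> exists h V W,
  [/\ Lalpha_minus alpha fg h, TX V h, TE W h & forall w, Y w = V w + W w].
Proof.
move=> hY.
have kap : 0 < stable_mom 1 alpha by apply: stable_mom_gt0; rewrite ?ltr01 ?a1//; have /andP[] := halpha.
have /choice[b hb] n : exists b : seq R[i], SaS P alpha (fun w => Y w - past_combination zeta b w) /\
    alpha_norm P alpha (fun w => Y w - past_combination zeta b w) < n.+1%:R^-1.
  by apply: hY; rewrite invr_gt0.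
pose X_ n := past_combination xi (b n); pose E_ n := past_combination eta (b n).
pose q n := past_polynomial (b n).
have gX n : trig_graph xi (X_ n) (q n) by exact: past_graph.
have gE n : trig_graph eta (E_ n) (q n) by exact: past_graph.
have mq n : cm (q n) by have [] := trig_graph_meas halpha hxi hf hf0 (gX n).
have mX n : cmeas setT (X_ n) by have [] := trig_graph_meas halpha hxi hf hf0 (gX n).
have mE n : cmeas setT (E_ n) by have [] := trig_graph_meas halpha heta hg hg0 (gE n).
have zE n : past_combination zeta (b n) = (fun w => X_ n w + E_ n w).
  by apply/funext => w; rewrite past_combinationD.
have mY : cmeas setT Y.
  have [[m _] _] := hb 0%N; have := cmeasD (m tt Logic.I) (cmeasD (mX 0%N) (mE 0%N)).
  by congr cmeas; apply/funext => w; rewrite -[X_ 0%N w + _](congr1 (fun F => F w) (zE 0%N)) subrK.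
have cY : l1_cvg P (fun n w => X_ n w + E_ n w) Y.
  move=> e e0; have k0 : 0 < 2 * stable_mom 1 alpha by exact: mulr_gt0.
  have [n0 h0] := inv_nat_small (divr_gt0 e0 k0); exists n0 => n /h0 hn.
  have [s1 s2] := hb n; have := cnorm1_le_alpha_norm halpha s1.
  have -> : E1 (fun w => Y w - past_combination zeta (b n) w) = E1 (fun w => X_ n w + E_ n w - Y w).
    by apply: eq_integral => w _; rewrite -cabsN opprB -[X_ n w + _](congr1 (fun F => F w) (zE n)).
  move=> /le_trans; apply; rewrite lee_fin mulrC -(ler_pdivlMr _ _ k0).
  exact: le_trans (ltW s2) hn.
have gXD m n : TX (fun w => X_ m w - X_ n w) (fun x => q m x - q n x).
  by apply: (trig_extB halpha hxi hf hf0); apply: (trig_ext_sub halpha hxi hf hf0).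
have gED m n : TE (fun w => E_ m w - E_ n w) (fun x => q m x - q n x).
  by apply: (trig_extB halpha heta hg hg0); apply: (trig_ext_sub halpha heta hg hg0).
have [B B0 hB] := alpha_norm_le_cnorm1 P halpha.
have [|h mh ch] := lp_fg_complete mq.
  move=> e e0; have e1 : 0 < e `^ alpha^-1 by exact: powR_gt0.
  have e2 : 0 < e `^ alpha^-1 / B / 2 by rewrite !divr_gt0.
  have [n0 h0] := cY _ e2; exists n0 => m n /h0 hm /h0 hn.
  have [sJ nJ] := joint_isometry (gXD m n) (gED m n).
  rewrite lp_add_weight; last exact: cmeasB.
  rewrite -nJ lee_fin.
  have hE1 : (E1 (fun w => (X_ m w - X_ n w + (E_ m w - E_ n w))%R) <= (e `^ alpha^-1 / B)%:E)%E.
    rewrite (splitr (_ / B)) EFinD; apply: le_trans (leeD hm hn).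
    have -> : E1 (fun w => (X_ n w + E_ n w - Y w)%R) = E1 (fun w => (Y w - (X_ n w + E_ n w))%R).
      by apply: eq_integral => w _; rewrite -cabsN opprB.
    apply: le_trans (cnorm1D P measurableT (cmeasB (cmeasD (mX m) (mE m)) mY) (cmeasB mY (cmeasD (mX n) (mE n)))).
    rewrite /cnorm1 le_eqVlt; apply/orP; left; apply/eqP; apply: eq_integral => w _.
    by congr (cabs _)%:E; ring.
  have := hB _ _ sJ (ltW (divr_gt0 e1 B0)) hE1; rewrite mulrC divfK ?gt_eqF// => hle.
  rewrite -[leRHS](_ : (e `^ alpha^-1) `^ alpha = e); last by rewrite -powRrM mulVf ?gt_eqF// powRr1// ltW.
  by apply: ge0_ler_powR; rewrite ?nnegrE ?(ltW e1) ?(ltW a0) ?alpha_norm_ge0.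
have cf : lp_cvg leb cir alpha f q h.
  move=> e /ch[n0 h0]; exists n0 => n /h0; apply: le_trans.
  by have [] := le_fg (cmeasB (mq n) mh).
have [V cV hV] := trig_limit hxi hf hf0 gX mh cf.
have [mV _ _] := hV.
(* Taking the noise part as a difference makes the decomposition of Y hold at every point, rather
   than almost surely. *)
exists h, V, (fun w => Y w - V w); split=> //; last by move=> w; ring.
- have hLm : forall e : R, 0 < e -> exists b : seq R[i], (N fg (fun x => (h x - past_polynomial b x)%R) < e%:E)%E.
    move=> e e0; have [n0 h0] := ch (e / 2) (divr_gt0 e0 (ltr0n _ 2)); exists (b n0).
    by rewrite lpBC; apply: le_lt_trans (h0 n0 (leqnn _)) _; rewrite lte_fin; lra.
  split=> //; split=> //.
  have [_ n1] := joint_isometry (trig_ext_sub halpha hxi hf hf0 (gX 0%N)) (trig_ext_sub halpha heta hg hg0 (gE 0%N)).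
  have q0 : (N fg (q 0%N) < +oo)%E by rewrite lp_add_weight// -n1 ltry.
  have [n0 h0] := ch 1 ltr01.
  have [_ n2] := joint_isometry (trig_ext_sub halpha hxi hf hf0 (gX n0)) (trig_ext_sub halpha heta hg hg0 (gE n0)).
  have qn : (N fg (q n0) < +oo)%E by rewrite lp_add_weight// -n2 ltry.
  have hd : (N fg (fun x => (h x - q n0 x)%R) < +oo)%E.
    by rewrite lpBC; apply: le_lt_trans (h0 n0 (leqnn _)) (ltry _).
  have := @lp_fin_add R _ (measurableTypeR R) leb cir mc alpha fg a0 mfg fg0' _ _ (cmeasB mh (mq n0)) (mq n0) hd qn.
  by rewrite (_ : (fun x => _) = h)//; apply/funext => x; rewrite subrK.
- split=> //; first exact: cmeasB.
  move=> e e0; have e2 : 0 < e / 2 by rewrite divr_gt0.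
  have [n1 h1] := ch e e0; have [n2 h2] := cY _ e2; have [n3 h3] := cV _ e2.
  pose n := maxn n1 (maxn n2 n3); exists (E_ n), (q n); split=> //.
    rewrite lpBC; apply: le_trans (h1 n (leq_maxl _ _)).
    by have [] := le_fg (cmeasB (mq n) mh).
  have hn2 : (n2 <= n)%N by rewrite !leq_max leqnn orbT.
  have hn3 : (n3 <= n)%N by rewrite !leq_max leqnn !orbT.
  rewrite (splitr e) EFinD; apply: le_trans (leeD (h2 n hn2) (h3 n hn3)).
  have -> : E1 (fun w => (X_ n w - V w)%R) = E1 (fun w => (V w - X_ n w)%R).
    by apply: eq_integral => w _; rewrite -cabsN opprB.
  apply: le_trans (cnorm1D P measurableT (cmeasB (cmeasD (mX n) (mE n)) mY) (cmeasB mV (mX n))).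
  rewrite /cnorm1 le_eqVlt; apply/orP; left; apply/eqP; apply: eq_integral => w _.
  by congr (cabs _)%:E; ring.
Qed.

End Joint.

(** * Minimisation of the energy *)

Section Pointwise.
Context {R : realType}.
Implicit Types (p a b r x : R) (z y : R[i]).

Lemma bernoulli_le s x : 0 <= s <= 1 -> -1 <= x -> (1 + x) `^ s <= 1 + s * x.
Proof.
move=> /andP[]; rewrite le_eqVlt => /predU1P[<- _ _|s0].
  by rewrite powRr0 mul0r addr0.
rewrite le_eqVlt => /predU1P[-> x1|s1 x1]; first by rewrite powRr1 ?mul1r//; lra.
have x0 : 0 <= 1 + x by lra.
have a1 : 1 < s^-1 by rewrite invf_gt1.
have := powR_tangent a1 ler01 (powR_ge0 (1 + x) s).
rewrite !powR1 mulr1 -powRrM mulfV ?gt_eqF// powRr1// => h.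
have : s * (1 + s^-1 * ((1 + x) `^ s - 1)) <= s * (1 + x) by rewrite ler_pM2l.
rewrite mulrDr mulrA mulfV ?gt_eqF// mul1r; lra.
Qed.

(** When the left-hand side T is positive, both sides are multiplied by (1+x)^(2-p), which
    Bernoulli's inequality bounds by 1 + (2-p) x. What remains is T (1 + (2-p) x) <= (1+x)^2, where
    constant and linear terms cancel and a factor x^2 can be taken out. *)
Lemma one_add_powR p x : 1 < p -> p <= 2 -> -1 <= x <= 1 ->
  1 + p * x + (p - 1) ^+ 2 / 2 * x ^+ 2 <= (1 + x) `^ p.
Proof.
move=> p1 p2 /andP[x1 x2]; set T := _ + _.
have [T0|T0] := leP T 0; first exact: le_trans T0 (powR_ge0 _ _).
have p10 : 0 < p - 1 by lra.
have q0 := sqr_ge0 (p - 1).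
have xm1 : -1 < x.
  rewrite lt_neqAle x1 andbT; apply/eqP => e; move: T0; rewrite /T -e.
  rewrite (_ : _ + _ = (p - 1) * ((p - 1) / 2 - 1)); last by rewrite expr2; field.
  by rewrite pmulr_rgt0//; lra.
have x0 : 0 < 1 + x by lra.
have s01 : 0 <= 2 - p <= 1 by apply/andP; split; lra.
have B := bernoulli_le s01 x1.
have pw : (1 + x) `^ p * (1 + x) `^ (2 - p) = (1 + x) ^+ 2.
  rewrite -powRD ?(gt_eqF x0) ?implybT// (_ : p + (2 - p) = 2%:R); last by ring.
  by rewrite powR_mulrn// ltW.
have poly : T * (1 + (2 - p) * x) <= (1 + x) ^+ 2.
  rewrite -subr_ge0.
  rewrite (_ : _ - _ = x ^+ 2 * ((p - 1) ^+ 2 - (p - 1) ^+ 2 / 2 * (1 + (2 - p) * x))); last by rewrite /T; field.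
  apply: mulr_ge0; first exact: sqr_ge0.
  rewrite subr_ge0 mulrAC -mulrA ler_piMr//.
  have : (2 - p) * x <= 2 - p by apply: ler_piMr => //; lra.
  lra.
have sp : 0 < (1 + x) `^ (2 - p) by exact: powR_gt0.
rewrite -(ler_pM2r sp) pw; apply: le_trans poly.
by rewrite ler_pM2l.
Qed.

(** With mean r, the numbers are r (1 + x) and r (1 - x); in the sum of the two instances of
    [one_add_powR] the linear terms cancel. *)
Lemma powR_midpoint p a b : 1 < p -> p <= 2 -> 0 <= a -> 0 <= b ->
  2 * ((a + b) / 2) `^ p + (p - 1) ^+ 2 / 4 * (a - b) ^+ 2 * ((a + b) / 2) `^ (p - 2) <= a `^ p + b `^ p.
Proof.
move=> p1 p2 a0 b0; have p0 : 0 < p by lra.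
have [r0|r0] := leP ((a + b) / 2) 0.
  have -> : a = 0 by lra. have -> : b = 0 by lra.
  by rewrite addr0 mul0r powR0 ?gt_eqF// subrr expr0n/= !mulr0 mul0r addr0.
set r := (a + b) / 2 in r0 *; pose x := (a - b) / (2 * r).
have rr : 2 * r = a + b by rewrite /r; field.
have xr : x * (2 * r) = a - b by rewrite /x divfK// gt_eqF// mulr_gt0.
have x1 : -1 <= x <= 1.
  have r20 : 0 < 2 * r by rewrite mulr_gt0.
  by apply/andP; split; [rewrite /x ler_pdivlMr//|rewrite /x ler_pdivrMr//]; rewrite rr; lra.
have x1' : -1 <= - x <= 1 by move: x1 => /andP[? ?]; apply/andP; split; lra.
have ea : a = r * (1 + x) by move: xr rr; lra.
have eb : b = r * (1 - x) by move: xr rr; lra.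
have x10 : 0 <= 1 + x by move: x1 => /andP[? ?]; lra.
have x20 : 0 <= 1 - x by move: x1 => /andP[? ?]; lra.
have h1 := one_add_powR p1 p2 x1; have h2 := one_add_powR p1 p2 x1'.
rewrite sqrrN in h2.
have rp : 0 < r `^ p by exact: powR_gt0.
have er : (a - b) ^+ 2 * r `^ (p - 2) = 4 * x ^+ 2 * r `^ p.
  have -> : r `^ p = r `^ (p - 2) * r ^+ 2.
    by rewrite -(powR_mulrn 2 (ltW r0)) -powRD ?(gt_eqF r0) ?implybT//; congr (_ `^ _); ring.
  by rewrite -xr; ring.
have -> : a `^ p = r `^ p * (1 + x) `^ p by rewrite {1}ea powRM// ltW.
have -> : b `^ p = r `^ p * (1 - x) `^ p by rewrite {1}eb powRM// ltW.
rewrite -mulrDr -mulrA er.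
have -> : 2 * r `^ p + (p - 1) ^+ 2 / 4 * (4 * x ^+ 2 * r `^ p) =
   r `^ p * (2 + (p - 1) ^+ 2 * x ^+ 2) by field.
rewrite ler_pM2l//; lra.
Qed.

(** By the parallelogram law the squared modulus of the midpoint is r^2 - del, where r is the mean
    of the moduli and [del] is the part of |z - y|^2/4 not due to the difference of the moduli.
    Bernoulli's inequality with exponent p/2 accounts for [del], [powR_midpoint] for the moduli. *)
Lemma midpoint_gap p z y : 1 < p -> p <= 2 ->
  (p - 1) ^+ 2 / 4 * (cabs (z - y) ^+ 2 * ((cabs z + cabs y) / 2) `^ (p - 2)) +
  2 * cabs ((1 / 2)%:C * (z + y)) `^ p <= cabs z `^ p + cabs y `^ p.
Proof.
move=> p1 p2; have p0 : 0 < p by lra.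
have a0 := cabs_ge0 z; have b0 := cabs_ge0 y.
set a := cabs z in a0 *; set b := cabs y in b0 *; set D := cabs (z - y); set M := cabs _.
have D0 : 0 <= D by exact: cabs_ge0. have M0 : 0 <= M by exact: cabs_ge0.
have M2 : M ^+ 2 = ((a + b) / 2) ^+ 2 - (D ^+ 2 - (a - b) ^+ 2) / 4.
  have e1 := cabs_sqr z; have e2 := cabs_sqr y.
  rewrite /M /D !cabs_sqr cReD cImD cReM cImM cReD cImD cReN cImN /=.
  rewrite (_ : ((a + b) / 2) ^+ 2 = (a ^+ 2 + b ^+ 2) / 2 - (a - b) ^+ 2 / 4); last by field.
  by rewrite /a /b e1 e2; field.
have dD : (a - b) ^+ 2 <= D ^+ 2.
  by rewrite -(real_normK (num_real (a - b))) ler_sqr ?nnegrE//; exact: cabs_dist.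
have [r0|r0] := leP ((a + b) / 2) 0.
  have az : a = 0 by lra. have bz : b = 0 by lra.
  have Dz : D = 0.
    apply/eqP; rewrite eq_le D0 andbT; apply: le_trans (cabsB _ _) _.
    by rewrite -/a -/b az bz addr0.
  have Mz : M = 0.
    have : M ^+ 2 = 0 by rewrite M2 Dz az bz; field.
    by move=> /eqP; rewrite expf_eq0/= => /eqP.
  by rewrite Mz Dz az bz powR0 ?gt_eqF// expr0n/= mul0r !mulr0 !addr0.
have PM := powR_midpoint p1 p2 a0 b0.
set r := (a + b) / 2 in r0 M2 PM *; pose del := (D ^+ 2 - (a - b) ^+ 2) / 4.
have del0 : 0 <= del by rewrite /del divr_ge0// subr_ge0.
have Mle : M `^ p <= r `^ p - p / 2 * del * r `^ (p - 2).
  have rn : r != 0 by rewrite gt_eqF.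
  have r2 : 0 < r ^+ 2 by rewrite exprn_gt0.
  have e : M `^ p = (r ^+ 2) `^ (p / 2) * (1 + - (del / r ^+ 2)) `^ (p / 2).
    have u0 : 0 <= 1 + - (del / r ^+ 2).
      rewrite subr_ge0 ler_pdivrMr// mul1r; have := sqr_ge0 M; rewrite M2 -/del; lra.
    rewrite -powRM ?(ltW r2)//.
    have -> : r ^+ 2 * (1 + - (del / r ^+ 2)) = M ^+ 2.
      by rewrite M2 -/del mulrDr mulr1 mulrN mulrC divfK ?gt_eqF.
    by rewrite -(powR_mulrn 2 M0) -powRrM; congr (_ `^ _); field.
  have er : (r ^+ 2) `^ (p / 2) = r `^ p.
    by rewrite -(powR_mulrn 2 (ltW r0)) -powRrM; congr (_ `^ _); field.
  have s01 : 0 <= p / 2 <= 1 by apply/andP; split; lra.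
  have x1 : -1 <= - (del / r ^+ 2).
    rewrite lerN2 ler_pdivrMr// mul1r; have := sqr_ge0 M; rewrite M2 -/del; lra.
  rewrite e er; apply: le_trans (ler_wpM2l (powR_ge0 _ _) (bernoulli_le s01 x1)) _.
  have -> : r `^ p = r `^ (p - 2) * r ^+ 2.
    by rewrite -(powR_mulrn 2 (ltW r0)) -powRD ?rn ?implybT//; congr (_ `^ _); ring.
  rewrite le_eqVlt; apply/orP; left; apply/eqP; field; exact: rn.
have rp2 : 0 <= r `^ (p - 2) by exact: powR_ge0.
apply: le_trans PM.
have q : (p - 1) ^+ 2 / 4 * (D ^+ 2 * r `^ (p - 2)) =
   (p - 1) ^+ 2 / 4 * (a - b) ^+ 2 * r `^ (p - 2) + (p - 1) ^+ 2 * (del * r `^ (p - 2)).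
  by rewrite /del; field.
have pp : (p - 1) ^+ 2 <= p.
  by rewrite -subr_ge0 (_ : _ - _ = p * (2 - p) + (p - 1)); [rewrite addr_ge0 ?mulr_ge0//; lra|ring].
have h : (p - 1) ^+ 2 * (del * r `^ (p - 2)) <= p * (del * r `^ (p - 2)).
  by rewrite ler_wpM2r// mulr_ge0.
rewrite q; move: Mle h; set X := del * _; rewrite (_ : p / 2 * del * r `^ (p - 2) = p * X / 2); last by rewrite /X; field.
lra.
Qed.

(* midpoint_gap controls |z - y|^2 r^(p - 2), where r is the mean of |z| and |y|;
   this dominates |z - y|^p, up to a constant, unless |z - y| is small compared
   with r. *)
Lemma unif_convex p e : 1 < p -> p <= 2 -> 0 < e -> exists2 C : R, 0 <= C & forall z y,
  cabs (z - y) `^ p + 2 * C * cabs ((1 / 2)%:C * (z + y)) `^ p <=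
  (e + C) * (cabs z `^ p + cabs y `^ p).
Proof.
move=> p1 p2 e0; have p0 : 0 < p by lra.
pose e' := e `^ p^-1; have e'0 : 0 < e' by exact: powR_gt0.
have e'p : e' `^ p = e by rewrite /e' -powRrM mulVf ?gt_eqF// powRr1// ltW.
have k0 : 0 < (p - 1) ^+ 2 / 4 by rewrite divr_gt0// exprn_gt0// subr_gt0.
have e2 : 0 < e' `^ (2 - p) by exact: powR_gt0.
(* With threshold e' r for |z - y|: below it |z - y|^p <= e r^p; above it |z - y|^p e'^(2-p) <= |z -
   y|^2 r^(p-2), which [midpoint_gap] bounds after multiplication by (p-1)^2/4. *)
pose C := ((p - 1) ^+ 2 / 4 * e' `^ (2 - p))^-1.
have C0 : 0 < C by rewrite invr_gt0 mulr_gt0.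
exists C => [|z y]; first exact: ltW.
have G := midpoint_gap z y p1 p2.
have a0 := cabs_ge0 z; have b0 := cabs_ge0 y; have D0 := cabs_ge0 (z - y).
have Ss : 0 <= cabs z `^ p + cabs y `^ p by rewrite addr_ge0 ?powR_ge0.
have Db : cabs (z - y) <= cabs z + cabs y := cabsB z y.
move: G Ss Db a0 b0 D0; set a := cabs z; set b := cabs y; set D := cabs (z - y); set M := cabs _ `^ p.
move=> G Ss Db a0 b0 D0; set r := (a + b) / 2 in G.
have r0 : 0 <= r by rewrite divr_ge0// addr_ge0.
have rS : r `^ p <= a `^ p + b `^ p.
  have [ab|ba] := leP a b.
    apply: le_trans (_ : b `^ p <= _); last by rewrite lerDr powR_ge0.
    by apply: ge0_ler_powR; rewrite ?nnegrE ?(ltW p0)// /r; lra.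
  apply: le_trans (_ : a `^ p <= _); last by rewrite lerDl powR_ge0.
  by apply: ge0_ler_powR; rewrite ?nnegrE ?(ltW p0)// /r; lra.
have gap0 : 0 <= a `^ p + b `^ p - 2 * M.
  have := mulr_ge0 (ltW k0) (mulr_ge0 (sqr_ge0 D) (powR_ge0 r (p - 2))); lra.
have key : D `^ p <= e * (a `^ p + b `^ p) + C * (a `^ p + b `^ p - 2 * M); last by lra.
have [hD|hD] := leP D (e' * r).
  have : D `^ p <= e * r `^ p.
    rewrite -e'p -powRM ?(ltW e'0)//; apply: ge0_ler_powR; rewrite ?nnegrE ?(ltW p0)//.
    by rewrite mulr_ge0// ltW.
  have := ler_wpM2l (ltW e0) rS; have := mulr_ge0 (ltW C0) gap0; lra.
have Dp : 0 < D by apply: le_lt_trans hD; rewrite mulr_ge0// ltW.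
have rp : 0 < r by rewrite /r; lra.
have : D `^ p * e' `^ (2 - p) <= D ^+ 2 * r `^ (p - 2).
  have -> : D ^+ 2 = D `^ p * D `^ (2 - p).
    by rewrite -powRD ?(gt_eqF Dp) ?implybT// (_ : p + (2 - p) = 2%:R) ?powR_mulrn//; ring.
  rewrite -mulrA ler_pM2l ?powR_gt0//.
  have -> : r `^ (p - 2) = (r `^ (2 - p))^-1 by rewrite -powRN opprB.
  rewrite ler_pdivlMr ?powR_gt0// -powRM ?(ltW e'0)//.
  by apply: ge0_ler_powR; rewrite ?nnegrE ?(ltW hD) ?subr_ge0// mulr_ge0// ltW.
move=> h.
have : D `^ p <= C * ((p - 1) ^+ 2 / 4 * (D ^+ 2 * r `^ (p - 2))).
  have K0 : 0 < (p - 1) ^+ 2 / 4 * e' `^ (2 - p) by exact: mulr_gt0.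
  rewrite -(ler_pM2l K0) /C [leRHS]mulrA mulfV ?(gt_eqF K0)// mul1r.
  apply: le_trans (ler_wpM2l (ltW k0) h).
  by rewrite le_eqVlt; apply/orP; left; apply/eqP; ring.
have := ler_wpM2l (ltW C0) (_ : (p - 1) ^+ 2 / 4 * (D ^+ 2 * r `^ (p - 2)) <= a `^ p + b `^ p - 2 * M).
have es : 0 <= e * (a `^ p + b `^ p) by rewrite mulr_ge0// ltW.
move=> /(_ ltac:(lra)); lra.
Qed.

Lemma cabs_spow p z : 0 < p -> cabs (spow z p) = cabs z `^ p.
Proof.
move=> p0; rewrite /spow cabsM cabsR cabs_conj ger0_norm ?powR_ge0//.
have [->|z0] := eqVneq (cabs z) 0; first by rewrite mulr0 powR0 ?gt_eqF.
have zp : 0 < cabs z by rewrite lt_def z0 cabs_ge0.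
rewrite -[X in _ * X]powRr1 ?cabs_ge0// -powRD ?z0 ?implybT//; congr (_ `^ _); ring.
Qed.

(** The real tangent inequality for the moduli, since Re (z y^{<p-1>}) <= |z| |y|^(p-1) with
    equality at z = y. *)
Lemma cabs_tangent p z y : 1 < p ->
  cabs y `^ p + p * complex.Re ((z - y) * spow y (p - 1)) <= cabs z `^ p.
Proof.
move=> p1; have p0 : 0 < p by lra. have q0 : 0 < p - 1 by lra.
apply: le_trans (powR_tangent p1 (cabs_ge0 y) (cabs_ge0 z)).
rewrite lerD2l -mulrA ler_pM2l// mulrBl cReD cReN mul_spow// mulrBr /=.
apply: lerB.
  apply: le_trans (ler_norm _) _; apply: le_trans (Re_le_cabs _) _.
  by rewrite cabsM cabs_spow// mulrC.
have [y0|y0] := eqVneq (cabs y) 0; first by rewrite y0 mulr0 powR_ge0.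
rewrite -[X in _ * X <= _]powRr1 ?cabs_ge0// -powRD ?y0 ?implybT// (_ : p - 1 + 1 = p)//; ring.
Qed.

(** The tangents at z and at y are both compared with the value at the midpoint. Adding them bounds
    the gap of [midpoint_gap] by p/2 times the real part in question; if the latter is 0, the gap
    vanishes and z = y. *)
Lemma spow_mono p z y : 1 < p -> p <= 2 ->
  0 <= complex.Re ((z - y) * (spow z (p - 1) - spow y (p - 1))) /\
  (complex.Re ((z - y) * (spow z (p - 1) - spow y (p - 1))) = 0 -> z = y).
Proof.
move=> p1 p2; have p0 : 0 < p by lra.
pose m := (1 / 2)%:C * (z + y).
have h2 : ((1 / 2)%:C + (1 / 2)%:C : R[i]) = 1 by rewrite -rmorphD/= -(rmorph1 (real_complex R)); congr (_%:C); field.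
have e1 : m - y = (1 / 2)%:C * (z - y).
  by rewrite /m mulrDr mulrBr -[X in _ + _ - X]mul1r -h2 mulrDl; ring.
have e2 : m - z = (1 / 2)%:C * (y - z).
  by rewrite /m mulrDr mulrBr -[X in _ + _ - X]mul1r -h2 mulrDl; ring.
have t1 := cabs_tangent m y p1; have t2 := cabs_tangent m z p1.
have G := midpoint_gap z y p1 p2; rewrite -/m in G.
have hR (u : R[i]) : complex.Re ((1 / 2)%:C * u) = complex.Re u / 2.
  by rewrite cReM /= mul0r subr0 mulrC mul1r.
rewrite e1 -mulrA hR in t1; rewrite e2 -mulrA hR -opprB mulNr cReN in t2.
have eR : complex.Re ((z - y) * (spow z (p - 1) - spow y (p - 1))) =
   complex.Re ((z - y) * spow z (p - 1)) - complex.Re ((z - y) * spow y (p - 1)).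
  by rewrite mulrBr cReD cReN.
rewrite eR; move: t1 t2; set X := complex.Re _; set Y := complex.Re _ => t1 t2.
set gp := (p - 1) ^+ 2 / 4 * _ in G.
have gp0 : 0 <= gp.
  by apply: mulr_ge0; [exact: divr_ge0 (sqr_ge0 _) (ler0n _ 4)|exact: mulr_ge0 (sqr_ge0 _) (powR_ge0 _ _)].
have le1 : gp <= p * ((Y - X) / 2) by lra.
split.
  have := le_trans gp0 le1; rewrite pmulr_rge0//; lra.
move=> YX; have gz : gp = 0 by apply/le_anti; rewrite gp0 andbT; move: le1; rewrite YX mul0r mulr0.
have k0 : 0 < (p - 1) ^+ 2 / 4 by rewrite divr_gt0// exprn_gt0// subr_gt0.
move: gz => /eqP; rewrite /gp mulf_eq0 (gt_eqF k0) orFb mulf_eq0 expf_eq0 andTb.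
move=> /orP[/eqP/cabs0_eq/eqP|]; first by rewrite subr_eq0 => /eqP.
rewrite powR_eq0 => /andP[/eqP h _].
have a0 := cabs_ge0 z; have b0 := cabs_ge0 y.
have za : cabs z = 0 by lra. have yb : cabs y = 0 by lra.
by rewrite (cabs0_eq za) (cabs0_eq yb).
Qed.

(* This avoids taking limits in the first variation: the remainder of
   cabs_taylor is O(t^p) along h + t q. *)
Lemma spow_holder p z y : 1 < p -> p <= 2 ->
  cabs (spow z (p - 1) - spow y (p - 1)) <= 4 * cabs (z - y) `^ (p - 1).
Proof.
move=> p1 p2; wlog yz : z y / cabs y <= cabs z.
  move=> H; have [/H//|/ltW/H] := leP (cabs y) (cabs z).
  by rewrite -opprB cabsN -(opprB z y) cabsN.
have q0 : 0 < p - 1 by lra.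
have [z0|z0] := eqVneq (cabs z) 0.
  have y0 : cabs y = 0 by apply/le_anti; rewrite cabs_ge0 andbT -z0.
  by rewrite (cabs0_eq z0) (cabs0_eq y0) !subrr cabs0 mulr_ge0// powR_ge0.
have a0 : 0 < cabs z by rewrite lt_def z0 cabs_ge0.
have b0 := cabs_ge0 y.
have D2 : cabs (z - y) <= 2 * cabs z by apply: le_trans (cabsB _ _) _; lra.
have D0 := cabs_ge0 (z - y).
have Dd : cabs z - cabs y <= cabs (z - y).
  by apply: le_trans (cabs_dist _ _); exact: ler_norm.
set a := cabs z in yz z0 a0 D2 Dd *; set b := cabs y in yz b0 Dd *.
set D := cabs (z - y) in D2 D0 Dd *.
have split1 (x : R) : 0 < x -> x `^ (p - 1) = x `^ (p - 2) * x.
  move=> x0; rewrite -[X in _ = _ * X]powRr1 ?(ltW x0)// -powRD ?(gt_eqF x0) ?implybT//.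
  by congr (_ `^ _); ring.
have anti (x x' : R) : 0 < x -> x <= x' -> x' `^ (p - 2) <= x `^ (p - 2).
  move=> x0 xx; rewrite -(opprB 2 p) !powRN lef_pV2 ?posrE ?powR_gt0//; last exact: lt_le_trans xx.
  by apply: ge0_ler_powR; rewrite ?nnegrE ?subr_ge0// ltW// (lt_le_trans x0).
have e2 : p - 1 - 1 = p - 2 by ring.
have main : cabs (spow z (p - 1) - spow y (p - 1)) <= 2 * (a `^ (p - 2) * D).
  have [y0|y0] := eqVneq b 0.
    have -> : y = 0 by exact: cabs0_eq.
    rewrite {2}/spow rmorph0 mulr0 subr0 cabs_spow// -/a split1//.
    have : a `^ (p - 2) * a <= a `^ (p - 2) * D by rewrite ler_wpM2l ?powR_ge0//; lra.
    have := mulr_ge0 (powR_ge0 a (p - 2)) D0; lra.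
  have yp : 0 < b by rewrite lt_def y0.
  (* The factor |z|^(p-2) of the larger number is common to both parts; the correction in y is
     controlled because x |-> x^(p-2) decreases while x |-> x^(p-1) increases. *)
  have -> : spow z (p - 1) - spow y (p - 1) =
      (a `^ (p - 2))%:C * (z - y)^* - ((b `^ (p - 2) - a `^ (p - 2)))%:C * y^*.
    by rewrite /spow !e2 -/a -/b !rmorphB/=; ring.
  apply: le_trans (cabsB _ _) _; rewrite !cabsM !cabsR !cabs_conj -/D -/b.
  rewrite (ger0_norm (powR_ge0 _ _)) ger0_norm ?subr_ge0 ?anti//.
  have : b `^ (p - 2) * b <= a `^ (p - 2) * a.
    by rewrite -!split1//; apply: ge0_ler_powR; rewrite ?nnegrE ?(ltW q0)// ltW.
  have : a `^ (p - 2) * (a - b) <= a `^ (p - 2) * D by rewrite ler_wpM2l ?powR_ge0.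
  rewrite mulrBl mulrBr; lra.
apply: le_trans main _.
have [Dz|Dz] := eqVneq D 0; first by rewrite Dz !mulr0 mulr_ge0// powR_ge0.
have Dp : 0 < D by rewrite lt_def Dz.
rewrite (split1 D)// mulrA [leRHS]mulrA ler_pM2r//.
have h : a `^ (p - 2) <= (D / 2) `^ (p - 2) by apply: anti; lra.
have e : (D / 2) `^ (p - 2) = D `^ (p - 2) * 2 `^ (2 - p).
  by rewrite powRM ?invr_ge0// -[in LHS]powR_inv1// -powRrM; congr (_ * _ `^ _); ring.
have l2 : 2 `^ (2 - p) <= 2 :> R.
  by rewrite -[leRHS]powRr1//; apply: ler_powR; lra.
have : D `^ (p - 2) * 2 `^ (2 - p) <= D `^ (p - 2) * 2 by rewrite ler_wpM2l ?powR_ge0.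
move: h; rewrite e; lra.
Qed.

(** The tangent is taken at z, which yields an upper bound of |z|^p, and [spow_holder] moves the
    slope from z to y. *)
Lemma cabs_taylor p z y : 1 < p -> p <= 2 ->
  cabs z `^ p <= cabs y `^ p + p * complex.Re ((z - y) * spow y (p - 1)) +
    4 * p * cabs (z - y) `^ p.
Proof.
move=> p1 p2; have p0 : 0 < p by lra.
have := cabs_tangent y z p1.
have -> : (y - z) * spow z (p - 1) = - ((z - y) * spow y (p - 1)) -
    (z - y) * (spow z (p - 1) - spow y (p - 1)) by ring.
rewrite cReD !cReN.
have h : complex.Re ((z - y) * (spow z (p - 1) - spow y (p - 1))) <= 4 * cabs (z - y) `^ p.
  apply: le_trans (ler_norm _) _; apply: le_trans (Re_le_cabs _) _; rewrite cabsM.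
  apply: le_trans (ler_wpM2l (cabs_ge0 _) (spow_holder z y p1 p2)) _.
  rewrite mulrCA ler_pM2l//.
  have [->|D0] := eqVneq (cabs (z - y)) 0; first by rewrite mul0r powR_ge0.
  rewrite -[X in X * _]powRr1 ?cabs_ge0// -powRD ?D0 ?implybT// (_ : 1 + (p - 1) = p)//; ring.
have := ler_wpM2l (ltW p0) h; rewrite mulrDr !mulrN; lra.
Qed.

End Pointwise.

(** Concludes estimates made with [powR_split]: K may depend on e, so e is fixed first and [del] is
    chosen after K. *)
Lemma le_of_split {R : realType} (x m : R) : 0 <= m ->
  (forall e : R, 0 < e -> exists2 K : R, 0 <= K & forall del : R, 0 < del -> x <= (1 + e) * (m + del) + K * del) ->
  x <= m.
Proof.
move=> m0 H; apply/ler_addgt0Pr => eta eta0.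
have m1 : 0 < 2 * (m + 1) by lra.
have e0 : 0 < eta / (2 * (m + 1)) by exact: divr_gt0.
have [K K0 hK] := H _ e0; set e := eta / _ in e0 hK *.
have s0 : 0 < 2 * (1 + e + K) by lra.
have := hK _ (divr_gt0 eta0 s0); set del := eta / _ => h.
have e1 : e * m <= eta / 2.
  have -> : e * m = (eta / 2) * (m / (m + 1)) by rewrite /e; field; rewrite !gt_eqF//; lra.
  rewrite ler_piMr//; first lra.
  by rewrite ler_pdivrMr ?mul1r; lra.
have e2 : (1 + e + K) * del = eta / 2 by rewrite /del; field; rewrite gt_eqF//; lra.
have e3 : (1 + e) * (m + del) + K * del = m + e * m + (1 + e + K) * del by ring.
by move: h; rewrite e3 e2; lra.
Qed.

Lemma powR_young {R : realType} (p a b : R) : 1 < p -> 0 <= a -> 0 <= b ->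
  a * b `^ (p - 1) <= a `^ p + b `^ p.
Proof.
move=> p1 a0 b0; have q0 : 0 < p - 1 by lra.
have main (c : R) : 0 <= c -> c * c `^ (p - 1) = c `^ p.
  rewrite le_eqVlt => /predU1P[<-|c0]; first by rewrite mul0r powR0// gt_eqF//; lra.
  rewrite -[X in X * _]powRr1 ?ltW// -powRD ?(gt_eqF c0) ?implybT//; congr (_ `^ _); ring.
have [ab|ba] := leP a b.
  apply: le_trans (_ : b * b `^ (p - 1) <= _); first by rewrite ler_wpM2r ?powR_ge0.
  by rewrite main// lerDr powR_ge0.
apply: le_trans (_ : a * a `^ (p - 1) <= _); last by rewrite main// lerDl powR_ge0.
by rewrite ler_wpM2l//; apply: ge0_ler_powR; rewrite ?nnegrE ?(ltW q0) ?(ltW ba).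
Qed.

Lemma lt_sum_bound {R : realType} (x y m del s t : R) :
  x < m + s -> y < m + t -> s <= del -> t <= del -> x + y <= 2 * m + 2 * del.
Proof. lra. Qed.

Lemma cauchy_arith {R : realType} (I C e m eps del S M : R) :
  I + 2 * C * M <= (e + C) * S -> (e + C) * S <= (e + C) * (2 * m + 2 * del) ->
  C * m <= C * M -> e * m <= eps / 4 -> (e + C) * del = eps / 4 -> I <= eps.
Proof. lra. Qed.

Lemma ratio_le {R : realType} (m eps : R) : 0 <= m -> 0 < eps -> eps / (4 * (m + 1)) * m <= eps / 4.
Proof.
move=> m0 e0; have -> : eps / (4 * (m + 1)) * m = (eps / 4) * (m / (m + 1)) by field; rewrite !gt_eqF//; lra.
by rewrite ler_piMr//; [lra|rewrite ler_pdivrMr ?mul1r; lra].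
Qed.

Lemma ratio_eq {R : realType} (s eps : R) : 0 < s -> s * (eps / (4 * s)) = eps / 4.
Proof. by move=> s0; field; rewrite gt_eqF. Qed.

Lemma convex_weights {R : realType} (e C D M1 M2 u1 u2 v1 v2 f g : R) : 0 <= f -> 0 <= g ->
  D + 2 * C * M1 <= (e + C) * (u1 + v1) -> D + 2 * C * M2 <= (e + C) * (u2 + v2) ->
  D * (f + g) + 2 * C * (M1 * f + M2 * g) <= (e + C) * (u1 * f + u2 * g + (v1 * f + v2 * g)).
Proof. by move=> f0 g0 /(ler_wpM2r f0) h1 /(ler_wpM2r g0) h2; lra. Qed.

Lemma taylor_weights {R : realType} (p t T Q z1 z2 y1 y2 s1 s2 f g : R) : 0 <= f -> 0 <= g ->
  z1 <= y1 + p * - (t * s1) + 4 * p * (T * Q) -> z2 <= y2 + p * (t * s2) + 4 * p * (T * Q) ->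
  z1 * f + z2 * g <=
    y1 * f + y2 * g - p * t * (s1 * f - s2 * g) + 4 * p * T * (Q * (f + g)).
Proof. by move=> f0 g0 /(ler_wpM2r f0) h1 /(ler_wpM2r g0) h2; lra. Qed.

Lemma first_order {R : realType} (p t s X L E E' : R) : E <= E' ->
  E' <= E - p * t * X + 4 * p * (t * s) * L -> p * t * X <= p * t * (4 * L * s).
Proof. by move=> h1 h2; lra. Qed.

Lemma scaled_lt {R : realType} (L X : R) : 0 <= L -> 0 < X -> 4 * L * (X / (8 * (L + 1))) < X.
Proof.
move=> L0 X0; have -> : 4 * L * (X / (8 * (L + 1))) = X / 2 * (L / (L + 1)) by field; rewrite !gt_eqF//; lra.
have X2 : 0 <= X / 2 by lra.
have : L / (L + 1) <= 1 by rewrite ler_pdivrMr ?mul1r; lra.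
move=> /(ler_wpM2l X2); lra.
Qed.

Lemma cabs_spow_weight {R : realType} (p k : R) (a z : R[i]) : 1 < p -> 0 <= k ->
  cabs (a * (spow z (p - 1) * k%:C)) = cabs a * cabs z `^ (p - 1) * k.
Proof.
move=> p1 k0; have q0 : 0 < p - 1 by lra.
by rewrite (cabsM a) (cabsM (spow _ _)) cabsR cabs_spow// (ger0_norm k0) mulrA.
Qed.

(** * Existence and first-order condition for the minimiser *)

Section Minimisation.
Context {R : realType} {d : measure_display} {T : measurableType d}.
Variables (mu : {measure set T -> \bar R}) (D : set T).
Hypothesis mD : measurable D.
Variables (p : R) (f g : T -> R) (A : T -> R[i]).
Hypotheses (p1 : 1 < p) (p2 : p <= 2)
  (mf : measurable_fun D f) (mg : measurable_fun D g)
  (f0 : forall x, D x -> 0 <= f x) (g0 : forall x, D x -> 0 <= g x).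
Local Notation w := (fun x => f x + g x).
Implicit Types u v h q : T -> R[i].
Local Notation cm u := (cmeas D u).
Local Notation dn w u := (fun x => cabs (u x) `^ p * w x).
Local Notation I F := (\int[mu]_(x in D) F x).
Local Notation ig F := (mu.-integrable D (EFin \o F)).

Let p0 : 0 < p. Proof. exact: lt_trans p1. Qed.
Let mw : measurable_fun D w. Proof. exact: measurable_funD. Qed.
Let w0 x : D x -> 0 <= f x + g x. Proof. by move=> Dx; rewrite addr_ge0 ?f0 ?g0. Qed.

Lemma lp_integrable (k : T -> R) u : measurable_fun D k -> (forall x, D x -> 0 <= k x) ->
  cm u -> (lp mu D p k u < +oo)%E -> ig (dn k u) /\ lp mu D p k u = (I (dn k u))%:E.
Proof.
move=> mk k0 mu_ foo; have iI : ig (dn k u).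
  apply/integrableP; split; first exact: measurable_lp.
  rewrite (eq_integral (fun x => (dn k u x)%:E)) // => x /set_mem Dx /=.
  by rewrite ger0_norm// mulr_ge0 ?powR_ge0 ?k0.
by split=> //; rewrite /Rintegral fineK//; apply: integrable_fin_num.
Qed.

Definition gap u x := cabs (A x - u x) `^ p * f x + cabs (u x) `^ p * g x.

Hypotheses (mA : cm A) (Afin : (lp mu D p f A < +oo)%E).

Definition fin_norm u := cm u /\ (lp mu D p w u < +oo)%E.

Lemma fin_normD u v : fin_norm u -> fin_norm v -> fin_norm (fun x => u x + v x).
Proof.
move=> [mu_ uo] [mv vo]; split; first exact: cmeasD.
exact: (@lp_fin_add R _ T mu D mD p w p0 mw w0 u v mu_ mv uo vo).
Qed.

Lemma fin_normZ c u : fin_norm u -> fin_norm (fun x => c * u x).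
Proof.
move=> [mu_ uo]; split; first by apply: cmeasM => //; exact: cmeas_cst.
rewrite (@lpZ R _ T mu D mD p w mw w0 c u mu_); apply: lte_mul_pinfty => //.
by rewrite lee_fin powR_ge0.
Qed.

Let lefg u : cm u -> (lp mu D p f u <= lp mu D p w u)%E /\ (lp mu D p g u <= lp mu D p w u)%E.
Proof.
move=> mu_; split; apply: ge0_le_integral => //;
  do ?[exact: measurable_lp|by move=> x Dx; rewrite lee_fin mulr_ge0 ?powR_ge0 ?f0 ?g0 ?w0].
  by move=> x Dx; rewrite lee_fin ler_wpM2l ?powR_ge0// lerDl g0.
by move=> x Dx; rewrite lee_fin ler_wpM2l ?powR_ge0// lerDr f0.
Qed.

Lemma fin_norm_parts u : fin_norm u -> [/\ ig (dn f (fun x => A x - u x)), ig (dn g u) & ig (dn w u)].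
Proof.
move=> [mu_ uo]; have [hf hg] := lefg mu_.
have fo := le_lt_trans hf uo; have go := le_lt_trans hg uo.
have mN : cm (fun x => - u x) by exact: cmeasN.
have No : (lp mu D p f (fun x => - u x)%R < +oo)%E by rewrite lpN.
have [hI _] := lp_integrable mf f0 (cmeasB mA mu_)
  (@lp_fin_add R _ T mu D mD p f p0 mf f0 A _ mA mN Afin No).
by split; [exact: hI|exact: (lp_integrable mg g0 mu_ go).1|exact: (lp_integrable mw w0 mu_ uo).1].
Qed.

Lemma gap_integrable u : fin_norm u -> ig (gap u).
Proof.
move=> /fin_norm_parts[h1 h2 _]; have := integrableD mD h1 h2.
by apply: eq_integrable.
Qed.

Definition energy u := I (gap u).

Lemma gap_ge0 u x : D x -> 0 <= gap u x.
Proof. by move=> Dx; rewrite addr_ge0// mulr_ge0 ?powR_ge0 ?f0 ?g0. Qed.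

Lemma energy_ge0 u : 0 <= energy u.
Proof. by apply: Rintegral_ge0 => x Dx; exact: gap_ge0. Qed.

Lemma energyE u : fin_norm u ->
  ((energy u)%:E = lp mu D p f (fun x => A x - u x)%R + lp mu D p g u)%E.
Proof.
move=> /[dup] hu /fin_norm_parts[h1 h2 _]; have [mu_ _] := hu.
rewrite /energy RintegralD// EFinD /Rintegral !fineK//; exact: integrable_fin_num.
Qed.

Let fBw (a b c : T -> R) (r s : R) : ig a -> ig b -> ig c ->
  (forall x, D x -> a x <= r * b x + s * c x) -> I a <= r * I b + s * I c.
Proof.
move=> ha hb hc h.
have hb' : ig (fun x => r * b x) by apply: eq_integrable (integrableZl mD r hb).
have hc' : ig (fun x => s * c x) by apply: eq_integrable (integrableZl mD s hc).
rewrite -(RintegralZl r mD hb) -(RintegralZl s mD hc) -RintegralD//.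
apply: le_Rintegral => //; first exact: eq_integrable (integrableD mD hb' hc').
Qed.

Lemma energy_split (e : R) : 0 < e -> exists2 K : R, 0 <= K & forall u v, fin_norm u -> fin_norm v ->
  energy u <= (1 + e) * energy v + K * I (dn w (fun x => u x - v x)).
Proof.
move=> e0; have [K K0 hK] := powR_split p1 e0; exists K => // u v hu hv.
have hN : fin_norm (fun x => u x - v x).
  have := fin_normD hu (fin_normZ (-1) hv); congr fin_norm.
  by apply/funext => x; rewrite mulN1r.
have [_ _ hd] := fin_norm_parts hN.
apply: fBw => //; do ?exact: gap_integrable.
move=> x Dx; rewrite /gap.
have tri (z y r : R[i]) : cabs z <= cabs y + cabs r -> cabs z `^ p <= (1 + e) * cabs y `^ p + K * cabs r `^ p.
  move=> h; apply: le_trans (hK _ _ (cabs_ge0 _) (cabs_ge0 _)).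
  by apply: ge0_ler_powR; rewrite ?nnegrE ?addr_ge0 ?cabs_ge0// ltW.
have h1 := tri (A x - u x) (A x - v x) (u x - v x).
have {h1} h1 : cabs (A x - u x) `^ p <= (1 + e) * cabs (A x - v x) `^ p + K * cabs (u x - v x) `^ p.
  apply: h1; rewrite -(cabsN (u x - v x)); apply: le_trans _ (cabsD _ _).
  by rewrite (_ : A x - v x - (u x - v x) = A x - u x)//; ring.
have h2 : cabs (u x) `^ p <= (1 + e) * cabs (v x) `^ p + K * cabs (u x - v x) `^ p.
  by apply: tri; apply: le_trans _ (cabsD _ _); rewrite addrC subrK.
have := ler_wpM2r (f0 Dx) h1; have := ler_wpM2r (g0 Dx) h2; lra.
Qed.

(** [unif_convex] is applied to the pairs (A - u, A - v), with weight f, and (u, v), with weight g.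
    Both pairs have the same difference up to sign, so together they control it in L^p(f+g). *)
Lemma energy_convex (e : R) : 0 < e -> exists2 C : R, 0 <= C & forall u v, fin_norm u -> fin_norm v ->
  I (dn w (fun x => u x - v x)) + 2 * C * energy (fun x => (1 / 2)%:C * (u x + v x)) <=
  (e + C) * (energy u + energy v).
Proof.
move=> e0; have [C C0 hC] := unif_convex p1 p2 e0; exists C; [exact: C0|move=> u v hu hv].
have hN : fin_norm (fun x => u x - v x).
  have := fin_normD hu (fin_normZ (-1) hv); congr fin_norm.
  by apply/funext => x; rewrite mulN1r.
have hM : fin_norm (fun x => (1 / 2)%:C * (u x + v x)) by apply: fin_normZ; exact: fin_normD.
have [_ _ hd] := fin_norm_parts hN.
have iu := gap_integrable hu; have iv := gap_integrable hv; have iM := gap_integrable hM.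
have iS : ig (fun x => gap u x + gap v x) by exact: eq_integrable (integrableD mD iu iv).
have eS : I (fun x => gap u x + gap v x) = energy u + energy v by exact: RintegralD.
rewrite -lerBrDr -eS -mulNr.
apply: fBw => // x Dx; rewrite mulNr lerBrDr /gap.
have h1 := hC (A x - u x) (A x - v x); have h2 := hC (u x) (v x).
rewrite (_ : A x - u x - (A x - v x) = - (u x - v x)) ?cabsN in h1; last by ring.
have hh : ((1 / 2)%:C * (A x - u x + (A x - v x)) : R[i]) = A x - (1 / 2)%:C * (u x + v x).
  have h2' : ((1 / 2)%:C + (1 / 2)%:C : R[i]) = 1 by rewrite -rmorphD/= -(rmorph1 (real_complex R)); congr (_%:C); field.
  by rewrite -[X in _ = X - _]mul1r -h2'; ring.
rewrite hh in h1.
exact: convex_weights (f0 Dx) (g0 Dx) h1 h2.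
Qed.

Variable E : (T -> R[i]) -> Prop.
Hypotheses (E0 : E (fun=> 0)) (ED : forall u v, E u -> E v -> E (fun x => u x + v x))
  (EZ : forall c u, E u -> E (fun x => c * u x)) (Efin : forall u, E u -> fin_norm u).

Definition closure_of u := fin_norm u /\ forall e : R, 0 < e -> exists2 q, E q &
  (lp mu D p w (fun x => (u x - q x)%R) <= e%:E)%E.

Let dnI u v (e : R) : fin_norm u -> fin_norm v ->
  (lp mu D p w (fun x => (u x - v x)%R) <= e%:E)%E -> I (dn w (fun x => u x - v x)) <= e.
Proof.
move=> hu hv; have [mB Bo] : fin_norm (fun x => u x - v x).
  have := fin_normD hu (fin_normZ (-1) hv); congr fin_norm.
  by apply/funext => x; rewrite mulN1r.
by have [_ ->] := lp_integrable mw w0 mB Bo; rewrite lee_fin.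
Qed.

Lemma closure_ofD u q : closure_of u -> E q -> closure_of (fun x => u x + q x).
Proof.
move=> [hu cu] Eq; split; first exact: (fin_normD hu (Efin Eq)).
move=> e /cu[r Er h]; exists (fun x => r x + q x); first exact: ED.
apply: le_trans h; rewrite le_eqVlt; apply/orP; left; apply/eqP; apply: lp_eq => x _.
by rewrite opprD addrACA subrr addr0.
Qed.

Hypothesis dom : forall e : R, 0 < e -> exists2 k : R, 0 < k &
  forall v, cm v -> (lp mu D p w v <= k%:E)%E -> (cnorm1 mu D v <= e%:E)%E.

(** A minimising sequence is taken in E itself; midpoints stay in E, so [energy_convex] makes it
    Cauchy. [energy_split] shows that the closure has the same infimum and that the limit attains
    it. *)
Theorem min_exists : exists h, closure_of h /\ forall u, closure_of u -> energy h <= energy u.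
Proof.
pose S := [set y | exists2 q, E q & y = energy q].
have hS : has_inf S.
  split; first by exists (energy (fun=> 0)), (fun=> 0).
  by exists 0 => _ [q _ ->]; exact: energy_ge0.
pose m := inf S; have m0 : 0 <= m by apply: lb_le_inf; [exact: hS.1|move=> _ [q _ ->]; exact: energy_ge0].
have mle q : E q -> m <= energy q by move=> Eq; apply: ge_inf; [exact: hS.2|exists q].
have /choice[q hq] n : exists q, E q /\ energy q < m + n.+1%:R^-1.
  have h : 0 < n.+1%:R^-1 :> R by rewrite invr_gt0.
  by have [_ [q Eq ->] lt] := inf_adherent h hS; exists q.
have Eq n : E (q n) by have [] := hq n.
have fq n : fin_norm (q n) by exact: Efin.
have [||h mh ch] := @lp_complete R _ T mu D mD p w p0 mw w0 q (fun n => (fq n).1).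
- exact: dom.
- move=> eps eps0; have m4 : 0 < 4 * (m + 1) by lra.
  (* The squared-distance analogue is at most 2 e m + 2 (e + C) del once the midpoint energy is
     bounded below by [m]; each of e m and (e + C) del is made at most eps/4. *)
  have e0 : 0 < eps / (4 * (m + 1)) by exact: divr_gt0.
  have [C C0 hC] := energy_convex e0; set e := eps / _ in e0 hC.
  have s0 : 0 < 4 * (e + C) by apply: mulr_gt0 => //; exact: (ltr_wpDr C0 e0).
  have [N hN] := inv_nat_small (divr_gt0 eps0 s0); set del := eps / _ in hN.
  exists N => a b /hN ha /hN hb.
  have hBf : fin_norm (fun x => q a x - q b x).
    have := fin_normD (fq a) (fin_normZ (-1) (fq b)); congr fin_norm.
    by apply/funext => x; rewrite mulN1r.
  have [_ ->] := lp_integrable mw w0 hBf.1 hBf.2; rewrite lee_fin.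
  have := hC _ _ (fq a) (fq b).
  have mM : m <= energy (fun x => (1 / 2)%:C * (q a x + q b x)) by apply: mle; apply: EZ; exact: ED.
  have := ler_wpM2l C0 mM; have := (hq a).2; have := (hq b).2.
  move=> h1 h2; set M := energy _ => h3 h4.
  have h5 : (e + C) * (energy (q a) + energy (q b)) <= (e + C) * (2 * m + 2 * del).
    by apply: ler_wpM2l; [exact: addr_ge0 (ltW e0) C0|exact: lt_sum_bound h2 h1 ha hb].
  have h6 : e * m <= eps / 4 by exact: ratio_le.
  have h7 : (e + C) * del = eps / 4 by apply: ratio_eq; exact: (ltr_wpDr C0 e0).
  exact: cauchy_arith h4 h5 h3 h6 h7.
have fh : fin_norm h.
  split=> //; have [N /(_ N (leqnn N)) h1] := ch 1 ltr01.
  have h2 : (lp mu D p w (fun x => h x - q N x)%R < +oo)%E by rewrite lpBC; apply: le_lt_trans h1 (ltry _).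
  have := @lp_fin_add R _ T mu D mD p w p0 mw w0 (fun x => h x - q N x) (q N) (cmeasB mh (fq N).1) (fq N).1 h2 (fq N).2.
  by congr (lp _ _ _ _ _ < +oo)%E; apply/funext => x; rewrite subrK.
have cl : closure_of h.
  split; [exact: fh|move=> e /ch[N /(_ N (leqnn N)) h1]; exists (q N); [exact: Eq|by rewrite lpBC]].
exists h; split; [exact: cl|move=> u [fu cu]].
have mu_ : m <= energy u.
  apply: le_of_split; first exact: energy_ge0.
  move=> e e0; have [K K0 hK] := energy_split e0; exists K; [exact: K0|move=> del del0].
  have [r Er hr] := cu _ del0.
  apply: le_trans (mle _ Er) _; apply: le_trans (hK _ _ (Efin Er) fu) _.
  rewrite lpBC in hr; apply: lerD; last exact: (ler_wpM2l K0 (dnI (Efin Er) fu hr)).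
  by apply: ler_wpM2l; [exact: addr_ge0 ler01 (ltW e0)|rewrite lerDl ltW].
apply: le_trans mu_; apply: le_of_split; [exact: m0|move=> e e0].
have [K K0 hK] := energy_split e0; exists K; [exact: K0|move=> del del0].
have [N1 h1] := ch del del0; have [N2 h2] := inv_nat_small del0.
have hr := h1 (maxn N1 N2) (leq_maxl _ _); have hs := h2 (maxn N1 N2) (leq_maxr _ _).
set n := maxn N1 N2 in hr hs; rewrite lpBC in hr.
apply: le_trans (hK _ _ fh (fq n)) _; apply: lerD; last exact: (ler_wpM2l K0 (dnI fh (fq n) hr)).
apply: ler_wpM2l; first exact: addr_ge0 ler01 (ltW e0).
by apply: ltW; apply: lt_le_trans (hq n).2 _; rewrite lerD2l.
Qed.

Definition residual u x := spow (A x - u x) (p - 1) * (f x)%:C - spow (u x) (p - 1) * (g x)%:C.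

Lemma residual_meas u : cm u -> cm (residual u).
Proof.
by move=> mu_; apply: cmeasB; apply: cmeasM; [apply: cmeas_spow; exact: cmeasB|exact: cmeasR
  |exact: cmeas_spow|exact: cmeasR].
Qed.

Lemma residual_integrable u q : fin_norm u -> fin_norm q -> cintegrable mu D (fun x => q x * residual u x).
Proof.
move=> hu hq; have [i1 i2 _] := fin_norm_parts hu; have [_ _ i3] := fin_norm_parts hq.
have i4 : ig (fun x => dn w q x + gap u x) by exact: eq_integrable (integrableD mD i3 (gap_integrable hu)).
apply: (cintegrable_le mD _ _ i4); first by apply: cmeasM; [exact: hq.1|apply: residual_meas; exact: hu.1].
move=> x Dx; rewrite /residual mulrBr; apply: le_trans (cabsB _ _) _.
rewrite (cabs_spow_weight _ _ p1 (f0 Dx)) (cabs_spow_weight _ _ p1 (g0 Dx)) /gap.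
have h1 := ler_wpM2r (f0 Dx) (powR_young p1 (cabs_ge0 (q x)) (cabs_ge0 (A x - u x))).
have h2 := ler_wpM2r (g0 Dx) (powR_young p1 (cabs_ge0 (q x)) (cabs_ge0 (u x))).
lra.
Qed.

(** Along h + t q, [cabs_taylor] bounds the energy by its value at h minus p t X plus 4 p t^p L.
    Minimality and division by p t give X <= 4 L t^(p-1) for all t > 0. *)
Lemma min_Re_le0 h q : closure_of h -> (forall u, closure_of u -> energy h <= energy u) -> E q ->
  complex.Re (cintegral mu D (fun x => q x * residual h x)) <= 0.
Proof.
move=> ch hmin Eq; have fh := ch.1; have fq := Efin Eq.
have [_ _ iq] := fin_norm_parts fq; have [iR _] := residual_integrable fh fq.
set X := complex.Re _; set L := I (dn w q).
have key (t : R) : 0 < t -> X <= 4 * L * t `^ (p - 1).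
  move=> t0; have fZ := EZ t%:C Eq.
  have c1 := closure_ofD ch fZ; have ht := hmin _ c1.
  have : energy (fun x => h x + t%:C * q x) <= 1 * I (fun x => gap h x - p * t * complex.Re (q x * residual h x)) + 4 * p * t `^ p * L.
    have i1 := integrableZl mD (p * t) iR.
    have i2 := integrableB mD (gap_integrable fh) i1.
    apply: fBw; [exact: gap_integrable c1.1|exact: eq_integrable i2|exact: iq|].
    move=> x Dx; rewrite mul1r /gap /residual.
    have t1 := cabs_taylor (A x - (h x + t%:C * q x)) (A x - h x) p1 p2.
    have t2 := cabs_taylor (h x + t%:C * q x) (h x) p1 p2.
    rewrite (_ : A x - (h x + t%:C * q x) - (A x - h x) = - (t%:C * q x)) in t1; last by ring.
    rewrite (_ : h x + t%:C * q x - h x = t%:C * q x) in t2; last by ring.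
    rewrite cabsN mulNr cReN in t1.
    have eR (z : R[i]) : complex.Re (t%:C * q x * z) = t * complex.Re (q x * z).
      by rewrite -mulrA cReM /= mul0r subr0.
    have eC : cabs (t%:C * q x) `^ p = t `^ p * cabs (q x) `^ p.
      by rewrite cabsM cabsR gtr0_norm// powRM ?cabs_ge0// ltW.
    rewrite eR eC in t1; rewrite eR eC in t2.
    have eM (z : R[i]) (k : R) : complex.Re (q x * (z * k%:C)) = complex.Re (q x * z) * k.
      by rewrite mulrA cReM /= mulr0 subr0.
    rewrite mulrBr cReD cReN !eM.
    exact: taylor_weights (f0 Dx) (g0 Dx) t1 t2.
  rewrite mul1r RintegralB//; last 2 first.
  - exact: gap_integrable.
  - exact: eq_integrable (integrableZl mD (p * t) iR).
  rewrite RintegralZl// -/(energy h) -[I (fun x => complex.Re _)]/X => h1.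
  have tp : t `^ p = t * t `^ (p - 1).
    by rewrite -[X in X * _]powRr1 ?(ltW t0)// -powRD ?(gt_eqF t0) ?implybT//; congr (_ `^ _); ring.
  have pt : 0 < p * t by exact: mulr_gt0.
  rewrite -(ler_pM2l pt); rewrite tp in h1; exact: first_order ht h1.
have L0 : 0 <= L by apply: Rintegral_ge0 => x Dx; rewrite mulr_ge0 ?powR_ge0 ?w0.
rewrite leNgt; apply/negP => X0.
have q0 : 0 < p - 1 by rewrite subr_gt0.
(* The test value of t^(p-1): with it 4 L t^(p-1) is smaller than X, a contradiction. *)
have b0 : 0 < X / (8 * (L + 1)) by apply: divr_gt0 => //; lra.
have := key _ (powR_gt0 (p - 1)^-1 b0).
rewrite -powRrM mulVf ?gt_eqF// powRr1 ?(ltW b0)//.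
by apply/negP; rewrite -ltNge; exact: scaled_lt.
Qed.

Theorem min_variational h q : closure_of h -> (forall u, closure_of u -> energy h <= energy u) -> E q ->
  cintegral mu D (fun x => q x * residual h x) = 0.
Proof.
move=> ch hmin Eq; have fh := ch.1; have iR := residual_integrable fh (Efin Eq).
have key c : complex.Re (c * cintegral mu D (fun x => q x * residual h x)) <= 0.
  rewrite -cintegralZ//; have := min_Re_le0 ch hmin (EZ c Eq).
  by under cintegral_eq do rewrite -mulrA.
(* E is a complex vector space, so the one-sided inequality holds for the four unit multiples of q,
   which kills both parts of the integral. *)
have h1 := key 1; have h2 := key (-1); have h3 := key (0 +i* 1); have h4 := key (0 +i* (-1)).
move: h1 h2 h3 h4; rewrite mul1r mulN1r cReN !cReM /=; set z := cintegral _ _ _.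
by move=> h1 h2 h3 h4; apply: complex_eq => /=; lra.
Qed.

End Minimisation.

(** * Uniqueness of Fourier coefficients *)

Section Threshold.
Context {R : realType}.
Implicit Types (x y dlt : R) (n : nat).

Lemma bernoulli_expr x n : -1 <= x -> 1 + n%:R * x <= (1 + x) ^+ n.
Proof.
move=> x1; have x0 : 0 <= 1 + x by lra.
elim: n => [|n IH]; first by rewrite mul0r addr0 expr0.
rewrite exprS; apply: le_trans (ler_wpM2l x0 IH).
have : 0 <= n%:R * x ^+ 2 by rewrite mulr_ge0// sqr_ge0.
rewrite -natr1 expr2; lra.
Qed.

(** The factor 1/8 keeps the values in [0, 1] for differences of two cosines: at dlt = -2 and n = 0
    the value is exactly 1. *)
Definition thr_base dlt n : R := 1 / 2 - dlt / 8 + (4 * n.+1%:R)^-1.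
(* For 0 <= s <= 1, (1 - s^N)^(2^N) tends to 1 if s < 1/2 and to 0 if s > 1/2;
   the last term of thr_base, which vanishes more slowly than 1/N, makes the
   limit 0 on the level set as well. *)
Definition threshold dlt n : R := (1 - thr_base dlt n ^+ (n.+1 * n.+1)) ^+ (2 ^ (n.+1 * n.+1)).

Lemma thr_base01 dlt n : -2 <= dlt <= 2 -> 0 <= thr_base dlt n <= 1.
Proof.
move=> /andP[d1 d2]; have n0 : 1 <= n.+1%:R :> R by rewrite ler1n.
have i0 : 0 <= (4 * n.+1%:R)^-1 :> R by rewrite invr_ge0 mulr_ge0.
have i1 : (4 * n.+1%:R)^-1 <= 4^-1 :> R by rewrite lef_pV2 ?posrE ?mulr_gt0//; lra.
by rewrite /thr_base; move: i0 i1; set i := (4 * _)^-1; move=> i0 i1; apply/andP; split; lra.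
Qed.

Lemma threshold01 dlt n : -2 <= dlt <= 2 -> 0 <= threshold dlt n <= 1.
Proof.
move=> /(thr_base01 n)/andP[t0 t1].
have tn0 : 0 <= thr_base dlt n ^+ (n.+1 * n.+1) by exact: exprn_ge0.
have tn1 : thr_base dlt n ^+ (n.+1 * n.+1) <= 1 by exact: exprn_ile1.
rewrite /threshold exprn_ge0 ?subr_ge0//= exprn_ile1 ?subr_ge0//; lra.
Qed.

(** Bernoulli's inequality gives the lower bound 1 - (2 s)^K, where 2 s is eventually at most 1 -
    dlt/8. *)
Lemma threshold_gt dlt : -2 <= dlt <= 2 -> 0 < dlt -> threshold dlt @ \oo --> (1 : R).
Proof.
move=> dd d0; have /andP[d1 d2] := dd.
pose rho := 1 - dlt / 8; have rho0 : 0 <= rho by rewrite /rho; lra.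
have rho1 : rho < 1 by rewrite /rho; lra.
have hrho : `|rho| < 1 by rewrite ger0_norm.
have c0 : (fun n => 1 - rho ^+ n) @ \oo --> (1 : R).
  by rewrite -[X in _ --> X]subr0; apply: cvgB; [exact: cvg_cst|exact: cvg_expr].
apply: (@squeeze_cvgr _ _ _ _ (fun n => 1 - rho ^+ n) (fun=> 1)) => //; last exact: cvg_cst.
have d8 : 0 < dlt / 4 by lra.
have [N hN] := inv_nat_small d8.
exists N => // n /= /hN hn; have /andP[_ ->] := threshold01 n dd; rewrite andbT.
have /andP[t0 t1] := thr_base01 n dd; set t := thr_base dlt n in t0 t1 *.
set K := (n.+1 * n.+1)%N.
have tk0 : 0 <= t ^+ K by exact: exprn_ge0.
have tk1 : t ^+ K <= 1 by exact: exprn_ile1.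
have x1 : -1 <= - (t ^+ K) by lra.
apply: le_trans (bernoulli_expr (2 ^ K) x1); rewrite mulrN lerD2l lerN2 natrX -exprMn.
have h2t : 2 * t <= rho.
  have e : 2 * t = 1 - dlt / 4 + n.+1%:R^-1 / 2.
    rewrite /t /thr_base; have : n.+1%:R != 0 :> R by rewrite pnatr_eq0.
    by move: (n.+1%:R : R) => y y1; field.
  rewrite e /rho; move: hn; set i := n.+1%:R^-1 => hn; lra.
have t20 : 0 <= 2 * t by rewrite mulr_ge0.
apply: le_trans (_ : rho ^+ K <= _); first exact: lerXn2r.
apply: ler_wiXn2l; rewrite ?rho0 ?ltW//.
by rewrite /K (leq_trans (leqnSn n))// leq_pmulr.
Qed.

(** Multiplying by (1 + s^K)^(2^K) gives at most 1, and this factor is at least (2 s)^K >= (1 +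
    1/(2(n+1)))^K >= (n+1)/2 because K = (n+1)^2. Hence the bound 2/(n+1). *)
Lemma threshold_le dlt : -2 <= dlt <= 2 -> dlt <= 0 -> threshold dlt @ \oo --> (0 : R).
Proof.
move=> dd d0.
have c0 : (fun n => 2 * n.+1%:R^-1 : R) @ \oo --> (0 : R).
  by rewrite -[X in _ --> X](mulr0 2); apply: cvgM; [exact: cvg_cst|exact: cvg_harmonic].
apply: (@squeeze_cvgr _ _ _ _ (fun=> 0) (fun n => 2 * n.+1%:R^-1)) => //; last exact: cvg_cst.
exists 0%N => // n _ /=; have /andP[y0 _] := threshold01 n dd; rewrite y0/=.
have /andP[t0 t1] := thr_base01 n dd; rewrite /threshold; set t := thr_base dlt n in t0 t1 *.
set K := (n.+1 * n.+1)%N; set M := (2 ^ K)%N.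
have tk0 : 0 <= t ^+ K by exact: exprn_ge0.
have tk1 : t ^+ K <= 1 by exact: exprn_ile1.
have n0 : 0 < n.+1%:R :> R by rewrite ltr0n.
have h2t : 1 + (2 * n.+1%:R)^-1 <= 2 * t.
  have e : 2 * t = 1 - dlt / 4 + (2 * n.+1%:R)^-1.
    rewrite /t /thr_base; have : n.+1%:R != 0 :> R by rewrite pnatr_eq0.
    by move: (n.+1%:R : R) => y y1; field.
  rewrite e; set i := (2 * _)^-1; lra.
have i0 : 0 <= (2 * n.+1%:R)^-1 :> R by rewrite invr_ge0 mulr_ge0// ltW.
have big : n.+1%:R / 2 <= (2 * t) ^+ K.
  apply: le_trans (_ : (1 + (2 * n.+1%:R)^-1) ^+ K <= _); last by apply: lerXn2r; rewrite ?nnegrE ?addr_ge0 ?mulr_ge0.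
  have x1 : -1 <= (2 * n.+1%:R)^-1 :> R by apply: le_trans i0; rewrite oppr_le0 ler01.
  apply: le_trans (bernoulli_expr K x1); rewrite /K natrM.
  have -> : n.+1%:R * n.+1%:R * (2 * n.+1%:R)^-1 = n.+1%:R / 2 :> R by field; rewrite gt_eqF.
  lra.
have prod1 : (1 - t ^+ K) ^+ M * (1 + t ^+ K) ^+ M <= 1.
  rewrite -exprMn; apply: exprn_ile1.
    by rewrite mulr_ge0 ?subr_ge0 ?addr_ge0.
  have := sqr_ge0 (t ^+ K); rewrite expr2; lra.
have mt : (2 * t) ^+ K <= (1 + t ^+ K) ^+ M.
  rewrite exprMn; have x1 : -1 <= t ^+ K by lra.
  apply: le_trans (bernoulli_expr M x1); rewrite /M natrX; lra.
have Y0 : 0 <= (1 - t ^+ K) ^+ M by rewrite exprn_ge0 ?subr_ge0.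
have h : (1 - t ^+ K) ^+ M * (n.+1%:R / 2) <= 1.
  apply: le_trans prod1; apply: ler_wpM2l => //; exact: le_trans mt.
rewrite -[leRHS]mul1r -[X in _ <= 1 * (X * _)](invrK 2) -invfM mul1r.
by rewrite -[leRHS]mul1r ler_pdivlMr ?mulr_gt0// mulrC (mulrC 2^-1) mulrC.
Qed.

End Threshold.

(** * Uniqueness theorem *)

Section FourierUniqueness.
Context {R : realType}.
Local Notation leb := (@lebesgue_measure R).
Local Notation cir := (circle : set (measurableTypeR R)).
Implicit Types (F u : R -> R[i]).

Let mc : measurable cir. Proof. exact: measurable_itv. Qed.

(** Vanishing of all Fourier coefficients of u F. The property is linear in u and stable under
    multiplication by exponentials, so it reaches powers of trigonometric polynomials by induction
    on the exponents, without expanding them. *)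
Definition annihilates u F := forall k : int,
  cintegrable leb cir (fun x => expi (k%:~R * x) * (u x * F x)) /\
  cintegral leb cir (fun x => expi (k%:~R * x) * (u x * F x)) = 0.

Lemma annihilatesD u v F : annihilates u F -> annihilates v F -> annihilates (fun x => u x + v x) F.
Proof.
move=> hu hv k; have [iu u0] := hu k; have [iv v0] := hv k.
have e x : expi (k%:~R * x) * ((u x + v x) * F x) =
  expi (k%:~R * x) * (u x * F x) + expi (k%:~R * x) * (v x * F x) by ring.
rewrite (_ : (fun x => _ * (_ * _)) = (fun x => expi (k%:~R * x) * (u x * F x) + expi (k%:~R * x) * (v x * F x))); last exact/funext.
split; first exact: (cintegrableD mc iu iv).
by rewrite (cintegralD mc iu iv) u0 v0 addr0.
Qed.

Lemma annihilatesZ c u F : annihilates u F -> annihilates (fun x => c * u x) F.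
Proof.
move=> hu k; have [iu u0] := hu k.
rewrite (_ : (fun x => _ * (_ * _)) = (fun x => c * (expi (k%:~R * x) * (u x * F x)))); last by apply/funext => x; ring.
split; first exact: (cintegrableZ mc c iu).
by rewrite (cintegralZ mc c iu) u0 mulr0.
Qed.

Lemma annihilates_expi (l : int) u F : annihilates u F -> annihilates (fun x => expi (l%:~R * x) * u x) F.
Proof.
move=> hu k; have [iu u0] := hu (k + l).
rewrite (_ : (fun x => _ * (_ * _)) = (fun x => expi ((k + l)%:~R * x) * (u x * F x)))//.
by apply/funext => x; rewrite intrD mulrDl expiD; ring.
Qed.

Lemma expi_cos (x m : R) : (cos (x - m))%:C = (1 / 2)%:C * (expi (- m) * expi (1%:~R * x)) +
  (1 / 2)%:C * (expi m * expi ((-1)%:~R * x)).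
Proof.
have -> : expi (- m) * expi (1%:~R * x) = expi (x - m) by rewrite -expiD mulr1z mul1r addrC.
have -> : expi m * expi ((-1)%:~R * x) = expi (- (x - m)) by rewrite -expiD mulrN1z mulN1r opprB.
by rewrite expiN; apply: complex_eq; rewrite ?cReM ?cImM ?cReD ?cImD ?cReC ?cImC /=; field.
Qed.

Lemma annihilates_affine (a b m : R) u F : annihilates u F ->
  annihilates (fun x => (a + b * cos (x - m))%:C * u x) F.
Proof.
move=> hu.
have h1 := annihilatesZ (b%:C * ((1 / 2)%:C * expi (- m))) (annihilates_expi 1 hu).
have h2 := annihilatesZ (b%:C * ((1 / 2)%:C * expi m)) (annihilates_expi (-1) hu).
have := annihilatesD (annihilatesZ a%:C hu) (annihilatesD h1 h2).
congr (annihilates _ _); apply/funext => x.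
have -> : (a + b * cos (x - m))%:C = a%:C + b%:C * (cos (x - m))%:C.
  by apply: complex_eq; rewrite ?cReD ?cImD ?cReM ?cImM /=; ring.
by rewrite expi_cos; ring.
Qed.

Lemma annihilates_threshold (c m : R) n u F : annihilates u F ->
  annihilates (fun x => (threshold (cos (x - m) - c) n)%:C * u x) F.
Proof.
move=> hu; rewrite /threshold; set K := (n.+1 * n.+1)%N.
have step v j : annihilates v F -> annihilates (fun x => (thr_base (cos (x - m) - c) n ^+ j)%:C * v x) F.
  move=> hv; elim: j => [|j IH].
    by move: hv; congr (annihilates _ _); apply/funext => x; rewrite expr0 mul1r.
  have := annihilates_affine (1 / 2 + c / 8 + (4 * n.+1%:R)^-1) (- (1 / 8)) m IH.
  congr (annihilates _ _); apply/funext => x; rewrite exprS rmorphM/= mulrA; congr (_ * _ * _).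
  by rewrite /thr_base; congr (_%:C); field.
elim: (2 ^ K)%N => [|j IH].
  by move: hu; congr (annihilates _ _); apply/funext => x; rewrite expr0 mul1r.
have := annihilatesD IH (annihilatesZ (-1) (step _ K IH)).
congr (annihilates _ _); apply/funext => x.
by rewrite exprS rmorphM rmorphB/= !rmorph1; ring.
Qed.

(** The interval ]-pi, t[ is the arc with midpoint (t - pi)/2 and half-length (t + pi)/2, so
    membership is a comparison of cosines. When x - m exceeds pi the distance is measured the other
    way round the circle. *)
Lemma cos_gt_interval (t x : R) : - pi <= t -> t <= pi -> circle x ->
  (cos ((t + pi) / 2) < cos (x - (t - pi) / 2)) = (- pi < x < t).
Proof.
move=> t1 t2; rewrite /circle/= in_itv/= => /andP[x1 x2].
have pi0 := pi_gt0 R.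
set m := (t - pi) / 2; set r := (t + pi) / 2.
have r0 : 0 <= r by rewrite /r; lra.
have rpi : r <= pi by rewrite /r; lra.
have ri : r \in `[0, pi] by rewrite in_itv/= r0.
have [xm|xm] := leP 0 (x - m); last first.
  have h : - (x - m) \in `[0, pi] by rewrite in_itv/=; apply/andP; split; move: xm; rewrite /m; lra.
  rewrite -(cosN (x - m)) ltr_cos//=; apply/idP/idP => [h1|/andP[h1 h2]].
    by apply/andP; split; move: h1 xm; rewrite /m /r; lra.
  by rewrite /m /r; lra.
have [xp|xp] := leP (x - m) pi.
  have h : x - m \in `[0, pi] by rewrite in_itv/= xm.
  rewrite ltr_cos//=; apply/idP/idP => [h1|/andP[h1 h2]].
    by apply/andP; split; move: h1 xm; rewrite /m /r; lra.
  by rewrite /m /r; lra.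
have h : 2 * pi - (x - m) \in `[0, pi] by rewrite in_itv/=; apply/andP; split; move: xp; rewrite /m; lra.
have -> : cos (x - m) = cos (2 * pi - (x - m)).
  have -> : 2 * pi - (x - m) = - (x - m) + pi + pi by ring.
  by rewrite !cosDpi opprK cosN.
rewrite ltr_cos//=; apply/idP/idP => [h1|/andP[h1 h2]].
  by exfalso; move: h1; rewrite /m /r; lra.
by exfalso; move: xp h2; rewrite /m; lra.
Qed.

(** The trigonometric polynomials obtained by composing [threshold] with a cosine stay in [0, 1] and
    converge at every point to the indicator of ]-pi, t[; dominated convergence carries the
    vanishing integrals over. *)
Lemma initial_integral0 F (t : R) : (cintegrable leb cir F) ->
  (forall k : int, cintegral leb cir (fun x => expi (k%:~R * x) * F x) = 0) ->
  - pi <= t -> t <= pi ->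
  \int[leb]_(x in cir) (complex.Re (F x) * (x \in `]- pi, t[)%:R) = 0 /\
  \int[leb]_(x in cir) (complex.Im (F x) * (x \in `]- pi, t[)%:R) = 0.
Proof.
move=> iF hF t1 t2; set c := cos ((t + pi) / 2); set m := (t - pi) / 2.
have mF := cintegrable_meas mc iF; have /cmeasP[mR mI] := mF.
have h0 : annihilates (fun=> 1) F.
  move=> k; rewrite (_ : (fun x => _ * (_ * _)) = (fun x => expi (k%:~R * x) * F x)); last by apply/funext => x; rewrite mul1r.
  split=> //; apply: (cintegrableMb mc iF (M := 1)).
    by apply: cmeas_expi; exact: measurable_funM.
  by move=> x _; rewrite cabs_expi.
pose P n x := threshold (cos (x - m) - c) n.
have dd x : -2 <= cos (x - m) - c <= 2.
  have := cos_le1 (x - m); have := cos_geN1 (x - m); have := cos_le1 ((t + pi) / 2); have := cos_geN1 ((t + pi) / 2).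
  by rewrite -/c => a1 a2 a3 a4; apply/andP; split; lra.
have P01 n x : 0 <= P n x <= 1 by exact: threshold01.
have mcos : measurable_fun cir (fun x => cos (x - m)).
  have mB : measurable_fun cir (fun x : measurableTypeR R => x - m) by exact: measurable_funB.
  by have /cmeasP[] := cmeas_expi mB.
have mP n : measurable_fun cir (P n).
  rewrite /P /threshold /thr_base; apply: measurable_funX; apply: measurable_funB => //; apply: measurable_funX.
  by apply: measurable_funD => //; apply: measurable_funB => //; apply: measurable_funM => //; exact: measurable_funB.
have Pc x : circle x -> P n x @[n --> \oo] --> ((x \in `]- pi, t[)%:R : R).
  move=> cx; rewrite in_itv/= -(cos_gt_interval t1 t2 cx) -/c -/m.
  have [h|h] := ltP c (cos (x - m)).
    by apply: threshold_gt => //; rewrite subr_gt0.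
  by apply: threshold_le => //; rewrite subr_le0.
have part (G : R -> R) : leb.-integrable cir (EFin \o G) ->
    (forall n, \int[leb]_(x in cir) (P n x * G x) = 0) ->
    \int[leb]_(x in cir) (G x * (x \in `]- pi, t[)%:R) = 0.
  move=> iG hG; have mG : measurable_fun cir G by have /integrableP[/measurable_EFinP] := iG.
  have iN : leb.-integrable cir (EFin \o (fun x => `|G x|)) by exact: integrable_norm.
  have [] := @Rintegral_cvg R _ (measurableTypeR R) leb cir mc (fun n x => P n x * G x)
    (fun x => G x * (x \in `]- pi, t[)%:R) (fun x => `|G x|) _ _ _ iN _.
  - by move=> n; exact: measurable_funM.
  - apply: measurable_funM => //; have e : (fun x : measurableTypeR R => (x \in `]- pi, t[)%:R : R) = \1_(`]- pi, t[%classic).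
      by apply/funext => x; rewrite indicE mem_setE.
    by rewrite e; apply: measurable_indic; exact: measurable_itv.
  - by apply: nearW => x cx; rewrite mulrC; apply: cvgM; [exact: Pc|exact: cvg_cst].
  - move=> n x _; rewrite normrM; have /andP[a b] := P01 n x.
    by rewrite ger0_norm// ler_piMl.
  move=> _; under eq_fun do rewrite hG.
  by move=> h; apply/esym; apply: (cvg_unique _ (cvg_cst 0) h).
have [iR iI] := iF.
split; apply: part => // n; have [_ /(congr1 (@complex.Re R))] := annihilates_threshold c m n h0 0.
- rewrite Re_cintegral /= => <-; apply: eq_Rintegral => x _.
  by rewrite mulr0z mul0r expi0 mul1r mulr1 cReM /= mul0r subr0.
- have [_ /(congr1 (@complex.Im R))] := annihilates_threshold c m n h0 0.
  rewrite /cintegral /= => <- _; apply: eq_Rintegral => x _.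
  by rewrite mulr0z mul0r expi0 mul1r mulr1 cImM /= mul0r addr0.
Qed.

(** The primitive of G, extended by 0, is identically zero, and almost everywhere its derivative is
    G. *)
Lemma initial_integral_ae0 (G : R -> R) : leb.-integrable cir (EFin \o G) ->
  (forall t, - pi <= t -> t <= pi -> \int[leb]_(x in cir) (G x * (x \in `]- pi, t[)%:R) = 0) ->
  {ae leb, forall x, circle x -> G x = 0}.
Proof.
move=> iG hG; have pi0 := pi_gt0 R.
have mG : measurable_fun cir G by have /integrableP[/measurable_EFinP] := iG.
pose f := G \_ cir.
have iF : leb.-integrable setT (EFin \o f).
  by have /(integrable_mkcond _ mc) := iG; apply: eq_integrable => // x _; rewrite /f /= /patch; case: ifP.
pose a : itv_bound R := BRight (- pi).
have F0 x : \int[leb]_(t in [set` Interval a (BRight x)]) f t = 0.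
  have [xpi|xpi] := leP x (- pi).
    rewrite (_ : [set` _] = set0) ?Rintegral_set0//.
    by apply/seteqP; split => y //=; rewrite /a in_itv/= => /andP[h1 h2]; lra.
  pose t := Num.min x pi.
  have t1 : - pi <= t by rewrite le_min (ltW xpi) /=; lra.
  have t2 : t <= pi by rewrite ge_min lexx orbT.
  rewrite /f -Rintegral_mkcondr (_ : _ `&` _ = [set` Interval a (BRight t)]); last first.
    apply/seteqP; split => y /=; rewrite /circle/= /a !in_itv/= le_min.
      by move=> [/andP[-> ->] /andP[_ ->]].
    by move=> /andP[h1 /andP[-> ->]]; rewrite h1 (ltW h1).
  have sub : [set` Interval a (BLeft t)] `<=` cir.
    by move=> y; rewrite /circle/= /a !in_itv/= => /andP[h1 h2]; rewrite (ltW h1) (ltW (lt_le_trans h2 t2)).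
  rewrite -Rintegral_itv_bndo_bndc; last by apply: integrableS iG => //; exact: measurable_itv.
  rewrite -[RHS](hG t t1 t2) -(setIidr sub) Rintegral_mkcondr.
  apply: eq_Rintegral => y _; rewrite /patch mem_setE.
  by case: ifP => _; rewrite ?mulr1 ?mulr0.
have h1 y : leb.-integrable [set` Interval a (BRight y)] (EFin \o f).
  by apply: integrableS iF => //; exact: measurable_itv.
have D0 := FTC1 h1 (integrable_locally mc iG).
have N0 : {ae leb, forall x : R, x != - pi}.
  exists [set (- pi : R)]; split; [exact: measurable_set1|exact: lebesgue_measure_set1|].
  by move=> x /= /negP; rewrite negbK => /eqP.
apply: ae_mono (ae_and D0 N0) _ => x [hD xn] cx.
have xpi : - pi < x by move: cx; rewrite /circle/= in_itv/= lt_def xn => /andP[].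
have [|_] := hD; first by rewrite /a /= lte_fin.
rewrite (_ : (fun _ => _) = cst 0); last exact/funext.
by rewrite derive1_cst /f /patch mem_set.
Qed.

Theorem fourier_uniqueness F : cintegrable leb cir F ->
  (forall k : int, cintegral leb cir (fun x => expi (k%:~R * x) * F x) = 0) ->
  {ae leb, forall x, circle x -> F x = 0}.
Proof.
move=> iF hF; have [iR iI] := iF.
have hR : {ae leb, forall x, circle x -> complex.Re (F x) = 0}.
  by apply: initial_integral_ae0 => // t t1 t2; have [] := initial_integral0 iF hF t1 t2.
have hI : {ae leb, forall x, circle x -> complex.Im (F x) = 0}.
  by apply: initial_integral_ae0 => // t t1 t2; have [] := initial_integral0 iF hF t1 t2.
apply: ae_mono (ae_and hR hI) _ => x [h1 h2] cx; apply: complex_eq; [exact: h1|exact: h2].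
Qed.

End FourierUniqueness.

(** * Products of integrable functions with one-sided spectra *)

Section PastPolynomials.
Context {R : realType}.
Local Notation leb := (@lebesgue_measure R).
Local Notation cir := (circle : set (measurableTypeR R)).
Implicit Types (F u v : R -> R[i]).

Let mc : measurable cir. Proof. exact: measurable_itv. Qed.

Lemma leb_circle : leb cir = (2 * pi)%:E.
Proof.
have pi0 := pi_gt0 R.
rewrite /circle lebesgue_measure_itv/= lte_fin ifT; last lra.
by rewrite -EFinD; congr EFin; ring.
Qed.

Lemma integral_cos0 (k : R) : k != 0 -> sin (k * pi) = 0 ->
  \int[leb]_(x in cir) cos (k * x) = 0.
Proof.
move=> k0 sk; have pi0 := pi_gt0 R.
have dF (x : R) : is_derive x 1 (fun x => k^-1 * sin (k * x)) (cos (k * x)).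
  apply: is_derive_eq; rewrite /GRing.scale/=.
  by rewrite mulr1 ?addr0 mulrCA mulVf// ?mulr1.
have cc : continuous (fun x : R => cos (k * x)).
  by move=> x; apply: continuous_comp; [exact: mulrl_continuous|exact: continuous_cos].
have cF : continuous (fun x : R => k^-1 * sin (k * x)).
  by move=> x; apply: cvgM; [exact: cvg_cst|apply: continuous_comp; [exact: mulrl_continuous|exact: continuous_sin]].
rewrite /Rintegral (@continuous_FTC2 R _ (fun x => k^-1 * sin (k * x)) (- pi) pi).
- by rewrite mulrN sinN sk oppr0 mulr0 -EFinB subrr.
- lra.
- by apply: continuous_subspaceT.
- split.
  + by move=> x _; apply: ex_derive.
  + by apply: cvg_at_right_filter; exact: cF.
  + by apply: cvg_at_left_filter; exact: cF.
- by move=> x _; rewrite derive1E; apply: derive_val.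
Qed.

Lemma integral_sin0 (k : R) : \int[leb]_(x in cir) sin (k * x) = 0.
Proof.
have [->|k0] := eqVneq k 0.
  by rewrite /Rintegral; under eq_integral do rewrite mul0r sin0; rewrite integral0.
have pi0 := pi_gt0 R.
have dF (x : R) : is_derive x 1 (fun x => - (k^-1 * cos (k * x))) (sin (k * x)).
  apply: is_derive_eq; rewrite /GRing.scale/=.
  by rewrite mulr1 ?addr0 mulNr mulrN opprK mulrCA mulVf// ?mulr1.
have cc : continuous (fun x : R => sin (k * x)).
  by move=> x; apply: continuous_comp; [exact: mulrl_continuous|exact: continuous_sin].
have cF : continuous (fun x : R => - (k^-1 * cos (k * x))).
  by move=> x; apply: cvgN; apply: cvgM; [exact: cvg_cst|apply: continuous_comp; [exact: mulrl_continuous|exact: continuous_cos]].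
rewrite /Rintegral (@continuous_FTC2 R _ (fun x => - (k^-1 * cos (k * x))) (- pi) pi).
- by rewrite mulrN cosN -EFinB subrr.
- lra.
- by apply: continuous_subspaceT.
- split.
  + by move=> x _; apply: ex_derive.
  + by apply: cvg_at_right_filter; exact: cF.
  + by apply: cvg_at_left_filter; exact: cF.
- by move=> x _; rewrite derive1E; apply: derive_val.
Qed.

Lemma sin_natpi (n : nat) : sin (n%:R * pi) = 0 :> R.
Proof. by elim: n => [|n IH]; rewrite ?mul0r ?sin0// -natr1 mulrDl mul1r sinDpi IH oppr0. Qed.

Lemma cintegral_expi (k : int) : k != 0 -> cintegral leb cir (fun x => expi (k%:~R * x)) = 0.
Proof.
move=> k0; rewrite /cintegral /expi /=.
have kR : k%:~R != 0 :> R by rewrite intr_eq0.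
have s0 : sin (k%:~R * pi) = 0 :> R.
  by case: k {k0 kR} => n; rewrite ?NegzE ?mulrNz ?mulNr ?sinN sin_natpi ?oppr0.
by rewrite (integral_cos0 kR s0) (integral_sin0 k%:~R).
Qed.

Lemma integrable_cst_circle (k : R) : leb.-integrable cir (EFin \o (fun=> k)).
Proof.
have h : (leb cir < +oo)%E by rewrite leb_circle ltry.
exact: (@integrable_bounded_cst R _ (measurableTypeR R) leb cir k mc h).
Qed.

Lemma cintegrable_bounded F (M : R) : cmeas cir F -> (forall x, circle x -> cabs (F x) <= M) ->
  cintegrable leb cir F.
Proof. by move=> mF FM; apply: (cintegrable_le mc mF FM); exact: integrable_cst_circle. Qed.

Lemma cmeas_expiZ (k : R) : cmeas cir (fun x => expi (k * x)).
Proof. by apply: cmeas_expi; exact: measurable_funM. Qed.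

Definition past u := exists b, u = past_polynomial b.

Lemma past_polynomial_widen b n x : (size b <= n)%N ->
  past_polynomial b x = \sum_(j < n) b`_j * expi (- (j.+1)%:R * x) :> R[i].
Proof.
move=> bn; rewrite /past_polynomial -(big_mkord xpredT (fun j => b`_j * expi (- (j.+1)%:R * x))).
rewrite -(big_mkord xpredT (fun j => b`_j * expi (- (j.+1)%:R * x))) [RHS](big_cat_nat (leq0n _) bn)//=.
rewrite [X in _ = _ + X]big_nat_cond [X in _ = _ + X]big1 ?addr0// => j /andP[/andP[bj _] _].
by rewrite nth_default ?mul0r.
Qed.

Lemma past0 : past (fun=> 0).
Proof. by exists [::]; apply/funext => x; rewrite /past_polynomial big_ord0. Qed.

Lemma past_expi (k : nat) : past (fun x => expi (- k.+1%:R * x)).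
Proof.
exists (rcons (nseq k 0) 1); apply/funext => x.
rewrite /past_polynomial size_rcons size_nseq big_ord_recr /= nth_rcons size_nseq ltnn eqxx mul1r.
rewrite big1 ?add0r// => j _; rewrite nth_rcons size_nseq ltn_ord nth_nseq ltn_ord mul0r//.
Qed.

Lemma pastD u v : past u -> past v -> past (fun x => u x + v x).
Proof.
move=> [b ->] [c ->]; exists (mkseq (fun j => b`_j + c`_j) (maxn (size b) (size c))).
apply/funext => x; rewrite [RHS]/past_polynomial size_mkseq.
rewrite (past_polynomial_widen x (leq_maxl (size b) (size c))) (past_polynomial_widen x (leq_maxr (size b) (size c))).
by rewrite -big_split/=; apply: eq_bigr => j _; rewrite nth_mkseq// mulrDl.
Qed.

Lemma pastZ c u : past u -> past (fun x => c * u x).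
Proof.
move=> [b ->]; exists (mkseq (fun j => c * b`_j) (size b)).
apply/funext => x; rewrite [RHS]/past_polynomial size_mkseq mulr_sumr.
by apply: eq_bigr => j _; rewrite nth_mkseq// mulrA.
Qed.

Lemma past_cmeas u : past u -> cmeas cir u.
Proof.
by move=> [b ->]; apply: cmeas_sum => j; apply: cmeasM; [exact: cmeas_cst|exact: cmeas_expiZ].
Qed.

Lemma past_bounded u : past u -> exists2 M : R, 0 <= M & forall x, cabs (u x) <= M.
Proof.
move=> [b ->]; exists (\sum_(j < size b) cabs b`_j); first by apply: sumr_ge0 => j _; exact: cabs_ge0.
move=> x; apply: le_trans (cabs_sum _ _) _; apply: ler_sum => j _.
by rewrite cabsM cabs_expi mulr1.
Qed.

Lemma past_fin_norm (p : R) (f g : R -> R) u : 0 < p ->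
  measurable_fun cir f -> measurable_fun cir g ->
  (forall x, circle x -> 0 <= f x) -> (forall x, circle x -> 0 <= g x) ->
  leb.-integrable cir (EFin \o f) -> leb.-integrable cir (EFin \o g) ->
  past u -> fin_norm leb cir p f g u.
Proof.
move=> p0 mf mg f0 g0 iF iG pu; have mu_ := past_cmeas pu; split => //.
have [M M0 uM] := past_bounded pu.
have iw : leb.-integrable cir (fun x => (f x + g x)%:E) by exact: eq_integrable (integrableD mc iF iG).
have iM := integrableZl mc (M `^ p) iw.
have /integrableP[_] := iM; apply: le_lt_trans; apply: ge0_le_integral => //.
- by move=> x cx; rewrite lee_fin mulr_ge0 ?powR_ge0 ?addr_ge0 ?f0 ?g0.
- by apply: (@measurable_lp R _ (measurableTypeR R)) => //; exact: measurable_funD.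
- by apply: measurableT_comp => //; have /integrableP[] := iM.
- move=> x cx; have w0 : 0 <= f x + g x by rewrite addr_ge0 ?f0 ?g0.
  rewrite -EFinM /= lee_fin ger0_norm ?mulr_ge0 ?powR_ge0// ler_wpM2r//.
  by apply: ge0_ler_powR; rewrite ?nnegrE ?cabs_ge0 ?(ltW p0).
Qed.

(** The pairing is bilinear, without conjugation: K has no positive frequencies. The constant 1
    qualifies, and multiplication by an exponential of nonpositive frequency preserves the
    property. *)
Definition past_null K := cintegrable leb cir K /\
  forall k : nat, cintegral leb cir (fun x => expi (- k.+1%:R * x) * K x) = 0.

Lemma cintegrable_expiM (k : R) K : cintegrable leb cir K ->
  cintegrable leb cir (fun x => expi (k * x) * K x).
Proof.
move=> iK; apply: (cintegrableMb mc iK (M := 1)); first exact: cmeas_expiZ.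
by move=> x _; rewrite cabs_expi.
Qed.

Lemma past_null_shift (k : nat) K : past_null K -> past_null (fun x => expi (- k%:R * x) * K x).
Proof.
move=> [iK hK]; split; first exact: cintegrable_expiM.
move=> j; rewrite -[RHS](hK (j + k)%N); apply: cintegral_eq => x _.
by rewrite mulrA -expiD -mulrDl -opprD -natrD addSn.
Qed.

Lemma past_null_past u K : past u -> past_null K ->
  cintegrable leb cir (fun x => u x * K x) /\ cintegral leb cir (fun x => u x * K x) = 0.
Proof.
move=> [b ->] [iK hK].
have e x : past_polynomial b x * K x = \sum_(j < size b) b`_j * (expi (- (j.+1)%:R * x) * K x).
  by rewrite /past_polynomial mulr_suml; apply: eq_bigr => j _; rewrite mulrA.
have i1 j : cintegrable leb cir (fun x => b`_j * (expi (- (j.+1)%:R * x) * K x)).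
  by apply: (cintegrableZ mc); exact: cintegrable_expiM.
rewrite (_ : (fun x => _) = (fun x => \sum_(j < size b) b`_j * (expi (- (j.+1)%:R * x) * K x))); last exact/funext.
split; first by apply: (cintegrable_sum mc) => j; exact: i1.
rewrite (@cintegral_sum R _ (measurableTypeR R) leb cir mc _ _ (fun (j : 'I_(size b)) x => b`_j * (expi (- (j.+1)%:R * x) * K x)) (fun j => i1 j)) big1// => j _.
by rewrite (cintegralZ mc) ?hK ?mulr0//; exact: cintegrable_expiM.
Qed.

Lemma past_null1 : past_null (fun=> 1).
Proof.
split; first by apply: (cintegrable_bounded (M := 1)) => [|x _]; [exact: cmeas_cst|rewrite -[1]expi0 cabs_expi].
move=> k; rewrite -[RHS](@cintegral_expi (- (k.+1)%:Z)); last by rewrite oppr_eq0.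
by apply: cintegral_eq => x _; rewrite mulr1 mulrNz.
Qed.

End PastPolynomials.

(** * Projection onto the past in weighted L^2 *)

Section Orthogonality.
Context {R : realType}.
Local Notation leb := (@lebesgue_measure R).
Local Notation cir := (circle : set (measurableTypeR R)).
Implicit Types (F G K u v m h O : R -> R[i]) (w : R -> R).
Local Notation cm u := (cmeas cir u).
Local Notation N w u := (lp leb cir 2 w u).
Local Notation Nv w u := (lp leb cir 2 (fun x => (w x)^-1) u).

Let mc : measurable cir. Proof. exact: measurable_itv. Qed.

Lemma circle_eq F G : F =1 G -> cintegral leb cir F = cintegral leb cir G.
Proof. by move=> h; apply: cintegral_eq => x _; exact: h. Qed.

Lemma cintegral_conj0 F : cintegrable leb cir F -> cintegral leb cir F = 0 ->
  cintegral leb cir (fun x => (F x)^*) = 0.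
Proof. by move=> iF F0; rewrite (cintegral_conj mc iF) F0; apply: complex_eq; rewrite ?cReC ?cImC //= oppr0. Qed.

Lemma conj_expiM (k x : R) (z : R[i]) : (expi (- k * x) * z)^* = expi (k * x) * z^*.
Proof.
by rewrite mulNr expiN; apply: complex_eq; rewrite ?cReC ?cImC ?cReM ?cImM ?cReC ?cImC; ring.
Qed.

Lemma measurable_inv w : measurable_fun cir w -> (forall x, circle x -> 0 < w x) ->
  measurable_fun cir (fun x => (w x)^-1).
Proof.
move=> mw w0; have h : measurable_fun cir (fun x => w x `^ (-1)).
  exact: (measurableT_comp (measurable_powR _)).
apply: eq_measurable_fun h => x /set_mem cx; rewrite powR_inv1// ltW//; exact: w0.
Qed.

Lemma young_weight (a b del k : R) : 0 < del -> 0 < k ->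
  a * b <= del^-1 * (a ^+ 2 * k) + del * (b ^+ 2 * k^-1).
Proof.
move=> d0 k0; have h := sqr_ge0 (a - del * b / k).
have dk : 0 < del * k^-1 by rewrite mulr_gt0 ?invr_gt0.
have i0 : 0 < k / del by rewrite divr_gt0.
have := mulr_ge0 (ltW i0) h.
have -> : k / del * (a - del * b / k) ^+ 2 = del^-1 * (a ^+ 2 * k) + del * (b ^+ 2 * k^-1) - 2 * (a * b).
  by field; rewrite !gt_eqF.
move=> h1; have [ab|ab] := leP 0 (a * b); first lra.
apply: le_trans (ltW ab) _; apply: addr_ge0; apply: mulr_ge0.
- by rewrite invr_ge0 ltW.
- by apply: mulr_ge0; [exact: sqr_ge0|exact: ltW].
- exact: ltW.
- by apply: mulr_ge0; [exact: sqr_ge0|rewrite invr_ge0 ltW].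
Qed.

Lemma cnorm1_young w u v (del : R) : measurable_fun cir w -> (forall x, circle x -> 0 < w x) ->
  cm u -> cm v -> 0 < del ->
  (cnorm1 leb cir (fun x => (u x * v x)%R) <= (del^-1)%:E * N w u + del%:E * Nv w v)%E.
Proof.
move=> mw w0 mu_ mv d0; have mi := measurable_inv mw w0.
have w0' x : circle x -> 0 <= w x by move=> /w0/ltW.
have i0' x : circle x -> 0 <= (w x)^-1 by move=> /w0; rewrite -invr_gt0 => /ltW.
have m1 := @measurable_lp R _ (measurableTypeR R) cir 2 w mw u mu_.
have m2 := @measurable_lp R _ (measurableTypeR R) cir 2 _ mi v mv.
rewrite /lp -!ge0_integralZl//; do ?[by move=> x Dx; rewrite lee_fin ?mulr_ge0 ?powR_ge0 ?w0' ?i0'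
    |by rewrite lee_fin ?invr_ge0 ltW].
rewrite -ge0_integralD//; do ?[by move=> x Dx; rewrite -EFinM lee_fin ?mulr_ge0 ?invr_ge0 ?powR_ge0 ?w0' ?i0' ?(ltW d0)
  |by apply: emeasurable_funM].
apply: ge0_le_integral => //; do ?[by move=> x Dx; rewrite lee_fin cabs_ge0
  |by apply: measurable_cabsE; exact: cmeasM
  |by apply: emeasurable_funD; apply: emeasurable_funM].
move=> x cx; rewrite -!EFinM -EFinD lee_fin cabsM !powR_mulrn ?cabs_ge0//.
exact: young_weight (w0 x cx).
Qed.

Definition past_limit w m := cm m /\ (N w m < +oo)%E /\
  forall e : R, 0 < e -> exists2 q, past q & (N w (fun x => (m x - q x)%R) <= e%:E)%E.

(** Integration against K is continuous on L^2(w) when K belongs to L^2(1/w), so what holds for past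
    polynomials holds for their limits. *)
Lemma past_limit_null w m K : measurable_fun cir w -> (forall x, circle x -> 0 < w x) ->
  past_limit w m -> past_null K -> (Nv w K < +oo)%E ->
  cintegrable leb cir (fun x => m x * K x) /\ cintegral leb cir (fun x => m x * K x) = 0.
Proof.
move=> mw w0 [mm [mo hm]] nK Ko; have mK := cintegrable_meas mc nK.1.
have i0' x : circle x -> 0 <= (w x)^-1 by move=> /w0; rewrite -invr_gt0 => /ltW.
have K0 : (0 <= Nv w K)%E by apply: lp_ge0.
have Kfin : Nv w K \is a fin_num by rewrite ge0_fin_numE.
have iM : cintegrable leb cir (fun x => m x * K x).
  apply/(cintegrableP _ mc); split; first exact: cmeasM.
  apply: le_lt_trans (cnorm1_young mw w0 mm mK ltr01) _.
  by rewrite invr1 !mul1e lte_add_pinfty.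
split=> //; apply: (cintegral0_closed mc iM) => e e0.
pose L := fine (Nv w K); have L0 : 0 <= L by rewrite fine_ge0.
pose del := e / (2 * (L + 1)); have del0 : 0 < del by rewrite divr_gt0// mulr_gt0//; lra.
have [q pq hq] := hm (del * (e / 2)) (mulr_gt0 del0 (divr_gt0 e0 (ltr0Sn R 1))).
have [iq q0] := past_null_past pq nK.
exists (fun x => q x * K x); split => //.
have mq := past_cmeas pq.
have -> : (fun x => m x * K x - q x * K x) = (fun x => (m x - q x) * K x).
  by apply/funext => x; rewrite mulrBl.
apply: le_trans (cnorm1_young mw w0 (cmeasB mm mq) mK del0) _.
have h1 : ((del^-1)%:E * N w (fun x => (m x - q x)%R) <= (e / 2)%:E)%E.
  apply: le_trans (lee_wpmul2l _ hq) _; first by rewrite lee_fin invr_ge0 ltW.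
  by rewrite -EFinM lee_fin mulKf ?gt_eqF.
have h2 : (del%:E * Nv w K <= (e / 2)%:E)%E.
  rewrite -(fineK Kfin) -EFinM lee_fin -/L /del.
  have -> : e / (2 * (L + 1)) * L = e / 2 * (L / (L + 1)) by field; rewrite !gt_eqF//; lra.
  by rewrite ler_piMr ?divr_ge0 ?(ltW e0)// ler_pdivrMr ?mul1r; lra.
by apply: (@le_trans _ _ ((e / 2)%:E + (e / 2)%:E)%E); [exact: (leeD h1 h2)|rewrite -EFinD -splitr].
Qed.

Lemma spow1 (z : R[i]) : spow z (2 - 1) = z^*.
Proof.
have [->|z0] := eqVneq z 0.
  by apply: complex_eq; rewrite /spow ?cReM ?cImM ?cReC ?cImC /= ?oppr0 !mulr0 ?subrr ?addr0.
rewrite /spow (_ : 2 - 1 - 1 = 0 :> R); last by ring.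
by rewrite powRr0 mul1r.
Qed.

(** The minimisation with p = 2 and second weight 0, where z^{<1>} is the conjugate of z and the
    first-order condition becomes ordinary orthogonality. The lower bound on w gives the domination
    of the L^1 norm. *)
Lemma past_projection w A : measurable_fun cir w -> (forall x, circle x -> 1 <= w x) ->
  leb.-integrable cir (EFin \o w) -> cm A -> (N w A < +oo)%E ->
  exists m, [/\ past_limit w m, past_null (fun x => (A x - m x)^* * (w x)%:C),
    (N w (fun x => (A x - m x)%R) <= N w A)%E & (N w (fun x => (A x - m x)%R) < +oo)%E].
Proof.
move=> mw w1 iw mA Ao.
have w0 x : circle x -> 0 < w x by move=> /w1; exact: lt_le_trans.
have w0' x : circle x -> 0 <= w x by move=> /w0/ltW.
have p1 : 1 < 2 :> R by lra. have p2 : 2 <= 2 :> R by [].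
have p0 : 0 < 2 :> R by [].
pose z := (fun=> 0 : R) : R -> R.
have mz : measurable_fun cir z by exact: measurable_cst.
have z0 x : circle x -> 0 <= z x by [].
have iz : leb.-integrable cir (EFin \o z) by exact: integrable_cst_circle.
have wz : (fun x => w x + z x) = w by apply/funext => x; rewrite addr0.
have Efin u : past u -> fin_norm leb cir 2 w z u by exact: past_fin_norm.
have ED u v : past u -> past v -> past (fun x => u x + v x) by exact: pastD.
have EZ c u : past u -> past (fun x => c * u x) by exact: pastZ.
have hw : (\int[leb]_(x in cir) (((w x + z x) `^ (- (2 - 1)^-1))%:E) < +oo)%E.
  apply: (@le_lt_trans _ _ (\int[leb]_(x in cir) 1%:E)%E); last first.
    have h : (leb cir < +oo)%E by rewrite leb_circle ltry.
    by rewrite integral_cst// mul1e; exact: h.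
  apply: ge0_le_integral => //.
  - by move=> x cx; rewrite lee_fin powR_ge0.
  - by apply/measurable_EFinP; apply: (measurableT_comp (measurable_powR _)); rewrite wz.
  - move=> x cx; rewrite lee_fin /z addr0 (_ : - (2 - 1)^-1 = -1 :> R); last first.
      by rewrite (_ : 2 - 1 = 1 :> R) ?invr1//; ring.
    by rewrite powR_inv1 ?w0'// invf_le1 ?w0// w1.
have mwz : measurable_fun cir (fun x => w x + z x) by rewrite wz.
have wz0 x : circle x -> 0 < w x + z x by rewrite /z addr0; exact: w0.
have dom := @lp_dominates_cnorm1 R _ (measurableTypeR R) leb cir mc 2 (fun x => w x + z x) p1 mwz wz0 hw.
have [m [cl mmin]] := @min_exists R _ (measurableTypeR R) leb cir mc 2 w z A p1 p2 mw mz w0' z0 mA Ao past past0 ED EZ Efin dom.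
have [[mm mo] cm_] := cl; rewrite wz in mo.
have hE := @energyE R _ (measurableTypeR R) leb cir mc 2 w z A p1 mw mz w0' z0 mA Ao.
have hm := hE _ cl.1; have h0 := hE _ (Efin _ past0).
have Nz u : N z u = 0%E by rewrite /lp; under eq_integral do rewrite mulr0; rewrite integral0.
rewrite (Nz m) adde0 in hm; rewrite (Nz (fun=> 0)) adde0 in h0.
have cl0 : closure_of leb cir 2 w z past (fun=> 0).
  split; first exact: Efin _ past0.
  move=> e e0; exists (fun=> 0); first exact: past0.
  by under lp_eq do rewrite subrr; rewrite lp0// lee_fin ltW.
have hle : (N w (fun x => (A x - m x)%R) <= N w A)%E.
  rewrite -hm; have -> : N w A = N w (fun x => (A x - 0)%R).
    by apply: lp_eq => x _; rewrite subr0.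
  by rewrite -h0 lee_fin; exact: mmin.
exists m; split.
- split; [exact: mm|split; [exact: mo|move=> e /cm_[q pq hq]]].
  by exists q; [exact: pq|move: hq; rewrite wz].
- have rE : (fun x => (A x - m x)^* * (w x)%:C) = residual 2 w z A m.
    by apply/funext => x; rewrite /residual spow1 /z mulr0 subr0.
  split.
    have := @residual_integrable R _ (measurableTypeR R) leb cir mc 2 w z A p1 mw mz w0' z0 mA Ao m _ cl.1 (Efin _ (past_expi 0)).
    move=> /(cintegrable_expiM 1); congr (cintegrable _ _ _); apply/funext => x.
    rewrite mulrA -expiD mulNr mul1r subrr expi0 mul1r.
    exact: esym (congr1 (@^~ x) rE).
  move=> k; apply: etrans (circle_eq (fun x => congr1 (fun c => expi (- k.+1%:R * x) * c) (congr1 (@^~ x) rE))) _.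
  exact: (@min_variational R _ (measurableTypeR R) leb cir mc 2 w z A p1 p2 mw mz w0' z0 mA Ao past ED EZ Efin m _ cl mmin (past_expi k)).
- exact: hle.
- exact: le_lt_trans hle Ao.
Qed.

Lemma lp_ae w u v : measurable_fun cir w -> cm u -> cm v ->
  {ae leb, forall x, circle x -> u x = v x} -> N w u = N w v.
Proof.
move=> mw mu_ mv uv; apply: ae_eq_integral => //.
- exact: (@measurable_lp R _ (measurableTypeR R) cir 2 w mw u mu_).
- exact: (@measurable_lp R _ (measurableTypeR R) cir 2 w mw v mv).
- by apply: ae_mono uv _ => x h cx; rewrite h.
Qed.

Lemma lp_bounded (p : R) w u (M : R) : measurable_fun cir w -> (forall x, circle x -> 0 <= w x) -> cm u ->
  (forall x, circle x -> cabs (u x) `^ p * w x <= M) -> (lp leb cir p w u <= (2 * pi * M)%:E)%E.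
Proof.
move=> mw w0 mu_ h; apply: (@le_trans _ _ (\int[leb]_(x in cir) M%:E)%E).
  apply: ge0_le_integral => //.
  - by move=> x cx; rewrite lee_fin mulr_ge0 ?powR_ge0 ?w0.
  - exact: (@measurable_lp R _ (measurableTypeR R) cir p w mw u mu_).
rewrite integral_cst//; have e : leb cir = (2 * pi)%:E := leb_circle.
by rewrite [X in (_ * X <= _)%E]e -EFinM mulrC.
Qed.

Lemma past_ext w u v : measurable_fun cir w -> cm u -> {ae leb, forall x, circle x -> u x = v x} ->
  past_limit w v -> past_limit w u.
Proof.
move=> mw mu_ uv [mv [vo hv]]; split; first exact: mu_.
split; first by rewrite (lp_ae mw mu_ mv uv).
move=> e /hv[q pq hq]; exists q; first exact: pq.
have mq := past_cmeas pq.
rewrite (lp_ae mw (cmeasB mu_ mq) (cmeasB mv mq)); first exact: hq.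
by apply: ae_mono uv _ => x h cx; rewrite h.
Qed.

Let one : R -> R := fun=> 1.
Let mone : measurable_fun cir one. Proof. exact: measurable_cst. Qed.
Let one1 x : circle x -> 1 <= one x. Proof. by []. Qed.
Let one_gt0 x : circle x -> 0 < one x. Proof. by []. Qed.
Let ione : leb.-integrable cir (EFin \o one). Proof. exact: integrable_cst_circle. Qed.

Let Nv1_bounded K (M : R) : cm K -> (forall x, circle x -> cabs (K x) <= M) -> (Nv one K < +oo)%E.
Proof.
move=> mK KM; apply: le_lt_trans (lp_bounded (M := M ^+ 2) (measurable_inv mone one_gt0) _ mK _) (ltry _).
  by move=> x _; rewrite invr1.
move=> x cx; rewrite invr1 mulr1 powR_mulrn ?cabs_ge0//; apply: lerXn2r; rewrite ?nnegrE ?cabs_ge0 ?KM//.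
exact: le_trans (cabs_ge0 _) (KM x cx).
Qed.

Let N1_bounded K (M : R) : cm K -> (forall x, circle x -> cabs (K x) <= M) -> (N one K < +oo)%E.
Proof.
move=> mK /(Nv1_bounded mK); congr (_ < _)%E; apply: eq_integral => x _; by rewrite invr1.
Qed.

(** Let m be the projection of u on the past in L^2. The coefficients of u - m at nonnegative
    frequencies vanish because those of u and m do, and the others vanish by orthogonality;
    uniqueness gives u = m. *)
Lemma bounded_past_limit u (M : R) : cm u -> (forall x, circle x -> cabs (u x) <= M) ->
  (forall k : nat, cintegral leb cir (fun x => expi (- k%:R * x) * u x) = 0) -> past_limit one u.
Proof.
move=> mu_ uM hu; have iu := cintegrable_bounded mu_ uM.
have [m [lm [ir nr] _ _]] := past_projection mone one1 ione mu_ (N1_bounded mu_ uM).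
have [mm _] := lm.
have mk0 (k : nat) : cintegrable leb cir (fun x => m x * (expi (- k%:R * x) * 1)) /\
    cintegral leb cir (fun x => m x * (expi (- k%:R * x) * 1)) = 0.
  apply: (past_limit_null mone one_gt0 lm (past_null_shift k (@past_null1 R))).
  apply: (@Nv1_bounded _ 1); first by apply: cmeasM; [exact: cmeas_expiZ|exact: cmeas_cst].
  by move=> x _; rewrite mulr1 cabs_expi.
have im : cintegrable leb cir m.
  have [h _] := mk0 0%N; move: h; congr (cintegrable _ _ _).
  by apply/funext => x; rewrite oppr0 mul0r expi0 !mulr1.
have iB : cintegrable leb cir (fun x => u x - m x) by exact: cintegrableB.
have uv : {ae leb, forall x, circle x -> u x - m x = 0}.
  apply: fourier_uniqueness iB _ => -[k|k]; last first.
    rewrite NegzE.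
    have e x : expi ((- k.+1%:Z)%:~R * x) * (u x - m x) = expi (- k.+1%:R * x) * u x - m x * (expi (- k.+1%:R * x) * 1).
      by rewrite mulrNz; ring.
    have i1 := cintegrable_expiM (- k.+1%:R) iu; have [i2 m0] := mk0 k.+1.
    by apply: etrans (circle_eq e) _; rewrite (cintegralB mc i1 i2) hu m0 subrr.
  case: k => [|k].
    have e x : expi (0%:Z%:~R * x) * (u x - m x) = expi (- 0%:R * x) * u x - m x * (expi (- 0%:R * x) * 1).
      by rewrite mulr0z oppr0 mul0r expi0; ring.
    have i1 := cintegrable_expiM (- 0%:R) iu; have [i2 m0] := mk0 0%N.
    by apply: etrans (circle_eq e) _; rewrite (cintegralB mc i1 i2) hu m0 subrr.
  apply: etrans (circle_eq _) (cintegral_conj0 (cintegrable_expiM (- k.+1%:R) ir) (nr k)) => x.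
  rewrite conj_expiM; congr (_ * _).
  by rewrite /one; case: (u x - m x) => a b; apply: complex_eq => /=; ring.
apply: past_ext mone mu_ _ lm; apply: ae_mono uv _ => x h cx.
by apply/eqP; rewrite -subr_eq0 h.
Qed.

(** For a real function the coefficients at opposite frequencies are conjugate, so only the mean
    survives. *)
Lemma real_const (H : R -> R) : leb.-integrable cir (EFin \o H) ->
  (forall k : nat, cintegral leb cir (fun x => expi (- k.+1%:R * x) * (H x)%:C) = 0) ->
  {ae leb, forall x, circle x -> H x = (2 * pi)^-1 * \int[leb]_(x in cir) H x}.
Proof.
move=> iH hH; set k0 := _ * _; have pi0 := pi_gt0 R.
have iHc : cintegrable leb cir (fun x => (H x)%:C).
  by split=> //=; exact: integrable_cst_circle.
have ik : cintegrable leb cir (fun=> k0%:C) by split; exact: integrable_cst_circle.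
have := @fourier_uniqueness R (fun x => (H x)%:C - k0%:C) (cintegrableB mc iHc ik).
have ek k : k != 0 -> cintegral leb cir (fun x => expi (k%:~R * x) * k0%:C) = 0.
  move=> kn; apply: etrans (circle_eq (fun x => mulrC _ _)) _.
  rewrite (cintegralZ mc) ?cintegral_expi ?mulr0//.
  have := cintegrable_expiM k%:~R (@past_null1 R).1; congr (cintegrable _ _ _).
  by apply/funext => x; rewrite mulr1.
have eB k : cintegral leb cir (fun x => expi (k%:~R * x) * ((H x)%:C - k0%:C)) =
    cintegral leb cir (fun x => expi (k%:~R * x) * (H x)%:C) - cintegral leb cir (fun x => expi (k%:~R * x) * k0%:C).
  apply: etrans (circle_eq (fun x => mulrBr _ _ _)) _.
  by apply: (cintegralB mc); exact: cintegrable_expiM.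
move=> h; apply: ae_mono (h _) _ => [[k|k]|x hx cx]; last first.
- by have /(congr1 (@complex.Re R)) := hx cx; rewrite /= => /eqP; rewrite subr_eq0 => /eqP.
- rewrite eB ek ?subr0 ?NegzE ?oppr_eq0//.
  by rewrite -[RHS](hH k); apply: circle_eq => x; rewrite mulrNz.
- case: k => [|k]; last first.
    rewrite eB ek ?subr0//.
    apply: etrans (circle_eq _) (cintegral_conj0 (cintegrable_expiM (- k.+1%:R) iHc) (hH k)) => x.
    rewrite conj_expiM; congr (_ * _).
    by apply: complex_eq; rewrite ?cReC ?cImC /= ?oppr0.
  rewrite eB; apply/eqP; rewrite subr_eq0; apply/eqP.
  have e0 x : expi (0%:Z%:~R * x) = 1 :> R[i] by rewrite mulr0z mul0r expi0.
  have e1 : (fun x => expi (0%:Z%:~R * x) * (H x)%:C) = (fun x => (H x)%:C) by apply/funext => x; rewrite e0 mul1r.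
  have e2 : (fun x => expi (0%:Z%:~R * x) * k0%:C) = (fun=> k0%:C) by apply/funext => x; rewrite e0 mul1r.
  rewrite e1 e2.
  rewrite /cintegral /=; congr (_ +i* _).
  rewrite Rintegral_cst//; have e : fine (leb cir) = 2 * pi by rewrite leb_circle.
  by rewrite e /k0 mulrAC mulVf ?mul1r// gt_eqF// mulr_gt0.
Qed.

End Orthogonality.

(** * Products of functions with one-sided spectra *)

Section Product.
Context {R : realType}.
Local Notation leb := (@lebesgue_measure R).
Local Notation cir := (circle : set (measurableTypeR R)).
Implicit Types (F G K u v m h O : R -> R[i]) (w : R -> R).
Local Notation cm u := (cmeas cir u).
Local Notation N w u := (lp leb cir 2 w u).
Local Notation Nv w u := (lp leb cir 2 (fun x => (w x)^-1) u).
Local Notation ci F := (cintegral leb cir F).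
Local Notation I H := (\int[leb]_(x in cir) H x).

Let mc : measurable cir. Proof. exact: measurable_itv. Qed.

Let pi0 : 0 < (pi : R). Proof. exact: pi_gt0. Qed.

Let cabs1 : cabs (1 : R[i]) = 1. Proof. by rewrite -(@expi0 R) cabs_expi. Qed.

Let I1 (k : R) : I (fun=> k) = 2 * pi * k.
Proof.
rewrite Rintegral_cst//; have e : fine (leb cir) = 2 * pi by rewrite leb_circle.
by rewrite e mulrC.
Qed.

(** The change is the subtraction of (1 - O) K, and 1 - O is a limit of past polynomials, orthogonal
    to K and to all its shifts towards the past. *)
Lemma past_limit_factor w O K : measurable_fun cir w -> (forall x, circle x -> 0 < w x) ->
  past_limit w (fun x => 1 - O x) -> past_null K -> (Nv w K < +oo)%E ->
  past_null (fun x => O x * K x) /\ ci (fun x => O x * K x) = ci K.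
Proof.
move=> mw w0 lO nK Ko.
have eO x : O x * K x = K x - (1 - O x) * K x by ring.
have [i1 c1] := past_limit_null mw w0 lO nK Ko.
have eF : (fun x => O x * K x) = (fun x => K x - (1 - O x) * K x) by apply/funext.
rewrite eF; split; last by rewrite (cintegralB mc nK.1 i1) c1 subr0.
split; first exact: (cintegrableB mc nK.1 i1).
move=> k; have nS := past_null_shift k.+1 nK.
have So : (Nv w (fun x => expi (- k.+1%:R * x) * K x)%R < +oo)%E.
  apply: le_lt_trans Ko; rewrite le_eqVlt; apply/orP; left; apply/eqP.
  by apply: eq_integral => x _; congr (_ `^ _ * _)%:E; rewrite cabsM cabs_expi mul1r.
have [i2 c2] := past_limit_null mw w0 lO nS So.
have e x : expi (- k.+1%:R * x) * (K x - (1 - O x) * K x) =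
  expi (- k.+1%:R * x) * K x - (1 - O x) * (expi (- k.+1%:R * x) * K x) by ring.
apply: etrans (circle_eq e) _.
by rewrite (cintegralB mc (cintegrable_expiM (- k.+1%:R) nK.1) i2) c2 (nK.2 k) subrr.
Qed.

(* O = 1 - m with m the best past approximation of 1 in L^2(w).  Orthogonality of
   the residual conj(O) w to the past, multiplied by O, shows that |O|^2 w has
   vanishing Fourier coefficients except for the mean, hence is constant. *)
Lemma outer_function w : measurable_fun cir w -> (forall x, circle x -> 1 <= w x) ->
  leb.-integrable cir (EFin \o w) ->
  exists O k, [/\ cm O, past_limit w (fun x => 1 - O x),
    forall x, circle x -> cabs (O x) ^+ 2 * w x <= k,
    2 * pi * k <= I w &
    (N (fun=> 1%R) (fun x => (1 - O x)%R) <= ((2 * pi * (k - 1))%R)%:E)%E].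
Proof.
move=> mw w1 iw.
have w0 x : circle x -> 0 < w x by move=> /w1; exact: lt_le_trans.
have w0' x : circle x -> 0 <= w x by move=> /w0/ltW.
have m1 : cm (fun=> (1 : R[i])) by exact: measurable_cst.
have N1 : N w (fun=> 1) = (I w)%:E.
  rewrite /Rintegral fineK; last exact: integrable_fin_num.
  by apply: eq_integral => x _; rewrite cabs1 powR1 mul1r.
have No : (N w (fun=> 1%R) < +oo)%E by rewrite N1 ltry.
have [m [lm [iP nP] hle hfin]] := past_projection mw w1 iw m1 No.
have [mm _] := lm.
pose O x := 1 - m x; have mO : cm O by exact: cmeasB.
have lmO : past_limit w (fun x => 1 - O x).
  by move: lm; congr past_limit; apply/funext => x; rewrite /O; ring.
have [iO NO] := @lp_integrable R _ (measurableTypeR R) leb cir mc 2 w O mw w0' mO hfin.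
pose H x := cabs (O x) ^+ 2 * w x.
have HE : (fun x => cabs (O x) `^ 2 * w x) = H by apply/funext => x; rewrite powR_mulrn ?cabs_ge0.
rewrite HE in iO NO.
have hH (j : nat) : ci (fun x => expi (- j.+1%:R * x) * (H x)%:C) = 0.
  have nS := past_null_shift j.+1 (conj iP nP : past_null (fun x => (1 - m x)^* * (w x)%:C)).
  have So : (Nv w (fun x => expi (- j.+1%:R * x) * ((1 - m x)^* * (w x)%:C))%R < +oo)%E.
    move: hfin; congr (_ < _)%E; apply: eq_integral => x /set_mem cx; congr EFin.
    rewrite !cabsM cabs_expi mul1r cabs_conj cabsR (ger0_norm (w0' _ cx)).
    by rewrite !powR_mulrn ?mulr_ge0 ?cabs_ge0 ?w0'//; field; rewrite gt_eqF ?w0.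
  have [i1 c1] := past_limit_factor mw w0 lmO nS So.
  have e x : expi (- j.+1%:R * x) * (H x)%:C = O x * (expi (- j.+1%:R * x) * ((1 - m x)^* * (w x)%:C)).
    have -> : (H x)%:C = O x * (O x)^* * (w x)%:C.
      by apply: complex_eq; rewrite /H /= ?cabs_sqr ?cReM ?cImM ?cReC ?cImC /=; ring.
    by rewrite -/(O x); ring.
  by apply: etrans (circle_eq e) _; rewrite c1; exact: nP.
have hk := real_const iO hH; set k := (2 * pi)^-1 * I H in hk.
have p2 : 0 < 2 * pi :> R by exact: mulr_gt0.
have kI : 2 * pi * k = I H by rewrite /k mulrA mulfV ?mul1r ?gt_eqF.
have mH : measurable_fun cir H by have /integrableP[/measurable_EFinP] := iO.
pose S : set (measurableTypeR R) := cir `&` H @^-1` `]-oo, k]%classic.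
have mS : measurable S by apply: mH => //; exact: measurable_itv.
(* The bound by [k] is wanted at every point and holds almost everywhere so far; O is replaced by 0
   on the exceptional set. *)
pose O' x := (\1_S x)%:C * O x.
have mO' : cm O'.
  by apply: cmeasM => //; apply: cmeasR; exact: measurable_indic.
have eO : {ae leb, forall x, circle x -> O' x = O x}.
  apply: ae_mono hk _ => x h cx; rewrite /O' indicE mem_set ?mul1r//.
  by split=> //=; rewrite in_itv/= (h cx).
have kle : 2 * pi * k <= I w by rewrite kI -lee_fin -NO -N1.
have k0 : 0 <= k.
  rewrite -(pmulr_rge0 _ p2) kI; apply: Rintegral_ge0 => x cx.
  by rewrite mulr_ge0 ?sqr_ge0 ?w0'.
have bO x : circle x -> cabs (O' x) ^+ 2 * w x <= k.
  move=> cx; rewrite /O' cabsM cabsR indicE; have [hS|hS] := boolP (x \in S).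
    by rewrite normr1 mul1r; move/set_mem: hS => [_] /=; rewrite in_itv/=.
  by rewrite normr0 mul0r expr0n mul0r.
have lmO' : past_limit w (fun x => 1 - O' x).
  apply: past_ext mw (cmeasB m1 mO') _ lmO.
  by apply: ae_mono eO _ => x h cx; rewrite h.
suff fin : (N (fun=> 1%R) (fun x => (1 - O' x)%R) <= ((2 * pi * (k - 1))%R)%:E)%E.
  by exists O', k; split; [exact: mO'|exact: lmO'|exact: bO|exact: kle|exact: fin].
have mone : measurable_fun cir (fun=> 1 : R) by exact: measurable_cst.
have b1 x : circle x -> cabs (O' x) ^+ 2 <= k.
  by move=> cx; apply: le_trans (bO x cx); rewrite ler_peMr ?sqr_ge0 ?w1.
have b2 x : circle x -> cabs (O' x) <= 1 + k.
  move=> cx; have := b1 x cx; have := sqr_ge0 (cabs (O' x) - 1); rewrite sqrrB; have := cabs_ge0 (O' x); lra.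
have iO' : cintegrable leb cir O' by exact: cintegrable_bounded mO' b2.
have i1 : cintegrable leb cir (fun=> 1) := (@past_null1 R).1.
(* Multiplication by O does not change the integral of the constant 1. *)
have mean : complex.Re (ci O') = 2 * pi.
  have fin1 : (Nv w (fun=> 1%R) < +oo)%E.
    apply: le_lt_trans (lp_bounded (M := 1) (measurable_inv mw w0) _ m1 _) (ltry _) => x cx.
      by rewrite invr_ge0 w0'.
    by rewrite cabs1 powR1 mul1r invf_le1 ?w0 ?w1.
  have [_] := past_limit_factor mw w0 lmO (@past_null1 R) fin1.
  rewrite (circle_eq (fun x => mulr1 (O x))) => cO.
  rewrite (cintegral_ae mc mO' mO eO) cO Re_cintegral /= I1; ring.
have ire : leb.-integrable cir (EFin \o (fun x => complex.Re (O' x))) := iO'.1.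
have bl : (N (fun=> 1%R) (fun x => (1 - O' x)%R) < +oo)%E.
  apply: le_lt_trans (lp_bounded (M := (2 + k) ^+ 2) mone _ (cmeasB m1 mO') _) (ltry _) => // x cx.
  rewrite mulr1 powR_mulrn ?cabs_ge0//; apply: lerXn2r; rewrite ?nnegrE ?cabs_ge0//; first lra.
  by apply: le_trans (cabsB _ _) _; rewrite cabs1; have := b2 x cx; lra.
have [iN ->] := @lp_integrable R _ (measurableTypeR R) leb cir mc 2 _ _ mone (fun x _ => ler01) (cmeasB m1 mO') bl.
rewrite lee_fin.
have ic : leb.-integrable cir (EFin \o (fun=> 1 + k)) by exact: integrable_cst_circle.
have i2 : leb.-integrable cir (EFin \o (fun x => 2 * complex.Re (O' x))).
  by apply: eq_integrable (integrableZl mc 2 ire).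
(* Since |O|^2 <= k, the square |1 - O|^2 is at most 1 + k - 2 Re O, whose integral is 2 pi (k - 1)
   as O has mean 1. *)
apply: (@le_trans _ _ (I (fun x => (1 + k) - 2 * complex.Re (O' x)))).
  apply: le_Rintegral => //; first by apply: eq_integrable (integrableB mc ic i2).
  move=> x cx; rewrite mulr1 powR_mulrn ?cabs_ge0//.
  have := b1 x cx; rewrite !cabs_sqr cReD cImD cReN cImN /=; lra.
rewrite (RintegralB mc ic i2) (RintegralZl 2 mc ire) I1.
move: mean; rewrite Re_cintegral => ->; lra.
Qed.

Lemma spectrum_product_bounded u v (M : R) : cm u -> (forall x, circle x -> cabs (u x) <= M) ->
  cm v -> (forall x, circle x -> cabs (v x) <= M) ->
  (forall k : nat, ci (fun x => expi (- k%:R * x) * u x) = 0) -> past_null v ->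
  ci (fun x => u x * v x) = 0.
Proof.
move=> mu_ uM mv vM hu nv.
have lu := bounded_past_limit mu_ uM hu.
have mone : measurable_fun cir (fun=> 1 : R) by exact: measurable_cst.
suff fin : (Nv (fun=> 1%R) v < +oo)%E by have [_] := past_limit_null mone (fun x _ => ltr01) lu nv fin.
apply: le_lt_trans (lp_bounded (M := M ^+ 2) (measurable_inv mone (fun x _ => ltr01)) _ mv _) (ltry _) => x cx.
  by rewrite invr1.
rewrite invr1 mulr1 powR_mulrn ?cabs_ge0//; apply: lerXn2r; rewrite ?nnegrE ?cabs_ge0 ?vM//.
exact: le_trans (cabs_ge0 _) (vM x cx).
Qed.

(** With w = 1 + e (|F| + |G|) both functions are at most w/e, so |O|^2 w <= k makes O^2 F and O^2 G
    bounded by k/e. As 2 pi k is at most the integral of w, [k] tends to 1 with e, and then O tends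
    to 1 in L^2. *)
Lemma damped_product F G (e : R) : past_null F -> ci F = 0 -> past_null G -> 0 < e ->
  exists O k, [/\ cm O, 0 <= k /\ (forall x, circle x -> cabs (O x) ^+ 2 <= k),
    (N (fun=> 1%R) (fun x => (1 - O x)%R) <= ((2 * pi * (k - 1))%R)%:E)%E,
    2 * pi * (k - 1) <= e * (I (fun x => cabs (F x)) + I (fun x => cabs (G x))) &
    ci (fun x => O x ^+ 4 * (F x * G x)) = 0].
Proof.
move=> nF F0 nG e0; have mF := cintegrable_meas mc nF.1; have mG := cintegrable_meas mc nG.1.
have aF := integrable_cabs mc nF.1; have aG := integrable_cabs mc nG.1.
pose w x := 1 + e * (cabs (F x) + cabs (G x)).
have mw : measurable_fun cir w.
  by apply: measurable_funD => //; apply: measurable_funM => //; apply: measurable_funD; exact: measurable_cabs.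
have s0 x : 0 <= e * (cabs (F x) + cabs (G x)) by rewrite mulr_ge0 ?addr_ge0 ?cabs_ge0// ltW.
have w1 x : circle x -> 1 <= w x by move=> _; rewrite lerDl.
have w0 x : circle x -> 0 < w x by move=> /w1; exact: lt_le_trans.
have aS : leb.-integrable cir (EFin \o (fun x => cabs (F x) + cabs (G x))).
  exact: eq_integrable (integrableD mc aF aG).
have aeS : leb.-integrable cir (EFin \o (fun x => e * (cabs (F x) + cabs (G x)))).
  exact: eq_integrable (integrableZl mc e aS).
have i1 : leb.-integrable cir (EFin \o (fun=> 1 : R)) by exact: integrable_cst_circle.
have iw : leb.-integrable cir (EFin \o w) by exact: eq_integrable (integrableD mc i1 aeS).
have Iw : I w = 2 * pi + e * (I (fun x => cabs (F x)) + I (fun x => cabs (G x))).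
  by rewrite (RintegralD mc i1 aeS) I1 mulr1 (RintegralZl e mc aS) (RintegralD mc aF aG).
have [ O [k [mO lO bO hk hN]]] := outer_function mw w1 iw.
have bF x : e * cabs (F x) <= w x by rewrite /w mulrDr addrCA lerDl addr_ge0// mulr_ge0 ?cabs_ge0// ltW.
have bG x : e * cabs (G x) <= w x by rewrite /w mulrDr addrA lerDr addr_ge0// mulr_ge0 ?cabs_ge0// ltW.
have b1 x : circle x -> cabs (O x) ^+ 2 <= k.
  by move=> cx; apply: le_trans (bO x cx); rewrite ler_peMr ?sqr_ge0 ?w1.
have k0 : 0 <= k.
  have c0 : circle (0 : R) by rewrite /circle/= in_itv/= oppr_le0 ltW.
  exact: le_trans (sqr_ge0 _) (b1 0 c0).
(* [past_limit_factor] is applied twice. K is in L^2(1/w) because |K|^2/w <= |K|/e, and O K is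
   because |O K|^2/w <= k/e^2. *)
have key K : past_null K -> (forall x, e * cabs (K x) <= w x) ->
    [/\ past_null (fun x => O x * (O x * K x)), ci (fun x => O x * (O x * K x)) = ci K &
      forall x, circle x -> cabs (O x * (O x * K x)) <= k / e].
  move=> nK bK; have mK := cintegrable_meas mc nK.1.
  have aK := integrable_cabs mc nK.1.
  have ratio x : circle x -> cabs (K x) / w x <= e^-1.
    by move=> cx; rewrite ler_pdivrMr ?w0// mulrC ler_pdivlMr// mulrC.
  have r0 x : circle x -> 0 <= cabs (K x) / w x by move=> cx; rewrite divr_ge0 ?cabs_ge0// ltW ?w0.
  have mi := measurable_inv mw w0.
  have i0 x : circle x -> 0 <= (w x)^-1 by move=> /w0; rewrite -invr_gt0 => /ltW.
  have fin1 : (Nv w K < +oo)%E.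
    have aK' := integrableZl mc e^-1 aK; have /integrableP[_] := aK'; apply: le_lt_trans.
    apply: ge0_le_integral => //.
    - by move=> x cx; rewrite lee_fin mulr_ge0 ?powR_ge0 ?i0.
    - exact: (@measurable_lp R _ (measurableTypeR R) cir 2 _ mi K mK).
    - by apply: measurableT_comp => //; have /integrableP[] := aK'.
    - move=> x cx; rewrite -EFinM /= lee_fin powR_mulrn ?cabs_ge0// ger0_norm ?mulr_ge0 ?invr_ge0 ?(ltW e0) ?cabs_ge0//.
      by rewrite expr2 -mulrA mulrC ler_wpM2r ?cabs_ge0// ratio.
  have [nOK cOK] := past_limit_factor mw w0 lO nK fin1.
  have mOK := cintegrable_meas mc nOK.1.
  have fin2 : (Nv w (fun x => O x * K x)%R < +oo)%E.
    apply: le_lt_trans (lp_bounded (M := k * e^-1 ^+ 2) mi i0 mOK _) (ltry _) => x cx.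
    rewrite powR_mulrn ?cabs_ge0// cabsM.
    have -> : (cabs (O x) * cabs (K x)) ^+ 2 / w x = cabs (O x) ^+ 2 * w x * (cabs (K x) / w x) ^+ 2.
      by field; rewrite gt_eqF ?w0.
    apply: (ler_pM (mulr_ge0 (sqr_ge0 _) (ltW (w0 x cx))) (sqr_ge0 _) (bO x cx)).
    by apply: lerXn2r; rewrite ?nnegrE ?r0 ?ratio// invr_ge0 ltW.
  have [nOOK cOOK] := past_limit_factor mw w0 lO nOK fin2.
  split=> //; first by rewrite cOOK.
  move=> x cx; rewrite !cabsM.
  have -> : cabs (O x) * (cabs (O x) * cabs (K x)) = cabs (O x) ^+ 2 * w x * (cabs (K x) / w x).
    by field; rewrite gt_eqF ?w0.
  exact: (ler_pM (mulr_ge0 (sqr_ge0 _) (ltW (w0 x cx))) (r0 x cx) (bO x cx) (ratio x cx)).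
have [nu cu bu] := key F nF bF; have [nv _ bv] := key G nG bG.
exists O, k; split; [exact: mO|by split; [exact: k0|exact: b1]|exact: hN|by rewrite mulrBr mulr1 lerBlDl -Iw|].
have hu (j : nat) : ci (fun x => expi (- j%:R * x) * (O x * (O x * F x))) = 0.
  case: j => [|j]; last exact: nu.2.
  rewrite -[RHS]F0 -cu; apply: circle_eq => x; by rewrite oppr0 mul0r expi0 mul1r.
rewrite -[RHS](spectrum_product_bounded (cintegrable_meas mc nu.1) bu (cintegrable_meas mc nv.1) bv hu nv).
by apply: circle_eq => x; ring.
Qed.

Lemma excess_cvg0 (phi : R -> R) : leb.-integrable cir (EFin \o phi) -> (forall x, 0 <= phi x) ->
  I (fun x => phi x - Num.min (phi x) n%:R) @[n --> \oo] --> (0 : R).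
Proof.
move=> iphi phi0; have mphi : measurable_fun cir phi by have /integrableP[/measurable_EFinP] := iphi.
have [] := @Rintegral_cvg R _ (measurableTypeR R) leb cir mc (fun n x => phi x - Num.min (phi x) n%:R)
  (fun=> 0) phi _ _ _ iphi _.
- by move=> n; apply: measurable_funB => //; exact: measurable_minr.
- exact: measurable_cst.
- apply: nearW => x _; apply: cvg_near_cst; exists (Num.truncn (phi x)).+1 => // n /= hn.
  rewrite (min_idPl _) ?subrr//; apply: le_trans (ltW (truncnS_gt _)) _; by rewrite ler_nat.
- move=> n x _; rewrite ger0_norm ?subr_ge0 ?ge_min ?lexx//.
  by rewrite gerBl le_min phi0 /=.
by move=> _; rewrite I1 mulr0.
Qed.

(** The constants are 17 = 1 + 2^4 and 15 = 1 + 2 + 4 + 8, the latter from the geometric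
    factorisation of 1 - z^4. *)
Lemma one_sub_pow4 (z : R[i]) : cabs z <= 2 ->
  cabs (1 - z ^+ 4) <= 17 /\ cabs (1 - z ^+ 4) <= 15 * cabs (1 - z).
Proof.
move=> z2; have z0 := cabs_ge0 z.
have zz : cabs z * cabs z <= 4.
  by rewrite (_ : 4 = 2 * 2 :> R); [exact: ler_pM|ring].
have z3 : cabs z * (cabs z * cabs z) <= 8.
  by rewrite (_ : 8 = 2 * 4 :> R); [apply: ler_pM => //; exact: mulr_ge0|ring].
split.
  apply: le_trans (cabsB _ _) _; rewrite cabs1 (_ : z ^+ 4 = z * z * (z * z)) ?cabsM; last by ring.
  have : cabs z * cabs z * (cabs z * cabs z) <= 16.
    by rewrite (_ : 16 = 4 * 4 :> R); [apply: ler_pM => //; exact: mulr_ge0|ring].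
  lra.
rewrite (_ : 1 - z ^+ 4 = (1 + z + z * z + z * (z * z)) * (1 - z)) ?cabsM; last by ring.
apply: ler_wpM2r; first exact: cabs_ge0.
apply: le_trans (cabsD _ _) _; rewrite !cabsM.
have h1 := cabsD (1 + z) (z * z); have h2 := cabsD 1 z; move: h1 h2; rewrite cabsM cabs1; lra.
Qed.

(** The integral of F G equals that of (1 - O^4) F G. Where |F G| exceeds a level n, the excess is
    small in L^1 and 1 - O^4 is bounded; below the level, 1 - O^4 is small in L^1 because O is close
    to 1. *)
Lemma spectrum_product F G : past_null F -> ci F = 0 -> past_null G ->
  cintegrable leb cir (fun x => F x * G x) -> ci (fun x => F x * G x) = 0.
Proof.
move=> nF F0 nG iFG; have aFG := integrable_cabs mc iFG.
have mFG := cintegrable_meas mc iFG.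
pose phi x := cabs (F x * G x); have phi0 x : 0 <= phi x by exact: cabs_ge0.
pose B := I (fun x => cabs (F x)) + I (fun x => cabs (G x)).
have B0 : 0 <= B by apply: addr_ge0; apply: Rintegral_ge0 => x _; exact: cabs_ge0.
have mphi : measurable_fun cir phi by exact: measurable_cabs.
apply: cabs0_eq; apply/eqP; rewrite eq_le cabs_ge0 andbT; apply/ler_addgt0Pr => eps eps0; rewrite add0r.
(* 17 times this is eps/4. The truncated part gives another eps/4, and the sum eps/2 is doubled by
   [le_cintegral]. *)
have e68 : 0 < eps / 68 by exact: divr_gt0.
have [n tn] : exists n : nat, I (fun x => phi x - Num.min (phi x) n%:R) <= eps / 68.
  have /cvgrPdist_le/(_ _ e68)[n _ /(_ n (leqnn n))] := excess_cvg0 aFG phi0.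
  by rewrite sub0r normrN => h; exists n; exact: le_trans (ler_norm _) h.
(* The target for the L^1 distance from O to 1: then 15 n eta <= eps/4. *)
pose eta := eps / (60 * n.+1%:R).
have n1 : 0 < n.+1%:R :> R by rewrite ltr0n.
have eta0 : 0 < eta by rewrite divr_gt0// mulr_gt0.
(* The parameter of Young's inequality between 1 - O and the constant 1: the constant contributes 2
   pi del = eta/2, which leaves eta/2 for the L^2 distance divided by [del]. *)
pose del := eta / (4 * pi); have del0 : 0 < del by rewrite divr_gt0// mulr_gt0.
(* The first bound makes the squared L^2 distance from O to 1 at most del eta/2; the second keeps k
   <= 4, hence |O| <= 2. *)
pose e := Num.min (del * eta / (2 * (B + 1))) (B + 1)^-1.
have B1 : 0 < B + 1 by rewrite ltr_wpDl.
have de0 : 0 < del * eta by exact: mulr_gt0.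
have BB : 0 < 2 * (B + 1) by apply: mulr_gt0.
have e0 : 0 < e by rewrite lt_min invr_gt0 B1 andbT; exact: divr_gt0.
have eB1 : e * B <= 1.
  apply: le_trans (_ : (B + 1)^-1 * B <= _); first by rewrite ler_wpM2r// ge_min lexx orbT.
  by rewrite mulrC ler_pdivrMr// mul1r lerDl.
have eB2 : e * B <= del * eta / 2.
  apply: le_trans (_ : del * eta / (2 * (B + 1)) * B <= _); first by rewrite ler_wpM2r// ge_min lexx.
  have -> : del * eta / (2 * (B + 1)) * B = del * eta / 2 * (B / (B + 1)) by field; rewrite gt_eqF.
  by apply: ler_piMr; [exact: divr_ge0 (ltW de0) (ler0n _ 2)|rewrite ler_pdivrMr// mul1r lerDl].
have [ O [k [mO [k0 bO] hN hk cO]]] := damped_product nF F0 nG e0.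
rewrite -/B in hk.
have pi1 : 1 <= pi :> R by have := pi_ge2 R; lra.
have k4 : k <= 4.
  have h : 2 * pi * (k - 1) <= 1 by exact: le_trans hk eB1.
  rewrite leNgt; apply/negP => h4.
  have : 2 * 1 * 3 <= 2 * pi * (k - 1) by apply: ler_pM; lra.
  lra.
have O2 x : circle x -> cabs (O x) <= 2.
  move=> cx; rewrite -(@ler_pXn2r _ 2) ?nnegrE ?cabs_ge0//; apply: le_trans (bO x cx) _.
  by rewrite expr2; lra.
have m1 : cm (fun=> (1 : R[i])) by exact: measurable_cst.
have mB : cm (fun x => 1 - O x) by exact: cmeasB.
have mone : measurable_fun cir (fun=> 1 : R) by exact: measurable_cst.
have small : I (fun x => cabs (1 - O x)) <= eta.
  have h := cnorm1_young mone (fun x _ => ltr01) mB m1 del0.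
  have hv : (Nv (fun=> 1%R) (fun=> 1%R) <= (2 * pi * 1)%:E)%E.
    by apply: lp_bounded (measurable_inv mone (fun x _ => ltr01)) _ m1 _ => x cx; rewrite ?cabs1 ?powR1 ?mul1r invr1.
  have hN' : (N (fun=> 1%R) (fun x => (1 - O x)%R) <= (del * eta / 2)%:E)%E.
    by apply: le_trans hN _; rewrite lee_fin; exact: le_trans hk eB2.
  have h1 : ((del^-1)%:E * N (fun=> 1%R) (fun x => (1 - O x)%R) <= (eta / 2)%:E)%E.
    apply: le_trans (lee_wpmul2l _ hN') _; first by rewrite lee_fin invr_ge0 ltW.
    by rewrite -EFinM lee_fin -mulrA mulKf ?gt_eqF.
  have h2 : (del%:E * Nv (fun=> 1%R) (fun=> 1%R) <= (eta / 2)%:E)%E.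
    apply: le_trans (lee_wpmul2l _ hv) _; first by rewrite lee_fin ltW.
    have ed (q r : R) : q != 0 -> r / (4 * q) * (2 * q) = r / 2 by move=> q0; field.
    by rewrite -EFinM lee_fin mulr1 /del ed// gt_eqF.
  have h3 : (cnorm1 leb cir (fun x => (1 - O x) * 1)%R <= eta%:E)%E.
    by apply: le_trans h _; rewrite [in leRHS](splitr eta) EFinD; exact: (leeD h1 h2).
  rewrite -lee_fin /Rintegral fineK; last first.
    apply: integrable_fin_num => //; apply: integrable_cabs => //.
    by apply: (cintegrable_bounded (M := 3)) => // x cx; apply: le_trans (cabsB _ _) _; rewrite cabs1; have := O2 x cx; lra.
  by move: h3; congr (_ <= _)%E; apply: eq_integral => x _; rewrite mulr1.
have iD : cintegrable leb cir (fun x => (1 - O x ^+ 4) * (F x * G x)).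
  apply: (cintegrableMb mc iFG (M := 17)); last by move=> x cx; have [] := one_sub_pow4 (O2 x cx).
  apply: cmeasB => //; have -> : (fun x => O x ^+ 4) = (fun x => O x * O x * (O x * O x)) by apply/funext => x; ring.
  by apply: cmeasM; exact: cmeasM.
have iO4 : cintegrable leb cir (fun x => O x ^+ 4 * (F x * G x)).
  have := cintegrableB mc iFG iD; congr (cintegrable _ _ _); apply/funext => x; ring.
have eD : ci (fun x => F x * G x) = ci (fun x => (1 - O x ^+ 4) * (F x * G x)).
  have e1 x : F x * G x = (1 - O x ^+ 4) * (F x * G x) + O x ^+ 4 * (F x * G x) by ring.
  by apply: etrans (circle_eq e1) _; rewrite (cintegralD mc iD iO4) cO addr0.
have iB' : leb.-integrable cir (EFin \o (fun x => cabs (1 - O x))).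
  by apply: integrable_cabs => //; apply: (cintegrable_bounded (M := 3)) => // x cx; apply: le_trans (cabsB _ _) _; rewrite cabs1; have := O2 x cx; lra.
have iE : leb.-integrable cir (EFin \o (fun x => phi x - Num.min (phi x) n%:R)).
  apply: le_integrable aFG => //.
    by apply/measurable_EFinP; apply: measurable_funB => //; exact: measurable_minr.
  move=> x _; rewrite lee_fin !ger0_norm ?phi0 ?subr_ge0 ?ge_min ?lexx// gerBl le_min phi0 /=.
  by rewrite ler0n.
have i17 : leb.-integrable cir (EFin \o (fun x => 17 * (phi x - Num.min (phi x) n%:R))) by exact: eq_integrable (integrableZl mc 17 iE).
have i15 : leb.-integrable cir (EFin \o (fun x => (15 * n%:R) * cabs (1 - O x))) by exact: eq_integrable (integrableZl mc (15 * n%:R) iB').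
have bound : I (fun x => cabs ((1 - O x ^+ 4) * (F x * G x))) <= 17 * (eps / 68) + 15 * n%:R * eta.
  apply: (@le_trans _ _ (I (fun x => 17 * (phi x - Num.min (phi x) n%:R) + (15 * n%:R) * cabs (1 - O x)))).
    apply: le_Rintegral => //; first exact: integrable_cabs.
      exact: eq_integrable (integrableD mc i17 i15).
    move=> x cx; rewrite cabsM -/(phi x); have [h17 h15] := one_sub_pow4 (O2 x cx).
    have m0 : 0 <= Num.min (phi x) n%:R by rewrite le_min phi0 ler0n.
    have mn : Num.min (phi x) n%:R <= n%:R by rewrite ge_min lexx orbT.
    rewrite -{1}[phi x](subrK (Num.min (phi x) n%:R)) mulrDr; apply: lerD; first by rewrite ler_wpM2r// subr_ge0 ge_min lexx.
    have -> : 15 * n%:R * cabs (1 - O x) = 15 * cabs (1 - O x) * n%:R by ring.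
    by apply: ler_pM => //; exact: cabs_ge0.
  rewrite (RintegralD mc i17 i15) (RintegralZl 17 mc iE) (RintegralZl (15 * n%:R) mc iB').
  by apply: lerD; apply: ler_wpM2l => //; exact: mulr_ge0.
have h2 := le_cintegral mc iD.
have ne : 15 * n%:R * eta <= eps / 4.
  have -> : 15 * n%:R * eta = eps / 4 * (n%:R / n.+1%:R) by rewrite /eta; field; rewrite gt_eqF.
  by rewrite ler_piMr ?divr_ge0 ?(ltW eps0)// ler_pdivrMr// mul1r ler_nat.
have c1 : (cnorm1 leb cir (fun x => (1 - O x ^+ 4) * (F x * G x))%R <= (eps / 2)%:E)%E.
  have -> : cnorm1 leb cir (fun x => (1 - O x ^+ 4) * (F x * G x))%R = (I (fun x => cabs ((1 - O x ^+ 4) * (F x * G x))))%:E.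
    by rewrite /Rintegral fineK//; apply: integrable_fin_num => //; exact: integrable_cabs.
  by rewrite lee_fin; apply: le_trans bound _; lra.
rewrite eD -lee_fin; apply: le_trans h2 _.
apply: le_trans (lee_wpmul2l _ c1) _ => //.
by rewrite -EFinM lee_fin mulrC divfK.
Qed.

End Product.

(** * The optimal estimate *)

Section SeriesFunctional.
Context {R : realType} {d : measure_display} {Omega : measurableType d}.
Variable P : probability Omega R.
Variable alpha : R.
Hypothesis halpha : 1 < alpha <= 2.
Local Notation leb := (@lebesgue_measure R).
Local Notation cir := (circle : set (measurableTypeR R)).
Local Notation cm u := (cmeas cir u).
Variables (xi : int -> Omega -> R[i]) (Zxi : R -> Omega -> R[i])
    (muxi : {finite_measure set R -> \bar R}) (f : R -> R)
    (a : nat -> R[i]) (Axi : Omega -> R[i]).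
Hypotheses (hxi : harmonizable P alpha xi Zxi muxi)
    (hf : spectral_density muxi f)
    (hf0 : forall x, circle x -> 0 < f x)
    (ha1 : cvgn (series (fun j => cabs (a j))))
    (hAxi : alpha_cvg P alpha (fun n w => \sum_(j < n) a j * xi j%:Z w) Axi).
Local Notation TX := (ext P alpha f (trig_graph xi)).
Local Notation A := (fun x => cseries (fun j => a j * expi (j%:R * x))).

Let mc : measurable cir. Proof. exact: measurable_itv. Qed.

Let total := limn (series (fun j => cabs (a j))).
Let part n x := \sum_(j < n) a j * expi (j%:R * x).

Let tail n := total - series (fun j => cabs (a j)) n.

Let partial_le n : series (fun j => cabs (a j)) n <= total.
Proof.
apply: nondecreasing_cvgn_le => //; apply: nondecreasing_series => j _ _; exact: cabs_ge0.
Qed.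

Let tail_ge0 n : 0 <= tail n. Proof. by rewrite subr_ge0. Qed.

Let tail_cvg : tail @ \oo --> (0 : R).
Proof. by rewrite -[X in _ --> X](subrr total); apply: cvgB => //; exact: cvg_cst. Qed.

Let partB n m x : (n <= m)%N -> cabs (part n x - part m x) <= tail n.
Proof.
move=> nm; rewrite /part -!(big_mkord xpredT (fun j => a j * expi (j%:R * x))).
rewrite (big_cat_nat (leq0n n) nm)/= opprD addrA subrr add0r cabsN.
apply: le_trans (cabs_sum _ _) _; rewrite /tail lerBrDl; apply: le_trans (partial_le m).
rewrite /series/= (big_cat_nat (leq0n n) nm)/= lerD2l.
by apply: ler_sum => j _; rewrite cabsM cabs_expi mulr1.
Qed.

Let part_cvg (c : R[i] -> R) : (forall z, `|c z| <= cabs z) -> (forall z w, c (z + w) = c z + c w) -> c 0 = 0 ->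
  forall x, cvgn (fun n => c (part n x)).
Proof.
move=> hc cD c0 x; have hs n : c (part n x) = series (fun j => c (a j * expi (j%:R * x))) n.
  rewrite /series/= big_mkord /part; elim/big_rec2: _ => [//|i y z _ <-]; exact: cD.
rewrite (_ : (fun n => _) = series (fun j => c (a j * expi (j%:R * x)))); last exact/funext.
apply: normed_cvg; apply: series_le_cvg ha1 => j; rewrite ?normr_ge0 ?cabs_ge0//.
by apply: le_trans (hc _) _; rewrite cabsM cabs_expi mulr1.
Qed.

Lemma cseries_partial n x : cabs (part n x - A x) <= tail n.
Proof.
have cR : cvgn (fun n => complex.Re (part n x)).
  by apply: (@part_cvg (@complex.Re R)) => //; [exact: Re_le_cabs|exact: cReD].
have cI : cvgn (fun n => complex.Im (part n x)).
  by apply: (@part_cvg (@complex.Im R)) => //; [exact: Im_le_cabs|exact: cImD].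
have h : (fun m => cabs (part m x - A x)) @ \oo --> (0 : R) by exact: cvg_complex.
apply/ler_addgt0Pr => e e0; have /cvgrPdist_le/(_ e e0)[N _ hN] := h.
have := hN (maxn n N) (leq_maxr _ _); rewrite /= sub0r normrN ger0_norm ?cabs_ge0// => h1.
have := cabsD (part n x - part (maxn n N) x) (part (maxn n N) x - A x).
rewrite addrA subrK => /le_trans; apply; apply: lerD h1.
by apply: partB; exact: leq_maxl.
Qed.

Lemma cseries_meas : cm A.
Proof.
apply: (@cmeas_cvg R _ (measurableTypeR R) cir part).
  by move=> n; apply: cmeas_sum => j; apply: cmeasM; [exact: cmeas_cst|exact: cmeas_expiZ].
move=> x _; apply: (@squeeze_cvgr _ _ _ _ (fun=> 0) tail) => //; last exact: cvg_cst.
by apply: nearW => n; rewrite cabs_ge0 cseries_partial.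
Qed.

Lemma cseries_bounded x : cabs (A x) <= total.
Proof.
have := cseries_partial 0 x; rewrite /part big_ord0 sub0r cabsN => /le_trans; apply.
by rewrite /tail /series/= big_geq// subr0.
Qed.

Lemma lp_density_bounded u (M : R) : 0 <= M -> cm u -> (forall x, circle x -> cabs (u x) <= M) ->
  (lp leb cir alpha f u <= (M `^ alpha * \int[leb]_(x in cir) f x)%:E)%E.
Proof.
have a0 : 0 < alpha by have /andP[h _] := halpha; lra.
move=> M0 mu_ uM; have [mf _] := hf; have if_ := density_integrable hf hf0.
rewrite -(RintegralZl (M `^ alpha) mc if_) /Rintegral.
have iM : leb.-integrable cir (EFin \o (fun x => M `^ alpha * f x)).
  exact: eq_integrable (integrableZl mc (M `^ alpha) if_).
rewrite fineK; last exact: integrable_fin_num.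
apply: ge0_le_integral => //.
- by move=> x cx; rewrite lee_fin mulr_ge0 ?powR_ge0 ?(ltW (hf0 cx)).
- exact: (@measurable_lp R _ (measurableTypeR R) cir alpha f mf u mu_).
- by have /integrableP[] := iM.
- move=> x cx; rewrite lee_fin ler_wpM2r ?(ltW (hf0 cx))//.
  by apply: ge0_ler_powR; rewrite ?nnegrE ?cabs_ge0 ?(ltW a0) ?uM.
Qed.

Lemma cseries_lp : (lp leb cir alpha f A < +oo)%E.
Proof.
have t0 : 0 <= total by have := partial_le 0; rewrite /series/= big_geq.
apply: le_lt_trans (lp_density_bounded t0 cseries_meas (fun x _ => cseries_bounded x)) (ltry _).
Qed.

(** The variable is given only as a limit of partial sums in the covariation norm, which controls
    L^1(P); the functions of the partial sums converge uniformly to A, and f is integrable. *)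
Lemma cseries_ext : TX Axi A.
Proof.
have [sD nD] := hAxi.
pose p n := [seq (a j, j%:Z) | j <- iota 0 n].
have e n : iota 0 n = index_iota 0 n by rewrite /index_iota subn0.
have gU n : trig_graph xi (fun w => \sum_(j < n) a j * xi j%:Z w) (part n).
  exists (p n); split; apply/funext => w.
    by rewrite /trig_sum big_map e big_mkord.
  by rewrite /trig_poly big_map e big_mkord.
have mU n := (trig_graph_meas halpha hxi hf hf0 (gU n)).1.
have mA : cmeas setT Axi.
  have [m _] := sD 0%N; have := cmeasB (mU 0%N) (m tt Logic.I).
  by congr cmeas; apply/funext => w; ring.
split; [exact: mA|exact: cseries_meas|move=> eps eps0].
have a0 : 0 < alpha by have /andP[h _] := halpha; lra.
pose Mf := \int[leb]_(x in cir) f x.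
have Mf0 : 0 <= Mf by apply: Rintegral_ge0 => x cx; exact: ltW (hf0 cx).
pose t := (eps / (Mf + 1)) `^ alpha^-1.
have Mf1 : 0 < Mf + 1 by lra.
have q0 : 0 < eps / (Mf + 1) by exact: divr_gt0.
have t0 : 0 < t by exact: powR_gt0.
have /cvgrPdist_le/(_ t t0)[n1 _ h1] := tail_cvg.
have k0 : 0 < 2 * stable_mom 1 alpha.
  by apply: mulr_gt0 => //; apply: stable_mom_gt0; rewrite ?ltr01; have /andP[] := halpha.
have /cvgrPdist_le/(_ _ (divr_gt0 eps0 k0))[n2 _ h2] := nD.
pose n := maxn n1 n2.
exists (fun w => \sum_(j < n) a j * xi j%:Z w), (part n); split; first exact: gU.
  rewrite lpBC; have mP := (trig_graph_meas halpha hxi hf hf0 (gU n)).2.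
  have b x : circle x -> cabs (part n x - A x) <= t.
    move=> _; apply: le_trans (cseries_partial n x) _.
    by have := h1 n (leq_maxl _ _); rewrite /= sub0r normrN ger0_norm.
  apply: le_trans (lp_density_bounded (ltW t0) (cmeasB mP cseries_meas) b) _.
  rewrite lee_fin -/Mf /t -powRrM mulVf ?gt_eqF// powRr1 ?(ltW q0)//.
  by rewrite mulrAC ler_pdivrMr// ler_wpM2l ?(ltW eps0)//; lra.
apply: le_trans (cnorm1_le_alpha_norm halpha (sD n)) _.
have := h2 n (leq_maxr _ _); rewrite /= sub0r normrN ger0_norm ?alpha_norm_ge0// => h3.
by rewrite lee_fin mulrC -(ler_pdivlMr _ _ k0).
Qed.

End SeriesFunctional.

(** * Optimality, the spectral equation and uniqueness *)

Section Assembly.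
Context {R : realType} {d : measure_display} {Omega : measurableType d}.
Variable P : probability Omega R.
Variable alpha : R.
Hypothesis halpha : 1 < alpha <= 2.
Local Notation leb := (@lebesgue_measure R).
Local Notation cir := (circle : set (measurableTypeR R)).
Local Notation cm u := (cmeas cir u).
Local Notation ci F := (cintegral leb cir F).
Variables (xi eta : int -> Omega -> R[i]) (Zxi Zeta : R -> Omega -> R[i])
    (muxi mueta : {finite_measure set R -> \bar R}) (f g : R -> R)
    (a : nat -> R[i]) (Axi : Omega -> R[i]).
Hypotheses (hxi : harmonizable P alpha xi Zxi muxi)
    (heta : harmonizable P alpha eta Zeta mueta)
    (hind : independent_families P xi eta)
    (hf : spectral_density muxi f) (hg : spectral_density mueta g)
    (hf0 : forall x, circle x -> 0 < f x)
    (hg0 : forall x, circle x -> 0 < g x)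
    (hmin : (\int[leb]_(x in circle) ((f x + g x) `^ (- (alpha - 1)^-1))%:E < +oo)%E).
Variable A : R -> R[i].
Hypotheses (mA : cm A) (Afin : (lp leb cir alpha f A < +oo)%E).
Local Notation TX := (ext P alpha f (trig_graph xi)).
Local Notation TE := (ext P alpha g (trig_graph eta)).
Local Notation zeta := (fun k w => xi k w + eta k w).
Local Notation fg := (fun x => f x + g x).
Hypothesis hA : TX Axi A.
Implicit Types (V W Y : Omega -> R[i]) (u h F : R -> R[i]).

Let a1 : 1 < alpha. Proof. by have /andP[] := halpha. Qed.
Let a2 : alpha <= 2. Proof. by have /andP[] := halpha. Qed.
Let a0 : 0 < alpha. Proof. exact: lt_trans a1. Qed.
Let mc : measurable cir. Proof. exact: measurable_itv. Qed.
Let f0 x : circle x -> 0 <= f x. Proof. by move=> /hf0/ltW. Qed.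
Let g0 x : circle x -> 0 <= g x. Proof. by move=> /hg0/ltW. Qed.
Let mf : measurable_fun cir f. Proof. by case: hf. Qed.
Let mg : measurable_fun cir g. Proof. by case: hg. Qed.
Let mfg : measurable_fun cir fg. Proof. exact: measurable_funD. Qed.
Let fg0 x : circle x -> 0 < f x + g x. Proof. by move=> cx; rewrite addr_gt0 ?hf0 ?hg0. Qed.
Let dom := @lp_dominates_cnorm1 R _ (measurableTypeR R) leb cir mc alpha fg a1 mfg fg0 hmin.
Let Efin u : past u -> fin_norm leb cir alpha f g u.
Proof. exact: past_fin_norm a0 mf mg f0 g0 (density_integrable hf hf0) (density_integrable hg hg0). Qed.
Let ED u v : past u -> past v -> past (fun x => u x + v x). Proof. exact: pastD. Qed.
Let EZ c u : past u -> past (fun x => c * u x). Proof. exact: pastZ. Qed.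

Local Notation closed_past := (closure_of leb cir alpha f g past).
Local Notation en h := (energy leb cir alpha f g A h).
Local Notation res h := (residual alpha f g A h).

Lemma Lalpha_minusP h : Lalpha_minus alpha fg h <-> closed_past h.
Proof.
split=> [[[mh ho] hb]|[[mh ho] hb]].
  split; first by split.
  move=> e /hb[b hb']; exists (past_polynomial b); first by exists b.
  exact: ltW hb'.
split; first by split.
move=> e e0; have [q [b ->] hq] := hb (e / 2) (divr_gt0 e0 (ltr0n _ 2)); exists b.
by apply: le_lt_trans hq _; rewrite lte_fin; lra.
Qed.

(** The error is the integral of A - h against the signal process plus that of -h against the noise
    process, so its norm splits by [joint_isometry]. Optimality among random variables thus becomes
    minimality of the energy. *)
Lemma error_energy h V W Y : Lalpha_minus alpha fg h -> TX V h -> TE W h ->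
  (forall w, Y w = V w + W w) ->
  ((alpha_norm P alpha (fun w => Axi w - Y w) `^ alpha)%:E =
    lp leb cir alpha f (fun x => (A x - h x)%R) + lp leb cir alpha g h)%E /\
  alpha_norm P alpha (fun w => Axi w - Y w) `^ alpha = en h.
Proof.
move=> /Lalpha_minusP[hh _] hV hW eY.
have gX := trig_extB halpha hxi hf hf0 hA hV.
have gE := trig_extZ halpha heta hg hg0 (-1) hW.
have [_ nJ] := joint_isometry halpha hxi heta hind hf hg hf0 hg0 gX gE.
have ee : (fun w => Axi w - Y w) = (fun w => (Axi w - V w) + -1 * W w).
  by apply/funext => w; rewrite eY; ring.
have e1 : ((alpha_norm P alpha (fun w => Axi w - Y w) `^ alpha)%:E =
    lp leb cir alpha f (fun x => (A x - h x)%R) + lp leb cir alpha g h)%E.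
  rewrite (congr1 (fun S : Omega -> R[i] => (alpha_norm P alpha S `^ alpha)%:E) ee); apply: etrans nJ _; congr (_ + _)%E.
  by rewrite -[RHS]lpN; apply: lp_eq => x _; rewrite mulN1r.
split; first exact: e1.
by apply: EFin_inj; rewrite e1 (@energyE R _ (measurableTypeR R) leb cir mc alpha f g A a1 mf mg f0 g0 mA Afin h hh).
Qed.

Let norm_le (x y ex ey : R) : 0 <= x -> 0 <= y -> x `^ alpha = ex -> y `^ alpha = ey -> (ex <= ey <-> x <= y).
Proof.
move=> x0 y0 <- <-; split=> [|h]; last by apply: ge0_ler_powR; rewrite ?nnegrE ?(ltW a0).
by apply: contraTT; rewrite -!ltNge => h; apply: gt0_ltr_powR; rewrite ?nnegrE.
Qed.

Lemma optimal_exists : exists Ahat, is_optimal_estimate P alpha zeta Axi Ahat.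
Proof.
have [h [ch hmn]] := @min_exists R _ (measurableTypeR R) leb cir mc alpha f g A a1 a2 mf mg f0 g0 mA Afin past past0 ED EZ Efin dom.
have lh : Lalpha_minus alpha fg h by exact/Lalpha_minusP.
have [V [W [hV hW]]] := trig_ext_past halpha hxi heta hf hg hf0 hg0 lh.
exists (fun w => V w + W w); split.
  exact: (trig_ext_Hminus halpha hxi heta hind hf hg hf0 hg0 lh hV hW).
move=> Y /(Hminus_trig_ext halpha hxi heta hind hf hg hf0 hg0 hmin)[u [V' [W' [lu hV' hW' eY]]]].
apply: (norm_le (alpha_norm_ge0 _ _ _) (alpha_norm_ge0 _ _ _)
  (error_energy lh hV hW (fun w => erefl)).2 (error_energy lu hV' hW' eY).2).1.
by apply: hmn; exact/Lalpha_minusP.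
Qed.

Lemma optimal_minimal Ahat : is_optimal_estimate P alpha zeta Axi Ahat ->
  exists h V W, [/\ Lalpha_minus alpha fg h, TX V h, TE W h, forall w, Ahat w = V w + W w &
    forall u, closed_past u -> en h <= en u].
Proof.
move=> [/(Hminus_trig_ext halpha hxi heta hind hf hg hf0 hg0 hmin)[h [V [W [lh hV hW eA]]]] opt].
exists h, V, W; split; [exact: lh|exact: hV|exact: hW|exact: eA|move=> u /Lalpha_minusP lu].
have [V' [W' [hV' hW']]] := trig_ext_past halpha hxi heta hf hg hf0 hg0 lu.
exact: (norm_le (alpha_norm_ge0 _ _ _) (alpha_norm_ge0 _ _ _)
  (error_energy lh hV hW eA).2 (error_energy lu hV' hW' (fun w => erefl)).2).2
  (opt _ (trig_ext_Hminus halpha hxi heta hind hf hg hf0 hg0 lu hV' hW')).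
Qed.

Lemma residual_past_null h : closed_past h -> (forall u, closed_past u -> en h <= en u) -> past_null (res h).
Proof.
move=> ch hmn; split; last first.
  move=> k; exact: (@min_variational R _ (measurableTypeR R) leb cir mc alpha f g A a1 a2 mf mg f0 g0 mA Afin past ED EZ Efin h _ ch hmn (past_expi k)).
have := @residual_integrable R _ (measurableTypeR R) leb cir mc alpha f g A a1 mf mg f0 g0 mA Afin h _ ch.1 (Efin (past_expi 0)).
move=> /(cintegrable_expiM 1); congr (cintegrable _ _ _); apply/funext => x.
by rewrite mulrA -expiD mulNr mul1r subrr expi0 mul1r.
Qed.

(** Past polynomials have no coefficients at nonnegative frequencies, and under the minimality
    condition convergence in L^alpha(f+g) entails convergence in L^1. *)
Lemma past_coefficients h : closed_past h -> coefficient_system h.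
Proof.
move=> [[mh ho] hb].
have close (e : R) : 0 < e -> exists2 q, past q & (cnorm1 leb cir (fun x => (h x - q x)%R) <= e%:E)%E.
  move=> /dom[k k0 hk]; have [q pq hq] := hb k k0; exists q => //.
  by apply: hk hq; apply: cmeasB => //; exact: past_cmeas.
have iq q : past q -> cintegrable leb cir q.
  move=> pq; have [h1 _] := past_null_past pq (@past_null1 R); move: h1.
  by congr (cintegrable _ _ _); apply/funext => x; rewrite mulr1.
have ih : cintegrable leb cir h.
  have [q pq hq] := close 1 ltr01; have mq := past_cmeas pq.
  have i1 : cintegrable leb cir (fun x => h x - q x).
    by apply/(cintegrableP _ mc); split; [exact: cmeasB|exact: le_lt_trans hq (ltry _)].
  by have := cintegrableD mc i1 (iq q pq); congr (cintegrable _ _ _); apply/funext => x; rewrite subrK.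
split; first exact: ih.
move=> k; apply: (cintegral0_closed mc (cintegrable_expiM (- k%:R) ih)) => e /close[q pq hq].
have [i2 c2] := past_null_past pq (past_null_shift k (@past_null1 R)).
have eq x : q x * (expi (- k%:R * x) * 1) = expi (- k%:R * x) * q x by ring.
exists (fun x => expi (- k%:R * x) * q x); split.
- exact: cintegrable_expiM (iq q pq).
- by rewrite -[RHS]c2; apply: circle_eq => x; rewrite eq.
- apply: le_trans hq; rewrite le_eqVlt; apply/orP; left; apply/eqP; apply: eq_integral => x _.
  by rewrite -mulrBr cabsM cabs_expi mul1r.
Qed.

Definition residual_coef h (j : nat) : R[i] :=
  ((2 * pi)^-1)%:C * ci (fun x => expi (- j%:R * x) * (res h x)^*).

Lemma residual_spectral h : past_null (res h) -> spectral_equation alpha f g A h (residual_coef h).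
Proof.
move=> [ir nr]; exists (fun x => (res h x)^*).
  split; first exact: cintegrable_conj.
    by [].
  move=> j; apply: etrans (circle_eq _) (cintegral_conj0 (cintegrable_expiM (- j.+1%:R) ir) (nr j)) => x.
  by rewrite conj_expiM.
by apply: nearW => x _; rewrite conjcK.
Qed.

Lemma cintegrable_ae F G : cm F -> cintegrable leb cir G ->
  {ae leb, forall x, circle x -> F x = G x} -> cintegrable leb cir F.
Proof.
move=> mF iG FG; have mG := cintegrable_meas mc iG; apply/(cintegrableP _ mc); split => //.
have /(cintegrableP _ mc)[_] := iG; congr (_ < _)%E; apply: ae_eq_integral => //.
- exact: measurable_cabsE.
- exact: measurable_cabsE.
- by apply: ae_mono FG _ => x h cx; rewrite h.
Qed.

(** The series C has no negative frequencies, so its conjugate, which equals the residual almost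
    everywhere, has no positive ones; the c_j are then read off from the residual, hence determined
    by h. *)
Lemma spectral_past_null h c : fin_norm leb cir alpha f g h ->
  spectral_equation alpha f g A h c -> past_null (res h) /\ c = residual_coef h.
Proof.
move=> fh [C [iC cC nC] eC].
have mr := @residual_meas R _ (measurableTypeR R) cir alpha f g A mf mg mA h fh.1 : cm (res h).
have mC := cintegrable_meas mc iC.
have iCc := cintegrable_conj mc iC.
have eC' : {ae leb, forall x, circle x -> res h x = (C x)^*} := eC.
have ir := cintegrable_ae mr iCc eC'.
have mcC := cintegrable_meas mc iCc.
split.
  split=> // k.
  rewrite (cintegral_ae mc (cmeasM (cmeas_expiZ (- k.+1%:R)) mr) (cmeasM (cmeas_expiZ (- k.+1%:R)) mcC)); last first.
    by apply: ae_mono eC' _ => x hx cx; rewrite hx.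
  apply: etrans (circle_eq _) (cintegral_conj0 (cintegrable_expiM k.+1%:R iC) (nC k)) => x.
  by have := conj_expiM (- k.+1%:R) x (C x); rewrite opprK => ->.
apply/funext => j; rewrite -cC /residual_coef; congr (_ * _).
apply: (cintegral_ae mc (cmeasM (cmeas_expiZ (- j%:R)) mC) (cmeasM (cmeas_expiZ (- j%:R)) (cmeas_conj mr))).
by apply: ae_mono eC' _ => x hx cx; rewrite hx// conjcK.
Qed.

Lemma spectral_unique h h' : fin_norm leb cir alpha f g h -> fin_norm leb cir alpha f g h' ->
  past_null (res h) -> past_null (res h') -> coefficient_system h -> coefficient_system h' ->
  {ae leb, forall x, circle x -> h' x = h x}.
Proof.
move=> fh fh' [ir nr] [ir' nr'] [ih ch] [ih' ch'].
have fD : fin_norm leb cir alpha f g (fun x => h x - h' x).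
  have := fin_normD mc a1 mf mg f0 g0 fh (fin_normZ mc mf mg f0 g0 (-1) fh'); congr fin_norm.
  by apply/funext => x; rewrite mulN1r.
pose F x := h x - h' x; pose G x := res h x - res h' x.
have iF : cintegrable leb cir F by exact: cintegrableB.
have cF (k : nat) : ci (fun x => expi (- k%:R * x) * F x) = 0.
  apply: etrans (circle_eq (fun x => mulrBr _ _ _)) _.
  by rewrite (cintegralB mc (cintegrable_expiM _ ih) (cintegrable_expiM _ ih')) ch ch' subrr.
have nF : past_null F by split=> // k; exact: cF.
have F0 : ci F = 0.
  by rewrite -[RHS](cF 0%N); apply: circle_eq => x; rewrite oppr0 mul0r expi0 mul1r.
have nG : past_null G.
  split; first exact: cintegrableB.
  move=> k; apply: etrans (circle_eq (fun x => mulrBr _ _ _)) _.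
  by rewrite (cintegralB mc (cintegrable_expiM _ ir) (cintegrable_expiM _ ir')) nr nr' subrr.
have i1 := @residual_integrable R _ (measurableTypeR R) leb cir mc alpha f g A a1 mf mg f0 g0 mA Afin h _ fh fD.
have i2 := @residual_integrable R _ (measurableTypeR R) leb cir mc alpha f g A a1 mf mg f0 g0 mA Afin h' _ fh' fD.
have iFG : cintegrable leb cir (fun x => F x * G x).
  by have := cintegrableB mc i1 i2; congr (cintegrable _ _ _); apply/funext => x; exact: esym (mulrBr _ _ _).
have z0 := spectrum_product nF F0 nG iFG.
pose D1 x := complex.Re ((A x - h x - (A x - h' x)) * (spow (A x - h x) (alpha - 1) - spow (A x - h' x) (alpha - 1))).
pose D2 x := complex.Re ((h x - h' x) * (spow (h x) (alpha - 1) - spow (h' x) (alpha - 1))).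
have D10 x : 0 <= D1 x by exact: (spow_mono _ _ a1 a2).1.
have D20 x : 0 <= D2 x by exact: (spow_mono _ _ a1 a2).1.
(* The difference of A - h and A - h' is -F, and the g-term of the residual carries a minus sign, so
   both monotone quantities enter with the same sign. *)
have eD x : complex.Re (F x * G x) = - (D1 x * f x + D2 x * g x).
  rewrite /D1 /D2 /F /G /residual.
  have eM (z : R[i]) (k : R) : complex.Re z * k = complex.Re (z * k%:C) by rewrite cReM /= mulr0 subr0.
  by rewrite !eM -cReD -cReN; congr complex.Re; ring.
have [iR _] := iFG.
have mR : measurable_fun cir (fun x => complex.Re (F x * G x)) by have /integrableP[/measurable_EFinP] := iR.
have : (\int[leb]_(x in cir) `|(complex.Re (F x * G x))%:E| = 0)%E.
  have -> : (\int[leb]_(x in cir) `|(complex.Re (F x * G x))%:E| = \int[leb]_(x in cir) - (complex.Re (F x * G x))%:E)%E.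
    apply: eq_integral => x /set_mem cx; rewrite eD.
    have s0 : 0 <= D1 x * f x + D2 x * g x by apply: addr_ge0; apply: mulr_ge0; rewrite ?f0 ?g0.
    by rewrite /= normrN ger0_norm// opprK.
  apply: etrans (integralN (integrable_add_def mc iR)) _.
  rewrite -[X in (- X)%E](fineK (integrable_fin_num mc iR)).
  have -> : fine (\int[leb]_(x in cir) (complex.Re (F x * G x))%:E)%E = 0 by have := congr1 (@complex.Re R) z0.
  by rewrite oppe0.
have mE : measurable_fun cir (fun x => (complex.Re (F x * G x))%:E) by exact/measurable_EFinP.
move=> /(ae_eq_integral_abs leb mc mE) hae.
apply: ae_mono hae _ => x hx cx; have : complex.Re (F x * G x) = 0 by exact: EFin_inj (hx cx).
rewrite eD => /eqP.
rewrite oppr_eq0 paddr_eq0 ?mulr_ge0 ?f0 ?g0// => /andP[_].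
rewrite mulf_eq0 (gt_eqF (hg0 cx)) orbF => /eqP D2z.
by symmetry; apply: (spow_mono _ _ a1 a2).2.
Qed.

Lemma residual_coef_ae h h' : cm h -> cm h' ->
  {ae leb, forall x, circle x -> h' x = h x} -> residual_coef h' = residual_coef h.
Proof.
move=> mh mh' hh; have mr u (mu_ : cm u) : cm (res u) :=
  @residual_meas R _ (measurableTypeR R) cir alpha f g A mf mg mA u mu_.
apply/funext => j; rewrite /residual_coef; congr (_ * _).
apply: (cintegral_ae mc (cmeasM (cmeas_expiZ (- j%:R)) (cmeas_conj (mr _ mh')))
  (cmeasM (cmeas_expiZ (- j%:R)) (cmeas_conj (mr _ mh)))).
by apply: ae_mono hh _ => x hx cx; rewrite /residual hx.
Qed.

End Assembly.

Theorem theorem1 (R : realType) (d : measure_display) (Omega : measurableType d)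
    (P : probability Omega R) (alpha : R)
    (xi eta : int -> Omega -> R[i]) (Zxi Zeta : R -> Omega -> R[i])
    (muxi mueta : {finite_measure set R -> \bar R}) (f g : R -> R)
    (a : nat -> R[i]) (Axi : Omega -> R[i])
    (halpha : 1 < alpha <= 2)
    (hxi : harmonizable P alpha xi Zxi muxi)
    (heta : harmonizable P alpha eta Zeta mueta)
    (hind : independent_families P xi eta)
    (hf : spectral_density muxi f) (hg : spectral_density mueta g)
    (hf0 : forall x, circle x -> 0 < f x)
    (hg0 : forall x, circle x -> 0 < g x)
    (hmin : (\int[@lebesgue_measure R]_(x in circle)
               ((f x + g x) `^ (- (alpha - 1)^-1))%:E < +oo)%E)
    (ha1 : cvgn (series (fun j => cabs (a j))))
    (ha2 : cvgn (series (fun j => j.+1%:R * cabs (a j) ^+ 2)))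
    (hAxi : alpha_cvg P alpha (fun n w => \sum_(j < n) a j * xi j%:Z w) Axi) :
  let A := fun x => cseries (fun j => a j * expi (j%:R * x)) in
  let zeta := fun k w => xi k w + eta k w in
  let optimal := is_optimal_estimate P alpha zeta Axi in
  let fg := fun x => f x + g x in
  (exists Ahat, optimal Ahat) /\
  forall Ahat, optimal Ahat ->
  exists h : R -> R[i],
  [/\ Lalpha_minus alpha fg h,
      exists X Y : Omega -> R[i],
        [/\ is_stoch_integral P alpha Zxi muxi h X,
            is_stoch_integral P alpha Zeta mueta h Y
          & forall w, Ahat w = X w + Y w],
      exists c : nat -> R[i],
        [/\ spectral_equation alpha f g A h c,
            coefficient_system h
          & forall (h' : R -> R[i]) (c' : nat -> R[i]),
              Lalpha alpha fg h' -> spectral_equation alpha f g A h' c' ->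
              coefficient_system h' ->
              {ae @lebesgue_measure R, forall x, circle x -> h' x = h x} /\
              c' = c]
    & ((alpha_norm P alpha (fun w => Axi w - Ahat w) `^ alpha)%:E =
       \int[@lebesgue_measure R]_(x in circle)
          (cabs (A x - h x) `^ alpha * f x)%:E +
       \int[@lebesgue_measure R]_(x in circle)
          (cabs (h x) `^ alpha * g x)%:E)%E].
Proof.
move=> A zeta optimal fg.
have a1 : 1 < alpha by have /andP[] := halpha.
have a2 : alpha <= 2 by have /andP[] := halpha.
have a0 : 0 < alpha by exact: lt_trans a1.
have mc : measurable (circle : set (measurableTypeR R)) by exact: measurable_itv.
have f0 x : circle x -> 0 <= f x by move=> /hf0/ltW.
have g0 x : circle x -> 0 <= g x by move=> /hg0/ltW.
have mf : measurable_fun (circle : set (measurableTypeR R)) f by case: hf.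
have mg : measurable_fun (circle : set (measurableTypeR R)) g by case: hg.
have mA : cmeas (circle : set (measurableTypeR R)) A by exact: cseries_meas ha1.
have Afin : (lp (@lebesgue_measure R) (circle : set (measurableTypeR R)) alpha f A < +oo)%E by exact: (@cseries_lp R alpha halpha muxi f a hf hf0 ha1).
have hA : ext P alpha f (trig_graph xi) Axi A by exact: (@cseries_ext R d Omega P alpha halpha xi Zxi muxi f a Axi hxi hf hf0 ha1 hAxi).
split; first exact: (@optimal_exists R d Omega P alpha halpha xi eta Zxi Zeta muxi mueta f g Axi hxi heta hind hf hg hf0 hg0 hmin A mA Afin hA).
move=> Ahat /(@optimal_minimal R d Omega P alpha halpha xi eta Zxi Zeta muxi mueta f g Axi hxi heta hind hf hg hf0 hg0 hmin A mA Afin hA)[h [V [W [lh hV hW eA hmn]]]].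
have ch := (Lalpha_minusP alpha f g h).1 lh.
have nh := @residual_past_null R alpha halpha muxi mueta f g hf hg hf0 hg0 A mA Afin h ch hmn.
have ih := @past_coefficients R alpha halpha muxi mueta f g hf hg hf0 hg0 hmin h ch.
exists h; split; first exact: lh.
- exists V, W; split; [| |exact: eA].
    exact: (trig_ext_stoch halpha hxi hf hf0 hV).
  exact: (trig_ext_stoch halpha heta hg hg0 hW).
- exists (residual_coef alpha f g A h); split.
  + exact: residual_spectral nh.
  + exact: ih.
  + move=> h' c' fh' eh' ih'.
    have [nh' ->] := @spectral_past_null R alpha muxi mueta f g hf hg A mA h' c' fh' eh'.
    have hh := @spectral_unique R alpha halpha muxi mueta f g hf hg hf0 hg0 A mA Afin h h' ch.1 fh' nh nh' ih ih'.
    split; first exact: hh.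
    exact: (@residual_coef_ae R alpha muxi mueta f g hf hg A mA h h' ch.1.1 fh'.1 hh).
- exact: (@error_energy R d Omega P alpha halpha xi eta Zxi Zeta muxi mueta f g Axi hxi heta hind hf hg hf0 hg0 A mA Afin hA h V W Ahat lh hV hW eA).1.
Qed.
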